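(* Let $d \in \mathbb{N}^*$ and $\lambda \in \mathbb{R}$. 1. If $V(x)=\alpha |x|^2+ \beta \cdot x + \gamma$ with $\alpha,\gamma \in \mathbb{R}$, $\beta \in \mathbb{R}^d$, then the system $$\Big( i\partial_t+ \tfrac{1}{2} \Delta - V\Big)\psi =\lambda \psi \log|\psi|^2 +\Big( u_0(t) \tfrac{|x|^2}{2} + \sum_{j=1}^d u_{j}(t)x_j\Big)\psi, \quad x\in \mathbb{R}^d,$$ with controls $u=(u_0,\dots,u_d)$, is not (large-time) $L^2$-approximately controllable. 2. If $V\in C^\infty(\mathbb{R}^d,\mathbb{R})$ satisfies $\partial_x^\beta V\in L^\infty(\mathbb{R}^d)$ for every $\beta\in\mathbb{N}^d$ with $|\beta|\ge 2$, then the system $$\Big( i\partial_t+ \tfrac{1}{2} \Delta - V \Big)\psi =\lambda \psi \log|\psi|^2 +\Big( \sum_{j=1}^d u_{j}(t)x_j\Big)\psi, \quad x\in \mathbb{R}^d,$$ with controls $u=(u_1,\dots,u_d)$, is not small-time $L^2$-approximately controllable.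
   Context: Let $\mathbf{S}=\{\psi\in L^2(\mathbb{R}^d,\mathbb{C}):\|\psi\|_{L^2}=1\}$. For a piecewise constant control $u$ on $[0,T]$ and $\psi_0\in L^2(\mathbb{R}^d)$, $\psi(\cdot;u,\psi_0)\in C^0([0,T],L^2)$ denotes the unique solution with $\psi(0)=\psi_0$ (the solution map on $\Sigma=\{\psi\in H^1(\mathbb{R}^d): |x|\psi\in L^2\}$ extends uniquely by $L^2$-Lipschitz continuity to $L^2$); the $L^2$-norm is preserved. The nonlinearity $z\log|z|^2$ is $0$ at $z=0$. A system is $L^2$-approximately controllable (large time) if for every $\psi_0,\psi_1\in\mathbf{S}$ and $\varepsilon>0$ there exist $T>0$, $\theta\in[0,2\pi)$ and a piecewise constant control $u$ on $[0,T]$ with $\|\psi(T;u,\psi_0)-e^{i\theta}\psi_1\|_{L^2}<\varepsilon$. It is small-time $L^2$-approximately controllable if for every $\psi_0,\psi_1\in\mathbf{S}$ and $\varepsilon>0$ this can be achieved with some $T\in[0,\varepsilon]$. *)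

(* Defs.v *)
From HB Require Import structures.
From mathcomp Require Import all_boot all_order all_algebra.
From mathcomp Require Import complex.
From mathcomp Require Import all_classical all_reals all_analysis.

Set Implicit Arguments.
Unset Strict Implicit.
Unset Printing Implicit Defensive.

Import Order.TTheory GRing.Theory Num.Theory.
Import numFieldNormedType.Exports.

Local Open Scope classical_set_scope.
Local Open Scope ring_scope.

(* The Borel sigma-algebra of R^n, generated by the coordinates.              *)

Definition rV_display : measure_display -> measure_display.
Proof. exact. Qed.

Section measurable_rV.
Context {d} {T : measurableType d} {n : nat}.

Let coors : 'I_n -> 'rV[T]_n -> T := fun i x => x ord0 i.

Let rV_set0 : g_sigma_preimage coors set0.
Proof. exact: sigma_algebra0. Qed.

Let rV_setC A : g_sigma_preimage coors A -> g_sigma_preimage coors (~` A).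
Proof. exact: sigma_algebraC. Qed.

Let rV_bigcup (F : _^nat) : (forall i, g_sigma_preimage coors (F i)) ->
  g_sigma_preimage coors (\bigcup_i (F i)).
Proof. exact: sigma_algebra_bigcup. Qed.

HB.instance Definition _ := @isMeasurable.Build (rV_display d)
  'rV[T]_n (g_sigma_preimage coors) rV_set0 rV_setC rV_bigcup.

End measurable_rV.

Lemma measurable_coord d (T : measurableType d) n (i : 'I_n) :
  measurable_fun [set: 'rV[T]_n] (fun x : 'rV[T]_n => x ord0 i).
Proof.
move=> _ Y mY; rewrite setTI; apply: sub_sigma_algebra => /=.
rewrite -bigcup_seq/=; exists i => /=; first by rewrite mem_index_enum.
by exists Y => //; rewrite setTI.
Qed.

Lemma measurable_fun_rVP d1 d2 (T1 : measurableType d1) (T2 : measurableType d2)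
    n (f : T1 -> 'rV[T2]_n) :
  (forall i, measurable_fun [set: T1] (fun x => f x ord0 i)) ->
  measurable_fun [set: T1] f.
Proof.
move=> mf.
pose c := fun (i : 'I_n) (x : 'rV[T2]_n) => x ord0 i.
suff H : g_sigma_preimage (fun i => c i \o f) `<=` measurable.
  move: H; rewrite g_sigma_preimage_comp => H _ A mA.
  by apply: H; exists A.
apply: smallest_sub; first exact: sigma_algebra_measurable.
case: n => [|n] in f mf c *; first by rewrite big_ord0.
rewrite -bigcup_mkord_ord; apply: bigcup_sub => i Ii.
by move=> A [B mB <-]; exact: (mf _ measurableT).
Qed.

(* Lebesgue measure on R^n: the n-fold product of the one on R.               *)

Section lebesgue_rV.
Context {R : realType}.

Definition rV_cons n (p : measurableTypeR R * 'rV[R]_n) : 'rV[R]_n.+1 :=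
  \row_j oapp (p.2 ord0) p.1 (unlift ord0 j).

Definition rV_uncons n (x : 'rV[R]_n.+1) : measurableTypeR R * 'rV[R]_n :=
  (x ord0 ord0, \row_j x ord0 (lift ord0 j)).

Lemma rV_consK n : cancel (@rV_cons n) (@rV_uncons n).
Proof.
move=> [a x]; rewrite /rV_cons /rV_uncons/= mxE unlift_none/=; congr pair.
by apply/rowP => j; rewrite !mxE liftK.
Qed.

Lemma rV_unconsK n : cancel (@rV_uncons n) (@rV_cons n).
Proof.
move=> x; apply/rowP => j; rewrite !mxE.
by case: unliftP => [k ->|->]/=; rewrite ?mxE.
Qed.

Lemma measurable_rV_cons n :
  measurable_fun [set: measurableTypeR R * 'rV[R]_n] (@rV_cons n).
Proof.
apply: measurable_fun_rVP => i; under eq_fun do rewrite mxE.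
case: unliftP => [k ki|ki] /=; last exact: measurable_fst.
exact: (measurableT_comp (measurable_coord k) measurable_snd).
Qed.

Lemma measurable_rV_uncons n :
  measurable_fun [set: 'rV[R]_n.+1] (@rV_uncons n).
Proof.
apply: measurable_fun_pair; first exact: measurable_coord.
apply: measurable_fun_rVP => i; under eq_fun do rewrite mxE.
exact: measurable_coord.
Qed.


Section rV_cons_measure.
Context {n : nat} (m : {sigma_finite_measure set 'rV[R]_n -> \bar R}).

Definition rV_cons_measure : set 'rV[R]_n.+1 -> \bar R :=
  pushforward (@lebesgue_measure R \x m)%E (@rV_cons n).

Let rV_cons_measure0 : rV_cons_measure set0 = 0%E.
Proof. by rewrite /rV_cons_measure /pushforward preimage_set0 measure0. Qed.

Let rV_cons_measure_ge0 A : (0 <= rV_cons_measure A)%E.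
Proof. by rewrite /rV_cons_measure /pushforward; exact: measure_ge0. Qed.

Let rV_cons_measure_sigma_additive : semi_sigma_additive rV_cons_measure.
Proof.
move=> F mF tF mUF; rewrite /rV_cons_measure /pushforward preimage_bigcup.
apply: measure_semi_sigma_additive.
- by move=> k; rewrite -[X in measurable X]setTI; exact: measurable_rV_cons.
- apply/trivIsetP => /= i j _ _ ij; rewrite -preimage_setI.
  by move/trivIsetP : tF => -> //; rewrite preimage_set0.
- rewrite -preimage_bigcup -[X in measurable X]setTI.
  exact: measurable_rV_cons.
Qed.

HB.instance Definition _ := isMeasure.Build _ _ _ rV_cons_measure
  rV_cons_measure0 rV_cons_measure_ge0 rV_cons_measure_sigma_additive.

Let rV_cons_measure_sigma_finite : sigma_finite setT rV_cons_measure.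
Proof.
have [F FT mF] : sigma_finite setT (@lebesgue_measure R \x m)%E.
  have /sigma_finiteP[F [TF ndF Foo]] := sigma_finiteT (@lebesgue_measure R).
  have /sigma_finiteP[G [TG ndG Goo]] := sigma_finiteT m.
  exists (fun k => F k `*` G k).
    rewrite -setXTT TF TG predeqE => -[x y]; split.
      move=> [/= [k _ Fkx] [l _ Gly]]; exists (maxn k l) => //; split.
      - by move: x Fkx; exact/subsetPset/ndF/leq_maxl.
      - by move: y Gly; exact/subsetPset/ndG/leq_maxr.
    by move=> [k _ []/= ? ?]; split; exists k.
  move=> k; have [? ?] := Foo k; have [? ?] := Goo k.
  split; first exact: measurableX.
  by rewrite product_measure1E// lte_mul_pinfty// ge0_fin_numE.
exists (fun k => @rV_uncons n @^-1` F k).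
  by rewrite -preimage_bigcup -FT preimage_setT.
move=> k; have [mFk Fk] := mF k; split.
  by rewrite -[X in measurable X]setTI; exact: measurable_rV_uncons.
rewrite /rV_cons_measure /pushforward -comp_preimage.
by rewrite (_ : _ \o _ = id) //; apply/funext => p /=; rewrite rV_consK.
Qed.

HB.instance Definition _ := Measure_isSigmaFinite.Build _ _ _ rV_cons_measure
  rV_cons_measure_sigma_finite.

End rV_cons_measure.

Fixpoint lebesgue_rV n : {sigma_finite_measure set 'rV[R]_n -> \bar R} :=
  match n with
  | 0 => dirac (0 : 'rV[R]_0)
  | n.+1 => rV_cons_measure (lebesgue_rV n)
  end.

Lemma lebesgue_rV_box n (A : 'I_n -> set R) : (forall i, measurable (A i)) ->
  lebesgue_rV n [set x | forall i, A i (x ord0 i)] =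
  (\prod_(i < n) lebesgue_measure (A i))%E.
Proof.
elim: n A => [|n IH] A mA /=.
  by rewrite big_ord0 diracE mem_set//= => -[].
rewrite big_ord_recl -IH//.
rewrite -product_measure1E; last 2 first.
- exact: mA.
- rewrite (_ : (fun _ => _) = \bigcap_(i in [set: 'I_n])
      ((fun x : 'rV[R]_n => x ord0 i) @^-1` A (lift ord0 i))).
    apply: fin_bigcap_measurable => // i _.
    rewrite -[X in measurable X]setTI.
    by apply: measurable_coord => //; exact: mA.
  by apply/seteqP; split => x /= H; [move=> i _|move=> i]; exact: H.
rewrite /rV_cons_measure /pushforward; congr (_ _).
apply/seteqP; split => -[a x] /=.
  move=> H; split; first by have := H ord0; rewrite mxE unlift_none.
  by move=> i; have := H (lift ord0 i); rewrite mxE liftK.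
move=> [Aa H] i; rewrite mxE.
by case: unliftP => [k ->|->] //=; exact: H.
Qed.

End lebesgue_rV.

Section euclidean.
Context {R : realType} {d : nat}.
Implicit Types (x y : 'rV[R]_d) (f : 'rV[R]_d -> R).

(* The norm [`|x|] of ['rV[R]_d] is the sup norm, hence an explicit |x|^2.    *)
Definition sqnorm x : R := \sum_j x ord0 j ^+ 2.

Definition dotv x y : R := \sum_j x ord0 j * y ord0 j.

Definition partial (j : 'I_d) f : 'rV[R]_d -> R :=
  fun x => 'D_(delta_mx ord0 j) f x.

Definition mpartial (b : 'I_d -> nat) f : 'rV[R]_d -> R :=
  foldr (fun j => iter (b j) (partial j)) f (enum 'I_d).

Definition laplacian f : 'rV[R]_d -> R :=
  fun x => \sum_j partial j (partial j f) x.

(* All iterated partial derivatives, in any order, exist and are continuous.  *)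
Definition smooth f : Prop :=
  forall s : seq 'I_d, let g := foldr partial f s in
    continuous g /\ forall j x, derivable g x (delta_mx ord0 j).

Definition test_function f : Prop :=
  smooth f /\ compact (closure [set x | f x != 0]).

End euclidean.

Section complex_L2.
Context {R : realType}.

Definition Cintegral {dT} {T : measurableType dT} (mu : {measure set T -> \bar R})
    (D : set T) (f : T -> R[i]) : R[i] :=
  Complex (Rintegral mu D (fun x => complex.Re (f x)))
          (Rintegral mu D (fun x => complex.Im (f x))).

Context {d : nat}.
Implicit Types (psi g : 'rV[R]_d -> R[i]) (M : R).

Definition L2norm psi : \bar R :=
  'N[lebesgue_rV d]_2%:E[EFin \o (@Normc.normc R \o psi)]%E.

Definition L2 psi : Prop :=
  [/\ measurable_fun setT (fun x => complex.Re (psi x)),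
      measurable_fun setT (fun x => complex.Im (psi x)) &
      (L2norm psi < +oo)%E].

Definition L2sphere psi : Prop := L2 psi /\ L2norm psi = 1%E.

Definition weak_partial (j : 'I_d) psi g : Prop :=
  forall phi : 'rV[R]_d -> R, test_function phi ->
    Cintegral (lebesgue_rV d) setT (fun x => psi x * (partial j phi x)%:C%C) =
    - Cintegral (lebesgue_rV d) setT (fun x => g x * (phi x)%:C%C).

(* psi belongs to Sigma (H^1 with |x| psi in L^2), with norm at most M.       *)
Definition Sigma_le M psi : Prop :=
  [/\ L2 psi,
      (L2norm psi <= M%:E)%E,
      (L2norm (fun x => psi x * (Num.sqrt (sqnorm x))%:C%C)%R <= M%:E)%E &
      forall j, exists g, [/\ L2 g, weak_partial j psi g & (L2norm g <= M%:E)%E]].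

End complex_L2.

Section log_schrodinger.
Context {R : realType} {d m : nat}.

(* [lam] is the coefficient of the nonlinearity, [V] the potential, and       *)
(* [W c] the potential exerted when the control takes the value [c].          *)
Variables (lam : R) (V : 'rV[R]_d -> R) (W : 'rV[R]_m -> 'rV[R]_d -> R).
Implicit Types (T : R) (u : R -> 'rV[R]_m) (psi : R -> 'rV[R]_d -> R[i]).

(* The values at the breakpoints are irrelevant to the equation.              *)
Definition piecewise_constant T u : Prop :=
  exists2 s, itv_partition 0 T s &
    forall k, (k < size s)%N -> exists c,
      forall t, nth 0 (0 :: s) k < t < nth 0 (0 :: s) k.+1 -> u t = c.

(* z log |z|^2; it vanishes at z = 0 whatever [ln 0] is.                      *)
Definition logNL (z : R[i]) : R[i] := z * (ln (Normc.normc z ^+ 2))%:C%C.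

Definition continuous_L2 T psi : Prop :=
  forall t, 0 <= t <= T ->
    L2norm (fun x => psi s x - psi t x) @[s --> within `[0, T] (nbhs t)]
      --> 0%E.

(* The pairing of - 1/2 Delta f + (V + W c) f + lam f log |f|^2 with phi,     *)
(* bilinear (no conjugate), the Laplacian being moved onto phi.               *)
Definition weak_rhs (c : 'rV[R]_m) (f : 'rV[R]_d -> R[i])
    (phi : 'rV[R]_d -> R) : R[i] :=
  Cintegral (lebesgue_rV d) setT (fun x =>
    - f x * (2^-1 * laplacian phi x)%:C%C
    + ((V x + W c x)%:C%C * f x + lam%:C%C * logNL (f x)) * (phi x)%:C%C).

(* Solutions in C([0,T]; L^2) and L^oo(0,T; Sigma), the equation being taken  *)
(* in the sense of distributions and integrated in time.                      *)
Definition Sigma_solution T u psi : Prop :=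
  [/\ continuous_L2 T psi,
      (exists M, forall t, 0 <= t <= T -> Sigma_le M (psi t)) &
      forall phi, test_function phi -> forall t, 0 <= t <= T ->
        'i%C * Cintegral (lebesgue_rV d) setT
                 (fun x => (psi t x - psi 0 x) * (phi x)%:C%C) =
        Cintegral lebesgue_measure `[0, t]
          (fun s => weak_rhs (u s) (psi s) phi)].

(* The solution map on Sigma is L^2-Lipschitz and Sigma is dense in L^2:      *)
(* psi(.; u, psi0) is the limit in C([0,T]; L^2) of solutions in Sigma.       *)
Definition L2_solution T u (psi0 : 'rV[R]_d -> R[i]) psi : Prop :=
  [/\ forall t, 0 <= t <= T -> L2 (psi t),
      continuous_L2 T psi,
      {ae lebesgue_rV d, forall x, psi 0 x = psi0 x} &
      forall eta : R, 0 < eta -> exists2 psi', Sigma_solution T u psi' &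
        forall t, 0 <= t <= T ->
          (L2norm (fun x => psi' t x - psi t x)%R <= eta%:E)%E].

Definition expi (theta : R) : R[i] := Complex (cos theta) (sin theta).

Definition steers T u (psi0 psi1 : 'rV[R]_d -> R[i]) (eps : R) : Prop :=
  exists theta, 0 <= theta < 2 * pi /\
  exists2 psi, L2_solution T u psi0 psi &
    (L2norm (fun x => psi T x - expi theta * psi1 x)%R < eps%:E)%E.

Definition L2_approx_controllable : Prop :=
  forall psi0 psi1 : 'rV[R]_d -> R[i], L2sphere psi0 -> L2sphere psi1 ->
  forall eps : R, 0 < eps ->
  exists T, 0 < T /\
  exists2 u, piecewise_constant T u & steers T u psi0 psi1 eps.

Definition small_time_L2_approx_controllable : Prop :=
  forall psi0 psi1 : 'rV[R]_d -> R[i], L2sphere psi0 -> L2sphere psi1 ->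
  forall eps : R, 0 < eps ->
  exists T, 0 <= T <= eps /\
  exists2 u, piecewise_constant T u & steers T u psi0 psi1 eps.

End log_schrodinger.

(* Main.v *)
(* For [(q, p)] in phase space, the reflection of psi through [(q, p)] is                       *)
(* [psi (2 q - x) e^(2 i p.(x - q))], and the scalar product of psi with its reflection is the *)
(* Wigner function of psi at [(q, p)]. Its regularisation                                      *)
(*   [wig X k q p = Re int int psi(x) conj(psi(y)) e^(- i p.(x - y)) X(x - y) k(x + y - 2 q)]  *)
(* may be differentiated in time for a solution in the sense of distributions; when [(q, p)]   *)
(* follows the classical trajectory, the control disappears from the derivative up to the      *)
(* second-order Taylor remainder of the potential.                                             *)
(*                                                                                             *)
(* 1. For a quadratic potential there is no remainder: the reflection of a solution solves the *)
(* same equation, and the Cazenave--Haraux inequality gives that its squared distance to psi   *)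
(* grows at most by [e^(4 |lam| t)], whatever the control. So from an even state only states   *)
(* that are symmetric under some reflection can be approached, and two humps of unequal        *)
(* weights are not.                                                                            *)
(*                                                                                             *)
(* 2. For bounded second derivatives and fixed [X] and [k], the remainder bounds the           *)
(* derivative of [wig] independently of the control, so in small time the supremum of [wig]    *)
(* over phase space cannot drop much; but it is arbitrarily small for spread-out states.       *)

Require Import Defs.
From HB Require Import structures.
From mathcomp Require Import all_boot all_order all_algebra.
From mathcomp Require Import complex ring lra.
From mathcomp Require Import all_classical all_reals all_analysis.
From mathcomp Require Import measurable_realfun.

Set Implicit Arguments.
Unset Strict Implicit.
Unset Printing Implicit Defensive.

Import Order.TTheory GRing.Theory Num.Theory.
Import numFieldNormedType.Exports.

Local Open Scope classical_set_scope.
Local Open Scope ring_scope.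

(** For a state of mass [m], [2 m - 2 wig] is, up to regularisation, the squared L^2 distance
    between psi and its reflection through the point [(q, p)]: a defect of symmetry. [bilin_derive]
    and [wig_derive] differentiate it for a weak solution while [(q, p)] moves by [q' = p],
    [p' = - w]. The transport terms cancel, and what is left is [rate]: a kinetic term carrying one
    derivative of [X] and one of [k], the remainder [U x - U y - w.(x - y)] of the potential, and a
    difference of logarithms. The last is dominated by the defect itself, through the
    Cazenave--Haraux inequality ([lnsq_cross], [phase_log]). [rate_bound] collects the three
    estimates.

    The classical equations are not solved. [polygon_piece] follows parabolic arcs of frozen force
    [w], refined until [w] is within a tolerance of the true force, and [propagation] joins the
    pieces of constant control into one Gronwall inequality from [0] to [T]. The trajectory is
    bounded in terms of the control before the kernels are chosen.

    For a quadratic potential, [k] is an approximate identity of radius [ep] and [X] a wide cutoff.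
    The remainder is bilinear in [x + y - 2 q] and [x - y], hence small with [ep], and the kinetic
    term is small because [X] is nearly flat ([quadratic_rate]). So the defect, measured against a
    constant mass, grows at most by [e^(4 |lam| T)]. Constancy of the mass ([mass_const]) comes from
    the same functional at the origin, with the roles of [X] and [k] exchanged. The indicator of a
    centred cube has almost no defect, whereas the target of [two_hump_state] has [wig <= 4 / 5] at
    every point. The initial error must be small compared with [e^(- 4 |lam| T)]; this is possible
    because a fixed accuracy at the target determines [T], after which the solution in Sigma
    approximating the L^2 one can be taken as close as desired.

    For bounded second derivatives, [X] and [k] are both the fixed [bump]. By [bump_rate] the
    derivative of [wig] is at most a constant times the mass, the constant depending on the Taylor
    remainder and not on a linear control. Hence [wig], positive at the origin for the cube, is
    still bounded below somewhere in phase space after a short time, while for the target of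
    [spread_state] it is small everywhere. *)

Local Notation push m f := (measure_function_pushforward__canonical__measure_function_Measure m f).

(** * Integration on R^d and R^d x R^d *)

Section measure_rV.
Context {R : realType}.
Notation E d := 'rV[R]_d.

Lemma measurable_box d (A : 'I_d -> set R) :
  (forall i, measurable (A i)) -> measurable [set x : E d | forall i, A i (x ord0 i)].
Proof.
move=> mA; rewrite (_ : [set x | _] = \bigcap_(i in [set: 'I_d])
      ((fun x : 'rV[R]_d => x ord0 i) @^-1` A i)); last first.
  by apply/seteqP; split => x /= H; [move=> i _|move=> i]; exact: H.
apply: fin_bigcap_measurable => // i _.
by rewrite -[X in measurable X]setTI; apply: measurable_coord.
Qed.

Lemma normrV_le d (x : E d) (c : R) : 0 <= c ->
  reflect (forall i, `|x ord0 i| <= c) (`|x| <= c).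
Proof.
move=> c0; apply: (iffP idP).
  move=> xc i; apply: le_trans xc.
  rewrite [leRHS]/Num.norm/= mx_normrE.
  by apply: (le_bigmax _ (fun ij : 'I_1 * 'I_d => `|x ij.1 ij.2|) (ord0, i)).
move=> H; rewrite [leLHS]/Num.norm/= mx_normrE.
by apply/bigmax_leP; split => // -[i j] _ /=; rewrite ord1.
Qed.

Lemma coord_le_norm d (x : E d) i : `|x ord0 i| <= `|x|.
Proof. by apply/normrV_le. Qed.

Definition cube d (n : R) : set (E d) := [set x | `|x| <= n].

Lemma cubeE d n : 0 <= n ->
  @cube d n = [set x | forall i, `[- n, n]%classic (x ord0 i)].
Proof.
move=> n0; apply/seteqP; split => x /=.
  by move=> /normrV_le H i; rewrite in_itv/= -ler_norml H.
by move=> H; apply/normrV_le => // i; move: (H i); rewrite in_itv/= -ler_norml.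
Qed.

Lemma measurable_cube d n : measurable (@cube d n).
Proof.
have [n0|n0] := leP 0 n.
  rewrite cubeE//; apply: (@measurable_box _ (fun=> `[- n, n]%classic)) => i.
  exact: measurable_itv.
rewrite (_ : cube _ = set0)//; apply/seteqP; split => x //= /le_lt_trans -/(_ _ n0).
by rewrite ltNge normr_ge0.
Qed.

Lemma cube_lty d n : (lebesgue_rV d (@cube d n) < +oo)%E.
Proof.
have [n0|n0] := leP 0 n; last first.
  rewrite (_ : cube _ = set0) ?measure0//.
  by apply/seteqP; split => x //= /le_lt_trans -/(_ _ n0); rewrite ltNge normr_ge0.
rewrite cubeE// (lebesgue_rV_box (A := fun=> `[- n, n]%classic))//.
have -> : (\prod_(i < d) lebesgue_measure `[(- n)%R, n]%classic = \prod_(i < d) (n + n)%:E)%E.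
  apply: eq_bigr => i _; rewrite lebesgue_measure_itv/= lte_fin.
  case: ifP => [_|/negbT]; first by rewrite -EFinB opprK.
  by rewrite -leNgt => H; congr EFin; lra.
by rewrite prodEFin ltry.
Qed.

(** The sigma-algebra is generated by the coordinates, so continuity is linked to it by
    discretisation: [f] is the pointwise limit of its values at the grid points of step
    [1 / (n + 1)] below the argument. Each approximation takes countably many values, constant on
    boxes. *)
Lemma continuous_rV_measurable d (f : E d -> R) :
  continuous f -> measurable_fun setT f.
Proof.
move=> cf.
pose r (n : nat) (x : E d) : 'rV[int]_d := \row_i Num.floor (n.+1%:R * x ord0 i).
pose s (n : nat) (k : 'rV[int]_d) : E d := \row_i ((k ord0 i)%:~R / n.+1%:R).
apply: (measurable_fun_cvg (D := setT) (h := fun n x => f (s n (r n x)))).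
  move=> n _ Y mY; rewrite setTI.
  rewrite (_ : _ @^-1` _ = \bigcup_(k in [set k | Y (f (s n k))]) [set x | r n x = k]); last first.
    apply/seteqP; split => x /=; first by move=> H; exists (r n x).
    by move=> [k /= H E0]; rewrite E0.
  rewrite bigcup_mkcond; apply: countable_bigcupT_measurable.
    exact: countableP.
  move=> k; case: ifP => // _.
  rewrite (_ : [set x : E d | r n x = k] = [set x | forall i, [set y : R | Num.floor (n.+1%:R * y) = k ord0 i] (x ord0 i)]).
    apply: (@measurable_box _ (fun i => [set y : R | Num.floor (n.+1%:R * y) = k ord0 i])) => i.
    rewrite (_ : [set y : R | Num.floor (n.+1%:R * y) = k ord0 i] = `[(k ord0 i)%:~R / n.+1%:R, (k ord0 i + 1)%:~R / n.+1%:R[%classic).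
      exact: measurable_itv.
    apply/seteqP; split => y /=; rewrite in_itv/=.
      move=> <-; rewrite ler_pdivrMr// ltr_pdivlMr// ![y * _]mulrC.
      exact: floor_itv.
    rewrite ler_pdivrMr// ltr_pdivlMr// ![y * _]mulrC => H.
    by apply/floor_def.
  apply/seteqP; split => x /=.
    by move=> <- i; rewrite mxE.
  by move=> H; apply/rowP => i; rewrite mxE.
move=> x _; suff H : s n (r n x) @[n --> \oo] --> (x : E d) by exact: (cvg_comp _ f H (cf x)).
apply/cvgrPdist_le => e e0.
near=> n; apply/normrV_le; first exact: ltW.
move=> i; rewrite !mxE.
have /andP[h1 h2] := floor_itv (n.+1%:R * x ord0 i).
have n0 : 0 < n.+1%:R :> R by [].
rewrite ger0_norm; last by rewrite subr_ge0 ler_pdivrMr// [leRHS]mulrC.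
apply: (@le_trans _ _ (n.+1%:R^-1)).
  rewrite -(ler_pM2l n0) mulrBr mulrCA divff ?mulr1 ?gt_eqF//.
  by move: h2; rewrite intrD => /ltW; lra.
by apply: ltW; near: n; exact: (near_infty_natSinv_lt (PosNum e0)).
Unshelve. all: by end_near. Qed.

(** Lebesgue measure is determined by the half-open intervals, whose preimages are intervals of the
    same length, closed at the other end when [s = -1]. *)
Lemma lebesgue_measure_affine (s c : R) (A : set R) : s = 1 \/ s = -1 ->
  measurable A ->
  lebesgue_measure ((fun x : R => c + s * x) @^-1` A) = lebesgue_measure A.
Proof.
move=> s1 mA.
have mphi : measurable_fun setT (fun x : measurableTypeR R => c + s * x : measurableTypeR R).
  by apply: measurable_funD => //; exact: measurable_funM.
apply: esym; refine (@lebesgue_measure_unique R (push (@lebesgue_measure R) mphi) _ A mA).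
move=> X /ocitvP[->|[[a b] /= ab ->]].
  by rewrite !measure0.
apply: esym; rewrite /= /pushforward; case: s1 => ->.
  rewrite (_ : _ @^-1` _ = `]a - c, b - c]%classic); last first.
    by apply/seteqP; split => y /=; rewrite !in_itv/= mul1r ltrBlDl lerBrDl.
  rewrite !lebesgue_measure_itv/= !lte_fin ltrD2r ab -!EFinB.
  by congr EFin; lra.
rewrite (_ : _ @^-1` _ = `[c - b, c - a[%classic); last first.
  by apply/seteqP; split => y /=; rewrite !in_itv/= => /andP[h1 h2]; apply/andP; split; lra.
rewrite !lebesgue_measure_itv/= !lte_fin ltrD2l ltrN2 ab -!EFinB.
by congr EFin; lra.
Qed.

Lemma measurable_affine d (s : R) (c : E d) :
  measurable_fun setT (fun x : E d => c + s *: x).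
Proof.
apply: measurable_fun_rVP => i.
rewrite (_ : (fun _ => _) = (fun x : E d => c ord0 i + s * x ord0 i)).
  apply: measurable_funD => //; apply: measurable_funM => //.
  exact: measurable_coord.
by apply/funext => x; rewrite !mxE.
Qed.

(** Boxes are stable under intersection, generate the sigma-algebra and include cubes of finite
    measure exhausting the space, so the one-dimensional invariance on each side of a box
    suffices. *)
Lemma lebesgue_rV_affine d (s : R) (c : E d) (A : set (E d)) : s = 1 \/ s = -1 ->
  measurable A ->
  lebesgue_rV d ((fun x : E d => c + s *: x) @^-1` A) = lebesgue_rV d A.
Proof.
move=> s1 mA.
pose G := [set B : set (E d) | exists2 A : 'I_d -> set R, (forall i, measurable (A i))
   & B = [set x : E d | forall i, A i (x ord0 i)]].
apply: esym; apply: (@measure_unique _ _ _ G (fun n => @cube d n%:R) _ _ _ _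
  (lebesgue_rV d) (push (lebesgue_rV d) (measurable_affine s c))) => //.
- apply/seteqP; split.
    apply: smallest_sub; first exact: smallest_sigma_algebra.
    move=> {A mA}; case: d c @G => [|n] c G; first by rewrite big_ord0.
    rewrite -bigcup_mkord_ord; apply: bigcup_sub => i Ii.
    move=> B [Y mY <-]; apply: sub_sigma_algebra.
    exists (fun j => if j == inord i then Y else setT).
      by move=> j; case: ifP.
    apply/seteqP; split => x /=.
      by move=> [_ H] j; case: ifP => // /eqP ->.
    by move=> /(_ (inord i)); rewrite eqxx.
  apply: smallest_sub; first exact: sigma_algebra_measurable.
  by move=> B [F mF ->]; exact: measurable_box.
- move=> B C [F mF ->] [F' mF' ->]; exists (fun i => F i `&` F' i).
    by move=> i; exact: measurableI.
  apply/seteqP; split => x /=; first by move=> [h1 h2] i; split.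
  by move=> h; split => i; case: (h i).
- move=> n; exists (fun=> `[- n%:R, n%:R]%classic); first by move=> i; exact: measurable_itv.
  by rewrite cubeE.
- apply/seteqP; split => x //= _.
  exists (Num.bound `|x|) => //; rewrite /cube/=; apply: ltW.
  by have := archi_boundP (normr_ge0 x).
- move=> B [F mF ->]; transitivity (\prod_(i < d) lebesgue_measure (F i))%E.
    exact: lebesgue_rV_box.
  rewrite /= /pushforward.
  rewrite (_ : (fun x : E d => c + s *: x) @^-1` [set x | forall i, F i (x ord0 i)] =
    [set x | forall i, ((fun y => c ord0 i + s * y) @^-1` (F i)) (x ord0 i)]).
    rewrite (@lebesgue_rV_box _ _ (fun i => (fun y => c ord0 i + s * y) @^-1` F i)).
      by apply: eq_bigr => i _; rewrite lebesgue_measure_affine.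
    move=> i; rewrite -[X in measurable X]setTI.
    have mphi : measurable_fun setT (fun x : R => c ord0 i + s * x).
      by apply: measurable_funD => //; exact: measurable_funM.
    exact: mphi.
  by apply/seteqP; split => x /= h i; have := h i; rewrite !mxE.
- by move=> n; exact: cube_lty.
Qed.

Lemma integral_affine d (s : R) (c : E d) (f : E d -> \bar R) : s = 1 \/ s = -1 ->
  measurable_fun setT f -> (forall x, (0 <= f x)%E) ->
  (\int[lebesgue_rV d]_x f (c + s *: x)%R = \int[lebesgue_rV d]_x f x)%E.
Proof.
move=> s1 mf f0.
have mphi := measurable_affine s c.
rewrite -[RHS](@eq_measure_integral _ _ _ _ _ (push (lebesgue_rV d) mphi)).
  rewrite ge0_integral_pushforward//.
by move=> B mB _; rewrite -[RHS](lebesgue_rV_affine c s1 mB).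
Qed.

End measure_rV.

(** * Real-valued integrable functions *)

Section integration.
Context d (T : measurableType d) (R : realType).
Variable m : {measure set T -> \bar R}.
Implicit Types f g : T -> R.

Definition itg f := m.-integrable setT (EFin \o f).

Lemma itg_measurable f : itg f -> measurable_fun setT f.
Proof. by move=> /integrableP[/measurable_EFinP]. Qed.

Lemma itgD f g : itg f -> itg g -> itg (fun x => f x + g x).
Proof. by move=> hf hg; apply: eq_integrable (integrableD _ hf hg). Qed.

Lemma itgB f g : itg f -> itg g -> itg (fun x => f x - g x).
Proof. by move=> hf hg; apply: eq_integrable (integrableB _ hf hg). Qed.

Lemma itgZ c f : itg f -> itg (fun x => c * f x).
Proof. by move=> hf; apply: eq_integrable (integrableZl _ c hf). Qed.

Lemma itg0 : itg (fun=> 0).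
Proof. exact: integrable0. Qed.

Lemma itg_norm f : itg f -> itg (fun x => `|f x|).
Proof. by move=> hf; apply: eq_integrable (integrable_norm hf). Qed.

Lemma itg_dom f g : measurable_fun setT f -> itg g ->
  (forall x, `|f x| <= g x) -> itg f.
Proof.
move=> mf hg fg; apply: le_integrable hg => //; first exact/measurable_EFinP.
by move=> x _ /=; rewrite lee_fin (le_trans (fg x))// ler_norm.
Qed.

Lemma itg_ge0P f : measurable_fun setT f -> (forall x, 0 <= f x) ->
  (\int[m]_x (f x)%:E < +oo)%E -> itg f.
Proof.
move=> mf f0 foo; apply/integrableP; split; first exact/measurable_EFinP.
by under eq_integral do rewrite /= ger0_norm//.
Qed.

Lemma itg_sum I (s : seq I) (F : I -> T -> R) : (forall i, itg (F i)) ->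
  itg (fun x => \sum_(i <- s) F i x).
Proof.
move=> h; elim: s => [|i s ih].
  by under eq_fun do rewrite big_nil; exact: itg0.
by under eq_fun do rewrite big_cons; exact: itgD.
Qed.

Lemma intD f g : itg f -> itg g ->
  \int[m]_x (f x + g x) = \int[m]_x f x + \int[m]_x g x.
Proof. exact: RintegralD. Qed.

Lemma intB f g : itg f -> itg g ->
  \int[m]_x (f x - g x) = \int[m]_x f x - \int[m]_x g x.
Proof. exact: RintegralB. Qed.

Lemma intZ c f : itg f -> \int[m]_x (c * f x) = c * \int[m]_x f x.
Proof. exact: RintegralZl. Qed.

Lemma int_sum I (s : seq I) (F : I -> T -> R) : (forall i, itg (F i)) ->
  \int[m]_x (\sum_(i <- s) F i x) = \sum_(i <- s) \int[m]_x (F i x).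
Proof.
move=> h; elim: s => [|i s ih].
  rewrite big_nil; under eq_Rintegral do rewrite big_nil.
  by rewrite Rintegral_cst// mul0r.
rewrite big_cons; under eq_Rintegral do rewrite big_cons.
by rewrite intD// ?ih//; exact: itg_sum.
Qed.

Lemma int_le f g : itg f -> itg g -> (forall x, f x <= g x) ->
  \int[m]_x f x <= \int[m]_x g x.
Proof. by move=> hf hg fg; apply: le_Rintegral. Qed.

Lemma int_ge0 f : (forall x, 0 <= f x) -> 0 <= \int[m]_x f x.
Proof. by move=> f0; apply: Rintegral_ge0. Qed.

Lemma int_eq f g : (forall x, f x = g x) -> \int[m]_x f x = \int[m]_x g x.
Proof. by move=> fg; apply: eq_Rintegral. Qed.

Lemma int_norm f g : measurable_fun setT f -> itg g ->
  (forall x, `|f x| <= g x) -> `|\int[m]_x f x| <= \int[m]_x g x.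
Proof.
move=> mf hg fg; have hf := itg_dom mf hg fg.
apply: le_trans (le_normr_Rintegral _ hf) _ => //.
by apply: int_le => //; exact: itg_norm.
Qed.

Lemma itgE f : itg f -> (\int[m]_x (f x)%:E)%E = (\int[m]_x f x)%:E.
Proof. by move=> hf; rewrite /Rintegral fineK//; exact: integrable_fin_num. Qed.

End integration.

(** * Fubini and the Schur identities *)

Section product.
Context {R : realType} {d : nat}.
Notation E := 'rV[R]_d.
Notation mu := (@lebesgue_rV R d).
Notation mu2 := (lebesgue_rV d \x lebesgue_rV d)%E.

Lemma measurable_comb (s1 s2 : R) (c : E) :
  measurable_fun setT (fun z : E * E => c + s1 *: z.1 + s2 *: z.2).
Proof.
apply: measurable_fun_rVP => i.
rewrite (_ : (fun _ => _) = (fun z : E * E => c ord0 i + s1 * z.1 ord0 i + s2 * z.2 ord0 i)).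
  apply: measurable_funD; first (apply: measurable_funD => //).
    apply: measurable_funM => //.
    exact: (measurableT_comp (measurable_coord i) measurable_fst).
  apply: measurable_funM => //.
  exact: (measurableT_comp (measurable_coord i) measurable_snd).
by apply/funext => x; rewrite !mxE.
Qed.

Lemma measurable_fun1 (f : E -> R) : measurable_fun setT f ->
  measurable_fun setT (fun z : E * E => f z.1).
Proof. by move=> mf; exact: (measurableT_comp mf measurable_fst). Qed.

Lemma measurable_fun2 (f : E -> R) : measurable_fun setT f ->
  measurable_fun setT (fun z : E * E => f z.2).
Proof. by move=> mf; exact: (measurableT_comp mf measurable_snd). Qed.

Lemma itg_prod (f g : E -> R) : itg mu f -> itg mu g ->
  itg mu2 (fun z => f z.1 * g z.2).
Proof.
move=> hf hg.
have mfg : measurable_fun setT (fun z : E * E => f z.1 * g z.2).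
  apply: measurable_funM.
    exact: (measurable_fun1 (itg_measurable hf)).
  exact: (measurable_fun2 (itg_measurable hg)).
apply/integrableP; split; first exact/measurable_EFinP.
rewrite fubini_tonelli1//=; last first.
  by apply/measurable_EFinP; apply: measurableT_comp.
rewrite /fubini_F/=.
under eq_integral do under eq_integral do rewrite normrM EFinM.
under eq_integral => x _.
  rewrite ge0_integralZl//; last first.
    by apply/measurable_EFinP; apply: measurableT_comp => //; exact: (itg_measurable hg).
  rewrite (itgE (itg_norm hg)).
  over.
rewrite ge0_integralZr//; last 2 first.
- by apply/measurable_EFinP; apply: measurableT_comp => //; exact: (itg_measurable hf).
- by rewrite lee_fin; apply: int_ge0.
by rewrite (itgE (itg_norm hf)) -EFinM ltry.
Qed.

Lemma int2E (F : E * E -> R) : itg mu2 F -> (forall x, itg mu (fun y => F (x, y))) ->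
  \int[mu2]_z F z = \int[mu]_x (\int[mu]_y F (x, y)).
Proof.
move=> hF h1; rewrite /Rintegral -(integral12_prod_meas1 hF); congr fine.
by apply: eq_integral => x _; rewrite /fubini_F /=; exact: (itgE (h1 x)).
Qed.

Lemma int2E' (F : E * E -> R) : itg mu2 F -> (forall y, itg mu (fun x => F (x, y))) ->
  \int[mu2]_z F z = \int[mu]_y (\int[mu]_x F (x, y)).
Proof.
move=> hF h1; rewrite /Rintegral -(integral21_prod_meas1 hF); congr fine.
by apply: eq_integral => x _; rewrite /fubini_G /=; exact: (itgE (h1 x)).
Qed.

Section schur.
Variables (f h : E -> R) (c : E) (s : R).
Hypotheses (s1 : s = 1 \/ s = -1) (hf : itg mu f) (hh : itg mu h).
Hypotheses (f0 : forall x, 0 <= f x) (h0 : forall x, 0 <= h x).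

Let mh : measurable_fun setT (fun z : E * E => h (c + z.1 + s *: z.2)).
Proof.
have := measurableT_comp (itg_measurable hh) (measurable_comb 1 s c).
by apply: eq_measurable_fun => z _ /=; rewrite scale1r.
Qed.

(** For fixed [x], invariance under translation and reflection makes the inner integral equal to
    that of [h]. The bounds on bilinear forms below use this after dominating a kernel by a function
    of [x - y] or of [x + y]. *)
Let schur1E : (\int[mu2]_z (f z.1 * h (c + z.1 + s *: z.2))%:E =
  (\int[mu]_x f x * \int[mu]_x h x)%:E)%E.
Proof.
rewrite fubini_tonelli1//=; last 2 first.
- by apply/measurable_EFinP; apply: measurable_funM => //; exact: (measurable_fun1 (itg_measurable hf)).
- by move=> z; rewrite lee_fin mulr_ge0.
rewrite /fubini_F/=.
under eq_integral => x _.
  under eq_integral do rewrite EFinM.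
  rewrite ge0_integralZl//=; last 3 first.
  - apply/measurable_EFinP; apply: (measurableT_comp (itg_measurable hh)).
    exact: measurable_affine.
  - by move=> y _; rewrite lee_fin.
  - by rewrite lee_fin.
  rewrite (@integral_affine _ _ s (c + x) (EFin \o h))//=; last first.
    by apply/measurable_EFinP; exact: (itg_measurable hh).
  rewrite (itgE hh).
  over.
rewrite ge0_integralZr//=; last 3 first.
- by apply/measurable_EFinP; exact: (itg_measurable hf).
- by move=> x _; rewrite lee_fin.
- by rewrite lee_fin; apply: int_ge0.
by rewrite (itgE hf) EFinM.
Qed.

Let schur2E : (\int[mu2]_z (f z.2 * h (c + z.1 + s *: z.2))%:E =
  (\int[mu]_x f x * \int[mu]_x h x)%:E)%E.
Proof.
rewrite fubini_tonelli2//=; last 2 first.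
- by apply/measurable_EFinP; apply: measurable_funM => //; exact: (measurable_fun2 (itg_measurable hf)).
- by move=> z; rewrite lee_fin mulr_ge0.
rewrite /fubini_G/=.
under eq_integral => y _.
  under eq_integral do rewrite EFinM.
  rewrite ge0_integralZl//=; last 3 first.
  - apply/measurable_EFinP; apply: (measurableT_comp (itg_measurable hh)).
    under eq_fun do rewrite addrAC -[X in _ + X]scale1r.
    exact: measurable_affine.
  - by move=> x _; rewrite lee_fin.
  - by rewrite lee_fin.
  under eq_integral do rewrite addrAC -[X in _ + X]scale1r.
  rewrite (@integral_affine _ _ 1 (c + s *: y) (EFin \o h))//=; last 2 first.
    by left.
    by apply/measurable_EFinP; exact: (itg_measurable hh).
  rewrite (itgE hh).
  over.
rewrite ge0_integralZr//=; last 3 first.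
- by apply/measurable_EFinP; exact: (itg_measurable hf).
- by move=> x _; rewrite lee_fin.
- by rewrite lee_fin; apply: int_ge0.
by rewrite (itgE hf) EFinM.
Qed.

Lemma itg_schur1 : itg mu2 (fun z => f z.1 * h (c + z.1 + s *: z.2)).
Proof.
apply: itg_ge0P.
- by apply: measurable_funM => //; exact: (measurable_fun1 (itg_measurable hf)).
- by move=> z; rewrite mulr_ge0.
- by rewrite schur1E ltry.
Qed.

Lemma int_schur1 : \int[mu2]_z (f z.1 * h (c + z.1 + s *: z.2)) =
  \int[mu]_x f x * \int[mu]_x h x.
Proof. by rewrite [LHS]/Rintegral schur1E. Qed.

Lemma itg_schur2 : itg mu2 (fun z => f z.2 * h (c + z.1 + s *: z.2)).
Proof.
apply: itg_ge0P.
- by apply: measurable_funM => //; exact: (measurable_fun2 (itg_measurable hf)).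
- by move=> z; rewrite mulr_ge0.
- by rewrite schur2E ltry.
Qed.

Lemma int_schur2 : \int[mu2]_z (f z.2 * h (c + z.1 + s *: z.2)) =
  \int[mu]_x f x * \int[mu]_x h x.
Proof. by rewrite [LHS]/Rintegral schur2E. Qed.

End schur.
End product.

(** * Smooth and test functions *)

Section calculus.
Context {R : realType} {d : nat}.
Notation E := 'rV[R]_d.
Implicit Types (f g : E -> R) (x z v : E).

Lemma is_derive_line f p v (t : R) : derivable f (p + t *: v) v ->
  is_derive t 1 (fun s : R => f (p + s *: v)) ('D_v f (p + t *: v)).
Proof.
move=> df.
have H : (fun h : R => h^-1 *: (f (p + (h *: 1 + t) *: v) - f (p + t *: v))) =
   (fun h : R => h^-1 *: (f (h *: v + (p + t *: v)) - f (p + t *: v))).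
  apply/funext => h; congr (_ *: (f _ - _)).
  by rewrite scalerDl addrCA (_ : h *: 1 = h) // /GRing.scale /= mulr1.
split.
  by rewrite /derivable H.
by rewrite /derive H.
Qed.

Lemma line_mvt f p v (a : R) : (forall t : R, derivable f (p + t *: v) v) ->
  exists2 t : R, `|t| <= `|a| & f (p + a *: v) - f p = a * 'D_v f (p + t *: v).
Proof.
move=> df.
have dg (t : R) : is_derive t (1 : R) (fun s : R => f (p + s *: v)) ('D_v f (p + t *: v)).
  exact: is_derive_line.
have cg : continuous (fun s : R => f (p + s *: v)).
  by move=> t; apply: differentiable_continuous; apply/derivable1_diffP; case: (dg t).
have [a0|a0|->] := ltgtP a 0; last first.
- by exists 0; rewrite ?normr0// scale0r addr0 subrr mul0r.
- have [|t] := @MVT _ (fun s : R => f (p + s *: v)) (fun t => 'D_v f (p + t *: v)) 0 a a0.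
    exact: continuous_subspaceT.
  rewrite in_itv/= scale0r addr0 subr0 => /andP[t0 ta] H; exists t; last by rewrite H mulrC.
  by rewrite !gtr0_norm// ltW.
- have [|t] := @MVT _ (fun s : R => f (p + s *: v)) (fun t => 'D_v f (p + t *: v)) a 0 a0.
    exact: continuous_subspaceT.
  rewrite in_itv/= scale0r addr0 sub0r => /andP[t0 ta] H; exists t.
    by rewrite !ltr0_norm// lerN2 ltW.
  by rewrite -opprB H mulrN opprK mulrC.
Qed.

(** The corners of the broken line from [x] to [x + z] that follows the axes one after the other. *)
Definition partway (k : nat) x z : E :=
  \row_i (if (i < k)%N then x ord0 i + z ord0 i else x ord0 i).

(** The mean value theorem on each segment of the broken line, as smoothness is expressed by partial
    derivatives. That [xi j] leaves the coordinates after [j] unmoved matters in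
    [hessian_taylor]. *)
Lemma coordinate_mvt f x z : (forall j y, derivable f y (delta_mx ord0 j)) ->
  exists xi : 'I_d -> E,
    (forall j, exists2 t : R, `|t| <= `|z ord0 j| &
        xi j = partway j x z + t *: delta_mx ord0 j) /\
    f (x + z) - f x = \sum_j z ord0 j * partial j f (xi j).
Proof.
move=> df.
have step (j : 'I_d) : exists w : E, (exists2 t : R, `|t| <= `|z ord0 j| &
        w = partway j x z + t *: delta_mx ord0 j) /\
   f (partway j.+1 x z) - f (partway j x z) = z ord0 j * partial j f w.
  have [t tz H] := @line_mvt f (partway j x z) (delta_mx ord0 j) (z ord0 j) (fun t => df _ _).
  exists (partway j x z + t *: delta_mx ord0 j); split; first by exists t.
  rewrite /partial -H; congr (f _ - _); apply/rowP => i; rewrite !mxE /= ltnS leq_eqVlt.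
  have [->|ij] := eqVneq i j; first by rewrite eqxx ltnn /= mulr1.
  by rewrite (negbTE ij : (i == j :> nat) = false) /= mulr0 addr0.
have [xi Hxi] := choice step.
exists xi; split=> [j|]; first by case: (Hxi j).
transitivity (\sum_(0 <= k < d) (f (partway k.+1 x z) - f (partway k x z))).
  rewrite telescope_sumr//; congr (f _ - f _); apply/rowP => i; rewrite !mxE ?ltn_ord//.
by rewrite big_mkord; apply: eq_bigr => j _; case: (Hxi j).
Qed.

Lemma partway_close k x z (j : 'I_d) (t : R) : (k <= j)%N -> `|t| <= `|z ord0 j| ->
  `|partway k x z + t *: delta_mx ord0 j - x| <= `|z|.
Proof.
move=> kj tz; apply/normrV_le => // i; rewrite !mxE /=.
have [->|ij] := eqVneq i j.
  rewrite ltnNge kj /= mulr1 addrAC subrr add0r; exact: le_trans tz (coord_le_norm _ _).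
rewrite mulr0 addr0; case: ifP => _; last by rewrite subrr normr0.
by rewrite addrAC subrr add0r; exact: coord_le_norm.
Qed.

Lemma coordinate_mvt_close f x z : (forall j y, derivable f y (delta_mx ord0 j)) ->
  exists xi : 'I_d -> E, (forall j, `|xi j - x| <= `|z|) /\
    f (x + z) - f x = \sum_j z ord0 j * partial j f (xi j).
Proof.
move=> /coordinate_mvt -/(_ x z) [xi [h1 h2]]; exists xi; split => // j.
by have [t tz ->] := h1 j; apply: partway_close.
Qed.

Lemma smooth_cont f : smooth f -> continuous f.
Proof. by move=> /(_ [::]) []. Qed.

Lemma smooth_derivable f j x : smooth f -> derivable f x (delta_mx ord0 j).
Proof. by move=> /(_ [::]) []. Qed.

Lemma smooth_partial f j : smooth f -> smooth (partial j f).
Proof.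
by move=> sf s; have := sf (rcons s j); rewrite -cats1 foldr_cat.
Qed.

(** All iterated derivatives stay in a class closed under [partial], so first-order regularity
    within the class is enough. Most smoothness proofs below exhibit such a class. *)
Lemma smooth_coind (P : (E -> R) -> Prop) :
  (forall f, P f -> [/\ continuous f, forall j x, derivable f x (delta_mx ord0 j) &
     forall j, P (partial j f)]) -> forall f, P f -> smooth f.
Proof.
move=> H f Pf s; have : P (foldr partial f s).
  by elim: s => //= j s ih; case: (H _ ih).
by move=> /H[].
Qed.

(** Sums are included because the Leibniz rule leads out of the set of products. *)
Inductive smooth_alg : (E -> R) -> Prop :=
| SA_smooth f : smooth f -> smooth_alg f
| SA_add f g : smooth_alg f -> smooth_alg g -> smooth_alg (f + g)
| SA_mul f g : smooth_alg f -> smooth_alg g -> smooth_alg (f * g).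

Lemma smooth_algP f : smooth_alg f -> smooth f.
Proof.
apply: smooth_coind => {}f; elim => {f} [f sf|f g _ [cf df pf] _ [cg dg pg]|f g hf [cf df pf] hg [cg dg pg]].
- split; [exact: smooth_cont|by move=> *; exact: smooth_derivable|].
  by move=> j; apply: SA_smooth; exact: smooth_partial.
- split; first by move=> x; exact: (continuousD (cf x) (cg x)).
    by move=> j x; apply: derivableD; [exact: df|exact: dg].
  move=> j; rewrite (_ : partial j _ = partial j f + partial j g); first exact: SA_add.
  by apply/funext => x; rewrite /partial deriveD.
- split; first by move=> x; exact: (continuousM (cf x) (cg x)).
    by move=> j x; apply: derivableM; [exact: df|exact: dg].
  move=> j; rewrite (_ : partial j _ = f * partial j g + g * partial j f).
    by apply: SA_add; apply: SA_mul.
  by apply/funext => x; rewrite /partial deriveM.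
Qed.

Lemma smoothM f g : smooth f -> smooth g -> smooth (f * g).
Proof. by move=> sf sg; apply: smooth_algP; apply: SA_mul; exact: SA_smooth. Qed.

Lemma partialD f g j x : smooth f -> smooth g ->
  partial j (f + g) x = partial j f x + partial j g x.
Proof. by move=> sf sg; rewrite /partial deriveD//; exact: smooth_derivable. Qed.

Lemma partialM f g j x : smooth f -> smooth g ->
  partial j (f * g) x = f x * partial j g x + partial j f x * g x.
Proof.
move=> sf sg; rewrite /partial deriveM; try exact: smooth_derivable.
by congr (_ + _); rewrite mulrC.
Qed.

Lemma smooth_cst (k : R) : smooth (fun _ : E => k).
Proof.
apply: (@smooth_coind (fun f => exists k, f = fun=> k)); last by exists k.
move=> _ [{}k ->]; split; first by move=> x; exact: cst_continuous.
  by move=> j x; exact: derivable_cst.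
by move=> j; exists 0; apply/funext => x; rewrite /partial derive_cst.
Qed.

Lemma partial_affine f j (s : R) (c x : E) : smooth f ->
  is_derive x (delta_mx ord0 j) (fun y => f (c + s *: y)) (s * partial j f (c + s *: x)).
Proof.
move=> sf.
have H (t : R) : is_derive t (1 : R) (fun h : R => f ((c + s *: x) + h *: delta_mx ord0 j))
   (partial j f ((c + s *: x) + t *: delta_mx ord0 j)).
  by apply: is_derive_line; exact: smooth_derivable.
have H2 : is_derive (0 : R) 1 (fun h : R => f ((c + s *: x) + (s * h) *: delta_mx ord0 j))
    (s * partial j f (c + s *: x)).
  have := @is_derive1_comp _ _ (fun h : R => s * h) 0 _ s (H (s * 0)) _.
  rewrite mulr0 scale0r addr0 mulrC; apply.
  by apply: is_derive_eq; rewrite /GRing.scale/= mulr1.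
have e1 : (fun h : R => h^-1 *: (f ((c + s *: x) + (s * (h *: 1 + 0)) *: delta_mx ord0 j) -
   f ((c + s *: x) + (s * 0) *: delta_mx ord0 j))) =
   (fun h : R => h^-1 *: (f (c + s *: (h *: delta_mx ord0 j + x)) - f (c + s *: x))).
  apply/funext => h; rewrite mulr0 scale0r addr0 addr0; congr (_ *: (f _ - _)).
  rewrite (_ : h *: 1 = h); last by rewrite /GRing.scale/= mulr1.
  by rewrite scalerDr scalerA -addrA [s *: x + _]addrC.
case: H2 => h1 h2; split.
  by move: h1; rewrite /derivable e1.
by move: h2; rewrite /derive e1.
Qed.

Lemma partial_affineE f j (s : R) (c x : E) : smooth f ->
  partial j (fun y => f (c + s *: y)) x = s * partial j f (c + s *: x).
Proof. by move=> /partial_affine -/(_ j s c x) []. Qed.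

Lemma continuous_affine (s : R) (c : E) : continuous (fun y : E => c + s *: y).
Proof.
move=> x; apply: (@continuousD _ _ _ (cst c) (fun y : E => s *: y)).
  exact: cst_continuous.
exact: scaler_continuous.
Qed.

Lemma smooth_affine f (s : R) (c : E) : smooth f -> smooth (fun y => f (c + s *: y)).
Proof.
move=> sf.
apply: (@smooth_coind (fun g => exists k f, smooth f /\ g = fun y => k * f (c + s *: y))).
  move=> _ [k [{sf}f [sf ->]]].
  have dd j x : is_derive x (delta_mx ord0 j) (fun y => k * f (c + s *: y)) (k * (s * partial j f (c + s *: x))).
    exact: (@is_deriveZ _ _ _ _ k _ _ _ (partial_affine j s c x sf)).
  split.
  - move=> x; suff H : {for x, continuous (cst k \* (fun y => f (c + s *: y)))} by exact: H.
    apply: continuousM; first exact: cst_continuous.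
    exact: (continuous_comp (@continuous_affine s c x) (@smooth_cont _ sf _)).
  - by move=> j x; case: (dd j x).
  - move=> j; exists (k * s), (partial j f); split; first exact: smooth_partial.
    by apply/funext => x; rewrite /partial; case: (dd j x) => _ ->; rewrite mulrA.
by exists 1, f; split => //; apply/funext => x; rewrite mul1r.
Qed.

End calculus.

(** * The flat function exp (- 1 / s) *)

Section flat.
Context {R : realType}.
Implicit Types (f g h : R -> R).

(** Smoothness in one variable by an invariant class of functions; the class is what [smooth_lin]
    transports to several variables. *)
Definition smooth1 h := exists2 P : (R -> R) -> Prop, P h &
  forall f, P f -> exists2 f', P f' & forall x : R, is_derive x (1 : R) f (f' x).

(** The powers of [1 / s] make the family stable under derivation: the derivative of one member is a
    combination of the members of index [k + 2] and [k + 1]. *)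
Definition flat (k : nat) : R -> R :=
  fun s => if 0 < s then s^-1 ^+ k * expR (- s^-1) else 0.

Lemma exprn_le_expR (n : nat) (u : R) : 0 <= u -> u ^+ n.+1 <= (n.+1)`!%:R * expR u.
Proof.
move=> u0; have := expR_ge1Dxn n u0.
have f0 : 0 < (n.+1)`!%:R :> R by rewrite ltr0n fact_gt0.
rewrite -(ler_pM2l f0) mulrDr mulrCA divff ?gt_eqF// => h.
by apply: le_trans h; rewrite !mulr1 lerDr ltW.
Qed.

Lemma flat_ge0 k s : 0 <= flat k s.
Proof.
rewrite /flat; case: ifP => // s0.
by rewrite mulr_ge0 ?expR_ge0// exprn_ge0// invr_ge0 ltW.
Qed.

(** From [u^(k + 2) <= (k + 2)! e^u] at [u = 1 / s]. Quadratic decay is what gives a zero derivative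
    at [0]. *)
Lemma flat_bound k s : `|flat k s| <= (k.+2)`!%:R * s ^+ 2.
Proof.
rewrite ger0_norm ?flat_ge0// /flat; case: ifPn => [s0|_]; last by rewrite mulr_ge0 ?sqr_ge0.
have u0 : 0 <= s^-1 by rewrite invr_ge0 ltW.
have -> : s^-1 ^+ k * expR (- s^-1) = s^-1 ^+ k.+2 * expR (- s^-1) * s ^+ 2.
  by rewrite -addn2 exprD; field; rewrite gt_eqF.
rewrite ler_pM2r ?exprn_gt0// expRN ler_pdivrMr ?expR_gt0//.
exact: exprn_le_expR.
Qed.

Lemma is_derive_flat k x : is_derive x (1 : R) (flat k) (flat k.+2 x - k%:R * flat k.+1 x).
Proof.
have [x0|x0|->] := ltgtP x 0; last first.
- rewrite /flat ltxx mulr0 subr0.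
  suff H : h^-1 *: (flat k (h *: 1 + 0) - flat k 0) @[h --> (0:R)^'] --> (0:R).
    split; [by apply/cvg_ex; exists 0|exact/cvg_lim].
  apply/cvgr0Pnorm_le => e e0; near=> h.
  have h0 : h != 0 by near: h; exact: nbhs_dnbhs_neq.
  rewrite {2}/flat ltxx subr0 addr0 (_ : h *: 1 = h); last by rewrite /GRing.scale/= mulr1.
  rewrite /GRing.scale/= normrM normrV ?unitfE// ler_pdivrMl ?normr_gt0//.
  apply: le_trans (flat_bound _ _) _.
  rewrite -real_normK ?num_real// expr2 mulrCA ler_pM2l ?normr_gt0//.
  have f0 : 0 < (k.+2)`!%:R :> R by rewrite ltr0n fact_gt0.
  rewrite -ler_pdivlMl// mulrC; near: h.
  apply: dnbhs0_le; exact: divr_gt0.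
- have H : is_derive x (1:R) (fun s => s^-1 ^+ k * expR (- s^-1)) (flat k.+2 x - k%:R * flat k.+1 x).
    have d1 : is_derive x (1:R) (fun s : R => s^-1) (- x ^- 2).
      have := @is_deriveV _ (@id R) x 1 1 _ _.
      by rewrite /GRing.scale/= mulr1; apply; rewrite ?gt_eqF//; exact: is_derive_id.
    have d2 : is_derive x (1:R) (fun s : R => expR (- s^-1)) (expR (- x^-1) * x ^- 2).
      apply: (@is_derive1_comp _ expR (fun s => - s^-1)).
      by rewrite -[x ^- 2]opprK; exact: is_deriveN.
    have -> : (fun s : R => s^-1 ^+ k * expR (- s^-1)) = ([eta GRing.inv] ^+ k * (fun s : R => expR (- s^-1))).
      by apply/funext => s; rewrite !fctE.
    apply: (is_derive_eq (is_deriveM (is_deriveX k d1) d2)).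
    rewrite /GRing.scale/= /flat x0 fctE.
    case: k => [|k].
      by rewrite !mulr0n !mul0r !expr0 !exprVn; ring.
    rewrite !exprVn -mulr_natl /= !exprS; field.
    by rewrite expf_neq0 ?gt_eqF.
  apply: near_eq_is_derive H; near=> s; rewrite /flat ifT//.
  by near: s; exact: lt_nbhsr.
- have -> : flat k.+2 x - k%:R * flat k.+1 x = 0.
    by rewrite /flat !(lt_gtF x0) mulr0 subr0.
  apply: (near_eq_is_derive (f := cst (0 : R))).
  near=> s; rewrite /flat ifF//; apply: lt_gtF.
  by near: s; exact: lt_nbhsl.
Unshelve. all: by end_near. Qed.

Inductive flat_span : (R -> R) -> Prop :=
| FS_flat k : flat_span (flat k)
| FS_sub f g c : flat_span f -> flat_span g -> flat_span (fun s => f s - c * g s).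

Lemma smooth1_flat k : smooth1 (flat k).
Proof.
exists flat_span; first exact: FS_flat.
move=> f; elim => {f} [j|f g c _ [f' sf df] _ [g' sg dg]].
  exists (fun x => flat j.+2 x - j%:R * flat j.+1 x); last exact: is_derive_flat.
  by apply: FS_sub; exact: FS_flat.
exists (fun s => f' s - c * g' s); first exact: FS_sub.
move=> x; apply: is_deriveB; exact: (@is_deriveZ _ _ _ _ c _ _ _ (dg x)).
Qed.

Lemma smooth1_cos : smooth1 (@cos R).
Proof.
exists (fun f => exists a b, f = fun x => a * cos x + b * sin x).
  by exists 1, 0; apply/funext => x; rewrite mul1r mul0r addr0.
move=> _ [a [b ->]]; exists (fun x => b * cos x + - a * sin x); first by exists b, (- a).
move=> x; apply: is_derive_eq. rewrite /GRing.scale/=; ring.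
Qed.

Lemma smooth1_sin : smooth1 (@sin R).
Proof.
exists (fun f => exists a b, f = fun x => a * cos x + b * sin x).
  by exists 0, 1; apply/funext => x; rewrite mul1r mul0r add0r.
move=> _ [a [b ->]]; exists (fun x => b * cos x + - a * sin x); first by exists b, (- a).
move=> x; apply: is_derive_eq. rewrite /GRing.scale/=; ring.
Qed.

Lemma flat_homo (s t : R) : s <= t -> flat 0 s <= flat 0 t.
Proof.
move=> st; rewrite /flat !expr0 !mul1r; case: ifPn => [s0|_].
  rewrite (lt_le_trans s0 st) ler_expR lerN2 lef_pV2 ?posrE//.
  exact: lt_le_trans st.
by case: ifP => // _; exact: expR_ge0.
Qed.

Lemma flat_gt0 (s : R) : 0 < s -> 0 < flat 0 s.
Proof. by move=> s0; rewrite /flat s0 expr0 mul1r expR_gt0. Qed.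

Lemma flat_le1 (s : R) : flat 0 s <= 1.
Proof.
rewrite /flat; case: ifPn => // s0; rewrite expr0 mul1r -expR0 ler_expR oppr_le0 invr_ge0.
exact: ltW.
Qed.

Lemma flat_eq0 (s : R) : s <= 0 -> flat 0 s = 0.
Proof. by move=> s0; rewrite /flat ltNge s0. Qed.
End flat.

(** * Functions of linear forms, test functions and bumps *)

Section testfun.
Context {R : realType} {d : nat}.
Notation E := 'rV[R]_d.
Implicit Types (f g : E -> R) (x z v : E).

Lemma is_derive_from_line f x v (D : R) :
  is_derive (0 : R) 1 (fun t : R => f (x + t *: v)) D -> is_derive x v f D.
Proof.
have e1 : (fun h : R => h^-1 *: (f (x + (h *: 1 + 0) *: v) - f (x + 0 *: v))) =
   (fun h : R => h^-1 *: (f (h *: v + x) - f x)).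
  apply/funext => h; rewrite scale0r !addr0 (_ : h *: 1 = h) ?[_ *: v + x]addrC//.
  by rewrite /GRing.scale/= mulr1.
move=> [h1 h2]; split.
  by move: h1; rewrite /derivable e1.
by move: h2; rewrite /derive e1.
Qed.

Lemma dotvDr (a x y : E) : dotv a (x + y) = dotv a x + dotv a y.
Proof. by rewrite /dotv -big_split/=; apply: eq_bigr => i _; rewrite mxE mulrDr. Qed.

Lemma dotvZr (a x : E) (t : R) : dotv a (t *: x) = t * dotv a x.
Proof. by rewrite /dotv big_distrr/=; apply: eq_bigr => i _; rewrite mxE mulrCA. Qed.

Lemma dotv_delta (a : E) j : dotv a (delta_mx ord0 j) = a ord0 j.
Proof.
rewrite /dotv (bigD1 j)//= mxE !eqxx mulr1 big1 ?addr0// => i ij.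
by rewrite mxE (negbTE ij) andbF mulr0.
Qed.

Lemma is_derive_lin (h : R -> R) h' a x (c : R) j :
  (forall t : R, is_derive t (1 : R) h (h' t)) ->
  is_derive x (delta_mx ord0 j) (fun y => h (dotv a y + c)) (a ord0 j * h' (dotv a x + c)).
Proof.
move=> dh; apply: is_derive_from_line.
have -> : (fun t : R => h (dotv a (x + t *: delta_mx ord0 j) + c)) =
  (fun t : R => h (dotv a x + c + a ord0 j * t)).
  by apply/funext => t; rewrite dotvDr dotvZr dotv_delta addrAC [t * _]mulrC.
have := @is_derive1_comp _ h (fun t => dotv a x + c + a ord0 j * t) 0 _ (a ord0 j)
   (dh (dotv a x + c + a ord0 j * 0)).
rewrite mulr0 addr0 mulrC; apply.
by apply: is_derive_eq; rewrite add0r mul1r /GRing.scale/= mulr1.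
Qed.

Lemma continuous_dotv (a : E) : continuous (dotv a).
Proof.
have -> : dotv a = \sum_j (fun y : E => a ord0 j * y ord0 j).
  by apply/funext => y; rewrite fct_sumE.
elim/big_ind: _ => [|f g cf cg|i _]; first exact: cst_continuous.
  by move=> x; exact: (continuousD (cf x) (cg x)).
move=> x; suff H : {for x, continuous (cst (a ord0 i) \* (fun y : E => y ord0 i))} by exact: H.
apply: continuousM; first exact: cst_continuous.
exact: coord_continuous.
Qed.

Lemma smooth_lin (h : R -> R) a (c : R) : smooth1 h -> smooth (fun x => h (dotv a x + c)).
Proof.
move=> [P Ph HP].
apply: (@smooth_coind _ _ (fun g => exists2 f, P f & exists k, g = fun x => k * f (dotv a x + c))).
  move=> _ [f Pf [k ->]]; have [f' Pf' df] := HP _ Pf.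
  have dd j x : is_derive x (delta_mx ord0 j) (fun y => k * f (dotv a y + c))
     (k * (a ord0 j * f' (dotv a x + c))).
    exact: (@is_deriveZ _ _ _ _ k _ _ _ (is_derive_lin a x c j df)).
  split.
  - move=> x; suff H : {for x, continuous (cst k \* (fun y => f (dotv a y + c)))} by exact: H.
    apply: continuousM; first exact: cst_continuous.
    apply: (@continuous_comp _ _ _ (fun y => dotv a y + c) f).
      by apply: continuousD; [exact: continuous_dotv|exact: cst_continuous].
    by apply: differentiable_continuous; apply/derivable1_diffP; case: (df (dotv a x + c)).
  - by move=> j x; case: (dd j x).
  - move=> j; exists f' => //; exists (k * a ord0 j).
    by apply/funext => x; rewrite /partial; case: (dd j x) => _ ->; rewrite mulrA.
by exists h => //; exists 1; apply/funext => x; rewrite mul1r.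
Qed.

Lemma partial_lin (h h' : R -> R) a x (c : R) j :
  (forall t : R, is_derive t (1 : R) h (h' t)) ->
  partial j (fun y => h (dotv a y + c)) x = a ord0 j * h' (dotv a x + c).
Proof. by move=> /is_derive_lin -/(_ a x c j) []. Qed.

Lemma smooth_prod (I : Type) (s : seq I) (F : I -> E -> R) :
  (forall i, smooth (F i)) -> smooth (fun x => \prod_(i <- s) F i x).
Proof.
move=> sF; elim: s => [|i s ih].
  rewrite (_ : (fun _ => _) = (fun=> 1)); first exact: smooth_cst.
  by apply/funext => x; rewrite big_nil.
rewrite (_ : (fun _ => _) = F i * (fun x => \prod_(i <- s) F i x)); first exact: (smoothM (sF i) ih).
by apply/funext => x; rewrite big_cons.
Qed.

Lemma compact_cube (n : R) : compact (@cube R d n).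
Proof.
have [n0|n0] := leP 0 n; last first.
  rewrite (_ : cube _ = set0); first exact: compact0.
  by apply/seteqP; split => x //= /le_lt_trans -/(_ _ n0); rewrite ltNge normr_ge0.
rewrite cubeE//; apply: (@rV_compact _ _ (fun=> `[- n, n]%classic)) => i.
exact: segment_compact.
Qed.

(** A closed set inside a cube is compact, and a compact set is bounded; vanishing outside a cube is
    the usable form of compact support. *)
Lemma test_functionP f : test_function f <->
  smooth f /\ exists2 n : R, 0 < n & forall x, n < `|x| -> f x = 0.
Proof.
split => [[sf cf]|[sf [n n0 fn]]]; split => //.
  have [M [_ HM]] := compact_bounded cf.
  exists (Num.max M 0 + 1); first by rewrite ltr_wpDl// le_max lexx orbT.
  move=> x xn; apply/eqP/negP => /negP fx0.
  have := HM (Num.max M 0 + 1) _ x (@subset_closure _ [set x | f x != 0] _ fx0).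
  rewrite /= leNgt xn => /(_ _)/negP; apply => //.
  by rewrite (@le_lt_trans _ _ (Num.max M 0)) ?le_max ?lexx// ltrDl.
apply: (@subclosed_compact _ _ (cube n)).
- exact: closed_closure.
- exact: compact_cube.
- apply: (@subset_trans _ (closure (cube n))).
    apply: closureS => x /= fx; rewrite /cube/= leNgt; apply/negP => /fn fx0.
    by rewrite fx0 eqxx in fx.
  rewrite -(closure_id _).1//; apply: compact_closed; last exact: compact_cube.
  exact: norm_hausdorff.
Qed.

Lemma test_smooth f : test_function f -> smooth f.
Proof. by case. Qed.

Lemma test_partial f j : test_function f -> test_function (partial j f).
Proof.
move=> /test_functionP[sf [n n0 fn]]; apply/test_functionP; split; first exact: smooth_partial.
exists n => // x xn; rewrite /partial -[RHS](@derive_cst _ E _ (0 : R) x (delta_mx ord0 j)).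
apply: near_eq_derive; near=> y; apply: fn; near: y.
have : `|y| @[y --> x] --> `|x| by exact: norm_continuous.
by move=> /cvgr_gt; exact.
Unshelve. all: by end_near. Qed.

Lemma test_mul f g : test_function f -> smooth g -> test_function (f * g).
Proof.
move=> /test_functionP[sf [n n0 fn]] sg; apply/test_functionP; split; first exact: smoothM.
by exists n => // x xn; rewrite fctE fn// mul0r.
Qed.

Lemma test_affine f (s : R) c : s != 0 -> test_function f ->
  test_function (fun y => f (c + s *: y)).
Proof.
move=> s0 /test_functionP[sf [n n0 fn]]; apply/test_functionP; split; first exact: smooth_affine.
exists (`|s|^-1 * (n + `|c|)); first by rewrite mulr_gt0// ?invr_gt0 ?normr_gt0// ltr_wpDr.
move=> x; rewrite ltr_pdivrMl ?normr_gt0// => h; apply: fn.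
rewrite -(ltrD2r `|c|); apply: lt_le_trans h _.
rewrite -normrZ -[s *: x in leLHS](addrK c) [s *: x + c]addrC.
exact: ler_normB.
Qed.

Lemma test_bounded f : test_function f -> exists2 C : R, 0 < C & forall x, `|f x| <= C.
Proof.
move=> /test_functionP[sf [n n0 fn]].
have : compact (f @` cube n).
  apply: continuous_compact; last exact: compact_cube.
  by apply: continuous_subspaceT; exact: smooth_cont.
move=> /compact_bounded [M [_ HM]].
have M0 : 0 <= Num.max M 0 by rewrite le_max lexx orbT.
exists (Num.max M 0 + 1); first by rewrite ltr_wpDl.
move=> x; have [xn|xn] := leP `|x| n.
  have := HM (Num.max M 0 + 1); apply; last by exists x.
  by rewrite (@le_lt_trans _ _ (Num.max M 0)) ?le_max ?lexx// ltrDl.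
by rewrite fn// normr0 addr_ge0.
Qed.

Lemma derive_cvg (f : R -> R) (t D : R) : is_derive t (1 : R) f D ->
  h^-1 * (f (h + t) - f t) @[h --> (0 : R)^'] --> D.
Proof.
move=> [h1 <-]; rewrite /derive.
have E1 : (fun h => h^-1 * (f (h + t) - f t)) = (fun h => h^-1 *: (f (h *: 1 + t) - f t)).
  by apply/funext => h; rewrite (_ : h *: 1 = h)// /GRing.scale/= mulr1.
by rewrite E1; exact: h1.
Qed.

Lemma cvg_fin_sum (T I : Type) (F : set_system T) (FF : Filter F) (s : seq I)
    (f : I -> T -> R) (l : I -> R) :
  (forall i, f i x @[x --> F] --> l i) ->
  \sum_(i <- s) f i x @[x --> F] --> \sum_(i <- s) l i.
Proof.
move=> fl; elim: s => [|i s ih].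
  rewrite big_nil; under eq_fun do rewrite big_nil; exact: cvg_cst.
by rewrite big_cons; under eq_fun do rewrite big_cons; exact: cvgD.
Qed.

(** The chain rule from partial derivatives: the increment is split along the axes, the intermediate
    points tend to [c t], and the partial derivatives are continuous there. *)
Lemma curve_derive f (c : R -> E) (c' : 'I_d -> R) (t : R) : smooth f ->
  (forall j, is_derive t (1 : R) (fun s => c s ord0 j) (c' j)) ->
  is_derive t (1 : R) (fun s => f (c s)) (\sum_j c' j * partial j f (c t)).
Proof.
move=> sf dc.
have cc j : {for t, continuous (fun s => c s ord0 j)}.
  by apply: differentiable_continuous; apply/derivable1_diffP; case: (dc j).
have ccn : c (h + t) - c t @[h --> (0 : R)] --> (0 : E).
  apply/cvgr0Pnorm_le => e e0.
  have H j : \forall h \near (0 : R), `|c (h + t) ord0 j - c t ord0 j| <= e.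
    have : ((fun s => c s ord0 j) \o shift t) h @[h --> (0 : R)] --> c t ord0 j.
      have h0 : h + t @[h --> (0 : R)] --> t.
        by rewrite -[X in _ --> X]add0r; apply: cvgD; [exact: cvg_id|exact: cvg_cst].
      by apply: (cvg_comp _ (fun s => c s ord0 j) h0); exact: cc.
    by move=> /cvgrPdist_le /(_ _ e0); apply: filterS => h; rewrite distrC.
  have : \forall h \near (0 : R), forall j, `|c (h + t) ord0 j - c t ord0 j| <= e.
    exact: (@filter_forall _ _ (fun j h => `|c (h + t) ord0 j - c t ord0 j| <= e) _ _ H).
  apply: filterS => h Hh; apply/normrV_le; first exact: ltW.
  by move=> j; rewrite !mxE.
have df j y : derivable f y (delta_mx ord0 j) by exact: smooth_derivable.
have [xi Hxi] := choice (fun h : R => coordinate_mvt_close (c t) (c (h + t) - c t) df).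
suff H : h^-1 *: (f (c (h *: 1 + t)) - f (c t)) @[h --> (0 : R)^'] -->
    \sum_j c' j * partial j f (c t).
  by split; [apply/cvg_ex; exists (\sum_j c' j * partial j f (c t))|exact/cvg_lim].
have -> : (fun h : R => h^-1 *: (f (c (h *: 1 + t)) - f (c t))) =
  (fun h => \sum_j (h^-1 * (c (h + t) ord0 j - c t ord0 j)) * partial j f (xi h j)).
  apply/funext => h; have [_] := Hxi h; rewrite addrCA subrr addr0 => E1.
  rewrite (_ : h *: 1 = h) ?E1; last by rewrite /GRing.scale/= mulr1.
  rewrite /GRing.scale/= big_distrr/=; apply: eq_bigr => j _.
  by rewrite !mxE mulrA.
apply: cvg_fin_sum => j.
apply: cvgM.
  exact: derive_cvg.
apply: (cvg_comp (fun h => xi h j) (partial j f)); last exact: (smooth_cont (smooth_partial j sf)).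
apply/cvgrPdist_le => e e0.
have := ccn; move=> /cvgr0Pnorm_le /(_ _ e0) /nbhs_dnbhs.
apply: filterS => h Hh; rewrite distrC; apply: le_trans Hh.
by case: (Hxi h).
Qed.


(** A product over coordinates, because the norm is the sup norm: the support is contained in the
    unit cube. *)
Definition bump (x : E) : R := \prod_j (flat 0 (1 - x ord0 j) * flat 0 (1 + x ord0 j)).

Lemma smooth_bump : smooth bump.
Proof.
apply: smooth_prod => j.
have H (s : R) : smooth (fun x : E => flat 0 (1 + s * x ord0 j)).
  have := @smooth_lin (flat 0) (s *: delta_mx ord0 j) 1 (smooth1_flat 0).
  congr smooth; apply/funext => x; rewrite addrC; congr (flat 0 (_ + _)).
  rewrite /dotv (bigD1 j)//= !mxE !eqxx mulr1 big1 ?addr0// => i ij.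
  by rewrite !mxE (negbTE ij) andbF mulr0 mul0r.
have -> : (fun x : E => flat 0 (1 - x ord0 j) * flat 0 (1 + x ord0 j)) =
   (fun x : E => flat 0 (1 + -1 * x ord0 j)) * (fun x : E => flat 0 (1 + 1 * x ord0 j)).
  by apply/funext => x; rewrite fctE mulN1r mul1r.
exact: smoothM.
Qed.

Lemma bump_ge0 x : 0 <= bump x.
Proof. by apply: prodr_ge0 => j _; rewrite mulr_ge0 ?flat_ge0. Qed.

Lemma bump_le1 x : bump x <= 1.
Proof.
have H j : 0 <= flat 0 (1 - x ord0 j) * flat 0 (1 + x ord0 j) <= 1.
  by rewrite mulr_ge0 ?flat_ge0//= mulr_ile1 ?flat_ge0 ?flat_le1.
have /andP[] : 0 <= bump x <= 1; last by [].
rewrite /bump; elim/big_ind: _ => [|a b /andP[a0 a1] /andP[b0 b1]|j _]; rewrite ?ler01 ?lexx//.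
by rewrite mulr_ge0// mulr_ile1.
Qed.

Lemma bump_eq0 x : 1 <= `|x| -> bump x = 0.
Proof.
move=> x1; have [j xj] : exists j, 1 <= `|x ord0 j|.
  apply: contrapT => /forallNP H; have : `|x| < 1; last by rewrite ltNge x1.
  rewrite [ltLHS]/Num.norm/= mx_normrE; apply/bigmax_ltP; split=> // -[i j] _ /=.
  by rewrite ord1 ltNge; apply/negP; exact: H.
rewrite /bump (bigD1 j)//= (_ : _ * flat 0 _ = 0) ?mul0r//.
move: xj; rewrite ler_normr; case/orP => h.
  by rewrite flat_eq0 ?mul0r//; lra.
by rewrite [X in _ * X]flat_eq0 ?mulr0//; lra.
Qed.

Lemma bump_ge x : `|x| <= 2^-1 -> flat 0 (2^-1 : R) ^+ 2 ^+ d <= bump x.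
Proof.
move=> x2; rewrite -[d in _ ^+ d]card_ord -prodr_const.
apply: ler_prod => j _; rewrite exprn_ge0 ?flat_ge0//= expr2.
have := le_trans (coord_le_norm x j) x2; rewrite ler_norml => /andP[h1 h2].
by apply: ler_pM; rewrite ?flat_ge0//; apply: flat_homo; lra.
Qed.

Lemma bump_gt0 x : `|x| <= 2^-1 -> 0 < bump x.
Proof.
by move=> /bump_ge; apply: lt_le_trans; rewrite !exprn_gt0// flat_gt0.
Qed.

Lemma test_bump : test_function bump.
Proof.
apply/test_functionP; split; first exact: smooth_bump.
by exists 1 => // x /ltW; exact: bump_eq0.
Qed.

End testfun.

(** * Test functions of x - y and x + y *)

Section kernels.
Context {R : realType} {d : nat}.
Notation E := 'rV[R]_d.
Notation mu := (@lebesgue_rV R d).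
Notation mu2 := (lebesgue_rV d \x lebesgue_rV d)%E.
Implicit Types (f g : E -> R) (al be : E -> R) (x y : E).

Definition L1loc f := measurable_fun setT f /\
  forall n : R, itg mu (fun x => \1_(cube n) x * f x).

Definition L2r f := measurable_fun setT f /\ itg mu (fun x => f x ^+ 2).

Lemma measurable_ind (n : R) : measurable_fun setT (\1_(@cube R d n) : E -> R).
Proof. exact: measurable_indic (measurable_cube _). Qed.

Lemma itg_ind (n : R) : itg mu (\1_(@cube R d n) : E -> R).
Proof.
apply: itg_ge0P; first exact: measurable_ind.
  by move=> x; rewrite indicE.
rewrite integral_indic//; last exact: measurable_cube.
by rewrite setIT; exact: cube_lty.
Qed.

Lemma indE (n : R) x : (\1_(@cube R d n) x : R) = (`|x| <= n)%R%:R.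
Proof.
rewrite indicE; have [h|h] := leP `|x| n; first by rewrite mem_set.
by rewrite memNset// /cube/= leNgt h.
Qed.

Lemma ind_out (n : R) x : n < `|x| -> (\1_(@cube R d n) x : R) = 0.
Proof. by move=> xn; rewrite indE [`|x| <= n]leNgt xn. Qed.

Lemma ind_ge0 (n : R) x : 0 <= \1_(@cube R d n) x :> R.
Proof. by rewrite indicE. Qed.

Lemma ind_le1 (n : R) x : \1_(@cube R d n) x <= 1 :> R.
Proof. by rewrite indicE; case: (_ \in _). Qed.

Lemma ind_mono (m n : R) x : m <= n -> \1_(@cube R d m) x <= \1_(@cube R d n) x :> R.
Proof.
move=> mn; rewrite !indE; have [h|h] := leP `|x| m; last by rewrite ler0n.
by rewrite (le_trans h mn).
Qed.

Lemma L1loc_dom f g : measurable_fun setT f -> L1loc g -> (forall x, `|f x| <= g x) -> L1loc f.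
Proof.
move=> mf [mg ig] fg; split=> // n; apply: itg_dom (ig n) _.
  by apply: measurable_funM => //; exact: measurable_ind.
by move=> x; rewrite normrM ger0_norm ?ind_ge0// ler_wpM2l ?ind_ge0.
Qed.

Lemma L1locD f g : L1loc f -> L1loc g -> L1loc (fun x => f x + g x).
Proof.
move=> [mf hf] [mg hg]; split=> [|n]; first exact: measurable_funD.
by under eq_fun do rewrite mulrDr; exact: itgD.
Qed.

Lemma L1locZ c f : L1loc f -> L1loc (fun x => c * f x).
Proof.
move=> [mf hf]; split=> [|n]; first exact: measurable_funM.
by under eq_fun do rewrite mulrCA; exact: itgZ.
Qed.

Lemma L1loc_cst c : L1loc (fun=> c).
Proof.
split=> [//|n]; under eq_fun do rewrite mulrC.
exact/itgZ/itg_ind.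
Qed.

Lemma L1loc_itg f : itg mu f -> L1loc f.
Proof.
move=> hf; split; first exact: itg_measurable hf.
move=> n; apply: itg_dom (itg_norm hf) _.
  by apply: measurable_funM; [exact: measurable_ind|exact: itg_measurable hf].
by move=> x; rewrite normrM ger0_norm ?ind_ge0// ler_piMl ?ind_le1.
Qed.

Lemma L2r_L1loc f : L2r f -> L1loc f.
Proof.
move=> [mf hf]; apply: L1loc_dom (L1locD (L1loc_cst 1) (L1loc_itg hf)) _ => // x.
rewrite -real_normK ?num_real//; set t := `|f x|.
have : 0 <= (t - 1) ^+ 2 by exact: sqr_ge0.
have : 0 <= t by exact: normr_ge0.
by nra.
Qed.

Lemma L1loc_norm f : L1loc f -> L1loc (fun x => `|f x|).
Proof.
move=> [mf hf]; split => [|n]; first exact: measurableT_comp.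
apply: itg_dom (itg_norm (hf n)) _.
  by apply: measurable_funM; [exact: measurable_ind|exact: measurableT_comp].
by move=> x; rewrite !normrM normr_id.
Qed.

Lemma L1loc_contM f g : L1loc f -> continuous g -> L1loc (fun x => g x * f x).
Proof.
move=> [mf hf] cg; have mg := continuous_rV_measurable cg.
split=> [|n]; first exact: measurable_funM.
have : compact (g @` cube n).
  apply: continuous_compact; last exact: compact_cube.
  exact: continuous_subspaceT.
move=> /compact_bounded [M [_ HM]].
pose C := Num.max M 0 + 1.
have CM : M < C by rewrite (@le_lt_trans _ _ (Num.max M 0)) ?le_max ?lexx// ltrDl.
apply: itg_dom (itgZ C (itg_norm (hf n))) _.
  by apply: measurable_funM; [exact: measurable_ind|exact: measurable_funM].
move=> x; rewrite mulrCA normrM; rewrite indE; have [xn|_] := leP `|x| n; last by rewrite !mul0r !normr0 !mulr0.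
by rewrite ler_wpM2r//; apply: (HM C CM); exists x.
Qed.

Definition kern (M : E * E -> R) := measurable_fun setT M /\
  exists C n : R, forall x y, `|M (x, y)| <= C * (\1_(cube n) x * \1_(cube n) y).

Lemma kern_bound M : kern M -> exists C n : R, [/\ 0 < C, 0 < n &
  forall x y, `|M (x, y)| <= C * (\1_(cube n) x * \1_(cube n) y)].
Proof.
move=> [mM [C [n H]]]; exists (`|C| + 1), (`|n| + 1); split.
- by rewrite ltr_wpDl.
- by rewrite ltr_wpDl.
- move=> x y; apply: le_trans (H x y) _.
  apply: (@le_trans _ _ ((`|C| + 1) * (\1_(cube n) x * \1_(cube n) y))).
    by rewrite ler_wpM2r ?mulr_ge0 ?ind_ge0// (le_trans (ler_norm _))// lerDl.
  have nn : n <= `|n| + 1 by rewrite (le_trans (ler_norm _))// lerDl.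
  rewrite ler_wpM2l ?addr_ge0// ler_pM ?ind_ge0//; exact: ind_mono.
Qed.

Lemma kernD M N : kern M -> kern N -> kern (fun z => M z + N z).
Proof.
move=> hM hN; have [C [n [C0 n0 H]]] := kern_bound hM.
have [C' [n' [C0' n0' H']]] := kern_bound hN.
split; first by apply: measurable_funD; [case: hM|case: hN].
exists (C + C'), (Num.max n n') => x y; apply: le_trans (ler_normD _ _) _.
have K (a b : R) : 0 < a -> b <= Num.max n n' -> a * (\1_(cube b) x * \1_(cube b) y) <=
    a * (\1_(cube (Num.max n n')) x * \1_(cube (Num.max n n')) y).
  move=> a0 bm; rewrite ler_pM2l//; apply: ler_pM; rewrite ?ind_ge0//; exact: ind_mono.
rewrite mulrDl lerD//.
  by apply: le_trans (H x y) _; apply: K => //; rewrite le_max lexx.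
by apply: le_trans (H' x y) _; apply: K => //; rewrite le_max lexx orbT.
Qed.

Lemma kernZ c M : kern M -> kern (fun z => c * M z).
Proof.
move=> hM; have [C [n [C0 n0 H]]] := kern_bound hM.
split; first by apply: measurable_funM => //; case: hM.
by exists (`|c| * C), n => x y; rewrite normrM -mulrA ler_wpM2l.
Qed.

Lemma kern0 : kern (fun=> 0).
Proof. by split => //; exists 0, 0 => x y; rewrite normr0 mul0r. Qed.

Lemma kern_sum (I : Type) (s : seq I) (F : I -> E * E -> R) :
  (forall i, kern (F i)) -> kern (fun z => \sum_(i <- s) F i z).
Proof.
move=> h; elim: s => [|i s ih].
  by under eq_fun do rewrite big_nil; exact: kern0.
by under eq_fun do rewrite big_cons; exact: kernD.
Qed.

Lemma itg_kern f g M : L1loc f -> L1loc g -> kern M ->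
  itg mu2 (fun z => f z.1 * g z.2 * M z).
Proof.
move=> hf hg hM; have [C [n [C0 n0 H]]] := kern_bound hM.
have := itgZ C (itg_prod ((L1loc_norm hf).2 n) ((L1loc_norm hg).2 n)).
move=> /itg_dom; apply.
  apply: measurable_funM; last by case: hM.
  apply: measurable_funM; [exact: (measurable_fun1 hf.1)|exact: (measurable_fun2 hg.1)].
move=> [x y] /=; rewrite !normrM.
apply: le_trans (ler_wpM2l _ (H x y)) _; first by rewrite mulr_ge0.
by rewrite le_eqVlt; apply/orP; left; apply/eqP; ring.
Qed.

Lemma measurable_section1 (M : E * E -> R) x : measurable_fun setT M ->
  measurable_fun setT (fun y => M (x, y)).
Proof. by move=> mM; apply: measurableT_comp mM _; exact: measurable_pair1. Qed.

Lemma measurable_section2 (M : E * E -> R) y : measurable_fun setT M ->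
  measurable_fun setT (fun x => M (x, y)).
Proof. by move=> mM; apply: measurableT_comp mM _; exact: measurable_pair2. Qed.

Lemma itg_section1 g M x : L1loc g -> kern M -> itg mu (fun y => g y * M (x, y)).
Proof.
move=> hg hM; have [C [n [C0 n0 H]]] := kern_bound hM.
apply: itg_dom (itgZ C ((L1loc_norm hg).2 n)) _.
  by apply: measurable_funM; [case: hg|apply: measurable_section1; case: hM].
move=> y; rewrite normrM; apply: le_trans (ler_wpM2l _ (H x y)) _ => //.
rewrite mulrCA ler_pM2l// mulrCA -[leRHS]mul1r.
apply: ler_pM; rewrite ?ind_ge0 ?ind_le1 ?mulr_ge0 ?ind_ge0//.
by rewrite mulrC.
Qed.

Lemma itg_section2 f M y : L1loc f -> kern M -> itg mu (fun x => f x * M (x, y)).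
Proof.
move=> hg hM; have [C [n [C0 n0 H]]] := kern_bound hM.
apply: itg_dom (itgZ C ((L1loc_norm hg).2 n)) _.
  by apply: measurable_funM; [case: hg|apply: measurable_section2; case: hM].
move=> x; rewrite normrM; apply: le_trans (ler_wpM2l _ (H x y)) _ => //.
rewrite mulrCA ler_pM2l// mulrA -[leRHS]mulr1.
apply: ler_pM; rewrite ?ind_ge0 ?ind_le1 ?mulr_ge0 ?ind_ge0//.
by rewrite mulrC.
Qed.

Lemma int_kern1 f g M : L1loc f -> L1loc g -> kern M ->
  \int[mu2]_z (f z.1 * g z.2 * M z) = \int[mu]_x (f x * \int[mu]_y (g y * M (x, y))).
Proof.
move=> hf hg hM; rewrite int2E/=; first last.
- by move=> x; under eq_fun do rewrite -mulrA; apply: itgZ; exact: itg_section1.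
- exact: itg_kern.
apply: int_eq => x; under eq_Rintegral do rewrite -mulrA.
by rewrite intZ//; exact: itg_section1.
Qed.

Lemma int_kern2 f g M : L1loc f -> L1loc g -> kern M ->
  \int[mu2]_z (f z.1 * g z.2 * M z) = \int[mu]_y (g y * \int[mu]_x (f x * M (x, y))).
Proof.
move=> hf hg hM; rewrite int2E'/=; first last.
- by move=> y; under eq_fun do rewrite mulrAC mulrC; apply: itgZ; exact: itg_section2.
- exact: itg_kern.
apply: int_eq => x; under eq_Rintegral do rewrite mulrAC mulrC.
by rewrite intZ//; exact: itg_section2.
Qed.

(** The variables [x - y] and [x + y] are those of the Wigner transform. Bounded support in both
    bounds [x] and [y], by [half_sum_norm]. *)
Definition pk al be : E * E -> R := fun z => al (z.1 - z.2) * be (z.1 + z.2).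

Lemma measurable_sub (f : E -> R) : measurable_fun setT f ->
  measurable_fun setT (fun z : E * E => f (z.1 - z.2)).
Proof.
move=> mf; have := measurableT_comp mf (measurable_comb 1 (-1) 0).
by apply: eq_measurable_fun => z _ /=; rewrite add0r scale1r scaleN1r.
Qed.

Lemma measurable_add (f : E -> R) : measurable_fun setT f ->
  measurable_fun setT (fun z : E * E => f (z.1 + z.2)).
Proof.
move=> mf; have := measurableT_comp mf (measurable_comb 1 1 0).
by apply: eq_measurable_fun => z _ /=; rewrite add0r !scale1r.
Qed.

Lemma test_measurable f : test_function f -> measurable_fun setT f.
Proof. by move=> /test_smooth/smooth_cont; exact: continuous_rV_measurable. Qed.

Lemma half_sum_norm (n m : R) x y : `|x - y| <= n -> `|x + y| <= m ->
  `|x| <= n + m /\ `|y| <= n + m.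
Proof.
move=> h1 h2; have h x' y' : `|x' - y'| <= n -> `|x' + y'| <= m -> `|x'| <= n + m.
  move=> h3 h4; have := le_trans (ler_normD (x' - y') (x' + y')) (lerD h3 h4).
  rewrite addrACA [- y' + _]addrC subrr addr0 -mulr2n normrMn mulr2n => h5.
  by apply: le_trans h5; rewrite lerDl.
split; first exact: h h1 h2.
by apply: (h y x); rewrite 1?distrC 1?[y + x]addrC.
Qed.

Lemma kern_pk al be : test_function al -> test_function be -> kern (pk al be).
Proof.
move=> ta tb; split.
  apply: measurable_funM; first exact: (measurable_sub (test_measurable ta)).
  exact: (measurable_add (test_measurable tb)).
have [Ca Ca0 Ha] := test_bounded ta; have [Cb Cb0 Hb] := test_bounded tb.
have [sa [n n0 Hn]] := (test_functionP al).1 ta.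
have [sb [m m0 Hm]] := (test_functionP be).1 tb.
exists (Ca * Cb), (n + m) => x y; rewrite /pk/=.
have [h1|h1] := leP `|x - y| n; last first.
  by rewrite Hn// mul0r normr0 !mulr_ge0 ?ind_ge0// ltW.
have [h2|h2] := leP `|x + y| m; last first.
  by rewrite Hm// mulr0 normr0 !mulr_ge0 ?ind_ge0// ltW.
have [h3 h4] := half_sum_norm h1 h2.
by rewrite !indE h3 h4 !mulr1 normrM ler_pM.
Qed.

(** The kernel integrated against [g] in [y] is a test function of [x] ([test_Phi]). This lets one
    solution be tested against another in the weak equation. *)
Definition Phi al be g x := \int[mu]_y (g y * pk al be (x, y)).

Lemma test_lipschitz f : test_function f ->
  exists2 L : R, 0 < L & forall x y, `|f x - f y| <= L * `|x - y|.
Proof.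
move=> tf; have /choice [C HC] : forall j, exists C : R, 0 < C /\ forall x, `|partial j f x| <= C.
  by move=> j; have [C C0 H] := test_bounded (test_partial j tf); exists C.
have C0 : 0 <= \sum_j `|C j| by apply: sumr_ge0.
exists (\sum_j `|C j| + 1); first by rewrite ltr_wpDl.
move=> x y.
have df j z : derivable f z (delta_mx ord0 j) by exact: smooth_derivable (test_smooth tf).
have [xi [_]] := coordinate_mvt_close y (x - y) df.
rewrite [y + _]addrC subrK => ->; apply: le_trans (ler_norm_sum _ _ _) _.
rewrite mulrDl mul1r ler_wpDr// mulr_suml; apply: ler_sum => j _.
rewrite normrM mulrC; apply: ler_pM => //; last exact: coord_le_norm.
by case: (HC j) => C0' H; apply: le_trans (H _) _; exact: ler_norm.
Qed.

Lemma pk_derive al be x y j (t : R) : test_function al -> test_function be ->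
  is_derive t (1 : R) (fun s : R => pk al be (x + s *: delta_mx ord0 j, y))
   (pk (partial j al) be (x + t *: delta_mx ord0 j, y) +
    pk al (partial j be) (x + t *: delta_mx ord0 j, y)).
Proof.
move=> ta tb; rewrite /pk /=.
have E1 (s : R) : x + s *: delta_mx ord0 j - y = x - y + s *: delta_mx ord0 j by rewrite addrAC.
have E2 (s : R) : x + s *: delta_mx ord0 j + y = x + y + s *: delta_mx ord0 j by rewrite addrAC.
rewrite E1 E2; under eq_fun do rewrite E1 E2.
have d1 : is_derive t (1 : R) (fun s : R => al (x - y + s *: delta_mx ord0 j))
     (partial j al (x - y + t *: delta_mx ord0 j)).
  by apply: is_derive_line; exact: smooth_derivable (test_smooth ta).
have d2 : is_derive t (1 : R) (fun s : R => be (x + y + s *: delta_mx ord0 j))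
     (partial j be (x + y + t *: delta_mx ord0 j)).
  by apply: is_derive_line; exact: smooth_derivable (test_smooth tb).
apply: (is_derive_eq (is_deriveM d1 d2)); rewrite /GRing.scale/= addrC; congr (_ + _).
by rewrite mulrC.
Qed.

Lemma Phi_derive al be g x j : test_function al -> test_function be -> L1loc g ->
  is_derive x (delta_mx ord0 j) (Phi al be g)
    (Phi (partial j al) be g x + Phi al (partial j be) g x).
Proof.
move=> ta tb hg.
pose M := fun z => pk (partial j al) be z + pk al (partial j be) z.
have kM : kern M by apply: kernD; apply: kern_pk => //; exact: test_partial.
have [C [n [C0 n0 HM]]] := kern_bound kM.
pose f (t : R) y := g y * pk al be (x + t *: delta_mx ord0 j, y).
pose G y := C * `|\1_(cube n) y * g y|.
have itf t : itg mu (f t) by apply: itg_section1 => //; exact: kern_pk.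
have df (t : R) y : is_derive t (1 : R) (f ^~ y) (g y * M (x + t *: delta_mx ord0 j, y)).
  exact: (@is_deriveZ _ _ _ _ (g y) _ _ _ (pk_derive x y j t ta tb)).
have iG : itg mu G by apply: itgZ; apply: itg_norm; exact: hg.2.
have G0 y : 0 <= G y by apply: mulr_ge0 => //; exact: ltW.
have Gub (t : R) y : `]-1, 1[%classic t -> setT y -> `|partial1of2 f t y| <= G y.
  move=> _ _; rewrite partial1of2E; case: (df t y) => _ ->; rewrite normrM.
  apply: le_trans (ler_wpM2l _ (HM _ _)) _ => //.
  rewrite /G mulrCA ler_pM2l// normrM [`|\1_(cube n) y|]ger0_norm ?ind_ge0// mulrCA -[leRHS]mul1r.
  apply: ler_pM; rewrite ?ind_ge0 ?ind_le1 ?mulr_ge0 ?ind_ge0//.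
  by rewrite mulrC.
have I0 : `]-1, 1[%classic (0 : R) by rewrite /= in_itv/= ltr01 andbT ltrN10.
have itf' : forall t, `]-1, 1[%classic t -> mu.-integrable setT (EFin \o f t) by move=> t _; exact: itf.
have df' : forall (t : R) y, `]-1, 1[%classic t -> setT y -> derivable (f ^~ y) t 1.
  by move=> t y _ _; case: (df t y).
have h1 := @derivable_under_integral R _ _ mu f setT measurableT 0 (-1) 1 I0 itf' df' G G0 iG Gub.
have h2 := @differentiation_under_integral R _ _ mu f setT measurableT 0 (-1) 1 I0 itf' df' G G0 iG Gub.
apply: is_derive_from_line; split; first exact: h1.
rewrite -derive1E; apply: (etrans h2).
rewrite /Phi -intD; last 2 first.
- exact: (itg_section1 (M := pk (partial j al) be) x hg (kern_pk (test_partial j ta) tb)).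
- exact: (itg_section1 (M := pk al (partial j be)) x hg (kern_pk ta (test_partial j tb))).
apply: eq_Rintegral => y _; rewrite partial1of2E; case: (df 0 y) => _ ->.
by rewrite /M scale0r addr0 mulrDr.
Qed.

Lemma lipschitz_continuous_at f x K : 0 <= K ->
  (forall x', `|f x' - f x| <= K * `|x' - x|) -> {for x, continuous f}.
Proof.
move=> K0 est; have FF : ProperFilter (nbhs x) := nbhs_pfilter x.
apply/(@cvgrPdist_le _ _ _ (nbhs x) FF) => e e0.
have K1 : 0 < K + 1 by rewrite ltr_wpDl.
have d0 : 0 < e / (K + 1) by rewrite divr_gt0.
have [_ h] := @cvgrPdist_le _ _ _ (nbhs x) FF id x.
have /= : forall e : R, 0 < e -> \forall t \near x, `|x - t| <= e.
  by move=> e' e0'; apply: (@cvgr_dist_le _ _ _ (nbhs x) FF id x) => //; exact: cvg_id.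
move=> /(_ _ d0); apply: filterS => x' hx; rewrite distrC; apply: le_trans (est x') _.
rewrite distrC; apply: (@le_trans _ _ ((K + 1) * (e / (K + 1)))).
  by apply: ler_pM => //; rewrite lerDl.
by rewrite mulrCA divff ?mulr1// gt_eqF.
Qed.

Lemma Phi_cont al be g : test_function al -> test_function be -> L1loc g ->
  continuous (Phi al be g).
Proof.
move=> ta tb hg x.
have [La La0 HLa] := test_lipschitz ta; have [Lb Lb0 HLb] := test_lipschitz tb.
have [Ca Ca0 Ha] := test_bounded ta; have [Cb Cb0 Hb] := test_bounded tb.
have [C [n [C0 n0 HM]]] := kern_bound (kern_pk ta tb).
pose L := La * Cb + Ca * Lb.
have L0 : 0 < L by rewrite addr_gt0// mulr_gt0.
have lip y x' : `|pk al be (x', y) - pk al be (x, y)| <=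
    L * `|x' - x| * \1_(cube n) y.
  rewrite indE; have [yn|yn] := leP `|y| n; last first.
    have z u : pk al be (u, y) = 0.
      apply/eqP; rewrite -normr_le0; apply: le_trans (HM _ _) _.
      by rewrite [X in _ * X]mulrC ind_out// mul0r mulr0.
    by rewrite !z subrr normr0 mulr0.
  rewrite mulr1 /pk/= (_ : _ - _ = (al (x' - y) - al (x - y)) * be (x' + y) +
     al (x - y) * (be (x' + y) - be (x + y))); last by ring.
  apply: le_trans (ler_normD _ _) _; rewrite !normrM /L mulrDl; apply: lerD.
    rewrite mulrAC; apply: ler_pM => //; apply: le_trans (HLa _ _) _.
    by rewrite opprB addrA subrK.
  rewrite -mulrA; apply: ler_pM => //; apply: le_trans (HLb _ _) _.
  by rewrite opprD addrACA subrr addr0.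
pose I := \int[mu]_y `|\1_(cube n) y * g y|.
have I0 : 0 <= I by exact: int_ge0.
have est x' : `|Phi al be g x' - Phi al be g x| <= L * I * `|x' - x|.
  rewrite /Phi -intB; try by (apply: itg_section1 => //; exact: kern_pk).
  rewrite mulrAC /I -intZ; last by apply: itg_norm; exact: hg.2.
  apply: int_norm.
  - apply: measurable_funB; apply: measurable_funM; try exact: hg.1;
      by apply: measurable_section1; case: (kern_pk ta tb).
  - by apply: itgZ; apply: itg_norm; exact: hg.2.
  - move=> y; rewrite -mulrBr normrM; apply: le_trans (ler_wpM2l _ (lip _ _)) _ => //.
    by rewrite mulrCA normrM [`|\1_(cube n) y|]ger0_norm ?ind_ge0// [\1_(cube n) y * _]mulrC.
apply: (@lipschitz_continuous_at _ x (L * I)) => //.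
by rewrite mulr_ge0// ltW.
Qed.

(** Closed under [partial], since differentiating [Phi] differentiates one factor of the kernel or
    the other. *)
Inductive phi_span g : (E -> R) -> Prop :=
| PS_base al be : test_function al -> test_function be -> phi_span g (Phi al be g)
| PS_add F G : phi_span g F -> phi_span g G -> phi_span g (F + G).

Lemma smooth_Phi al be g : test_function al -> test_function be -> L1loc g ->
  smooth (Phi al be g).
Proof.
move=> ta tb hg; apply: (@smooth_coind _ _ (phi_span g)); last exact: PS_base.
move=> f; elim => {f} [{}al {}be {}ta {}tb|F G _ [cF dF pF] _ [cG dG pG]].
  split; first exact: Phi_cont.
    by move=> j x; case: (Phi_derive x j ta tb hg).
  move=> j; rewrite (_ : partial j _ = Phi (partial j al) be g + Phi al (partial j be) g).
    by apply: PS_add; apply: PS_base => //; exact: test_partial.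
  by apply/funext => x; rewrite /partial; case: (Phi_derive x j ta tb hg).
split; first by move=> x; exact: (continuousD (cF x) (cG x)).
  by move=> j x; apply: derivableD; [exact: dF|exact: dG].
move=> j; rewrite (_ : partial j _ = partial j F + partial j G); first exact: PS_add.
by apply/funext => x; rewrite /partial deriveD.
Qed.

Lemma Phi_supp al be g : test_function al -> test_function be ->
  exists2 n : R, 0 < n & forall x, n < `|x| -> Phi al be g x = 0.
Proof.
move=> ta tb; have [C [n [C0 n0 HM]]] := kern_bound (kern_pk ta tb).
exists n => // x xn; transitivity (\int[mu]_(y in setT) (0 : R)); last first.
  by rewrite Rintegral_cst// mul0r.
apply: eq_Rintegral => y _; apply/eqP; rewrite -normr_le0 normrM.
apply: le_trans (ler_wpM2l _ (HM _ _)) _ => //.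
by rewrite ind_out// mul0r !mulr0.
Qed.

Lemma test_Phi al be g : test_function al -> test_function be -> L1loc g ->
  test_function (Phi al be g).
Proof.
move=> ta tb hg; apply/test_functionP; split; first exact: smooth_Phi.
exact: Phi_supp.
Qed.

Lemma partial_Phi al be g j x : test_function al -> test_function be -> L1loc g ->
  partial j (Phi al be g) x = Phi (partial j al) be g x + Phi al (partial j be) g x.
Proof. by move=> ta tb hg; rewrite /partial; case: (Phi_derive x j ta tb hg). Qed.

(* [s = 1] gives the Laplacian of [al (x - y) be (x + y)] in [x], [s = -1] the one in [y]. *)
Definition lapk (s : R) al be : E * E -> R := fun z =>
  \sum_j (pk (partial j (partial j al)) be z + s * 2 * pk (partial j al) (partial j be) z +
   pk al (partial j (partial j be)) z).

Lemma kern_lapk s al be : test_function al -> test_function be -> kern (lapk s al be).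
Proof.
move=> ta tb; apply: kern_sum => j; apply: kernD; first apply: kernD.
- by apply: kern_pk => //; do 2 apply: test_partial.
- by apply: kernZ; apply: kern_pk; exact: test_partial.
- by apply: kern_pk => //; do 2 apply: test_partial.
Qed.

Lemma laplacian_Phi al be g x : test_function al -> test_function be -> L1loc g ->
  laplacian (Phi al be g) x = \int[mu]_y (g y * lapk 1 al be (x, y)).
Proof.
move=> ta tb hg; rewrite /laplacian /lapk.
have i1 j : itg mu (fun y => g y * pk (partial j (partial j al)) be (x, y)).
  by apply: itg_section1 => //; apply: kern_pk => //; do 2 apply: test_partial.
have i2 j : itg mu (fun y => g y * pk (partial j al) (partial j be) (x, y)).
  by apply: itg_section1 => //; apply: kern_pk; exact: test_partial.
have i3 j : itg mu (fun y => g y * pk al (partial j (partial j be)) (x, y)).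
  by apply: itg_section1 => //; apply: kern_pk => //; do 2 apply: test_partial.
transitivity (\sum_j \int[mu]_y (g y * (pk (partial j (partial j al)) be (x, y) +
   1 * 2 * pk (partial j al) (partial j be) (x, y) + pk al (partial j (partial j be)) (x, y)))).
  apply: eq_bigr => j _.
  have -> : partial j (Phi al be g) = Phi (partial j al) be g + Phi al (partial j be) g.
    by apply/funext => z; exact: partial_Phi.
  rewrite partialD; try by (apply: smooth_Phi => //; exact: test_partial).
  rewrite !partial_Phi//; try exact: test_partial.
  rewrite /Phi addrA -[X in X + _]addrA -mulr2n -[X in _ + X *+ 2]mul1r -mulrnAl -intZ// -!intD//.
  - by apply: int_eq => y; ring.
  - by apply: itgD => //; exact: itgZ.
  - exact: itgZ.
rewrite -int_sum; last first.
  move=> j; under eq_fun do rewrite !mulrDr; apply: itgD => //; apply: itgD => //.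
  by under eq_fun do rewrite mulrCA; exact: itgZ.
by apply: int_eq => y; rewrite mulr_sumr.
Qed.

Lemma pk_swap al be x y : pk al be (x, y) = pk (fun z => al (- z)) be (y, x).
Proof. by rewrite /pk/= opprB [y + x]addrC. Qed.

End kernels.

(** * The logarithmic nonlinearity *)

Section logarithm.
Context {R : realType}.
Implicit Types (a b r s t : R).

Definition lnsq a b : R := ln (a ^+ 2 + b ^+ 2).
Definition mod2 a b : R := Num.sqrt (a ^+ 2 + b ^+ 2).

Lemma sumsq_ge0 a b : 0 <= a ^+ 2 + b ^+ 2.
Proof. by rewrite addr_ge0 ?sqr_ge0. Qed.

Lemma mod2_ge0 a b : 0 <= mod2 a b.
Proof. exact: sqrtr_ge0. Qed.

Lemma mod2_sqr a b : mod2 a b ^+ 2 = a ^+ 2 + b ^+ 2.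
Proof. by rewrite /mod2 sqr_sqrtr ?sumsq_ge0. Qed.

Lemma lnsqE a b : lnsq a b = 2 * ln (mod2 a b).
Proof.
rewrite /lnsq -mod2_sqr; have [h|h] := ltP 0 (mod2 a b).
  by rewrite lnXn// mulr2n mulr_natl mulr2n.
have -> : mod2 a b = 0 by apply/eqP; rewrite eq_le h mod2_ge0.
by rewrite expr0n/= ln0// mulr0.
Qed.

Lemma le_mod2l a b : `|a| <= mod2 a b.
Proof.
rewrite -sqrtr_sqr /mod2 ler_wsqrtr// lerDl; exact: sqr_ge0.
Qed.

Lemma le_mod2r a b : `|b| <= mod2 a b.
Proof.
rewrite -sqrtr_sqr /mod2 ler_wsqrtr// lerDr; exact: sqr_ge0.
Qed.

Lemma ln_abs_le r : 0 < r -> `|ln r| <= r + r^-1.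
Proof.
move=> r0; rewrite ler_norml.
have r1 : 0 < r^-1 by rewrite invr_gt0.
have h1 : ln r <= r - 1.
  by have := @le_ln1Dx _ (r - 1); rewrite (addrC 1) subrK; apply; lra.
have h2 : - ln r <= r^-1 - 1.
  have := @le_ln1Dx _ (r^-1 - 1); rewrite (addrC 1) subrK lnV ?posrE//; apply; lra.
by apply/andP; split; lra.
Qed.

(** [|ln r| <= r + 1 / r], multiplied by the modulus [r]. It makes the nonlinearity locally
    integrable for a state in L^2. *)
Lemma mul_lnsq_le a b c : `|c| <= mod2 a b -> `|c * lnsq a b| <= 2 * (1 + (a ^+ 2 + b ^+ 2)).
Proof.
move=> cr; rewrite lnsqE -mod2_sqr; set r := mod2 a b in cr *.
have := mod2_ge0 a b; rewrite -/r le_eqVlt => /predU1P[r0|r0].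
  by rewrite -r0 ln0// !mulr0 normr0 expr0n/= addr0 mulr1.
rewrite normrM; apply: (@le_trans _ _ (r * (2 * (r + r^-1)))).
  apply: ler_pM => //; rewrite normrM ger0_norm// ler_pM2l//.
  exact: ln_abs_le.
by rewrite mulrCA mulrDr divff ?gt_eqF// addrC.
Qed.

(** With [q = sqrt r], [r |ln r| = 2 q^2 |ln q| <= 2 q (1 + q^2)]. *)
Lemma small_ln r s : 0 <= r -> r <= s ^+ 2 -> 0 < s -> r * `|ln r| <= 2 * s * (1 + s ^+ 2).
Proof.
rewrite le_eqVlt => /predU1P[<-|r0] rs s0.
  by rewrite ln0// normr0 mulr0 mulr_ge0 ?mulr_ge0 ?addr_ge0 ?sqr_ge0// ltW.
set q := Num.sqrt r; have q0 : 0 < q by rewrite sqrtr_gt0.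
have rq : r = q ^+ 2 by rewrite sqr_sqrtr// ltW.
have qs : q <= s.
  by rewrite -(@ler_pXn2r _ 2) ?nnegrE ?(ltW q0) ?(ltW s0)// -rq.
have -> : ln r = 2 * ln q by rewrite rq lnXn// mulr2n; ring.
rewrite rq normrM [`|2|]ger0_norm//.
apply: (@le_trans _ _ (q ^+ 2 * (2 * (q + q^-1)))).
  by rewrite ler_pM2l ?exprn_gt0// ler_pM2l// ln_abs_le.
rewrite (_ : q ^+ 2 * (2 * (q + q^-1)) = 2 * q * (1 + q ^+ 2)); last by field; rewrite gt_eqF.
apply: ler_pM; rewrite ?mulr_ge0 ?addr_ge0 ?sqr_ge0 ?(ltW q0)//.
  by rewrite ler_pM2l.
by rewrite lerD2l ler_pXn2r ?nnegrE ?(ltW q0) ?(ltW s0).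
Qed.

(** [ln (r / r') <= r / r' - 1]; the weight by the smaller modulus [r'] removes the singularity of
    the logarithm at zero. *)
Lemma lnsq_diff a b a' b' : mod2 a' b' <= mod2 a b ->
  mod2 a' b' * `|lnsq a b - lnsq a' b'| <= 2 * (mod2 a b - mod2 a' b').
Proof.
rewrite !lnsqE; set r := mod2 a b; set r' := mod2 a' b' => rr.
have := mod2_ge0 a' b'; rewrite -/r' le_eqVlt => /predU1P[r0|r0].
  by rewrite -r0 mul0r subr0 mulr_ge0 ?mod2_ge0.
have r1 : 0 < r by exact: lt_le_trans rr.
rewrite -mulrBr normrM ger0_norm// mulrCA ler_pM2l//.
rewrite ger0_norm ?subr_ge0 ?ler_ln// -ln_div ?posrE//.
have -> : r - r' = r' * (r / r' - 1) by field; rewrite gt_eqF.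
rewrite ler_pM2l//; have := @le_ln1Dx _ (r / r' - 1); rewrite (addrC 1) subrK; apply.
have : 0 < r / r' by rewrite divr_gt0.
by lra.
Qed.

Lemma mod2_triangle a b a' b' : mod2 a b - mod2 a' b' <= mod2 (a - a') (b - b').
Proof.
rewrite lerBlDr; set r := mod2 a b; set r' := mod2 a' b'; set D := mod2 _ _.
have D0 : 0 <= D by exact: mod2_ge0.
have r0 : 0 <= r' by exact: mod2_ge0.
have CS : (a - a') * a' + (b - b') * b' <= D * r'.
  apply: le_trans (ler_norm _) _.
  rewrite -(@ler_pXn2r _ 2) ?nnegrE ?mulr_ge0// real_normK ?num_real// exprMn !mod2_sqr.
  rewrite -subr_ge0 (_ : _ - _ = ((a - a') * b' - (b - b') * a') ^+ 2); last by ring.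
  exact: sqr_ge0.
rewrite -(@ler_pXn2r _ 2) ?nnegrE ?addr_ge0 ?mod2_ge0// sqrrD !mod2_sqr.
have -> : a ^+ 2 + b ^+ 2 = (a - a') ^+ 2 + (b - b') ^+ 2 + 2 * ((a - a') * a' + (b - b') * b') +
   (a' ^+ 2 + b' ^+ 2) by ring.
by rewrite -mulr_natl; lra.
Qed.

(* Cazenave--Haraux *)
Lemma lnsq_cross a b a' b' :
  `|(b * a' - a * b') * (lnsq a b - lnsq a' b')| <= 2 * ((a - a') ^+ 2 + (b - b') ^+ 2).
Proof.
wlog rr : a b a' b' / mod2 a' b' <= mod2 a b.
  move=> H; have [/H//|/ltW/H] := leP (mod2 a' b') (mod2 a b).
  rewrite -[(a' - a) ^+ 2]sqrrN -[(b' - b) ^+ 2]sqrrN !opprB; congr (_ <= _).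
  by congr `|_|; ring.
rewrite -mod2_sqr; set D := mod2 _ _.
have D0 : 0 <= D by exact: mod2_ge0.
(* With [z = a + i b] and [z' = a' + i b'], the left side is the modulus of the imaginary part of
   [z conj(z')], which is also that of [(z - z') conj(z')]. *)
have h1 : `|b * a' - a * b'| <= D * mod2 a' b'.
  rewrite -(@ler_pXn2r _ 2) ?nnegrE ?mulr_ge0 ?mod2_ge0// real_normK ?num_real// exprMn !mod2_sqr.
  rewrite -subr_ge0 (_ : _ - _ = ((a - a') * a' + (b - b') * b') ^+ 2); last by ring.
  exact: sqr_ge0.
rewrite normrM; apply: le_trans (ler_wpM2r _ h1) _ => //.
rewrite -mulrA (_ : 2 * D ^+ 2 = D * (2 * D)); last by ring.
rewrite ler_wpM2l//; apply: le_trans (lnsq_diff rr) _.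
by rewrite ler_pM2l//; exact: mod2_triangle.
Qed.

(** The nonlinearity is not Lipschitz at zero, hence the additive [tau]. When the larger modulus is
    at most [s^2], the term is absorbed in [tau] by [small_ln]; otherwise [|ln r| <= r + s^(-2)].
    The difference of the logarithms is always handled by [lnsq_diff]. *)
Lemma mul_lnsq_continuous (tau : R) : 0 < tau -> exists2 C : R, 0 < C & forall a b a' b',
  `|a * lnsq a b - a' * lnsq a' b'| <=
    tau + C * mod2 (a - a') (b - b') * (1 + mod2 a b + mod2 a' b').
Proof.
move=> tau0; pose s := Num.min 1 (tau / 16).
have s0 : 0 < s by rewrite lt_min ltr01 divr_gt0.
have s1 : s <= 1 by rewrite ge_min lexx.
have st : 16 * s <= tau by rewrite mulrC -ler_pdivlMr// ge_min lexx orbT.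
have is0 : 0 < s ^- 2 by rewrite invr_gt0 exprn_gt0.
exists (4 + 2 * s ^- 2); first by rewrite addr_gt0// mulr_gt0.
move=> a b a' b'.
wlog rr : a b a' b' / mod2 a' b' <= mod2 a b.
  move=> H; have [/H//|/ltW/H] := leP (mod2 a' b') (mod2 a b).
  rewrite distrC (_ : mod2 (a' - a) (b' - b) = mod2 (a - a') (b - b')); last first.
    by rewrite /mod2 -[(a' - a) ^+ 2]sqrrN -[(b' - b) ^+ 2]sqrrN !opprB.
  by rewrite -!addrA [mod2 a' b' + _]addrC.
set D := mod2 (a - a') (b - b'); have D0 : 0 <= D by exact: mod2_ge0.
have -> : a * lnsq a b - a' * lnsq a' b' = (a - a') * lnsq a b + a' * (lnsq a b - lnsq a' b') by ring.
have r0 := mod2_ge0 a b; have r0' := mod2_ge0 a' b'.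
have h2 : `|a' * (lnsq a b - lnsq a' b')| <= 2 * D.
  rewrite normrM; apply: le_trans (ler_wpM2r _ (le_mod2l a' b')) _ => //.
  by apply: le_trans (lnsq_diff rr) _; rewrite ler_pM2l//; exact: mod2_triangle.
have h1 : `|(a - a') * lnsq a b| <= tau + 2 * D * (mod2 a b + s ^- 2).
  rewrite lnsqE normrM normrM [`|2|]ger0_norm//.
  have [rs|rs] := leP (mod2 a b) (s ^+ 2).
    apply: (@le_trans _ _ tau); last by rewrite lerDl !mulr_ge0// addr_ge0// ltW.
    apply: (@le_trans _ _ ((2 * mod2 a b) * (2 * `|ln (mod2 a b)|))).
      apply: ler_wpM2r; first by rewrite mulr_ge0.
      apply: le_trans (ler_normB _ _) _; have := le_mod2l a b; have := le_mod2l a' b'.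
      by lra.
    have := small_ln r0 rs s0.
    have : s * s ^+ 2 <= s by rewrite ler_piMr ?(ltW s0)// expr_le1// ltW.
    by nra.
  apply: (@le_trans _ _ (D * (2 * (mod2 a b + s ^- 2)))); last by rewrite mulrCA mulrA lerDr ltW.
  apply: ler_pM => //; first exact: le_mod2l.
  rewrite ler_pM2l//; apply: le_trans (ln_abs_le _) _.
    by apply: lt_trans rs; rewrite exprn_gt0.
  by rewrite lerD2l lef_pV2 ?posrE ?exprn_gt0 ?(ltW rs)//; apply: lt_trans rs; rewrite exprn_gt0.
apply: le_trans (ler_normD _ _) _; apply: le_trans (lerD h1 h2) _.
rewrite -addrA lerD2l.
have p1 : 0 <= D * mod2 a b by rewrite mulr_ge0.
have p2 : 0 <= D * mod2 a' b' by rewrite mulr_ge0.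
have p3 : 0 <= D * s ^- 2 by rewrite mulr_ge0// ltW.
have p4 : 0 <= D * s ^- 2 * mod2 a b by rewrite mulr_ge0.
have p5 : 0 <= D * s ^- 2 * mod2 a' b' by rewrite mulr_ge0.
set X := s ^- 2 in p3 p4 p5 *; lra.
Qed.

End logarithm.

(** * Solutions as curves in L^2 *)

Section L2.
Context {R : realType} {d : nat}.
Notation E := 'rV[R]_d.
Notation mu := (@lebesgue_rV R d).
Notation Rp := (complex.Re).
Notation Ip := (complex.Im).
Implicit Types psi : E -> R[i].

Lemma L2normE psi : L2norm psi =
  ((\int[mu]_x ((Rp (psi x)) ^+ 2 + (Ip (psi x)) ^+ 2)%:E) `^ 2^-1)%E.
Proof.
rewrite /L2norm unlock; congr (_ `^ _)%E; apply: eq_integral => x _ /=.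
rewrite -[Normc.normc _]ger0_norm; last by case: (psi x) => a b; exact: sqrtr_ge0.
rewrite normr_id ger0_norm; last by case: (psi x) => a b; exact: sqrtr_ge0.
rewrite powR_mulrn; last by case: (psi x) => a b; exact: sqrtr_ge0.
by case: (psi x) => a b /=; rewrite sqr_sqrtr// sumsq_ge0.
Qed.

Definition nrm2 psi : R := \int[mu]_x ((Rp (psi x)) ^+ 2 + (Ip (psi x)) ^+ 2).

Lemma nrm2_ge0 psi : 0 <= nrm2 psi.
Proof. by apply: int_ge0 => x; exact: sumsq_ge0. Qed.

Lemma L2_itg psi : L2 psi -> itg mu (fun x => (Rp (psi x)) ^+ 2 + (Ip (psi x)) ^+ 2).
Proof.
move=> [m1 m2]; rewrite L2normE => h; apply: itg_ge0P.
- by apply: measurable_funD; apply: measurable_funX.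
- by move=> x; exact: sumsq_ge0.
- by apply: lty_poweRy h; rewrite invr_eq0.
Qed.

Lemma L2_L2r psi : L2 psi -> L2r (fun x => Rp (psi x)) /\ L2r (fun x => Ip (psi x)).
Proof.
move=> h; have [m1 m2 _] := h; split; (split; first by []).
  apply: itg_dom (L2_itg h) _; first exact: measurable_funX.
  by move=> x; rewrite ger0_norm ?sqr_ge0// lerDl sqr_ge0.
apply: itg_dom (L2_itg h) _; first exact: measurable_funX.
by move=> x; rewrite ger0_norm ?sqr_ge0// lerDr sqr_ge0.
Qed.

Lemma L2_nrm psi : L2 psi -> L2norm psi = (Num.sqrt (nrm2 psi))%:E.
Proof.
move=> h; rewrite L2normE (itgE (L2_itg h)) -/(nrm2 psi) /= powR12_sqrt//.
exact: nrm2_ge0.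
Qed.

Lemma L2_le psi M : L2 psi -> 0 <= M -> (L2norm psi <= M%:E)%E <-> nrm2 psi <= M ^+ 2.
Proof.
move=> h M0; rewrite (L2_nrm h) lee_fin; split => H.
  rewrite -[nrm2 _]sqr_sqrtr ?nrm2_ge0// ler_pXn2r// nnegrE sqrtr_ge0//.
by rewrite -[M]ger0_norm// -sqrtr_sqr ler_wsqrtr.
Qed.

Lemma L2_of psi : measurable_fun setT (fun x => Rp (psi x)) ->
  measurable_fun setT (fun x => Ip (psi x)) ->
  itg mu (fun x => (Rp (psi x)) ^+ 2 + (Ip (psi x)) ^+ 2) -> L2 psi.
Proof.
move=> m1 m2 h; split => //; rewrite L2normE (itgE h) poweR_EFin; exact: ltry.
Qed.

Lemma L2r_measurable (f : E -> R) : L2r f -> measurable_fun setT f.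
Proof. by case. Qed.

Lemma L2r_prod (f g : E -> R) : L2r f -> L2r g -> itg mu (fun x => f x * g x).
Proof.
move=> [mf hf] [mg hg]; apply: itg_dom (itgD hf hg) _; first exact: measurable_funM.
move=> x; rewrite ler_norml; apply/andP; split.
  have := sqr_ge0 (f x + g x); rewrite sqrrD -mulr_natl; have := sumsq_ge0 (f x) (g x); lra.
by have := sqr_ge0 (f x - g x); rewrite sqrrB -mulr_natl; have := sumsq_ge0 (f x) (g x); lra.
Qed.

Lemma L2rD (f g : E -> R) : L2r f -> L2r g -> L2r (fun x => f x + g x).
Proof.
move=> hf hg; split; first by apply: measurable_funD; exact: L2r_measurable.
rewrite (_ : (fun _ => _) = (fun x => f x ^+ 2 + 2 * (f x * g x) + g x ^+ 2)).
  by apply: itgD hg.2; apply: itgD hf.2 _; apply: itgZ; exact: L2r_prod.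
by apply/funext => x; ring.
Qed.

Lemma L2rZ (c : R) (f : E -> R) : L2r f -> L2r (fun x => c * f x).
Proof.
move=> hf; split; first by apply: measurable_funM => //; exact: L2r_measurable.
by under eq_fun do rewrite exprMn; apply: itgZ hf.2.
Qed.

Lemma L2rB (f g : E -> R) : L2r f -> L2r g -> L2r (fun x => f x - g x).
Proof.
move=> hf hg; have := L2rD hf (L2rZ (-1) hg).
by congr L2r; apply/funext => x; rewrite mulN1r.
Qed.

(** Cauchy--Schwarz in additive form; the weight [e] is left to the caller. *)
Lemma int_amgm (f g : E -> R) (e : R) : 0 < e -> L2r f -> L2r g ->
  `|\int[mu]_x (f x * g x)| <= e * \int[mu]_x (g x ^+ 2) + e^-1 * \int[mu]_x (f x ^+ 2).
Proof.
move=> e0 hf hg; rewrite -!intZ ?hf.2 ?hg.2//; try (by case: hf); try by case: hg.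
rewrite -intD; try by apply: itgZ; case: hf; case: hg.
apply: int_norm.
- by apply: measurable_funM; exact: L2r_measurable.
- by apply: itgD; apply: itgZ; [case: hg|case: hf].
- move=> x; set u := f x; set v := g x.
  have -> : e * v ^+ 2 + e^-1 * u ^+ 2 = e^-1 * (`|e * v| - `|u|) ^+ 2 + 2 * `|u * v|.
    rewrite sqrrB !real_normK ?num_real// !normrM [`|e|]gtr0_norm//; field.
    by rewrite gt_eqF.
  have : 0 <= e^-1 * (`|e * v| - `|u|) ^+ 2 by rewrite mulr_ge0 ?sqr_ge0// invr_ge0 ltW.
  have : 0 <= `|u * v| by [].
  by lra.
Qed.

End L2.

(** * Pairing with continuous functions of bounded support *)

Section ccfun.
Context {R : realType} {d : nat}.
Notation E := 'rV[R]_d.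
Notation mu := (@lebesgue_rV R d).
Implicit Types (f g phi : E -> R).

Definition ccfun phi := continuous phi /\
  exists2 n : R, 0 < n & forall x, n < `|x| -> phi x = 0.

Lemma test_cc phi : test_function phi -> ccfun phi.
Proof.
move=> /test_functionP [sf h]; split => //; exact: smooth_cont.
Qed.

Lemma cc_bounded phi : ccfun phi -> exists C n : R, [/\ 0 < C, 0 < n &
  forall x, `|phi x| <= C * \1_(cube n) x].
Proof.
move=> [cf [n n0 fn]].
have : compact (phi @` cube n).
  apply: continuous_compact; last exact: compact_cube.
  exact: continuous_subspaceT.
move=> /compact_bounded [M [_ HM]].
have M0 : 0 <= Num.max M 0 by rewrite le_max lexx orbT.
exists (Num.max M 0 + 1), n; split => //; first by rewrite ltr_wpDl.
move=> x; rewrite indE; have [xn|xn] := leP `|x| n.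
  rewrite mulr1; have := HM (Num.max M 0 + 1); apply; last by exists x.
  by rewrite (@le_lt_trans _ _ (Num.max M 0)) ?le_max ?lexx// ltrDl.
by rewrite fn// normr0 mulr0.
Qed.

Lemma cc_sum (I : Type) (s : seq I) (F : I -> E -> R) :
  (forall i, ccfun (F i)) -> ccfun (fun x => \sum_(i <- s) F i x).
Proof.
move=> h; elim: s => [|i s [c1 [n n0 hn]]].
  split; last by exists 1 => // x _; rewrite big_nil.
  rewrite (_ : (fun _ => _) = cst 0); first exact: cst_continuous.
  by apply/funext => x; rewrite big_nil.
have [c2 [m m0 hm]] := h i; split.
  rewrite (_ : (fun _ => _) = F i + (fun x => \sum_(i <- s) F i x)).
    by move=> x; exact: (continuousD (c2 x) (c1 x)).
  by apply/funext => x; rewrite big_cons.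
exists (Num.max n m); first by rewrite lt_max n0.
by move=> x; rewrite gt_max => /andP[h1 h2]; rewrite big_cons hm// add0r hn.
Qed.

Lemma ccM f phi : continuous f -> ccfun phi -> ccfun (fun x => f x * phi x).
Proof.
move=> cf [cp [n n0 hn]]; split; last by exists n => // x xn; rewrite hn// mulr0.
by move=> x; exact: (continuousM (cf x) (cp x)).
Qed.

Lemma ccD f g : ccfun f -> ccfun g -> ccfun (fun x => f x + g x).
Proof.
move=> [c1 [n n0 hn]] [c2 [m m0 hm]]; split.
  by move=> x; exact: (continuousD (c1 x) (c2 x)).
exists (Num.max n m); first by rewrite lt_max n0.
by move=> x; rewrite gt_max => /andP[h1 h2]; rewrite hm// addr0 hn.
Qed.

Lemma cc_laplacian phi : test_function phi -> ccfun (laplacian phi).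
Proof. by move=> tp; apply: cc_sum => j; apply: test_cc; do 2 apply: test_partial. Qed.

Lemma cc_measurable phi : ccfun phi -> measurable_fun setT phi.
Proof. by move=> [cf _]; exact: continuous_rV_measurable. Qed.

Lemma L1loc_cc f phi : L1loc f -> ccfun phi -> itg mu (fun x => f x * phi x).
Proof.
move=> hf hp; have [C [n [C0 n0 H]]] := cc_bounded hp.
apply: itg_dom (itgZ C (itg_norm (hf.2 n))) _.
  by apply: measurable_funM; [case: hf|exact: cc_measurable].
move=> x; rewrite normrM; apply: le_trans (ler_wpM2l _ (H x)) _ => //.
by rewrite normrM [`|\1_(cube n) x|]ger0_norm ?ind_ge0// mulrCA [\1_(cube n) x * _]mulrC.
Qed.

Lemma L2r_cc phi : ccfun phi -> L2r phi.
Proof.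
move=> hp; have [C [n [C0 n0 H]]] := cc_bounded hp.
split; first exact: cc_measurable.
apply: itg_dom (itgZ (C ^+ 2) (itg_ind n)) _.
  by apply: measurable_funX; exact: cc_measurable.
move=> x; rewrite normrX; apply: (@le_trans _ _ ((C * \1_(cube n) x) ^+ 2)).
  by rewrite ler_pXn2r ?nnegrE ?mulr_ge0 ?ind_ge0// ltW.
by rewrite exprMn ler_pM2l ?exprn_gt0// expr2 ler_piMl ?ind_ge0 ?ind_le1.
Qed.

Lemma L1loc_lnsq (a b c : E -> R) : L2r a -> L2r b -> measurable_fun setT c ->
  (forall x, `|c x| <= mod2 (a x) (b x)) -> L1loc (fun x => c x * lnsq (a x) (b x)).
Proof.
move=> ha hb mc cab.
have h1 : L1loc (fun x => 2 * (1 + (a x ^+ 2 + b x ^+ 2))).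
  by apply: L1locZ; apply: L1locD (L1loc_cst 1) _; apply: L1loc_itg; apply: itgD; [case: ha|case: hb].
apply: L1loc_dom h1 _; last by move=> x; exact: mul_lnsq_le.
apply: measurable_funM => //; apply: (measurableT_comp (@measurable_ln R)).
by apply: measurable_funD; apply: measurable_funX; exact: L2r_measurable.
Qed.

Lemma L1loc_lnsq1 (a b : E -> R) : L2r a -> L2r b -> L1loc (fun x => a x * lnsq (a x) (b x)).
Proof.
by move=> ha hb; apply: L1loc_lnsq => //; [case: ha|move=> x; exact: le_mod2l].
Qed.

Lemma L1loc_lnsq2 (a b : E -> R) : L2r a -> L2r b -> L1loc (fun x => b x * lnsq (a x) (b x)).
Proof.
by move=> ha hb; apply: L1loc_lnsq => //; [case: hb|move=> x; exact: le_mod2r].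
Qed.

Lemma lnsqC (u v : R) : lnsq u v = lnsq v u.
Proof. by rewrite /lnsq addrC. Qed.

End ccfun.

(** * Bounded continuous curves of states *)

Section curves.
Context {R : realType} {d : nat}.
Notation E := 'rV[R]_d.
Notation mu := (@lebesgue_rV R d).
Implicit Types (a b : R -> E -> R) (phi : E -> R).

Definition dist2 (a b : R -> E -> R) (s t : R) : R :=
  \int[mu]_x ((a s x - a t x) ^+ 2 + (b s x - b t x) ^+ 2).

(** The real and imaginary parts of a solution, with uniform bounds on the mass and on the second
    moment. The moment pays for the removal of cutoffs and for potentials of quadratic growth. *)
Record basic (s0 s1 M : R) a b : Prop := Basic {
  bas_a : forall t, s0 <= t <= s1 -> L2r (a t);
  bas_b : forall t, s0 <= t <= s1 -> L2r (b t);
  bas_m : forall t, s0 <= t <= s1 -> \int[mu]_x (a t x ^+ 2 + b t x ^+ 2) <= M;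
  bas_wi : forall t, s0 <= t <= s1 ->
    itg mu (fun x => sqnorm x * (a t x ^+ 2 + b t x ^+ 2));
  bas_w : forall t, s0 <= t <= s1 ->
    \int[mu]_x (sqnorm x * (a t x ^+ 2 + b t x ^+ 2)) <= M;
  bas_c : forall t, s0 <= t <= s1 -> forall e, 0 < e -> exists2 de, 0 < de &
    forall s, s0 <= s <= s1 -> `|s - t| < de -> dist2 a b s t <= e }.

Section cont.
Variables (s0 s1 M : R) (a b : R -> E -> R).
Hypothesis hb : basic s0 s1 M a b.

Lemma basic_M : s0 <= s1 -> 0 <= M.
Proof.
move=> s01; apply: le_trans (bas_m hb (t := s0) _); last by rewrite lexx.
by apply: int_ge0 => x; exact: sumsq_ge0.
Qed.

Lemma itg_sumsq t : s0 <= t <= s1 -> itg mu (fun x => a t x ^+ 2 + b t x ^+ 2).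
Proof. by move=> ht; apply: itgD; [case: (bas_a hb ht)|case: (bas_b hb ht)]. Qed.

Lemma itg_dist2 s t : s0 <= s <= s1 -> s0 <= t <= s1 ->
  itg mu (fun x => (a s x - a t x) ^+ 2 + (b s x - b t x) ^+ 2).
Proof.
move=> hs ht; apply: itgD.
  by case: (L2rB (bas_a hb hs) (bas_a hb ht)).
by case: (L2rB (bas_b hb hs) (bas_b hb ht)).
Qed.

Definition cont_on (F : R -> R) := forall t, s0 <= t <= s1 -> forall e, 0 < e ->
  exists2 de, 0 < de & forall s, s0 <= s <= s1 -> `|s - t| < de -> `|F s - F t| <= e.

Lemma cont_lin phi : ccfun phi -> cont_on (fun s => \int[mu]_x (a s x * phi x)).
Proof.
move=> hp t ht e e0.
have L2p := L2r_cc hp; set P := \int[mu]_x (phi x ^+ 2).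
have P0 : 0 <= P by apply: int_ge0 => x; exact: sqr_ge0.
pose eta := e / (2 * (P + 1)).
have eta0 : 0 < eta by rewrite divr_gt0// mulr_gt0// ltr_wpDl.
have [de de0 H] := bas_c hb ht (e := eta * (e / 2)) (mulr_gt0 eta0 (divr_gt0 e0 (ltr0Sn _ 1))).
exists de => // s hs st; rewrite -intB; try by (apply: L1loc_cc => //; apply: L2r_L1loc; exact: (bas_a hb)).
under eq_Rintegral do rewrite -mulrBl.
have L2d := L2rB (bas_a hb hs) (bas_a hb ht).
apply: le_trans (int_amgm eta0 L2d L2p) _; rewrite -/P.
have h1 : eta * P <= e / 2.
  rewrite /eta invfM mulrA -mulrA ler_piMr ?divr_ge0 ?(ltW e0)//.
  by rewrite mulrC ler_pdivrMr ?mul1r ?lerDl// ltr_wpDl.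
have h2 : \int[mu]_x ((a s x - a t x) ^+ 2) <= dist2 a b s t.
  apply: int_le; [by case: L2d|exact: itg_dist2|].
  by move=> x; rewrite lerDl sqr_ge0.
have h3 : eta^-1 * \int[mu]_x ((a s x - a t x) ^+ 2) <= e / 2.
  rewrite ler_pdivrMl//; apply: le_trans h2 _; exact: H.
by have := lerD h1 h3; lra.
Qed.

(** The pointwise modulus of [mul_lnsq_continuous] is integrated, and its product [D (1 + rs + rt)]
    is split into [eta (1 + rs^2 + rt^2)] and [D^2 / eta]. In turn [tau], [eta] and the time gap are
    chosen so that each accounts for a third of [e]. *)
Lemma cont_log phi : ccfun phi ->
  cont_on (fun s => \int[mu]_x (a s x * lnsq (a s x) (b s x) * phi x)).
Proof.
move=> hp t ht e e0.
have [Cp [n [Cp0 n0 Hp]]] := cc_bounded hp.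
set m := \int[mu]_x (\1_(cube n) x : R).
have m0 : 0 <= m by apply: int_ge0 => x; exact: ind_ge0.
have M0 : 0 <= M.
  apply: basic_M; case/andP: ht => h1 h2; exact: le_trans h2.
pose tau := e / (3 * (Cp * (m + 1))).
have m1 : 0 < m + 1 by rewrite ltr_wpDl.
have tau0 : 0 < tau by rewrite divr_gt0// mulr_gt0// mulr_gt0.
have [C C0 HC] := mul_lnsq_continuous tau0.
pose K := 3 * m + 6 * M + 1.
have K0 : 0 < K by rewrite ltr_wpDl// addr_ge0// mulr_ge0.
pose eta := e / (3 * (Cp * C * K)).
have CC : 0 < Cp * C by rewrite mulr_gt0.
have eta0 : 0 < eta by rewrite divr_gt0// mulr_gt0// mulr_gt0.
have e3 : 0 < eta * (e / (3 * (Cp * C))) by rewrite mulr_gt0// divr_gt0// mulr_gt0.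
have [de de0 H] := bas_c hb ht e3.
exists de => // s hs st.
have Ls := L1loc_lnsq1 (bas_a hb hs) (bas_b hb hs).
have Lt := L1loc_lnsq1 (bas_a hb ht) (bas_b hb ht).
rewrite -intB; try exact: L1loc_cc.
under eq_Rintegral do rewrite -mulrBl.
have ii := itg_ind n (d := d) (R := R).
have its := itg_sumsq hs; have itt := itg_sumsq ht; have itd := itg_dist2 hs ht.
pose B x := Cp * tau * \1_(cube n) x + (Cp * C * eta * 3) * \1_(cube n) x +
  (Cp * C * eta * 3) * (a s x ^+ 2 + b s x ^+ 2) + (Cp * C * eta * 3) * (a t x ^+ 2 + b t x ^+ 2) +
  (Cp * C * eta^-1) * ((a s x - a t x) ^+ 2 + (b s x - b t x) ^+ 2).
have iB : itg mu B.
  by do 4 (apply: itgD; last exact: itgZ); exact: itgZ.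
apply: (@le_trans _ _ (\int[mu]_x B x)).
  apply: int_norm => //.
    apply: measurable_funM; last exact: cc_measurable.
    by apply: measurable_funB; [case: Ls|case: Lt].
  move=> x; rewrite normrM.
  have hx := HC (a s x) (b s x) (a t x) (b t x).
  have phx := Hp x.
  apply: le_trans (ler_pM (normr_ge0 _) (normr_ge0 _) hx phx) _.
  set D := mod2 _ _; set rs := mod2 (a s x) _; set rt := mod2 (a t x) _.
  rewrite /B -!mod2_sqr -/rs -/rt -/D.
  have D0 : 0 <= D by exact: mod2_ge0.
  have rs0 : 0 <= rs by exact: mod2_ge0.
  have rt0 : 0 <= rt by exact: mod2_ge0.
  have key : D * (1 + rs + rt) <= eta * 3 * (1 + rs ^+ 2 + rt ^+ 2) + eta^-1 * D ^+ 2.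
    have h1 : (1 + rs + rt) ^+ 2 <= 3 * (1 + rs ^+ 2 + rt ^+ 2).
      rewrite -subr_ge0 (_ : _ - _ = (rs - rt) ^+ 2 + (1 - rs) ^+ 2 + (1 - rt) ^+ 2); last by ring.
      by rewrite !addr_ge0 ?sqr_ge0.
    have h2 : 0 <= eta^-1 * (eta * (1 + rs + rt) - D) ^+ 2.
      by rewrite mulr_ge0 ?sqr_ge0// invr_ge0 ltW.
    have h3 : eta^-1 * (eta * (1 + rs + rt) - D) ^+ 2 =
        eta * (1 + rs + rt) ^+ 2 - 2 * D * (1 + rs + rt) + eta^-1 * D ^+ 2.
      by field; rewrite gt_eqF.
    have h4 : eta * (1 + rs + rt) ^+ 2 <= eta * (3 * (1 + rs ^+ 2 + rt ^+ 2)) by rewrite ler_pM2l.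
    have h5 : 0 <= D * (1 + rs + rt) by rewrite mulr_ge0// !addr_ge0.
    by lra.
  have k1 := ind_ge0 n x (d := d) (R := R); have k2 := ind_le1 n x (d := d) (R := R).
  set i := \1_(cube n) x in k1 k2 *.
  have k3 : 0 <= eta^-1 * D ^+ 2 by rewrite mulr_ge0 ?sqr_ge0// invr_ge0 ltW.
  have k4 : 0 <= eta * 3 * rs ^+ 2 by rewrite mulr_ge0 ?sqr_ge0// mulr_ge0// ltW.
  have k5 : 0 <= eta * 3 * rt ^+ 2 by rewrite mulr_ge0 ?sqr_ge0// mulr_ge0// ltW.
  set A1 := eta * 3 * rs ^+ 2 in k4; set A2 := eta * 3 * rt ^+ 2 in k5; set A3 := eta^-1 * D ^+ 2 in k3.
  have key2 : D * (1 + rs + rt) <= eta * 3 + A1 + A2 + A3 by rewrite /A1 /A2 /A3; lra.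
  have key3 : D * (1 + rs + rt) * i <= eta * 3 * i + A1 + A2 + A3.
    apply: le_trans (ler_wpM2r k1 key2) _; rewrite !mulrDl.
    by rewrite -!addrA lerD2l !lerD// ler_piMr.
  have -> : (tau + C * D * (1 + rs + rt)) * (Cp * i) = Cp * tau * i + Cp * C * (D * (1 + rs + rt) * i) by ring.
  have key4 := ler_wpM2l (ltW CC) key3.
  apply: le_trans (lerD (lexx _) key4) _.
  by rewrite /A1 /A2 /A3 le_eqVlt; apply/orP; left; apply/eqP; ring.
rewrite /B !intD; try (by do ? (apply: itgD; last exact: itgZ); exact: itgZ); try exact: itgZ.
rewrite !intZ// -/m -/(dist2 a b s t).
have b1 : Cp * tau * m <= e / 3.
  have -> : Cp * tau * m = (e / 3) * (m / (m + 1)).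
    by rewrite /tau; field; rewrite !gt_eqF.
  by rewrite ler_piMr ?divr_ge0 ?(ltW e0)// ler_pdivrMr// mul1r lerDl.
have b2 : Cp * C * eta * (3 * m + 6 * M) <= e / 3.
  have -> : Cp * C * eta * (3 * m + 6 * M) = (e / 3) * ((3 * m + 6 * M) / K).
    by rewrite /eta; field; rewrite !gt_eqF.
  by rewrite ler_piMr ?divr_ge0 ?(ltW e0)// ler_pdivrMr// mul1r /K lerDl.
have b3 : Cp * C * eta^-1 * dist2 a b s t <= e / 3.
  have h := H s hs st.
  have -> : e / 3 = Cp * C * eta^-1 * (eta * (e / (3 * (Cp * C)))).
    by field; rewrite !gt_eqF.
  by rewrite ler_pM2l// mulr_gt0// invr_gt0.
have m1' := bas_m hb hs; have m2' := bas_m hb ht.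
have CE3 : 0 < Cp * C * eta * 3 by apply: mulr_gt0 => //; exact: mulr_gt0.
have b4 : Cp * C * eta * 3 * \int[mu]_x (a s x ^+ 2 + b s x ^+ 2) <= Cp * C * eta * 3 * M.
  by rewrite (ler_pM2l CE3).
have b5 : Cp * C * eta * 3 * \int[mu]_x (a t x ^+ 2 + b t x ^+ 2) <= Cp * C * eta * 3 * M.
  by rewrite (ler_pM2l CE3).
rewrite mulrDr in b2.
have -> : e = e / 3 + e / 3 + e / 3 by lra.
set Y := Cp * C * eta in b2 b4 b5 *; lra.
Qed.

End cont.

Lemma basic_swap s0 s1 M a b : basic s0 s1 M a b -> basic s0 s1 M b a.
Proof.
move=> [h1 h2 h3 h4 h5 h6]; split => //.
- by move=> t ht; under eq_Rintegral do rewrite addrC; exact: h3.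
- by move=> t ht; under eq_fun do rewrite [b t _ ^+ 2 + _]addrC; exact: h4.
- by move=> t ht; under eq_Rintegral do rewrite [b t _ ^+ 2 + _]addrC; exact: h5.
- move=> t ht e e0; have [de de0 H] := h6 t ht e e0; exists de => // s hs st.
  by rewrite /dist2; under eq_Rintegral do rewrite addrC; exact: H.
Qed.

Lemma basic_sub s0 s1 s0' s1' M a b : s0 <= s0' -> s1' <= s1 ->
  basic s0 s1 M a b -> basic s0' s1' M a b.
Proof.
move=> h0 h1 [H1 H2 H3 H4 H5 H6].
have K t : s0' <= t <= s1' -> s0 <= t <= s1.
  by move=> /andP[k1 k2]; rewrite (le_trans h0 k1) (le_trans k2 h1).
split => [t /K|t /K|t /K|t /K|t /K|t /K ht e e0]; try by auto.
have [de de0 H] := H6 t ht e e0; exists de => // s /K; exact: H.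
Qed.

End curves.

(** * Time integrals over a partition *)

Section time.
Context {R : realType}.
Notation leb := (@lebesgue_measure R).

Lemma itg_setU (A B : set R) (f : R -> R) : measurable A -> measurable B -> [disjoint A & B] ->
  leb.-integrable A (EFin \o f) -> leb.-integrable B (EFin \o f) ->
  leb.-integrable (A `|` B) (EFin \o f).
Proof.
move=> mA mB AB /integrableP[fA iA] /integrableP[fB iB].
have mf : measurable_fun (A `|` B) (EFin \o f) by apply/measurable_funU.
apply/integrableP; split => //.
rewrite ge0_integral_setU//; last exact: measurableT_comp.
by rewrite lte_add_pinfty.
Qed.

Lemma itg_set1 (r : R) (f : R -> R) : leb.-integrable [set r] (EFin \o f).
Proof.
apply/integrableP; split; first exact: measurable_fun_set1.
by rewrite integral_set1.
Qed.

Lemma nth_partition (T : R) (ss : seq R) k : itv_partition 0 T ss -> (k < size ss)%N ->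
  nth 0 (0 :: ss) k < nth 0 (0 :: ss) k.+1.
Proof. by move=> [/(pathP 0) h _] ks; exact: h. Qed.

Lemma nth_partition_ge0 (T : R) (ss : seq R) k : itv_partition 0 T ss -> (k <= size ss)%N ->
  0 <= nth 0 (0 :: ss) k.
Proof.
move=> h; elim: k => [//|k ih] ks; apply: le_trans (ih (ltnW ks)) _.
exact/ltW/(nth_partition h).
Qed.

Lemma nth_partition_last (T : R) (ss : seq R) : itv_partition 0 T ss ->
  nth 0 (0 :: ss) (size ss) = T.
Proof. by move=> [_ /eqP <-]; rewrite (last_nth 0). Qed.

(** Open intervals are added one at a time together with their endpoints, where nothing is known of
    [f] but which are single points. *)
Lemma integrable_pieces (T : R) (ss : seq R) (f : R -> R) : itv_partition 0 T ss ->
  (forall k, (k < size ss)%N -> exists2 g : R -> R, leb.-integrable `[0, T] (EFin \o g) &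
     forall t, nth 0 (0 :: ss) k < t < nth 0 (0 :: ss) k.+1 -> f t = g t) ->
  leb.-integrable `[0, T] (EFin \o f).
Proof.
move=> hp H.
have le_T k : (k <= size ss)%N -> nth 0 (0 :: ss) k <= T.
  move=> ks; rewrite -(nth_partition_last hp).
  have K j : (k + j <= size ss)%N -> nth 0 (0 :: ss) k <= nth 0 (0 :: ss) (k + j).
    elim: j => [|j ih] kj; first by rewrite addn0.
    rewrite addnS in kj *; apply: le_trans (ih (ltnW kj)) _.
    exact/ltW/(nth_partition hp).
  by have := K (size ss - k)%N; rewrite subnKC//; apply.
suff K k : (k <= size ss)%N -> leb.-integrable `[0, nth 0 (0 :: ss) k] (EFin \o f).
  by rewrite -{1}(nth_partition_last hp); exact: K.
elim: k => [|k ih] ks; first by rewrite /= set_itv1; exact: itg_set1.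
have s0 := nth_partition_ge0 hp (ltnW ks).
have s1 := nth_partition hp ks.
set p := nth 0 (0 :: ss) k in s0 s1 ih *; set q := nth 0 (0 :: ss) k.+1 in s1 *.
have -> : `[0, q]%classic = (`[0, p] `|` `]p, q[ `|` [set q])%classic.
  apply/seteqP; split => t /=; rewrite !in_itv/=.
    move=> /andP[t0 tq]; have [tp|tp] := leP t p; first by left; left; rewrite t0.
    by move: tq; rewrite le_eqVlt => /predU1P[->|tq]; [right|left; right; rewrite tq].
  move=> [[/andP[-> h]|/andP[h1 h2]]|->]/=.
  - exact: le_trans h (ltW s1).
  - by rewrite (le_trans s0 (ltW h1)) ltW.
  - by rewrite lexx (le_trans s0 (ltW s1)).
have [g ig fg] := H k ks.
apply: itg_setU => //; first exact: measurableU.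
- apply/disj_setPS => t /= [[]]; rewrite !in_itv/=.
    by move=> /andP[_ h] E1; rewrite E1 leNgt s1 in h.
  by move=> /andP[_ h] E1; rewrite E1 ltxx in h.
- apply: itg_setU => //.
  + apply/disj_setPS => t /= []; rewrite !in_itv/= => /andP[_ h1] /andP[h2 _].
    by rewrite ltNge h1 in h2.
  + exact: ih (ltnW ks).
  + have : leb.-integrable `]p, q[ (EFin \o g).
      apply: integrableS ig => // t /=; rewrite !in_itv/= => /andP[h1 h2].
      rewrite (le_trans s0 (ltW h1)) (le_trans (ltW h2))//.
      exact: (le_T k.+1).
    apply: eq_integrable => // t; rewrite inE/= in_itv/= => h.
    by rewrite fg.
- exact: itg_set1.
Qed.

Lemma cont_on_integrable (T : R) (F : R -> R) : cont_on 0 T F ->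
  leb.-integrable `[0, T] (EFin \o F).
Proof.
move=> cF; apply: continuous_compact_integrable; first exact: segment_compact.
apply/subspace_continuousP => t /=; rewrite in_itv/= => ht.
apply/cvgrPdist_le => e e0; have [de de0 H] := cF t ht e e0.
rewrite near_withinE; have : \forall s \near t, `|t - s| < de.
  by apply: (@cvgr_dist_lt _ _ _ (nbhs t) _ id) => //; exact: cvg_id.
apply: filterS => s st; rewrite /= in_itv/= => hs; rewrite distrC; apply: H => //.
by rewrite distrC.
Qed.

Lemma cont_on_at (s0 s1 t : R) (F : R -> R) : cont_on s0 s1 F -> s0 < t < s1 ->
  {for t, continuous F}.
Proof.
move=> cF /andP[h1 h2]; apply/cvgrPdist_le => e e0.
have ht : s0 <= t <= s1 by rewrite !ltW.
have [de de0 H] := cF t ht e e0; near=> s; rewrite distrC; apply: H.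
  apply/andP; split; apply: ltW; near: s; [exact: lt_nbhsr|exact: lt_nbhsl].
by rewrite distrC; near: s; exact: cvgr_dist_lt.
Unshelve. all: by end_near. Qed.

Lemma cont_onD (s0 s1 : R) (F G : R -> R) : cont_on s0 s1 F -> cont_on s0 s1 G ->
  cont_on s0 s1 (fun t => F t + G t).
Proof.
move=> cF cG t ht e e0; have e2 : 0 < e / 2 by rewrite divr_gt0.
have [d1 d10 H1] := cF t ht _ e2; have [d2 d20 H2] := cG t ht _ e2.
exists (Num.min d1 d2); first by rewrite lt_min d10.
move=> s hs; rewrite lt_min => /andP[k1 k2].
rewrite opprD addrACA; apply: le_trans (ler_normD _ _) _.
by have := lerD (H1 s hs k1) (H2 s hs k2); lra.
Qed.

Lemma cont_onZ (s0 s1 c : R) (F : R -> R) : cont_on s0 s1 F ->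
  cont_on s0 s1 (fun t => c * F t).
Proof.
move=> cF t ht e e0; have c1 : 0 < `|c| + 1 by rewrite ltr_wpDl.
have [d1 d10 H1] := cF t ht _ (divr_gt0 e0 c1); exists d1 => // s hs st.
rewrite -mulrBr normrM; apply: (@le_trans _ _ ((`|c| + 1) * (e / (`|c| + 1)))).
  by apply: ler_pM => //; [rewrite lerDl|exact: H1].
by rewrite mulrCA divff ?mulr1// gt_eqF.
Qed.

End time.

(** * From the integrated equation to a derivative in time *)

Section solution.
Context {R : realType} {d m : nat}.
Notation E := 'rV[R]_d.
Notation mu := (@lebesgue_rV R d).
Notation leb := (@lebesgue_measure R).
Notation Rp := (complex.Re).
Notation Ip := (complex.Im).

(** [e] is separate from [f] because the logarithm of the density couples the two components: [f] is
    one of them, [e] depends on both. *)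
Definition ham_term (lam : R) (U : E -> R) (f e : E -> R) (phi : E -> R) : R :=
  \int[mu]_x (f x * (U x * phi x - 2^-1 * laplacian phi x)) +
  lam * \int[mu]_x (f x * e x * phi x).

(* The real and imaginary parts of the equation: [a' = H b] and [b' = - H a], *)
(* with [H v = - 1/2 Delta v + U v + lam v ln (a^2 + b^2)].                   *)
Definition hamiltonian (lam : R) (U : E -> R) (s0 s1 : R) (a b : R -> E -> R) :=
  forall phi, test_function phi -> forall t, s0 < t < s1 ->
   is_derive t (1 : R) (fun s => \int[mu]_x (a s x * phi x))
     (ham_term lam U (b t) (fun x => lnsq (a t x) (b t x)) phi) /\
   is_derive t (1 : R) (fun s => \int[mu]_x (b s x * phi x))
     (- ham_term lam U (a t) (fun x => lnsq (a t x) (b t x)) phi).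

Variables (lam : R) (V : E -> R) (W : 'rV[R]_m -> E -> R) (T : R) (u : R -> 'rV[R]_m)
  (psi : R -> E -> R[i]).
Hypothesis sol : Sigma_solution lam V W T u psi.
Hypothesis pu : piecewise_constant T u.
Hypothesis cVW : forall c, continuous (fun x => V x + W c x).

Let a t x := Rp (psi t x).
Let b t x := Ip (psi t x).

Lemma Sigma_basic : 0 <= T -> exists M, basic 0 T M a b.
Proof.
move=> T0; have [cpsi [M0 HM0] _] := sol.
have [M [M1 HM]] : exists M, 0 <= M /\ forall t, 0 <= t <= T -> Sigma_le M (psi t).
  exists M0; split => //; have [] := HM0 0 _; first by rewrite lexx.
  move=> _ h _ _; rewrite -lee_fin; apply: le_trans h; rewrite L2normE; exact: poweR_ge0.
have LL t : 0 <= t <= T -> L2 (psi t) by move=> /HM[].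
have wE t x : psi t x * (Num.sqrt (sqnorm x))%:C%C =
    Complex (a t x * Num.sqrt (sqnorm x)) (b t x * Num.sqrt (sqnorm x)).
  by rewrite /a /b; case: (psi t x) => p q /=; rewrite /GRing.mul /= !mulr0 subr0 add0r.
have sq0 x : 0 <= sqnorm x :> R by apply: sumr_ge0 => j _; exact: sqr_ge0.
have msq : measurable_fun setT (fun x : E => Num.sqrt (sqnorm x)).
  apply: continuous_rV_measurable => x.
  suff c : {for x, continuous (fun y : E => sqnorm y)}.
    exact: (continuous_comp c (@sqrt_continuous _ _)).
  have -> : sqnorm = \sum_j (fun y : E => y ord0 j ^+ 2).
    by apply/funext => y; rewrite fct_sumE.
  move: x; elim/big_ind: _ => [|f g cf cg|i _] x; first exact: cst_continuous.
    exact: (continuousD (cf x) (cg x)).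
  have h : {for x, continuous (fun y : E => y ord0 i)} by exact: coord_continuous.
  exact: (continuousM h h).
have wL t : 0 <= t <= T -> itg mu (fun x => sqnorm x * (a t x ^+ 2 + b t x ^+ 2)) /\
    \int[mu]_x (sqnorm x * (a t x ^+ 2 + b t x ^+ 2)) <= M ^+ 2.
  move=> ht; have [[m1 m2 _] _ h _] := HM t ht.
  have e1 x : (Rp (psi t x * (Num.sqrt (sqnorm x))%:C%C)) ^+ 2 +
     (Ip (psi t x * (Num.sqrt (sqnorm x))%:C%C)) ^+ 2 = sqnorm x * (a t x ^+ 2 + b t x ^+ 2).
    by rewrite wE /= !exprMn sqr_sqrtr// mulrDr ![_ * sqnorm x]mulrC.
  have Lw : L2 (fun x => psi t x * (Num.sqrt (sqnorm x))%:C%C).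
    split.
    - by under eq_fun do rewrite wE /=; apply: measurable_funM.
    - by under eq_fun do rewrite wE /=; apply: measurable_funM.
    - by apply: le_lt_trans h _; rewrite ltry.
  split.
    by have := L2_itg Lw; under eq_fun do rewrite e1.
  by have := (L2_le Lw M1).1 h; rewrite /nrm2; under eq_Rintegral do rewrite e1.
exists (M ^+ 2); split.
- by move=> t /LL/L2_L2r[].
- by move=> t /LL/L2_L2r[].
- move=> t ht; have [_ h _ _] := HM t ht; exact/(L2_le (LL t ht) M1).
- by move=> t /wL[].
- by move=> t /wL[].
- move=> t ht e e0; have := cpsi t ht.
  have e1 : 0 < Num.sqrt e by rewrite sqrtr_gt0.
  move=> /fine_cvgP[_]; move=> /cvgrPdist_lt /(_ _ e1).
  rewrite near_withinE => /nbhs_ballP [de /= de0 H].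
  exists de => // s hs st.
  have {}H := H s _ _; rewrite sub0r normrN in H.
  have Ld : L2 (fun x => psi s x - psi t x).
    have [La Lb] := L2_L2r (LL s hs); have [La' Lb'] := L2_L2r (LL t ht).
    have h1 := L2rB La La'; have h2 := L2rB Lb Lb'.
    have eR x : Rp (psi s x - psi t x) = Rp (psi s x) - Rp (psi t x).
      by case: (psi s x) (psi t x) => [p q] [p' q'].
    have eI x : Ip (psi s x - psi t x) = Ip (psi s x) - Ip (psi t x).
      by case: (psi s x) (psi t x) => [p q] [p' q'].
    apply: L2_of.
    + by under eq_fun do rewrite eR; case: h1.
    + by under eq_fun do rewrite eI; case: h2.
    + by under eq_fun do rewrite eR eI; apply: itgD; [case: h1|case: h2].
  have -> : dist2 a b s t = nrm2 (fun x => psi s x - psi t x).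
    apply: int_eq => x; rewrite /a /b.
    by case: (psi s x) (psi t x) => [p q] [p' q'].
  suff h : (L2norm (fun x => psi s x - psi t x)%R <= (Num.sqrt e)%:E)%E.
    by have := (L2_le Ld (ltW e1)).1 h; rewrite sqr_sqrtr// ltW.
  rewrite (L2_nrm Ld) lee_fin.
  have := H; rewrite /ball/= distrC => /(_ st); rewrite in_itv/= => /(_ hs).
  by rewrite (L2_nrm Ld)/= ger0_norm ?sqrtr_ge0// => /ltW.
Qed.

(** While the control is constant, the integrand in time agrees with a function that is continuous
    by [cont_lin] and [cont_log], so the fundamental theorem of calculus applies at every interior
    time. *)
Lemma Sigma_hamiltonian (s0 s1 : R) (c : 'rV[R]_m) : 0 <= s0 -> s0 < s1 -> s1 <= T ->
  (forall t, s0 < t < s1 -> u t = c) ->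
  hamiltonian lam (fun x => V x + W c x) s0 s1 a b.
Proof.
move=> s00 s01 s1T uc phi tphi t /andP[t0 t1].
have T0 : 0 <= T by exact: le_trans (le_trans s00 (ltW s01)) s1T.
have [M hbas] := Sigma_basic T0; have hbas' := basic_swap hbas.
have cphi := test_cc tphi; have clap := cc_laplacian tphi.
have cU c' : ccfun (fun x => (V x + W c' x) * phi x - 2^-1 * laplacian phi x).
  have h1 := ccM (@cVW c') cphi.
  have h2 : ccfun (fun x => - (2^-1 * laplacian phi x)).
    have := ccM (@cst_continuous E R (- 2^-1)) clap.
    by congr ccfun; apply/funext => x; rewrite /= mulNr.
  exact: (ccD h1 h2).
pose Ha c' s := ham_term lam (fun x => V x + W c' x) (a s) (fun x => lnsq (a s x) (b s x)) phi.
pose Hb c' s := ham_term lam (fun x => V x + W c' x) (b s) (fun x => lnsq (a s x) (b s x)) phi.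
have cHa c' : cont_on 0 T (Ha c').
  apply: cont_onD; first exact: (cont_lin hbas (cU c')).
  by apply: cont_onZ; exact: (cont_log hbas cphi).
have cHb c' : cont_on 0 T (Hb c').
  apply: cont_onD; first exact: (cont_lin hbas' (cU c')).
  apply: cont_onZ; have := cont_log hbas' cphi.
  congr cont_on; apply/funext => s; apply: int_eq => x.
  by rewrite lnsqC.
have rhsE s : 0 <= s <= T -> weak_rhs lam V W (u s) (psi s) phi = Complex (Ha (u s) s) (Hb (u s) s).
  move=> hs; rewrite /weak_rhs /Cintegral.
  have L1 := L2r_L1loc (bas_a hbas hs); have L2' := L2r_L1loc (bas_b hbas hs).
  have K1 := L1loc_lnsq1 (bas_a hbas hs) (bas_b hbas hs).
  have K2 := L1loc_lnsq2 (bas_a hbas hs) (bas_b hbas hs).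
  have e1 x : - psi s x * (2^-1 * laplacian phi x)%:C%C + ((V x + W (u s) x)%:C%C * psi s x
      + lam%:C%C * logNL (psi s x)) * (phi x)%:C%C =
    Complex (a s x * ((V x + W (u s) x) * phi x - 2^-1 * laplacian phi x) +
       lam * (a s x * lnsq (a s x) (b s x) * phi x))
     (b s x * ((V x + W (u s) x) * phi x - 2^-1 * laplacian phi x) +
       lam * (b s x * lnsq (a s x) (b s x) * phi x)).
    rewrite /a /b /logNL /lnsq; case: (psi s x) => p q /=.
    rewrite sqr_sqrtr ?sumsq_ge0//; set L := ln _.
    by apply/eqP; rewrite eq_complex /=; apply/andP; split; apply/eqP; ring.
  congr Complex.
    rewrite /Ha /ham_term -intZ; last exact: L1loc_cc.
    rewrite -intD; [|exact: L1loc_cc|by apply: itgZ; exact: L1loc_cc].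
    by apply: int_eq => x; rewrite e1.
  rewrite /Hb /ham_term -intZ; last exact: L1loc_cc.
  rewrite -intD; [|exact: L1loc_cc|by apply: itgZ; exact: L1loc_cc].
  by apply: int_eq => x; rewrite e1.
have [_ _ weq] := sol.
have [ss hss hpc] := pu.
have iHa : leb.-integrable `[0, T] (EFin \o (fun r => Ha (u r) r)).
  apply: (integrable_pieces hss) => k ks; have [c' hc'] := hpc k ks.
  exists (Ha c'); first exact: cont_on_integrable.
  by move=> r hr; rewrite (hc' r hr).
have iHb : leb.-integrable `[0, T] (EFin \o (fun r => Hb (u r) r)).
  apply: (integrable_pieces hss) => k ks; have [c' hc'] := hpc k ks.
  exists (Hb c'); first exact: cont_on_integrable.
  by move=> r hr; rewrite (hc' r hr).
have weq2 s : 0 <= s <= T ->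
   \int[mu]_x (a s x * phi x) = \int[mu]_x (a 0 x * phi x) + \int[leb]_(r in `[0, s]) Hb (u r) r /\
   \int[mu]_x (b s x * phi x) = \int[mu]_x (b 0 x * phi x) + \int[leb]_(r in `[0, s]) (- Ha (u r) r).
  move=> hs; have := weq phi tphi s hs.
  have h0 : 0 <= (0 : R) <= T by rewrite lexx.
  have L1 := L2r_L1loc (bas_a hbas hs); have L2' := L2r_L1loc (bas_b hbas hs).
  have L3 := L2r_L1loc (bas_a hbas h0); have L4 := L2r_L1loc (bas_b hbas h0).
  rewrite /Cintegral => /eqP; rewrite eq_complex /= => /andP[/eqP h1 /eqP h2].
  have e1 x : (psi s x - psi 0 x) * (phi x)%:C%C =
     Complex (a s x * phi x - a 0 x * phi x) (b s x * phi x - b 0 x * phi x).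
    rewrite /a /b; case: (psi s x) (psi 0 x) => [p q] [p' q'] /=.
    by apply/eqP; rewrite eq_complex /=; apply/andP; split; apply/eqP; ring.
  have I1 : \int[mu]_x Rp ((psi s x - psi 0 x) * (phi x)%:C%C) =
      \int[mu]_x (a s x * phi x) - \int[mu]_x (a 0 x * phi x).
    by rewrite -intB; try exact: L1loc_cc; apply: int_eq => x; rewrite e1.
  have I2 : \int[mu]_x Ip ((psi s x - psi 0 x) * (phi x)%:C%C) =
      \int[mu]_x (b s x * phi x) - \int[mu]_x (b 0 x * phi x).
    by rewrite -intB; try exact: L1loc_cc; apply: int_eq => x; rewrite e1.
  move: h1 h2; rewrite I1 I2 !mul0r !mul1r !add0r.
  move=> h1 h2; have K r : r \in `[0, s]%classic -> 0 <= r <= T.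
    rewrite inE/= in_itv/= => /andP[r0 rs]; rewrite r0 (le_trans rs)//.
    by case/andP: hs.
  split.
    apply/eqP; rewrite addrC -subr_eq; apply/eqP; rewrite h2.
    by apply: eq_Rintegral => r /K hr; have := rhsE r hr; rewrite /weak_rhs /Cintegral => -[_ ->].
  apply/eqP; rewrite addrC -subr_eq -[X in X == _]opprK; apply/eqP; rewrite h1.
  have iHa' : leb.-integrable `[0, s] (EFin \o (fun r => Ha (u r) r)).
    apply: integrableS (iHa) => // r /=; rewrite !in_itv/= => /andP[-> h3] /=.
    by apply: le_trans h3 _; case/andP: hs.
  have -> : \int[leb]_(r in `[0, s]) (- Ha (u r) r) = - \int[leb]_(r in `[0, s]) Ha (u r) r.
    by rewrite -mulN1r -RintegralZl//; apply: eq_Rintegral => r _; rewrite mulN1r.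
  congr (- _); apply: eq_Rintegral => r /K hr; by have := rhsE r hr; rewrite /weak_rhs /Cintegral => -[-> _].
have iHNa : leb.-integrable `[0, T] (EFin \o (fun r => - Ha (u r) r)).
  by apply: eq_integrable (integrableN iHa).
have fin (F : R -> R) (G : R -> R) (k : R) : cont_on 0 T G ->
  (forall r, s0 < r < s1 -> G r = F r) -> leb.-integrable `[0, T] (EFin \o F) ->
  is_derive t (1 : R) (fun s => k + \int[leb]_(r in `[0, s]) F r) (F t).
  move=> cG GF iF; have tT : t < T by exact: lt_le_trans s1T.
  have t00 : 0 < t by exact: le_lt_trans t0.
  have cF : {for t, continuous F}.
    have cGt : {for t, continuous G} by apply: (cont_on_at cG); rewrite t00.
    suff H : F r @[r --> t] --> F t by exact: H.
    have <- : G t = F t by apply: GF; rewrite t0.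
    apply: cvg_trans cGt; apply: near_eq_cvg.
    near=> r; apply: GF; apply/andP; split; near: r; [exact: lt_nbhsr|exact: lt_nbhsl].
  have [h1 h2] := @continuous_FTC1 R F (BLeft 0) t T tT iF t00 cF.
  have h3 : is_derive t (1 : R) (fun s => \int[leb]_(r in `[0, s]) F r) (F t).
    by split; [exact: h1|rewrite -[RHS]h2 derive1E].
  have h4 := is_deriveD (@is_derive_cst _ _ _ k t 1) h3.
  by rewrite add0r in h4.
have ht : s0 < t < s1 by rewrite t0.
have near_ok (F G : R -> R) (k : R) : (forall s, 0 <= s <= T -> F s = k + \int[leb]_(r in `[0, s]) G r) ->
  \forall s \near t, k + \int[leb]_(r in `[0, s]) G r = F s.
  move=> H; near=> s; rewrite H//; apply/andP; split; apply: ltW.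
    by near: s; apply: lt_nbhsr; exact: le_lt_trans t0.
  by near: s; apply: lt_nbhsl; exact: lt_le_trans s1T.
split.
- have h : \forall s \near t, \int[mu]_x (a 0 x * phi x) + \int[leb]_(r in `[0, s]) Hb (u r) r =
    \int[mu]_x (a s x * phi x) by apply: near_ok => s /weq2[].
  apply: near_eq_is_derive h _; rewrite -[ham_term _ _ _ _ _]/(Hb c t) -(uc t ht).
  by apply: (fin _ (Hb c)) => // r hr; rewrite (uc r hr).
- have h : \forall s \near t, \int[mu]_x (b 0 x * phi x) + \int[leb]_(r in `[0, s]) (- Ha (u r) r) =
    \int[mu]_x (b s x * phi x) by apply: near_ok => s /weq2[].
  apply: near_eq_is_derive h _; rewrite -[ham_term _ _ _ _ _]/(Ha c t) -(uc t ht).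
  apply: (fin _ (fun r => - Ha c r)) => // [|r hr]; last by rewrite (uc r hr).
  have := cont_onZ (-1) (cHa c); congr cont_on; apply/funext => r; exact: mulN1r.
Unshelve. all: by end_near. Qed.

End solution.

(** * Evolution of bilinear forms *)

Section real_calculus.
Context {R : realType}.

Lemma is_derive_small (f : R -> R) (t : R) : f t = 0 ->
  (forall e : R, 0 < e -> exists2 de, 0 < de &
     forall s, `|s - t| < de -> `|f s| <= e * `|s - t|) ->
  is_derive t (1 : R) f 0.
Proof.
move=> ft H.
suff K : h^-1 *: (f (h *: 1 + t) - f t) @[h --> (0:R)^'] --> (0:R).
  split; [by apply/cvg_ex; exists 0|exact/cvg_lim].
apply/cvgr0Pnorm_le => e e0; have [de de0 Hd] := H e e0; near=> h.
have h0 : h != 0 by near: h; exact: nbhs_dnbhs_neq.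
rewrite ft subr0 (_ : h *: 1 = h); last by rewrite /GRing.scale/= mulr1.
rewrite /GRing.scale/= normrM normrV ?unitfE// ler_pdivrMl ?normr_gt0//.
have := Hd (h + t); rewrite addrK mulrC; apply.
by near: h; apply: dnbhs0_lt.
Unshelve. all: by end_near. Qed.

Lemma mvt_le (f df : R -> R) (s0 s1 C : R) :
  (forall t, s0 < t < s1 -> is_derive t (1 : R) f (df t)) ->
  (forall t, s0 < t < s1 -> `|df t| <= C) ->
  forall s t, s0 < s < s1 -> s0 < t < s1 -> `|f s - f t| <= C * `|s - t|.
Proof.
move=> hd hC.
have K s t : s < t -> s0 < s < s1 -> s0 < t < s1 -> `|f t - f s| <= C * `|t - s|.
  move=> st /andP[h1 h2] /andP[h3 h4].
  have inn x : x \in `[s, t] -> s0 < x < s1.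
    rewrite in_itv/= => /andP[k1 k2]; rewrite (lt_le_trans h1 k1)/=.
    exact: le_lt_trans k2 h4.
  have [] := @MVT _ f df s t st.
  - by move=> x xi; apply: hd; apply: inn; exact: subset_itv_oo_cc.
  - apply: derivable_within_continuous => x xi; by case: (hd x (inn x xi)).
  move=> x xi ->; rewrite normrM ler_wpM2r//; apply: hC; apply: inn.
  exact: subset_itv_oo_cc.
move=> s t hs ht; have [st|st|->] := ltgtP s t.
- by rewrite distrC [X in _ * X]distrC; exact: K.
- exact: K.
- by rewrite !subrr normr0 mulr0.
Qed.

End real_calculus.

Section bilinear.
Context {R : realType} {d : nat}.
Notation E := 'rV[R]_d.
Notation mu := (@lebesgue_rV R d).
Notation mu2 := (lebesgue_rV d \x lebesgue_rV d)%E.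
Implicit Types (f g al be phi : E -> R) (n e K : R).

Definition l1 (n : R) (g : E -> R) : R := \int[mu]_x (\1_(cube n) x * `|g x|).

Lemma l1_ge0 n g : 0 <= l1 n g.
Proof. by apply: int_ge0 => x; rewrite mulr_ge0 ?ind_ge0. Qed.

Lemma itg_l1 n g : L1loc g -> itg mu (fun x => \1_(cube n) x * `|g x|).
Proof. by move=> /L1loc_norm[_]; apply. Qed.

Lemma l1D n f g : L1loc f -> L1loc g -> l1 n (fun x => f x + g x) <= l1 n f + l1 n g.
Proof.
move=> hf hg; rewrite /l1 -intD; try exact: itg_l1.
apply: int_le; [apply: itg_l1; exact: L1locD|apply: itgD; exact: itg_l1|].
by move=> x; rewrite -mulrDr ler_wpM2l ?ind_ge0 ?ler_normD.
Qed.

Lemma l1_small n e : 0 < e -> exists2 e' : R, 0 < e' & forall g, L2r g ->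
  \int[mu]_x (g x ^+ 2) <= e' -> l1 n g <= e.
Proof.
move=> e0; set m := \int[mu]_x (\1_(cube n) x : R).
have m0 : 0 <= m by apply: int_ge0 => x; exact: ind_ge0.
pose k := e / (2 * (m + 1)).
have m1 : 0 < m + 1 by rewrite ltr_wpDl.
have k0 : 0 < k by rewrite divr_gt0// mulr_gt0.
exists (k * (e / 2)); first by rewrite mulr_gt0// divr_gt0.
move=> g hg hge.
have hi : L2r (fun x : E => \1_(cube n) x : R).
  split; first exact: measurable_ind.
  by apply: itg_dom (itg_ind n) _ => [|x]; [apply: measurable_funX; exact: measurable_ind|
    rewrite normrX ger0_norm ?ind_ge0// expr2 ler_piMl ?ind_ge0 ?ind_le1].
have hn : L2r (fun x => `|g x|).
  split; first by apply: measurableT_comp => //; case: hg.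
  by under eq_fun do rewrite real_normK ?num_real//; case: hg.
have := int_amgm k0 hn hi; rewrite /l1.
under eq_Rintegral do rewrite mulrC.
move=> /(le_trans (ler_norm _)) h; apply: le_trans h _.
have -> : \int[mu]_x (\1_(cube n) x : R) ^+ 2 = m.
  by apply: int_eq => x; rewrite indE; case: (_ <= _); rewrite ?expr1n ?expr0n.
have -> : \int[mu]_x `|g x| ^+ 2 = \int[mu]_x (g x ^+ 2).
  by apply: int_eq => x; rewrite real_normK ?num_real.
have h1 : k * m <= e / 2.
  have -> : k * m = (e / 2) * (m / (m + 1)) by rewrite /k; field; rewrite gt_eqF.
  by rewrite ler_piMr ?divr_ge0 ?(ltW e0)// ler_pdivrMr// mul1r lerDl.
have h2 : k^-1 * \int[mu]_x (g x ^+ 2) <= e / 2 by rewrite ler_pdivrMl.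
by have := lerD h1 h2; lra.
Qed.

(** The bounds are linear in the local L^1 norm of [g]. Combined with [cv_b], they make the
    derivative of a pairing with [Phi al be g] small when [g] is small. *)
Lemma Phi_est al be n : test_function al -> test_function be ->
  exists2 C : R, 0 < C & exists m : R, n <= m /\ forall g, L1loc g -> forall x,
    `|Phi al be g x| <= C * l1 m g * \1_(cube m) x /\
    `|laplacian (Phi al be g) x| <= C * l1 m g * \1_(cube m) x.
Proof.
move=> ta tb.
have [C [m [C0 m0 H]]] := kern_bound (kern_pk ta tb).
have [C' [m' [C0' m0' H']]] := kern_bound (kern_lapk 1 ta tb).
pose p := Num.max n (Num.max m m').
have mp : m <= p by rewrite /p !le_max lexx !orbT.
have mp' : m' <= p by rewrite /p !le_max lexx !orbT.
exists (C + C'); first exact: addr_gt0.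
exists p; split; first by rewrite /p le_max lexx.
move=> g hg x.
have K (D q : R) (M : E * E -> R) : 0 < D -> D <= C + C' -> q <= p -> measurable_fun setT M ->
   (forall x y, `|M (x, y)| <= D * (\1_(cube q) x * \1_(cube q) y)) ->
   `|\int[mu]_y (g y * M (x, y))| <= (C + C') * l1 p g * \1_(cube p) x.
  move=> D0 DC qp mM HM; rewrite mulrAC /l1 -intZ; last exact: itg_l1.
  apply: int_norm.
  - by apply: measurable_funM; [case: hg|exact: measurable_section1].
  - by apply: itgZ; exact: itg_l1.
  move=> y; rewrite normrM mulrC mulrA; apply: ler_wpM2r => //.
  apply: le_trans (HM _ _) _; rewrite -mulrA; apply: ler_pM => //; rewrite ?(ltW D0) ?mulr_ge0 ?ind_ge0//.
  by apply: ler_pM; rewrite ?ind_ge0//; exact: ind_mono.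
split.
  by apply: (K C m) => //; [rewrite lerDl ltW|case: (kern_pk ta tb)].
rewrite laplacian_Phi//.
by apply: (K C' m') => //; [rewrite lerDr ltW|case: (kern_lapk 1 ta tb)].
Qed.

(** A weakly differentiable curve: [H t phi] is the derivative of the pairing with [phi]. As [cv_b]
    involves only the sup of [phi] and of its Laplacian on a cube, pairings are Lipschitz in time
    uniformly over such test functions ([curve_lip]). *)
Record curve (s0 s1 : R) (f : R -> E -> R) (H : R -> (E -> R) -> R) : Prop := Curve {
  cv_L2 : forall t, s0 < t < s1 -> L2r (f t);
  cv_c : forall t, s0 < t < s1 -> forall e, 0 < e -> exists2 de, 0 < de &
    forall s, s0 < s < s1 -> `|s - t| < de -> \int[mu]_x ((f s x - f t x) ^+ 2) <= e;
  cv_d : forall phi, test_function phi -> forall t, s0 < t < s1 ->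
    is_derive t (1 : R) (fun s => \int[mu]_x (f s x * phi x)) (H t phi);
  cv_b : forall n, exists2 C : R, 0 < C & forall t, s0 < t < s1 ->
    forall phi K, test_function phi -> 0 <= K ->
    (forall x, `|phi x| <= K * \1_(cube n) x) ->
    (forall x, `|laplacian phi x| <= K * \1_(cube n) x) -> `|H t phi| <= C * K }.

Lemma curve_lip s0 s1 (f : R -> E -> R) H n : curve s0 s1 f H -> exists2 C : R, 0 < C &
  forall s t, s0 < s < s1 -> s0 < t < s1 -> forall phi K, test_function phi -> 0 <= K ->
    (forall x, `|phi x| <= K * \1_(cube n) x) ->
    (forall x, `|laplacian phi x| <= K * \1_(cube n) x) ->
    `|\int[mu]_x ((f s x - f t x) * phi x)| <= C * K * `|s - t|.
Proof.
move=> cf; have [C C0 hC] := cv_b cf n; exists C => // s t hs ht phi K tp K0 h1 h2.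
have E1 r : s0 < r < s1 -> itg mu (fun x => f r x * phi x).
  by move=> hr; apply: L1loc_cc; [exact: L2r_L1loc (cv_L2 cf hr)|exact: test_cc].
under eq_Rintegral do rewrite mulrBl; rewrite intB//; try exact: E1.
apply: (@mvt_le _ (fun s => \int[mu]_x (f s x * phi x)) (fun r => H r phi) s0 s1) => //.
  by move=> r hr; exact: (cv_d cf tp hr).
by move=> r hr; exact: (hC r hr phi K).
Qed.

Lemma curve_l1 s0 s1 (f : R -> E -> R) H n t : curve s0 s1 f H -> s0 < t < s1 -> forall e, 0 < e ->
  exists2 de, 0 < de & forall s, s0 < s < s1 -> `|s - t| < de ->
    l1 n (fun x => f s x - f t x) <= e.
Proof.
move=> cf ht e e0; have [e' e0' H1] := l1_small n e0.
have [de de0 H2] := cv_c cf ht e0'; exists de => // s hs st.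
by apply: H1; [apply: L2rB; exact: (cv_L2 cf)|exact: H2].
Qed.

Definition kcurve (M M' : R -> E * E -> R) (t : R) := exists de C n : R, [/\ 0 < de,
  forall s, `|s - t| < de -> measurable_fun setT (M s),
  forall s, `|s - t| < de -> forall x y, `|M' s (x, y)| <= C * (\1_(cube n) x * \1_(cube n) y) &
  forall s, `|s - t| < de -> forall x y, is_derive s (1 : R) (fun r => M r (x, y)) (M' s (x, y))].

Lemma kcurve_lip M M' t : kcurve M M' t -> exists de C n : R, [/\ 0 < de, 0 < C &
  forall s, `|s - t| < de -> forall x y,
    `|M s (x, y) - M t (x, y)| <= C * `|s - t| * (\1_(cube n) x * \1_(cube n) y)].
Proof.
move=> [de [C [n [de0 mM M'C dM]]]]; exists de, (`|C| + 1), n; split => //.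
move=> s st x y.
have I0 : 0 <= \1_(cube n) x * \1_(cube n) y :> R by rewrite mulr_ge0 ?ind_ge0.
rewrite mulrAC; apply: (@mvt_le _ (fun s => M s (x, y)) (fun r => M' r (x, y)) (t - de) (t + de)).
- by move=> r hr; apply: dM; rewrite ltr_distl.
- move=> r hr; apply: (@le_trans _ _ (C * (\1_(cube n) x * \1_(cube n) y))).
    by apply: M'C; rewrite ltr_distl.
  by rewrite ler_wpM2r// (le_trans (ler_norm _))// lerDl.
- by rewrite -ltr_distl.
- by rewrite ltrBlDr !ltrDl de0.
Qed.

Lemma kcurve_kern M M' t : kern (M t) -> kcurve M M' t -> exists de : R, 0 < de /\
  forall s, `|s - t| < de -> kern (M s).
Proof.
move=> kM kc; have [de [C [n [de0 C0 HL]]]] := kcurve_lip kc.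
case: kc => [de' [_ [_ [de0' mM _ _]]]].
exists (Num.min de de'); split; first by rewrite lt_min de0.
move=> s; rewrite lt_min => /andP[h1 h2].
have -> : M s = fun z => M t z + (M s z - M t z) by apply/funext => z; rewrite addrC subrK.
apply: kernD => //; split.
  by apply: measurable_funB; [exact: mM|case: kM].
by exists (C * `|s - t|), n; exact: HL.
Qed.

Lemma kcurve_derive M M' t (f g : E -> R) : kern (M t) -> kcurve M M' t -> L1loc f -> L1loc g ->
  is_derive t (1 : R) (fun s => \int[mu2]_z (f z.1 * g z.2 * M s z))
    (\int[mu2]_z (f z.1 * g z.2 * M' t z)).
Proof.
move=> kM kc hf hg; have [de2 [de20 kMs]] := kcurve_kern kM kc.
have [de [C [n [de0 mM M'C dM]]]] := kc.
pose e := Num.min de de2; have e0 : 0 < e by rewrite lt_min de0.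
have ee s : s \in `]t - e, t + e[ -> `|s - t| < de /\ `|s - t| < de2.
  by rewrite in_itv/= -ltr_distl lt_min => /andP[].
pose F s z := f z.1 * g z.2 * M s z.
pose G z := `|C| * ((\1_(cube n) z.1 * `|f z.1|) * (\1_(cube n) z.2 * `|g z.2|)).
have iG : itg mu2 G by exact: itgZ (itg_prod (itg_l1 n hf) (itg_l1 n hg)).
have G0 z : 0 <= G z by rewrite !mulr_ge0 ?ind_ge0.
have I0 : `]t - e, t + e[%classic t by rewrite /= in_itv/= ltrBlDr !ltrDl e0.
have dF s z : `|s - t| < de -> is_derive s (1 : R) (F ^~ z) (f z.1 * g z.2 * M' s z).
  by move=> hs; case: z => x y; exact: (@is_deriveZ _ _ _ _ (f x * g y) _ _ _ (dM s hs x y)).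
have iF : forall s, `]t - e, t + e[%classic s -> mu2.-integrable setT (EFin \o F s).
  by move=> s /ee[_ hs]; apply: itg_kern => //; exact: kMs.
have dF' : forall s z, `]t - e, t + e[%classic s -> setT z -> derivable (F ^~ z) s 1.
  by move=> s z /ee[hs _] _; case: (dF s z hs).
have Gub s z : `]t - e, t + e[%classic s -> setT z -> `|partial1of2 F s z| <= G z.
  move=> /ee[hs _] _; rewrite partial1of2E; case: (dF s z hs) => _ ->; case: z => x y.
  rewrite !normrM; apply: le_trans (ler_wpM2l _ (M'C s hs x y)) _; first by rewrite mulr_ge0.
  rewrite /G /= (_ : `|f x| * `|g y| * _ = C * (\1_(cube n) x * `|f x| * (\1_(cube n) y * `|g y|))); last by ring.
  by rewrite ler_wpM2r ?ler_norm// !mulr_ge0 ?ind_ge0.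
have h1 := @derivable_under_integral R _ _ mu2 F setT measurableT t (t - e) (t + e) I0 iF dF' G G0 iG Gub.
have h2 := @differentiation_under_integral R _ _ mu2 F setT measurableT t (t - e) (t + e) I0 iF dF' G G0 iG Gub.
split; first exact: h1.
rewrite -derive1E; apply: (etrans h2); apply: eq_Rintegral => z _.
by rewrite partial1of2E; case: (dF t z) => //; rewrite subrr normr0.
Qed.

Lemma int2_l1 n f g : L1loc f -> L1loc g ->
  itg mu2 (fun z => (\1_(cube n) z.1 * `|f z.1|) * (\1_(cube n) z.2 * `|g z.2|)) /\
  \int[mu2]_z ((\1_(cube n) z.1 * `|f z.1|) * (\1_(cube n) z.2 * `|g z.2|)) = l1 n f * l1 n g.
Proof.
move=> hf hg; have i1 := itg_l1 n hf; have i2 := itg_l1 n hg.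
have i3 := itg_prod i1 i2; split; first exact: i3.
rewrite int2E//; last by move=> x /=; exact: (itgZ _ i2).
rewrite /l1 [RHS]mulrC -intZ//; apply: int_eq => x /=.
by rewrite intZ// mulrC.
Qed.

Lemma int_kern_le n C f g (M : E * E -> R) : L1loc f -> L1loc g -> measurable_fun setT M ->
  (forall x y, `|M (x, y)| <= C * (\1_(cube n) x * \1_(cube n) y)) ->
  `|\int[mu2]_z (f z.1 * g z.2 * M z)| <= C * (l1 n f * l1 n g).
Proof.
move=> hf hg mM HM; have [i1 e1] := int2_l1 n hf hg.
rewrite -e1 -intZ//; apply: int_norm.
- by apply: measurable_funM => //; apply: measurable_funM; [exact: (measurable_fun1 hf.1)|exact: (measurable_fun2 hg.1)].
- exact: itgZ.
move=> [x y] /=; rewrite !normrM; apply: le_trans (ler_wpM2l _ (HM x y)) _; first by rewrite mulr_ge0.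
by rewrite le_eqVlt; apply/orP; left; apply/eqP; ring.
Qed.

(** A product rule for curves that are differentiable only weakly. Beyond first order there remain
    the pairing of [f s - f t] with [Phi al be (g s - g t)], and the integral of [f s g s - f t g t]
    against [M s - M t]. In each, one factor is [O(|s - t|)], by [curve_lip] or by [kcurve_lip], and
    the other tends to zero by continuity in L^2. *)
Lemma bilin_derive s0 s1 (f g : R -> E -> R) H G (M M' : R -> E * E -> R) al be t :
  curve s0 s1 f H -> curve s0 s1 g G -> s0 < t < s1 ->
  test_function al -> test_function be -> M t = pk al be -> kcurve M M' t ->
  is_derive t (1 : R) (fun s => \int[mu2]_z (f s z.1 * g s z.2 * M s z))
    (H t (Phi al be (g t)) + G t (Phi (fun z => al (- z)) be (f t)) +
     \int[mu2]_z (f t z.1 * g t z.2 * M' t z)).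
Proof.
move=> cf cg ht ta tb Mt kc.
have ta' : test_function (fun z => al (- z)).
  have := @test_affine _ _ al (-1) 0; rewrite oppr_eq0 oner_eq0 => /(_ isT ta).
  by congr test_function; apply/funext => z; rewrite add0r scaleN1r.
have kMt : kern (M t) by rewrite Mt; exact: kern_pk.
have Lf s (hs : s0 < s < s1) := L2r_L1loc (cv_L2 cf hs).
have Lg s (hs : s0 < s < s1) := L2r_L1loc (cv_L2 cg hs).
have Lft := Lf t ht; have Lgt := Lg t ht.
pose A1 s := \int[mu]_x (f s x * Phi al be (g t) x).
pose A2 s := \int[mu]_y (g s y * Phi (fun z => al (- z)) be (f t) y).
pose A3 s := \int[mu2]_z (f t z.1 * g t z.2 * M s z).
pose F s := \int[mu2]_z (f s z.1 * g s z.2 * M s z).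
(* All of [F], [A1], [A2], [A3] take the value [F t] at [s = t]; the constant makes the remainder
   vanish there. *)
pose Rem s := F s - A1 s - A2 s - A3 s + 2 * F t.
have dA1 : is_derive t (1 : R) A1 (H t (Phi al be (g t))).
  by apply: (cv_d cf) => //; exact: test_Phi.
have dA2 : is_derive t (1 : R) A2 (G t (Phi (fun z => al (- z)) be (f t))).
  by apply: (cv_d cg) => //; exact: test_Phi.
have dA3 : is_derive t (1 : R) A3 (\int[mu2]_z (f t z.1 * g t z.2 * M' t z)).
  exact: kcurve_derive.
have A1E s : s0 < s < s1 -> A1 s = \int[mu2]_z (f s z.1 * g t z.2 * M t z).
  by move=> hs; rewrite (int_kern1 (Lf s hs) Lgt kMt) Mt.
have A2E s : s0 < s < s1 -> A2 s = \int[mu2]_z (f t z.1 * g s z.2 * M t z).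
  move=> hs; rewrite (int_kern2 Lft (Lg s hs) kMt).
  apply: int_eq => y; congr (_ * _); apply: int_eq => x; congr (_ * _).
  by rewrite Mt [RHS]pk_swap.
have [de1 [C1 [n1 [de10 C10 HL]]]] := kcurve_lip kc.
have [de2 [de20 kMs]] := kcurve_kern kMt kc.
have RemE s : s0 < s < s1 -> `|s - t| < de2 ->
    Rem s = \int[mu]_x ((f s x - f t x) * Phi al be (fun y => g s y - g t y) x) +
    \int[mu2]_z ((f s z.1 * g s z.2 - f t z.1 * g t z.2) * (M s z - M t z)).
  move=> hs st; rewrite /Rem A1E// A2E// /A3 /F.
  have kk := kMs s st.
  have L1' : L1loc (fun x => f s x - f t x).
    by apply: L2r_L1loc; apply: L2rB; exact: (cv_L2 cf).
  have L2' : L1loc (fun x => g s x - g t x).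
    by apply: L2r_L1loc; apply: L2rB; exact: (cv_L2 cg).
  have := int_kern1 L1' L2' kMt; rewrite /Phi Mt => <-; rewrite -Mt.
  have ii p q r : s0 < p < s1 -> s0 < q < s1 -> kern (M r) ->
     itg mu2 (fun z => f p z.1 * g q z.2 * M r z).
    by move=> hp hq hr; apply: itg_kern => //; [exact: Lf|exact: Lg].
  have j1 := ii s s s hs hs kk; have j2 := ii s t t hs ht kMt.
  have j3 := ii t s t ht hs kMt; have j4 := ii t t s ht ht kk.
  have j5 := ii t t t ht ht kMt; have j6 := ii s s t hs hs kMt.
  rewrite -intZ// -!intB//; try by (do ? apply: itgB).
  rewrite -intD//; try by (do ? apply: itgB); try exact: itgZ.
  rewrite -intD; first by apply: int_eq => z; ring.
    exact: (itg_kern L1' L2' kMt).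
  have : itg mu2 (fun z => f s z.1 * g s z.2 * M s z - f s z.1 * g s z.2 * M t z -
     (f t z.1 * g t z.2 * M s z - f t z.1 * g t z.2 * M t z)).
    by do ? apply: itgB.
  by congr (itg mu2); apply/funext => z; ring.
have dRem : is_derive t (1 : R) Rem 0.
  apply: is_derive_small.
    rewrite (RemE t)// ?subrr ?normr0//.
    rewrite [X in X + _](_ : _ = 0); last first.
      under eq_Rintegral do rewrite subrr mul0r.
      by rewrite Rintegral_cst// mul0r.
    by under eq_Rintegral do rewrite !subrr mulr0; rewrite Rintegral_cst// mul0r addr0.
  move=> e e0.
  have [C2 C20 [m [nm HPhi]]] := Phi_est n1 ta tb.
  have [C3 C30 Hlip] := curve_lip m cf.
  pose lf := l1 m (f t) + 1; pose lg := l1 m (g t) + 1.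
  have lf0 : 0 < lf by rewrite ltr_wpDl// l1_ge0.
  have lg0 : 0 < lg by rewrite ltr_wpDl// l1_ge0.
  pose D := C3 * C2 + C1 * lg + C1 * lf.
  have D0 : 0 < D by rewrite !addr_gt0// mulr_gt0.
  pose ee := Num.min 1 (e / D).
  have ee0 : 0 < ee by rewrite lt_min ltr01 divr_gt0.
  have ee1 : ee <= 1 by rewrite ge_min lexx.
  have eeD : D * ee <= e by rewrite mulrC -ler_pdivlMr// ge_min lexx orbT.
  have [d3 d30 Hf] := curve_l1 m cf ht ee0.
  have [d4 d40 Hg] := curve_l1 m cg ht ee0.
  have [d5 d50 Hin] : exists2 d5 : R, 0 < d5 & forall s, `|s - t| < d5 -> s0 < s < s1.
    case/andP: (ht) => h1 h2; exists (Num.min (t - s0) (s1 - t)).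
      by rewrite lt_min !subr_gt0 h1.
    move=> s; rewrite lt_min ltr_norml => /andP[/andP[k1 _]] /ltr_normlP[_ k2]; apply/andP; split; lra.
  exists (Num.min (Num.min de1 de2) (Num.min (Num.min d3 d4) d5)).
    by rewrite !lt_min de10 de20 d30 d40.
  move=> s; rewrite !lt_min => /andP[/andP[k1 k2] /andP[/andP[k3 k4] k5]].
  have hs := Hin s k5; rewrite RemE//.
  have Ldf : L1loc (fun x => f s x - f t x).
    by apply: L2r_L1loc; apply: L2rB; exact: (cv_L2 cf).
  have Ldg : L1loc (fun x => g s x - g t x).
    by apply: L2r_L1loc; apply: L2rB; exact: (cv_L2 cg).
  have lf1 := Hf s hs k3; have lg1 := Hg s hs k4.
  set df := l1 m (fun x => f s x - f t x) in lf1.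
  set dg := l1 m (fun x => g s x - g t x) in lg1.
  have df0 : 0 <= df by exact: l1_ge0.
  have dg0 : 0 <= dg by exact: l1_ge0.
  have b1 : `|\int[mu]_x ((f s x - f t x) * Phi al be (fun y => g s y - g t y) x)| <=
      C3 * (C2 * dg) * `|s - t|.
    apply: Hlip => //; [exact: test_Phi|by rewrite mulr_ge0// ltW|move=> x|move=> x];
      by have [] := HPhi _ Ldg x.
  have lgs : l1 m (g s) <= lg.
    have -> : g s = (fun x => g t x + (g s x - g t x)) by apply/funext => x; rewrite addrC subrK.
    by apply: le_trans (l1D _ _ _) _ => //; rewrite /lg lerD2l (le_trans lg1).
  have mMM : measurable_fun setT (fun z => M s z - M t z).
    by apply: measurable_funB; [case: (kMs s k2)|case: kMt].
  have HM x y : `|M s (x, y) - M t (x, y)| <= C1 * `|s - t| * (\1_(cube m) x * \1_(cube m) y).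
    apply: le_trans (HL s k1 x y) _; rewrite ler_wpM2l ?mulr_ge0 ?(ltW C10)//.
    by apply: ler_pM; rewrite ?ind_ge0//; exact: ind_mono.
  have q1 := int_kern_le Ldf (Lg s hs) mMM HM.
  have q2 := int_kern_le Lft Ldg mMM HM.
  have b2 : \int[mu2]_z ((f s z.1 * g s z.2 - f t z.1 * g t z.2) * (M s z - M t z)) =
     \int[mu2]_z ((f s z.1 - f t z.1) * g s z.2 * (M s z - M t z)) +
     \int[mu2]_z (f t z.1 * (g s z.2 - g t z.2) * (M s z - M t z)).
    have kk : kern (fun z => M s z - M t z).
      by split => //; exists (C1 * `|s - t|), m.
    rewrite -intD; first by apply: int_eq => z; ring.
      exact: (itg_kern Ldf (Lg s hs) kk).
    exact: (itg_kern Lft Ldg kk).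
  rewrite b2; apply: le_trans (ler_normD _ _) _.
  apply: le_trans (lerD b1 (le_trans (ler_normD _ _) (lerD q1 q2))) _.
  rewrite -/df -/dg.
  have r1 : df * l1 m (g s) <= ee * lg by apply: ler_pM => //; exact: l1_ge0.
  have r2 : l1 m (f t) * dg <= lf * ee.
    by apply: ler_pM => //; [exact: l1_ge0|rewrite lerDl].
  have st0 : 0 <= `|s - t| by [].
  have r3 := ler_wpM2l (mulr_ge0 (ltW C10) st0) r1.
  have r4 := ler_wpM2l (mulr_ge0 (ltW C10) st0) r2.
  have r5 := ler_wpM2l (mulr_ge0 (mulr_ge0 (ltW C30) (ltW C20)) st0) lg1.
  have r6 := ler_wpM2r st0 eeD.
  apply: (@le_trans _ _ (D * ee * `|s - t|)) => //.
  apply: (@le_trans _ _ (C3 * C2 * `|s - t| * ee + (C1 * `|s - t| * (ee * lg) + C1 * `|s - t| * (lf * ee)))).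
    apply: lerD; last exact: lerD.
    by move: r5; rewrite (_ : C3 * C2 * `|s - t| * dg = C3 * (C2 * dg) * `|s - t|)//; ring.
  by rewrite le_eqVlt; apply/orP; left; apply/eqP; rewrite /D; ring.
have dB := is_deriveD (is_deriveD (is_deriveD (is_deriveD dA1 dA2) dA3) dRem)
   (@is_derive_cst _ _ _ (- (2 * F t)) t 1).
rewrite !addr0 in dB; apply: (near_eq_is_derive _ dB).
near=> s; rewrite -[RHS]/(F s) -[LHS]/(A1 s + A2 s + A3 s + Rem s + - (2 * F t)) /Rem.
by ring.
Unshelve. all: by end_near. Qed.

End bilinear.

(** * Solutions as weakly differentiable curves *)

Section ham_curve.
Context {R : realType} {d : nat}.
Notation E := 'rV[R]_d.
Notation mu := (@lebesgue_rV R d).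
Notation mu2 := (lebesgue_rV d \x lebesgue_rV d)%E.
Implicit Types (f g al be phi : E -> R) (n e K : R).

Lemma cont_bounded (U : E -> R) n : continuous U -> exists2 C : R, 0 < C &
  forall x, `|x| <= n -> `|U x| <= C.
Proof.
move=> cU; have : compact (U @` cube n).
  by apply: continuous_compact; [exact: continuous_subspaceT|exact: compact_cube].
move=> /compact_bounded [M [_ HM]]; exists (Num.max M 0 + 1).
  by rewrite ltr_wpDl// le_max lexx orbT.
move=> x xn; apply: HM; last by exists x.
by rewrite (@le_lt_trans _ _ (Num.max M 0)) ?le_max ?lexx// ltrDl.
Qed.

(** The derivatives are on [phi], so its sup and that of its Laplacian suffice; the modulus of the
    state and the logarithmic term are dominated by [1 + |psi|^2], whose integral over the cube is
    controlled by [M]. *)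
Lemma ham_bound (M lam : R) (U : E -> R) n : continuous U -> 0 <= M -> exists2 C : R, 0 < C &
  forall (a b v : E -> R) phi K, L2r a -> L2r b -> measurable_fun setT v ->
    \int[mu]_x (a x ^+ 2 + b x ^+ 2) <= M -> (forall x, `|v x| <= mod2 (a x) (b x)) ->
    test_function phi -> 0 <= K ->
    (forall x, `|phi x| <= K * \1_(cube n) x) ->
    (forall x, `|laplacian phi x| <= K * \1_(cube n) x) ->
    `|ham_term lam U v (fun x => lnsq (a x) (b x)) phi| <= C * K.
Proof.
move=> cU M0; have [Uc Uc0 HU] := cont_bounded n cU.
set m := \int[mu]_x (\1_(cube n) x : R).
have m0 : 0 <= m by apply: int_ge0 => x; exact: ind_ge0.
exists ((Uc + 1 + 2 * `|lam|) * (m + M) + 1).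
  by rewrite ltr_wpDl// mulr_ge0 ?addr_ge0 ?(ltW Uc0)// mulr_ge0.
move=> a b v phi K ha hb mv hM vab tp K0 h1 h2.
have iab : itg mu (fun x => a x ^+ 2 + b x ^+ 2) by apply: itgD; [case: ha|case: hb].
pose G x := \1_(cube n) x + (a x ^+ 2 + b x ^+ 2).
have iG : itg mu G by apply: itgD => //; exact: itg_ind.
have eG : \int[mu]_x G x <= m + M by rewrite intD//; [rewrite lerD2l|exact: itg_ind].
have ind0 x : 0 <= \1_(cube n) x :> R by exact: ind_ge0.
have vG x : `|v x| * \1_(cube n) x <= G x.
  apply: (@le_trans _ _ ((1 + (a x ^+ 2 + b x ^+ 2)) * \1_(cube n) x)).
    rewrite ler_wpM2r//; apply: le_trans (vab x) _; rewrite -mod2_sqr.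
    have := mod2_ge0 (a x) (b x); set r := mod2 _ _ => r0; have := sqr_ge0 (r - 1).
    by rewrite sqrrB mulr1 expr1n mulr2n; lra.
  by rewrite mulrDl mul1r lerD2l ler_piMr ?sumsq_ge0// ind_le1.
have mphi := test_measurable tp; have mlap := cc_measurable (cc_laplacian tp).
have mU := continuous_rV_measurable cU.
have b1 : `|\int[mu]_x (v x * (U x * phi x - 2^-1 * laplacian phi x))| <= (Uc + 1) * K * (m + M).
  apply: (@le_trans _ _ (\int[mu]_x ((Uc + 1) * K * G x))); last first.
    by rewrite intZ// ler_wpM2l// mulr_ge0// addr_ge0// ltW.
  apply: int_norm.
  - by apply: measurable_funM => //; apply: measurable_funB; apply: measurable_funM.
  - exact: itgZ.
  move=> x; rewrite normrM; apply: (@le_trans _ _ (`|v x| * ((Uc + 1) * (K * \1_(cube n) x)))).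
    apply: ler_wpM2l => //; apply: le_trans (ler_normB _ _) _; rewrite !normrM mulrDl mul1r.
    apply: lerD.
      have [xn|xn] := leP `|x| n.
        by apply: ler_pM => //; exact: HU.
      have := h1 x; rewrite ind_out// mulr0 normr_le0 => /eqP ->.
      by rewrite normr0 !mulr0.
    apply: le_trans (h2 x); rewrite ler_piMl// ger0_norm ?invr_ge0// invf_le1//; lra.
  have -> : `|v x| * ((Uc + 1) * (K * \1_(cube n) x)) = (Uc + 1) * K * (`|v x| * \1_(cube n) x) by ring.
  by rewrite ler_wpM2l// mulr_ge0// addr_ge0// ltW.
have b2 : `|\int[mu]_x (v x * lnsq (a x) (b x) * phi x)| <= 2 * K * (m + M).
  apply: (@le_trans _ _ (\int[mu]_x (2 * K * G x))); last first.
    by rewrite intZ// ler_wpM2l// mulr_ge0.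
  apply: int_norm.
  - apply: measurable_funM => //; apply: measurable_funM => //.
    apply: (measurableT_comp (@measurable_ln R)).
    by apply: measurable_funD; apply: measurable_funX; exact: L2r_measurable.
  - exact: itgZ.
  move=> x; rewrite normrM; apply: le_trans (ler_pM _ _ (mul_lnsq_le (vab x)) (h1 x)) _ => //.
  have -> : 2 * (1 + (a x ^+ 2 + b x ^+ 2)) * (K * \1_(cube n) x) = 2 * K * ((1 + (a x ^+ 2 + b x ^+ 2)) * \1_(cube n) x) by ring.
  rewrite ler_wpM2l ?mulr_ge0// mulrDl mul1r lerD2l ler_piMr ?sumsq_ge0//.
apply: le_trans (ler_normD _ _) _; rewrite normrM.
apply: le_trans (lerD b1 (ler_wpM2l _ b2)) _ => //.
rewrite -subr_ge0 (_ : _ - _ = K)//; ring.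
Qed.

Variables (lam : R) (U : E -> R) (s0 s1 M : R) (a b : R -> E -> R).
Hypotheses (cU : continuous U) (hb : basic s0 s1 M a b) (hh : hamiltonian lam U s0 s1 a b).

Let K (t : R) : s0 < t < s1 -> s0 <= t <= s1.
Proof. by move=> /andP[h1 h2]; rewrite !ltW. Qed.

Let Mge0 t : s0 < t < s1 -> 0 <= M.
Proof. by move=> /andP[h1 h2]; apply: (basic_M hb); exact: ltW (lt_trans h1 h2). Qed.

(** The factor [1], against [-1] in [ham_curve2], lets [wig_part] treat both components of the
    equation with a sign parameter. *)
Lemma ham_curve1 : s0 < s1 ->
  curve s0 s1 a (fun t phi => 1 * ham_term lam U (b t) (fun x => lnsq (a t x) (b t x)) phi).
Proof.
move=> s01; have M0 : 0 <= M by apply: (basic_M hb); exact: ltW.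
split.
- by move=> t /K; exact: bas_a hb t.
- move=> t /K ht e e0; have [de de0 H] := bas_c hb ht e0; exists de => // s /K hs st.
  apply: le_trans (H s hs st); apply: int_le.
  + by case: (L2rB (bas_a hb hs) (bas_a hb ht)).
  + exact: (itg_dist2 hb).
  + by move=> x; rewrite lerDl sqr_ge0.
- by move=> phi tp t ht; rewrite mul1r; case: (hh tp ht).
- move=> n; have [C C0 HC] := ham_bound lam n cU M0; exists C => // t /K ht phi k tp k0 h1 h2.
  rewrite mul1r; apply: HC => //.
  + exact: (bas_a hb ht).
  + exact: (bas_b hb ht).
  + by case: (bas_b hb ht).
  + exact: (bas_m hb ht).
  + by move=> x; exact: le_mod2r.
Qed.

Lemma ham_curve2 : s0 < s1 ->
  curve s0 s1 b (fun t phi => -1 * ham_term lam U (a t) (fun x => lnsq (a t x) (b t x)) phi).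
Proof.
move=> s01; have M0 : 0 <= M by apply: (basic_M hb); exact: ltW.
split.
- by move=> t /K; exact: bas_b hb t.
- move=> t /K ht e e0; have [de de0 H] := bas_c hb ht e0; exists de => // s /K hs st.
  apply: le_trans (H s hs st); apply: int_le.
  + by case: (L2rB (bas_b hb hs) (bas_b hb ht)).
  + exact: (itg_dist2 hb).
  + by move=> x; rewrite lerDr sqr_ge0.
- by move=> phi tp t ht; rewrite mulN1r; case: (hh tp ht).
- move=> n; have [C C0 HC] := ham_bound lam n cU M0; exists C => // t /K ht phi k tp k0 h1 h2.
  rewrite mulN1r normrN; apply: HC => //.
  + exact: (bas_a hb ht).
  + exact: (bas_b hb ht).
  + by case: (bas_a hb ht).
  + exact: (bas_m hb ht).
  + by move=> x; exact: le_mod2l.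
Qed.

End ham_curve.

(** * The Hamiltonian acting on kernels *)

Section ham_kernel.
Context {R : realType} {d : nat}.
Notation E := 'rV[R]_d.
Notation mu := (@lebesgue_rV R d).
Notation mu2 := (lebesgue_rV d \x lebesgue_rV d)%E.
Implicit Types (f g al be phi U v e : E -> R).

Lemma partial_opp al j x : smooth al -> partial j (fun z => al (- z)) x = - partial j al (- x).
Proof.
move=> sa; have := partial_affineE j (-1) 0 x sa; rewrite add0r scaleN1r mulN1r => <-.
by congr (partial j _ x); apply/funext => z; rewrite add0r scaleN1r.
Qed.

(** Exchanging [x] and [y] reflects the argument of [al], which changes the sign of its first
    derivatives, hence of the mixed term, and not of its second ones. *)
Lemma lapk_swap al be x y : test_function al ->
  lapk 1 (fun z => al (- z)) be (y, x) = lapk (-1) al be (x, y).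
Proof.
move=> ta; rewrite /lapk; apply: eq_bigr => j _.
have sa := test_smooth ta; have sa' := smooth_partial j sa.
have p1 : partial j (fun z => al (- z)) = fun z => - partial j al (- z).
  by apply/funext => z; exact: partial_opp.
have p2 : partial j (fun z => - partial j al (- z)) = fun z => partial j (partial j al) (- z).
  apply/funext => z; rewrite (_ : (fun z => _) = (fun z => (-1) * partial j al (0 + (-1) *: z))); last first.
    by apply/funext => w; rewrite mulN1r add0r scaleN1r.
  have h := partial_affine j (-1) 0 z sa'.
  have := @is_deriveZ _ _ _ _ (-1) _ _ _ h; rewrite /partial => -[_ ->].
  by rewrite add0r [-1 *: z]scaleN1r /GRing.scale/= mulrA mulrNN !mul1r.
have pkE f h : pk f h (y, x) = f (- (x - y)) * h (x + y) by rewrite /pk/= opprB [y + x]addrC.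
have h1 : partial j (partial j (fun z => al (- z))) (- (x - y)) = partial j (partial j al) (x - y).
  by rewrite p1 p2 opprK.
have h2 : partial j (fun z => al (- z)) (- (x - y)) = - partial j al (x - y) by rewrite p1 opprK.
have h3 : al (- - (x - y)) = al (x - y) by rewrite opprK.
have h4 : - partial j al (x - y) * partial j be (x + y) = - pk (partial j al) (partial j be) (x, y).
  exact: mulNr.
have h5 (u v : R) : u = - v -> 1 * 2 * u = -1 * 2 * v by move=> ->; ring.
exact: (congr2 +%R (congr2 +%R (etrans (pkE _ _) (congr2 *%R h1 (erefl _)))
  (h5 _ _ (etrans (etrans (pkE _ _) (congr2 *%R h2 (erefl _))) h4)))
  (etrans (pkE _ _) (congr2 *%R h3 (erefl _)))).
Qed.

Variables (lam : R) (U : E -> R).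
Hypothesis cU : continuous U.
Variables (v e g al be : E -> R).
Hypotheses (hv : L1loc v) (hve : L1loc (fun x => v x * e x)) (hg : L1loc g).
Hypotheses (ta : test_function al) (tb : test_function be).

Lemma itg_ham1 : itg mu2 (fun z => v z.1 * g z.2 *
  ((U z.1 + lam * e z.1) * pk al be z - 2^-1 * lapk 1 al be z)).
Proof.
have i1 := itg_kern (L1loc_contM hv cU) hg (kern_pk ta tb).
have i2 := itg_kern hve hg (kern_pk ta tb).
have i3 := itg_kern hv hg (kern_lapk 1 ta tb).
have := itgB (itgD i1 (itgZ lam i2)) (itgZ 2^-1 i3).
by congr (itg mu2); apply/funext => z; ring.
Qed.

Lemma ham_Phi1 : ham_term lam U v e (Phi al be g) =
  \int[mu2]_z (v z.1 * g z.2 * ((U z.1 + lam * e z.1) * pk al be z - 2^-1 * lapk 1 al be z)).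
Proof.
have i1 := itg_kern (L1loc_contM hv cU) hg (kern_pk ta tb).
have i2 := itg_kern hve hg (kern_pk ta tb).
have i3 := itg_kern hv hg (kern_lapk 1 ta tb).
have e1 := int_kern1 (L1loc_contM hv cU) hg (kern_pk ta tb).
have e2 := int_kern1 hve hg (kern_pk ta tb).
have e3 := int_kern1 hv hg (kern_lapk 1 ta tb).
have tP := test_Phi ta tb hg.
transitivity (\int[mu]_x (U x * v x * Phi al be g x) - 2^-1 * \int[mu]_x (v x * laplacian (Phi al be g) x)
   + lam * \int[mu]_x (v x * e x * Phi al be g x)).
  rewrite /ham_term; congr (_ + _); rewrite -intZ; last exact: L1loc_cc hv (cc_laplacian tP).
  rewrite -intB; first by apply: int_eq => x; ring.
    exact: L1loc_cc (L1loc_contM hv cU) (test_cc tP).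
  exact: itgZ (L1loc_cc hv (cc_laplacian tP)).
have -> : \int[mu]_x (v x * laplacian (Phi al be g) x) = \int[mu]_x (v x * \int[mu]_y (g y * lapk 1 al be (x, y))).
  by apply: int_eq => x; rewrite laplacian_Phi.
rewrite /Phi -e1 -e2 -e3 -!intZ// -intB//; last exact: itgZ.
rewrite -intD//; [|by apply: itgB => //; exact: itgZ|exact: itgZ].
by apply: int_eq => z; ring.
Qed.

Let ta' : test_function (fun z => al (- z)).
Proof.
have := @test_affine _ _ al (-1) 0; rewrite oppr_eq0 oner_eq0 => /(_ isT ta).
by congr test_function; apply/funext => z; rewrite add0r scaleN1r.
Qed.

Lemma itg_ham2 : itg mu2 (fun z => g z.1 * v z.2 *
  ((U z.2 + lam * e z.2) * pk al be z - 2^-1 * lapk (-1) al be z)).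
Proof.
have i1 := itg_kern hg (L1loc_contM hv cU) (kern_pk ta tb).
have i2 := itg_kern hg hve (kern_pk ta tb).
have i3 := itg_kern hg hv (kern_lapk (-1) ta tb).
have := itgB (itgD i1 (itgZ lam i2)) (itgZ 2^-1 i3).
by congr (itg mu2); apply/funext => z; ring.
Qed.

Lemma ham_Phi2 : ham_term lam U v e (Phi (fun z => al (- z)) be g) =
  \int[mu2]_z (g z.1 * v z.2 * ((U z.2 + lam * e z.2) * pk al be z - 2^-1 * lapk (-1) al be z)).
Proof.
have i1 := itg_kern hg (L1loc_contM hv cU) (kern_pk ta tb).
have i2 := itg_kern hg hve (kern_pk ta tb).
have i3 := itg_kern hg hv (kern_lapk (-1) ta tb).
have e1 := int_kern2 hg (L1loc_contM hv cU) (kern_pk ta tb).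
have e2 := int_kern2 hg hve (kern_pk ta tb).
have e3 := int_kern2 hg hv (kern_lapk (-1) ta tb).
have tP := test_Phi ta' tb hg.
have PE y : \int[mu]_x (g x * pk al be (x, y)) = Phi (fun z => al (- z)) be g y.
  by apply: int_eq => x; rewrite -pk_swap.
have LE y : \int[mu]_x (g x * lapk (-1) al be (x, y)) = laplacian (Phi (fun z => al (- z)) be g) y.
  by rewrite (laplacian_Phi _ ta' tb hg); apply: int_eq => x; rewrite (lapk_swap be x y ta).
move: e1 e2 e3.
under [in X in _ = X -> _]eq_Rintegral do rewrite PE.
under [in X in _ -> _ = X -> _]eq_Rintegral do rewrite PE.
under [in X in _ -> _ -> _ = X -> _]eq_Rintegral do rewrite LE.
move=> e1 e2 e3.
transitivity (\int[mu]_x (U x * v x * Phi (fun z => al (- z)) be g x)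
   - 2^-1 * \int[mu]_x (v x * laplacian (Phi (fun z => al (- z)) be g) x)
   + lam * \int[mu]_x (v x * e x * Phi (fun z => al (- z)) be g x)).
  rewrite /ham_term; congr (_ + _); rewrite -intZ; last exact: L1loc_cc hv (cc_laplacian tP).
  rewrite -intB; first by apply: int_eq => x; ring.
    exact: L1loc_cc (L1loc_contM hv cU) (test_cc tP).
  exact: itgZ (L1loc_cc hv (cc_laplacian tP)).
rewrite -e1 -e2 -e3 -!intZ// -intB//; last exact: itgZ.
rewrite -intD//; [|by apply: itgB => //; exact: itgZ|exact: itgZ].
by apply: int_eq => z; ring.
Qed.

End ham_kernel.

(** * The smoothed Wigner function *)

Section phase_kernel.
Context {R : realType} {d : nat}.
Notation E := 'rV[R]_d.
Notation mu := (@lebesgue_rV R d).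
Notation mu2 := (lebesgue_rV d \x lebesgue_rV d)%E.
Implicit Types (X k : E -> R) (h : R -> R) (q p x y : E).

(** With [h] equal to [cos] and [sin], the real and imaginary parts of
    [e^(i p.(x - y)) X(x - y) k(x + y - 2 q)], the kernel of a Wigner transform localised at
    [(q, p)]. *)
Definition ker h X k q p : E * E -> R :=
  pk (fun z => X z * h (dotv p z)) (fun w => k (w - 2 *: q)).

Lemma kerE h X k q p x y : ker h X k q p (x, y) = X (x - y) * h (dotv p (x - y)) * k (x + y - 2 *: q).
Proof. by []. Qed.

Lemma test_phase h X p : smooth1 h -> test_function X -> test_function (fun z => X z * h (dotv p z)).
Proof.
move=> sh tX; have := test_mul tX (smooth_lin p 0 sh).
by congr test_function; apply/funext => z; rewrite fctE addr0.
Qed.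

Lemma test_shift k q : test_function k -> test_function (fun w => k (w - 2 *: q)).
Proof.
move=> tk; have := @test_affine _ _ k 1 (- 2 *: q); rewrite oner_eq0 => /(_ isT tk).
by congr test_function; apply/funext => w; rewrite scale1r addrC scaleNr.
Qed.

Lemma partial_shift k q j : smooth k -> partial j (fun w => k (w - 2 *: q)) = fun w => partial j k (w - 2 *: q).
Proof.
move=> sk; apply/funext => w; have := partial_affineE j 1 (- 2 *: q) w sk.
rewrite mul1r scale1r addrC scaleNr => <-.
by congr (partial j _ w); apply/funext => z; rewrite scale1r addrC.
Qed.

Lemma partial_phase h h' X p j : (forall t : R, is_derive t (1 : R) h (h' t)) -> smooth1 h -> smooth X ->
  partial j (fun z => X z * h (dotv p z)) =
  fun z => partial j X z * h (dotv p z) + p ord0 j * (X z * h' (dotv p z)).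
Proof.
move=> hh sh sX; apply/funext => z.
have -> : (fun z => X z * h (dotv p z)) = X * (fun z => h (dotv p z + 0)).
  by apply/funext => w; rewrite fctE addr0.
rewrite partialM//; last exact: smooth_lin.
rewrite (partial_lin p z 0 j hh) !addr0; ring.
Qed.

Lemma kern_ker h X k q p : smooth1 h -> test_function X -> test_function k -> kern (ker h X k q p).
Proof. by move=> sh tX tk; apply: kern_pk; [exact: test_phase|exact: test_shift]. Qed.

(** The Laplacians in [x] and in [y] of a function of [x - y] and [x + y] differ by four times the
    product of the two gradients. Where the gradient in [x - y] falls on the phase, it produces the
    transport term in [p]. *)
Lemma lapk_ker h h' X k q p x y : (forall t : R, is_derive t (1 : R) h (h' t)) -> smooth1 h ->
  test_function X -> test_function k ->
  lapk 1 (fun z => X z * h (dotv p z)) (fun w => k (w - 2 *: q)) (x, y) =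
  lapk (-1) (fun z => X z * h (dotv p z)) (fun w => k (w - 2 *: q)) (x, y) +
  4 * (\sum_j ker h (partial j X) (partial j k) q p (x, y) +
       \sum_j p ord0 j * ker h' X (partial j k) q p (x, y)).
Proof.
move=> hh sh tX tk.
rewrite -big_split mulr_sumr -big_split /=; apply: eq_bigr => j _.
have sX := test_smooth tX; have sk := test_smooth tk.
have K : pk (partial j (fun z => X z * h (dotv p z))) (partial j (fun w => k (w - 2 *: q))) (x, y) =
  ker h (partial j X) (partial j k) q p (x, y) + p ord0 j * ker h' X (partial j k) q p (x, y).
  transitivity (partial j (fun z => X z * h (dotv p z)) (x - y) * partial j (fun w => k (w - 2 *: q)) (x + y)); first by [].
  rewrite (partial_phase p j hh sh sX) (partial_shift q j sk) !kerE.
  move: (partial j X _) (partial j k _) => A B; ring.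
move: (ker h _ _ q p _ + _) K => S <-.
move: (pk _ _ _) (pk _ _ _) (pk _ _ _) => A B C; ring.
Qed.

Lemma dotv_norm p z : `|dotv p z| <= d%:R * (`|p| * `|z|).
Proof.
apply: le_trans (ler_norm_sum _ _ _) _.
apply: (@le_trans _ _ (\sum_(j < d) `|p| * `|z|)).
  by apply: ler_sum => j _; rewrite normrM ler_pM ?coord_le_norm.
by rewrite sumr_const card_ord mulr_natl.
Qed.

Lemma ker_bound X k Q : test_function X -> test_function k -> exists C n : R, [/\ 0 < C, 0 < n &
  forall h q p x y, (forall t, `|h t| <= 1) -> `|q| <= Q ->
   `|ker h X k q p (x, y)| <= C * (\1_(cube n) x * \1_(cube n) y)].
Proof.
move=> tX tk; have [Ca Ca0 Ha] := test_bounded tX; have [Cb Cb0 Hb] := test_bounded tk.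
have [sa [n n0 Hn]] := (test_functionP X).1 tX.
have [sb [m m0 Hm]] := (test_functionP k).1 tk.
exists (Ca * Cb), (n + (m + 2 * `|Q|)); split; [exact: mulr_gt0|by apply: addr_gt0 => //; apply: ltr_wpDr => //; exact: mulr_ge0|].
move=> h q p x y h1 qQ; rewrite kerE.
have [k1|k1] := leP `|x - y| n; last first.
  by rewrite Hn// !mul0r normr0 !mulr_ge0 ?ind_ge0// ltW.
have [k2|k2] := leP `|x + y - 2 *: q| m; last first.
  by rewrite Hm// mulr0 normr0 !mulr_ge0 ?ind_ge0// ltW.
have k3 : `|x + y| <= m + 2 * `|Q|.
  rewrite -(subrK (2 *: q) (x + y)); apply: le_trans (ler_normD _ _) _; apply: lerD => //.
  by rewrite normrZ ger0_norm// ler_pM2l// (le_trans qQ)// ler_norm.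
have [k4 k5] := half_sum_norm k1 k3.
rewrite !indE k4 k5 !mulr1 !normrM; apply: ler_pM => //.
rewrite -[leRHS]mulr1; exact: ler_pM.
Qed.

(** Motion under the constant force [- w], required near [t] only. *)
Record path (q p : R -> E) (w : E) (t : R) : Prop := Path {
  pathq : forall s, `|s - t| < 1 -> forall j, is_derive s (1 : R) (fun r => q r ord0 j) (p s ord0 j);
  pathp : forall s, `|s - t| < 1 -> forall j, is_derive s (1 : R) (fun r => p r ord0 j) (- w ord0 j);
  pathb : exists Q, forall s, `|s - t| < 1 -> `|q s| <= Q /\ `|p s| <= Q }.

(** The time derivative of [ker h] along a path: [p' = - w] acts on the phase, [q' = p] on [k]. *)
Definition ker' h h' X k (w q p : E) : E * E -> R := fun z =>
  - dotv w (z.1 - z.2) * ker h' X k q p z - 2 * \sum_j p ord0 j * ker h X (partial j k) q p z.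

Lemma kcurve_ker h h' X k (q p : R -> E) w t : (forall t : R, is_derive t (1 : R) h (h' t)) -> smooth1 h ->
  smooth1 h' -> (forall t, `|h t| <= 1) -> (forall t, `|h' t| <= 1) ->
  test_function X -> test_function k -> path q p w t ->
  kcurve (fun s => ker h X k (q s) (p s)) (fun s => ker' h h' X k w (q s) (p s)) t.
Proof.
move=> hh sh sh' h1 h1' tX tk [pq pp [Q HQ]].
have [C0 [n0 [C00 n00 H0]]] := ker_bound Q tX tk.
have /choice [f Hf] : forall j, exists cn : R * R, [/\ 0 < cn.1, 0 < cn.2 &
  forall h q p x y, (forall t, `|h t| <= 1) -> `|q| <= Q ->
   `|ker h X (partial j k) q p (x, y)| <= cn.1 * (\1_(cube cn.2) x * \1_(cube cn.2) y)].
  by move=> j; have [C [n H]] := ker_bound Q tX (test_partial j tk); exists (C, n).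
pose N := n0 + \sum_j (f j).2.
have N0 : 0 < N by rewrite ltr_wpDr// sumr_ge0// => j _; case: (Hf j) => _ /ltW.
have nN j : (f j).2 <= N.
  rewrite /N (bigD1 j)//= addrCA lerDl addr_ge0 ?(ltW n00)// sumr_ge0// => i _.
  by case: (Hf i) => _ /ltW.
have nN0 : n0 <= N by rewrite lerDl sumr_ge0// => i _; case: (Hf i) => _ /ltW.
pose D := d%:R * (`|w| * (N + N)) * C0 + 2 * \sum_j (`|Q| * (f j).1).
have up (c m : R) x y : 0 <= c -> m <= N -> c * (\1_(cube m) x * \1_(cube m) y) <= c * (\1_(cube N) x * \1_(cube N) y).
  by move=> c0 mN; rewrite ler_wpM2l// ler_pM ?ind_ge0//; exact: ind_mono.
exists 1, D, N; split => //.
- by move=> s st; case: (kern_ker (q s) (p s) sh tX tk).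
- move=> s st x y; have [qQ pQ] := HQ s st; rewrite /ker' /fst /snd.
  apply: le_trans (ler_normB _ _) _; rewrite [leRHS]mulrDl; apply: lerD.
    rewrite normrM normrN; have [xy|xy] := boolP ((`|x| <= N) && (`|y| <= N)).
      case/andP: xy => xN yN; rewrite -[leRHS](mulrA (d%:R * (`|w| * (N + N)))); apply: ler_pM => //.
        apply: le_trans (dotv_norm _ _) _; rewrite ler_wpM2l// ler_wpM2l//.
        by apply: le_trans (ler_normB _ _) _; exact: lerD.
      apply: le_trans (H0 _ _ _ _ _ h1' qQ) _; apply: up => //; exact: ltW.
    have z0 : \1_(cube N) x * \1_(cube N) y = 0 :> R.
      by move: xy; rewrite negb_and !indE; case: (`|x| <= N); case: (`|y| <= N); rewrite ?mulr0 ?mul0r.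
    have -> : ker h' X k (q s) (p s) (x, y) = 0.
      apply/eqP; rewrite -normr_le0; apply: le_trans (H0 _ _ _ _ _ h1' qQ) _.
      by apply: le_trans (up _ _ x y (ltW C00) nN0) _; rewrite z0 mulr0.
    by rewrite normr0 z0 !mulr0.
  rewrite normrM ger0_norm// -mulrA ler_pM2l// mulr_suml.
  apply: le_trans (ler_norm_sum _ _ _) _; apply: ler_sum => j _.
  rewrite normrM -mulrA; apply: ler_pM => //.
    by apply: le_trans (coord_le_norm _ _) _; apply: le_trans pQ _; exact: ler_norm.
  case: (Hf j) => c0 m0 H; apply: le_trans (H _ _ _ _ _ h1 qQ) _.
  by apply: up => //; exact: ltW.
- move=> s st x y; rewrite /ker' /fst /snd kerE.
  have dp : is_derive s (1 : R) (fun r => dotv (p r) (x - y)) (- dotv w (x - y)).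
    have -> : (fun r => dotv (p r) (x - y)) = \sum_j (fun r => (x - y) ord0 j * p r ord0 j).
      by apply/funext => r; rewrite fct_sumE; apply: eq_bigr => j _; rewrite mulrC.
    have -> : - dotv w (x - y) = \sum_j ((x - y) ord0 j * - w ord0 j).
      by rewrite /dotv -sumrN; apply: eq_bigr => j _; rewrite mulrN mulrC.
    apply: is_derive_sum => j; exact: (@is_deriveZ _ _ _ _ ((x - y) ord0 j) _ _ _ (pp s st j)).
  have dh : is_derive s (1 : R) (fun r => h (dotv (p r) (x - y))) (- dotv w (x - y) * h' (dotv (p s) (x - y))).
    by have := @is_derive1_comp _ h (fun r => dotv (p r) (x - y)) s _ _ (hh _) dp; rewrite mulrC.
  have dk : is_derive s (1 : R) (fun r => k (x + y - 2 *: q r))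
      (\sum_j (- 2 * p s ord0 j) * partial j k (x + y - 2 *: q s)).
    apply: (curve_derive (c := fun r => x + y - 2 *: q r)); first exact: test_smooth.
    move=> j; have h2 := @is_deriveD _ _ _ _ _ _ _ _ _ (@is_derive_cst _ _ _ ((x + y) ord0 j) s 1)
       (@is_deriveZ _ _ _ _ (- 2) _ _ _ (pq s st j)).
    rewrite add0r in h2; move: h2; congr is_derive.
    apply/funext => r; transitivity ((x + y) ord0 j + - 2 * q r ord0 j); first by [].
    by rewrite !mxE; ring.
  apply: (is_derive_eq (is_deriveM (@is_deriveZ _ _ _ _ (X (x - y)) _ _ _ dh) dk)).
  transitivity (X (x - y) * h (dotv (p s) (x - y)) *
      \sum_j (- 2 * p s ord0 j) * partial j k (x + y - 2 *: q s) +
      k (x + y - 2 *: q s) * (X (x - y) * (- dotv w (x - y) * h' (dotv (p s) (x - y))))); first by [].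
  rewrite mulr_sumr [RHS]addrC mulr_sumr; congr (_ + _); last by ring.
  by rewrite -sumrN; apply: eq_bigr => j _; rewrite kerE; ring.
Qed.

End phase_kernel.

(** * Derivative of the smoothed Wigner function *)

Section wigner.
Context {R : realType} {d : nat}.
Notation E := 'rV[R]_d.
Notation mu := (@lebesgue_rV R d).
Notation mu2 := (lebesgue_rV d \x lebesgue_rV d)%E.
Implicit Types (X k : E -> R) (h : R -> R).

(** [(a a' + b b') + i (b a' - a b')] is [psi(x) conj(psi(y))]; the integrand is the real part of
    its product with [e^(- i p.(x - y))], weighted by [X] and [k]. *)
Definition wig X k (q p : E) (a b : E -> R) : R :=
  \int[mu2]_z ((a z.1 * a z.2 + b z.1 * b z.2) * ker cos X k q p z +
               (b z.1 * a z.2 - a z.1 * b z.2) * ker sin X k q p z).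

(* [rate] has no transport term: [q' = p] cancels the part of the kinetic term in which the phase *)
(* is differentiated.                                                                             *)
Definition rate h (lam : R) (U : E -> R) X k (w q p : E) (e : E -> R) : E * E -> R := fun z =>
  - 2 * \sum_j ker h (partial j X) (partial j k) q p z +
  (U z.1 - U z.2 - dotv w (z.1 - z.2) + lam * (e z.1 - e z.2)) * ker h X k q p z.

Variables (lam : R) (U : E -> R) (s0 s1 M : R) (a b : R -> E -> R).
Hypotheses (cU : continuous U) (hb : basic s0 s1 M a b) (hh : hamiltonian lam U s0 s1 a b).
Hypothesis (s01 : s0 < s1).
Variables (X k : E -> R) (q p : R -> E) (w : E) (t : R).
Hypotheses (tX : test_function X) (tk : test_function k) (pth : path q p w t) (ht : s0 < t < s1).

Let e x := lnsq (a t x) (b t x).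
Let P x := U x + lam * e x.
Let al h := fun z => X z * h (dotv (p t) z).
Let be := fun w => k (w - 2 *: q t).

Definition evol (f : R -> E -> R) (sg : R) (v : E -> R) := exists G,
  [/\ curve s0 s1 f G, forall phi, G t phi = sg * ham_term lam U v e phi,
      L1loc v & L1loc (fun x => v x * e x)].

(** The derivative of one bilinear form: the equation for [f], the equation for [g], and the motion
    of the kernel. *)
Definition bigG h h' (f g vf vg : E -> R) (sf sg : R) : E * E -> R := fun z =>
  sf * (vf z.1 * g z.2 * (P z.1 * pk (al h) be z - 2^-1 * lapk 1 (al h) be z)) +
  sg * (f z.1 * vg z.2 * (P z.2 * pk (al h) be z - 2^-1 * lapk (-1) (al h) be z)) +
  f z.1 * g z.2 * ker' h h' X k w (q t) (p t) z.

Lemma wig_part h h' (f g : R -> E -> R) vf vg sf sg :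
  (forall t : R, is_derive t (1 : R) h (h' t)) -> smooth1 h ->
  smooth1 h' -> (forall t, `|h t| <= 1) -> (forall t, `|h' t| <= 1) ->
  evol f sf vf -> evol g sg vg ->
  itg mu2 (bigG h h' (f t) (g t) vf vg sf sg) /\
  is_derive t (1 : R) (fun s => \int[mu2]_z (f s z.1 * g s z.2 * ker h X k (q s) (p s) z))
    (\int[mu2]_z (bigG h h' (f t) (g t) vf vg sf sg z)).
Proof.
move=> dh sh sh' h1 h1' [H [cf HE hvf hvef]] [G [cg GE hvg hveg]].
have ta : test_function (al h) by exact: test_phase.
have tb : test_function be by exact: test_shift.
have Lf := L2r_L1loc (cv_L2 cf ht); have Lg := L2r_L1loc (cv_L2 cg ht).
have kc := kcurve_ker dh sh sh' h1 h1' tX tk pth.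
have kk : kern (ker h X k (q t) (p t)) by exact: kern_ker.
have kk' : kern (ker' h h' X k w (q t) (p t)).
  have [de [C [n [de0 mM HM dM]]]] := kc; split; last first.
    by exists C, n; apply: HM; rewrite subrr normr0.
  rewrite /ker'; apply: measurable_funB.
    apply: measurable_funM; last by case: (kern_ker (q t) (p t) sh' tX tk).
    apply: measurableT_comp => //.
    exact: (measurable_sub (f := dotv w) (continuous_rV_measurable (@continuous_dotv _ _ w))).
  apply: measurable_funM => //; apply: measurable_sum => j; apply: measurable_funM => //.
  by case: (kern_ker (q t) (p t) sh tX (test_partial j tk)).
have D := bilin_derive cf cg ht ta tb (erefl (ker h X k (q t) (p t))) kc.
have i1 := itgZ sf (itg_ham1 lam cU hvf hvef Lg ta tb).
have i2 := itgZ sg (itg_ham2 lam cU hvg hveg Lf ta tb).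
have i3 := itg_kern Lf Lg kk'.
have iG : itg mu2 (bigG h h' (f t) (g t) vf vg sf sg) by apply: itgD i3; exact: itgD.
split; first exact: iG.
apply: is_derive_eq D _.
rewrite HE GE (ham_Phi1 lam cU hvf hvef Lg ta tb) (ham_Phi2 lam cU hvg hveg Lf ta tb).
by rewrite -!intZ -?intD//; [exact: itgD|exact: itg_ham2|exact: itg_ham1].
Qed.

Lemma evol1 : evol a 1 (b t).
Proof.
have ht' : s0 <= t <= s1 by case/andP: ht => h1 h2; rewrite !ltW.
eexists; split; first exact: (ham_curve1 cU hb hh s01).
- by [].
- exact: L2r_L1loc (bas_b hb ht').
- exact: L1loc_lnsq2 (bas_a hb ht') (bas_b hb ht').
Qed.

Lemma evol2 : evol b (-1) (a t).
Proof.
have ht' : s0 <= t <= s1 by case/andP: ht => h1 h2; rewrite !ltW.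
eexists; split; first exact: (ham_curve2 cU hb hh s01).
- by [].
- exact: L2r_L1loc (bas_a hb ht').
- exact: L1loc_lnsq1 (bas_a hb ht') (bas_b hb ht').
Qed.

Lemma norm_sin_le1 (x : R) : `|sin x| <= 1.
Proof. by rewrite ler_norml sin_geN1 sin_le1. Qed.

Lemma norm_cos_le1 (x : R) : `|cos x| <= 1.
Proof. by rewrite ler_norml cos_geN1 cos_le1. Qed.

Lemma ker_opp h X' k' (q' p' : E) z : ker (fun x => - h x) X' k' q' p' z = - ker h X' k' q' p' z.
Proof. by rewrite /ker /pk mulrN mulNr. Qed.

(** The Hamiltonian acts on [psi(x)] and on [conj(psi(y))] with opposite signs. So the Laplacians
    cancel up to the gradient product of [lapk_ker], whose transport part is cancelled by [q' = p];
    the potentials enter through their difference, from which [p' = - w] subtracts [w.(x - y)]. *)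
Lemma wig_derive : is_derive t (1 : R) (fun s => wig X k (q s) (p s) (a s) (b s))
  (\int[mu2]_z ((b t z.1 * a t z.2 - a t z.1 * b t z.2) * rate cos lam U X k w (q t) (p t) e z -
     (a t z.1 * a t z.2 + b t z.1 * b t z.2) * rate sin lam U X k w (q t) (p t) e z)).
Proof.
have dcos (x : R) : is_derive x (1 : R) cos (- sin x) by exact: is_derive_cos.
have dsin (x : R) : is_derive x (1 : R) sin (cos x) by exact: is_derive_sin.
have sns : smooth1 (fun x : R => - sin x).
  exists (fun f => exists u v : R, f = fun x => u * cos x + v * sin x).
    by exists 0, (-1); apply/funext => x; rewrite mulN1r mul0r add0r.
  move=> _ [u [v ->]]; exists (fun x => v * cos x + - u * sin x); first by exists v, (- u).
  by move=> x; apply: is_derive_eq; rewrite /GRing.scale/=; ring.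
have nsn (x : R) : `|- sin x| <= 1 by rewrite normrN norm_sin_le1.
have [i1 d1] := wig_part dcos smooth1_cos sns norm_cos_le1 nsn evol1 evol1.
have [i2 d2] := wig_part dcos smooth1_cos sns norm_cos_le1 nsn evol2 evol2.
have [i3 d3] := wig_part dsin smooth1_sin smooth1_cos norm_sin_le1 norm_cos_le1 evol2 evol1.
have [i4 d4] := wig_part dsin smooth1_sin smooth1_cos norm_sin_le1 norm_cos_le1 evol1 evol2.
have D := is_deriveD (is_deriveD d1 d2) (is_deriveB d3 d4).
apply: (is_derive_eq (near_eq_is_derive _ D)).
  have [h1 h2] : s0 < t /\ t < s1 by apply/andP.
  near=> s; have hs : s0 <= s <= s1.
    apply/andP; split; apply: ltW; near: s; [exact: lt_nbhsr|exact: lt_nbhsl].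
  have La := L2r_L1loc (bas_a hb hs); have Lb := L2r_L1loc (bas_b hb hs).
  have kc := kern_ker (q s) (p s) (@smooth1_cos R) tX tk.
  have ks := kern_ker (q s) (p s) (@smooth1_sin R) tX tk.
  have j1 := itg_kern La La kc; have j2 := itg_kern Lb Lb kc.
  have j3 := itg_kern Lb La ks; have j4 := itg_kern La Lb ks.
  transitivity (\int[mu2]_z (a s z.1 * a s z.2 * ker cos X k (q s) (p s) z) +
    \int[mu2]_z (b s z.1 * b s z.2 * ker cos X k (q s) (p s) z) +
    (\int[mu2]_z (b s z.1 * a s z.2 * ker sin X k (q s) (p s) z) -
    \int[mu2]_z (a s z.1 * b s z.2 * ker sin X k (q s) (p s) z))); first by [].
  rewrite -(intD j1 j2) -(intB j3 j4) -(intD (itgD j1 j2) (itgB j3 j4)).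
  by apply: int_eq => z; ring.
rewrite -(intD i1 i2) -(intB i3 i4) -(intD (itgD i1 i2) (itgB i3 i4)).
apply: int_eq => -[x y]; rewrite /bigG /rate /ker' /fst /snd.
rewrite /al /be (lapk_ker (q t) (p t) x y dcos smooth1_cos tX tk).
rewrite (lapk_ker (q t) (p t) x y dsin smooth1_sin tX tk).
rewrite -![pk _ _ (x, y)]/(ker _ _ _ _ _ (x, y)).
have sumN : \sum_j p t ord0 j * ker (fun x => - sin x) X (partial j k) (q t) (p t) (x, y) =
    - \sum_j p t ord0 j * ker sin X (partial j k) (q t) (p t) (x, y).
  by rewrite -[RHS]sumrN; apply: eq_bigr => j _; rewrite ker_opp mulrN.
rewrite sumN ker_opp /P.
set Lc := lapk (-1) (fun z => X z * cos (dotv (p t) z)) (fun w => k (w - 2 *: q t)) (x, y).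
set Ls := lapk (-1) (fun z => X z * sin (dotv (p t) z)) (fun w => k (w - 2 *: q t)) (x, y).
move: Lc Ls (dotv w (x - y)) => Lc Ls dw.
move: (\sum_j ker cos (partial j X) (partial j k) (q t) (p t) (x, y)) => S1.
move: (\sum_j ker sin (partial j X) (partial j k) (q t) (p t) (x, y)) => S2.
move: (\sum_j p t ord0 j * ker cos X (partial j k) (q t) (p t) (x, y)) => S3.
move: (\sum_j p t ord0 j * ker sin X (partial j k) (q t) (p t) (x, y)) => S4.
move: (ker cos X k (q t) (p t) (x, y)) (ker sin X k (q t) (p t) (x, y)) => kc ks.
by field.
Unshelve. all: by end_near. Qed.


End wigner.

(** * Mollification and conservation of mass *)

Section mollifiers.
Context {R : realType} {d : nat}.
Notation E := 'rV[R]_d.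
Notation mu := (@lebesgue_rV R d).
Notation mu2 := (lebesgue_rV d \x lebesgue_rV d)%E.
Implicit Types (f g h k : E -> R) (A : set E).

Section schur_forms.
Variables f h : E -> R.
Hypotheses (hf : itg mu f) (hh : itg mu h) (f0 : forall x, 0 <= f x) (h0 : forall x, 0 <= h x).

Lemma schur_sub1 : itg mu2 (fun z => f z.1 * h (z.1 - z.2)) /\
  \int[mu2]_z (f z.1 * h (z.1 - z.2)) = \int[mu]_x f x * \int[mu]_x h x.
Proof.
have e1 : (fun z : E * E => f z.1 * h (z.1 - z.2)) = fun z => f z.1 * h (0 + z.1 + (-1) *: z.2).
  by apply/funext => z; rewrite add0r scaleN1r.
have s1 : (-1 : R) = 1 \/ (-1 : R) = -1 by right.
rewrite e1; split; [exact: itg_schur1|exact: int_schur1].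
Qed.

Lemma schur_sub2 : itg mu2 (fun z => f z.2 * h (z.1 - z.2)) /\
  \int[mu2]_z (f z.2 * h (z.1 - z.2)) = \int[mu]_x f x * \int[mu]_x h x.
Proof.
have e1 : (fun z : E * E => f z.2 * h (z.1 - z.2)) = fun z => f z.2 * h (0 + z.1 + (-1) *: z.2).
  by apply/funext => z; rewrite add0r scaleN1r.
have s1 : (-1 : R) = 1 \/ (-1 : R) = -1 by right.
rewrite e1; split; [exact: itg_schur2|exact: int_schur2].
Qed.

Lemma schur_add1 c : itg mu2 (fun z => f z.1 * h (z.1 + z.2 - c)) /\
  \int[mu2]_z (f z.1 * h (z.1 + z.2 - c)) = \int[mu]_x f x * \int[mu]_x h x.
Proof.
have e1 : (fun z : E * E => f z.1 * h (z.1 + z.2 - c)) = fun z => f z.1 * h (- c + z.1 + 1 *: z.2).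
  by apply/funext => z; rewrite scale1r addrC addrA.
have s1 : (1 : R) = 1 \/ (1 : R) = -1 by left.
rewrite e1; split; [exact: itg_schur1|exact: int_schur1].
Qed.

End schur_forms.

Record mollifier (e : R) k : Prop := Mollifier {
  mol_test : test_function k; mol_ge0 : forall x, 0 <= k x;
  mol_int : \int[mu]_x k x = 1; mol_supp : forall x, e <= `|x| -> k x = 0 }.

Lemma test_itg k : test_function k -> itg mu k.
Proof.
move=> tk; have := L1loc_cc (L1loc_cst 1) (test_cc tk).
by under eq_fun do rewrite mul1r.
Qed.

Lemma mol_itg e k : mollifier e k -> itg mu k.
Proof. by move=> [tk _ _ _]; exact: test_itg. Qed.

Lemma cube_measure (n : R) : 0 <= n -> \int[mu]_x (\1_(cube n) x : R) = (2 * n) ^+ d.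
Proof.
move=> n0; rewrite /Rintegral integral_indic//; last exact: measurable_cube.
rewrite setIT cubeE//; transitivity (fine (\prod_(i < d) lebesgue_measure `[(- n)%R, n]%classic)%E).
  by congr fine; exact: (lebesgue_rV_box (A := fun=> `[- n, n]%classic)).
rewrite (eq_bigr (fun=> (2 * n)%:E)); first by rewrite prodEFin big_const_ord iter_mulr_1.
move=> i _; rewrite lebesgue_measure_itv/= lte_fin.
case: ifP => [_|/negbT]; first by rewrite -EFinB opprK; congr EFin; ring.
by rewrite -leNgt => H; congr EFin; lra.
Qed.

Lemma mollifier_exists e : 0 < e -> exists k, mollifier e k.
Proof.
move=> e0; pose b (x : E) : R := bump (e^-1 *: x).
have ei : e^-1 != 0 by rewrite invr_eq0 gt_eqF.
have tb : test_function b.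
  have := test_affine 0 ei (@test_bump R d); congr test_function.
  by apply/funext => x; rewrite add0r.
have bE x : `|e^-1 *: x| = e^-1 * `|x| by rewrite normrZ ger0_norm// invr_ge0 ltW.
have b0 x : 0 <= b x by exact: bump_ge0.
have ib := test_itg tb.
set c := flat 0 (2^-1 : R) ^+ 2 ^+ d.
have c0 : 0 < c by rewrite !exprn_gt0// flat_gt0.
have e2 : 0 < e / 2 by rewrite divr_gt0.
have I0 : 0 < \int[mu]_x b x.
  apply: (@lt_le_trans _ _ (\int[mu]_x (c * \1_(@cube R d (e / 2)) x))).
    rewrite intZ; last exact: itg_ind.
    by rewrite mulr_gt0// cube_measure ?ltW// exprn_gt0// mulr_gt0.
  apply: int_le => //; first by apply: itgZ; exact: itg_ind.
  move=> x; rewrite indE; have [xe|_] := leP `|x| (e / 2); last by rewrite mulr0.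
  by rewrite mulr1; apply: bump_ge; rewrite bE ler_pdivrMl.
exists (fun x => (\int[mu]_x b x)^-1 * b x); split.
- have := test_mul tb (smooth_cst (\int[mu]_x b x)^-1); congr test_function.
  by apply/funext => x; rewrite mulrC.
- by move=> x; rewrite mulr_ge0// invr_ge0 ltW.
- by rewrite intZ// mulVf// gt_eqF.
- move=> x xe; rewrite /b bump_eq0 ?mulr0// bE.
  by rewrite mulrC ler_pdivlMr// mul1r.
Qed.

Definition gap (n : R) A k : R := \int[mu2]_z (\1_(cube n) z.1 * `|\1_A z.1 - \1_A z.2| * k (z.1 - z.2)).

(* The sets whose indicator is continuous in mean under translations; they form a sigma-algebra. *)
Definition good A := measurable A /\ forall n tau : R, 0 < n -> 0 < tau ->
  exists2 e0, 0 < e0 & forall e k, e <= e0 -> mollifier e k -> gap n A k <= tau.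

Lemma itg_gap n A e k : measurable A -> mollifier e k ->
  itg mu2 (fun z => \1_(cube n) z.1 * `|\1_A z.1 - \1_A z.2| * k (z.1 - z.2)).
Proof.
move=> mA mk; have [i1 _] := schur_sub1 (itg_ind n) (mol_itg mk) (@ind_ge0 _ _ n) (mol_ge0 mk).
apply: itg_dom i1 _.
  apply: measurable_funM; last exact: measurable_sub (itg_measurable (mol_itg mk)).
  apply: measurable_funM; first exact: (measurable_fun1 (measurable_ind n)).
  apply: measurableT_comp => //; have mi : measurable_fun setT (\1_A : E -> R) by exact: measurable_indic.
  by apply: measurable_funB; [exact: (measurable_fun1 mi)|exact: (measurable_fun2 mi)].
move=> [x y]; rewrite /fst /snd !normrM normr_id (ger0_norm (mol_ge0 mk _)) (ger0_norm (ind_ge0 _ _)).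
rewrite ler_wpM2r ?(mol_ge0 mk)// ler_piMr ?ind_ge0// !indicE.
by case: (x \in A); case: (y \in A); rewrite ?subrr ?subr0 ?sub0r ?normrN ?normr0 ?normr1.
Qed.

Lemma good0 : good set0.
Proof.
split => // n tau n0 tau0; exists 1 => // e k _ _.
rewrite /gap; under eq_Rintegral do rewrite !indic0 /= subrr normr0 mulr0 mul0r.
by rewrite Rintegral_cst// mul0r ltW.
Qed.

Lemma goodC A : good A -> good (~` A).
Proof.
move=> [mA H]; split; first exact: measurableC.
move=> n tau n0 tau0; have [e0 e00 He] := H n tau n0 tau0; exists e0 => // e k ee mk.
apply: le_trans (He e k ee mk); rewrite le_eqVlt; apply/orP; left; apply/eqP.
apply: int_eq => z; congr (_ * _ * _); rewrite !indicE !in_setC.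
case: (z.1 \in A); case: (z.2 \in A) => /=; rewrite ?subrr ?subr0 ?sub0r//.
all: by rewrite normrN.
Qed.

(** At points less than [e] apart the indicator can only differ if [x] is within [e] of one of the
    two bounding hyperplanes; inside a cube these layers have measure [O(e)]. *)
Lemma good_slab (i : 'I_d) (a b : R) : good [set x : E | `]a, b]%classic (x ord0 i)].
Proof.
have mA : measurable [set x : E | `]a, b]%classic (x ord0 i)].
  by rewrite -[X in measurable X]setTI; apply: (@measurable_coord _ _ d i).
split => // n tau n0 tau0.
pose D (c e : R) : set E := [set x | forall j, (if j == i then `[c - e, c + e] else `[- n, n])%classic (x ord0 j)].
have mD c e : measurable (D c e).
  by apply: (@measurable_box _ _ (fun j => (if j == i then `[c - e, c + e] else `[- n, n])%classic)) => j; case: eqP.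
pose K := (2 * n) ^+ d.-1.
have K0 : 0 < K by rewrite exprn_gt0// mulr_gt0.
have DE c e : 0 < e -> mu (D c e) = (2 * e * K)%:E.
  move=> e0; rewrite (lebesgue_rV_box (A := fun j => (if j == i then `[c - e, c + e] else `[- n, n])%classic)); last first.
    by move=> j; case: eqP.
  rewrite (bigD1 i)//= eqxx lebesgue_measure_itv/= lte_fin.
  rewrite ifT; last by lra.
  rewrite -EFinB (eq_bigr (fun=> (2 * n)%:E)); last first.
    move=> j ji; rewrite (negbTE ji) lebesgue_measure_itv/= lte_fin ifT; last by lra.
    by rewrite -EFinB; congr EFin; ring.
  rewrite prodEFin -EFinM; congr EFin; congr (_ * _); first by ring.
  by rewrite prodr_const cardC1 card_ord.
have iD c e : 0 < e -> itg mu (\1_(D c e) : E -> R) /\ \int[mu]_x (\1_(D c e) x : R) = 2 * e * K.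
  move=> e0; have h : (\int[mu]_x (\1_(D c e) x)%:E = (2 * e * K)%:E)%E.
    by rewrite integral_indic// setIT; exact: DE.
  split; last by rewrite /Rintegral h.
  apply: itg_ge0P; first exact: measurable_indic.
    by move=> x; rewrite indicE.
  by rewrite h ltry.
exists (tau / (4 * K)); first by rewrite divr_gt0// mulr_gt0.
move=> e k ee mk.
have [e0|e0] := leP e 0.
  rewrite /gap; under eq_Rintegral do rewrite (mol_supp mk) ?mulr0 ?(le_trans e0)//.
  by rewrite Rintegral_cst// mul0r ltW.
have [ia ea] := iD a e e0; have [ib eb] := iD b e e0.
pose F (x : E) : R := \1_(D a e) x + \1_(D b e) x.
have iF : itg mu F by exact: itgD.
have F0 x : 0 <= F x by rewrite addr_ge0// indicE.
have [i1 e1] := schur_sub1 iF (mol_itg mk) F0 (mol_ge0 mk).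
apply: (@le_trans _ _ (\int[mu2]_z (F z.1 * k (z.1 - z.2)))); last first.
  rewrite e1 (mol_int mk) mulr1 /F intD// ea eb.
  rewrite (_ : 2 * e * K + 2 * e * K = e * (4 * K)); last by ring.
  by rewrite -ler_pdivlMr// mulr_gt0.
apply: int_le => //; first exact: itg_gap mk.
move=> [x y]; rewrite /fst /snd.
have [xye|xye] := leP e `|x - y|; first by rewrite (mol_supp mk xye) !mulr0.
apply: ler_wpM2r; first exact: mol_ge0 mk _.
have [xn|xn] := leP `|x| n; last by rewrite ind_out// mul0r.
rewrite indE xn mul1r /F !indicE.
have Dx c : `|x ord0 i - c| <= e -> x \in D c e.
  move=> h; rewrite inE => j /=; case: eqP => [->|_].
    by rewrite /= in_itv/= -ler_distl.
  by rewrite /= in_itv/= -ler_norml; apply: le_trans (coord_le_norm _ _) xn.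
have hxy : `|x ord0 i - y ord0 i| < e.
  by apply: le_lt_trans xye; have := coord_le_norm (x - y) i; rewrite !mxE.
have [h1|h1] := boolP (x \in [set x : E | `]a, b]%classic (x ord0 i)]);
  have [h2|h2] := boolP (y \in [set x : E | `]a, b]%classic (x ord0 i)]);
  rewrite ?subrr ?subr0 ?sub0r ?normrN ?normr0 ?normr1 ?addr_ge0//.
- move: h1; rewrite inE/= in_itv/= => /andP[k1 k2].
  move: h2; rewrite notin_setE/= in_itv/= => /negP; rewrite negb_and -leNgt -ltNge => h2.
  case/orP: h2 => h2.
    rewrite (Dx a); first by rewrite lerDl.
    by move: hxy; rewrite !ler_norml !ltr_norml; lra.
  rewrite (Dx b); first by rewrite lerDr.
  by move: hxy; rewrite !ler_norml !ltr_norml; lra.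
- move: h2; rewrite inE/= in_itv/= => /andP[k1 k2].
  move: h1; rewrite notin_setE/= in_itv/= => /negP; rewrite negb_and -leNgt -ltNge => h2.
  case/orP: h2 => h2.
    rewrite (Dx a); first by rewrite lerDl.
    by move: hxy; rewrite !ler_norml !ltr_norml; lra.
  rewrite (Dx b); first by rewrite lerDr.
  by move: hxy; rewrite !ler_norml !ltr_norml; lra.
Qed.


Lemma goodU A B : good A -> good B -> good (A `|` B).
Proof.
move=> [mA gA] [mB gB]; split; first exact: measurableU.
move=> n tau n0 tau0; have t2 : 0 < tau / 2 by rewrite divr_gt0.
have [ea ea0 Ha] := gA n _ n0 t2; have [eb eb0 Hb] := gB n _ n0 t2.
exists (Num.min ea eb); first by rewrite lt_min ea0.
move=> e k; rewrite le_min => /andP[h1 h2] mk.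
have := lerD (Ha e k h1 mk) (Hb e k h2 mk).
rewrite -splitr; apply: le_trans; rewrite /gap -intD; try exact: itg_gap mk.
apply: int_le; [exact: itg_gap (measurableU _ _ mA mB) mk|apply: itgD; exact: itg_gap mk|].
move=> z; rewrite -mulrDl -mulrDr; apply: ler_wpM2r; first exact: mol_ge0 mk _.
apply: ler_wpM2l; first exact: ind_ge0.
rewrite !indicE !in_setU; case: (z.1 \in A); case: (z.1 \in B); case: (z.2 \in A); case: (z.2 \in B);
  rewrite /= ?subrr ?subr0 ?sub0r ?normrN ?normr0 ?normr1; lra.
Qed.

(** For a countable union, the part of a cube missed by a finite subunion has small measure. It
    contributes at most twice that measure to [gap], by the Schur identities. *)
Lemma good_sigma : sigma_algebra setT good.
Proof.
split; first exact: good0.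
  by move=> A gA; rewrite setTD; exact: goodC.
move=> A gA; have mA i : measurable (A i) by case: (gA i).
have mU : measurable (\bigcup_i A i) by exact: bigcup_measurable.
set U := \bigcup_i A i in mU *.
pose B (N : nat) : set E := \big[setU/set0]_(i < N) A i.
have gB N : good (B N).
  elim: N => [|N ih]; rewrite /B ?big_ord0 ?big_ord_recr; [exact: good0|exact: goodU].
have mB N : measurable (B N) by case: (gB N).
split => // n tau n0 tau0.
(* The cube is enlarged by [1] because [y] may lie up to [e <= 1] outside the cube of [x]. *)
pose C (N : nat) : set E := cube (n + 1) `&` (U `\` B N).
have mC N : measurable (C N) by apply: measurableI; [exact: measurable_cube|exact: measurableD].
have C_lty : (mu (C 0%N) < +oo)%E.
  apply: le_lt_trans (cube_lty d (n + 1)); apply: le_measure; rewrite ?inE//.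
    exact: measurable_cube.
  by move=> x [].
have CN : \bigcap_N C N = set0.
  apply/seteqP; split => x // H; have [_ [[i _ Aix] _]] := H 0%N I.
  have [_ [_]] := H i.+1 I; apply; rewrite /B big_ord_recr /=; by right.
have Cd : {homo C : i j / (i <= j)%N >-> (j <= i)%O}.
  move=> i j ij; apply/subsetPset => x [h1 [h2 h3]]; split => //; split => // h4; apply: h3.
  by move: h4; apply: subset_bigsetU.
have := @nonincreasing_cvg_mu _ _ _ mu C C_lty mC _ Cd.
rewrite CN measure0 => /(_ measurable0) /fine_cvgP[_ /cvgrPdist_lt].
have t4 : 0 < tau / 4 by rewrite divr_gt0.
move=> /(_ _ t4) [N _ /(_ N (leqnn N))]; rewrite /= sub0r normrN.
have CNfin : mu (C N) \is a fin_num.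
  rewrite ge0_fin_numE//; apply: le_lt_trans C_lty; apply: le_measure; rewrite ?inE//.
  exact/subsetPset/Cd.
rewrite ger0_norm ?fine_ge0// => muC.
have [e0 e00 He] := (gB N).2 n (tau / 2) n0 (divr_gt0 tau0 (ltr0Sn _ 1)).
exists (Num.min 1 e0); first by rewrite lt_min ltr01.
move=> e k; rewrite le_min => /andP[e1 ee0] mk.
pose F x : R := \1_(C N) x.
have iF : itg mu F.
  apply: itg_ge0P; first exact: measurable_indic.
    by move=> x; rewrite /F indicE.
  by rewrite integral_indic// setIT; move: CNfin; rewrite ge0_fin_numE.
have IF : \int[mu]_x F x <= tau / 4.
  by rewrite /Rintegral integral_indic// setIT; exact: ltW.
have F0 x : 0 <= F x by rewrite /F indicE.
have [i1 e1'] := schur_sub1 iF (mol_itg mk) F0 (mol_ge0 mk).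
have [i2 e2'] := schur_sub2 iF (mol_itg mk) F0 (mol_ge0 mk).
rewrite (mol_int mk) mulr1 in e1' e2'.
have ig := itg_gap n (mB N) mk.
apply: (@le_trans _ _ (\int[mu2]_z (\1_(cube n) z.1 * `|\1_(B N) z.1 - \1_(B N) z.2| * k (z.1 - z.2) +
   F z.1 * k (z.1 - z.2) + F z.2 * k (z.1 - z.2)))); last first.
  rewrite intD// ?intD//; last exact: itgD.
  by rewrite e1' e2'; have := He e k ee0 mk; rewrite /gap; lra.
apply: int_le; [exact: itg_gap mk|by apply: itgD => //; exact: itgD|].
move=> [x y]; rewrite /fst /snd.
have [xye|xye] := leP e `|x - y|; first by rewrite (mol_supp mk xye) !mulr0 !addr0.
rewrite -!mulrDl; apply: ler_wpM2r; first exact: mol_ge0 mk _.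
have [xn|xn] := leP `|x| n; last by rewrite ind_out// !mul0r add0r addr_ge0.
rewrite indE xn !mul1r.
have x1 : `|x| <= n + 1 by rewrite ler_wpDr.
have y1 : `|y| <= n + 1.
  rewrite -(subrK x y); apply: le_trans (ler_normD _ _) _; rewrite addrC distrC; apply: lerD => //.
  exact: le_trans (ltW xye) e1.
have K z : `|z| <= n + 1 -> z \in U -> z \notin B N -> F z = 1.
  move=> zn zU zB; rewrite /F indicE (_ : z \in C N)// inE; split => //; split; first by rewrite inE in zU.
  by rewrite notin_setE in zB.
have BU z : z \in B N -> z \in U.
  rewrite !inE /B -bigcup_mkord => -[i _ Aiz]; by exists i.
rewrite !indicE.
have [xU|xU] := boolP (x \in U); have [yU|yU] := boolP (y \in U);
have [xB|xB] := boolP (x \in B N); have [yB|yB] := boolP (y \in B N) => /=;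
rewrite ?subrr ?subr0 ?sub0r ?normrN ?normr0 ?normr1.
all: try (by rewrite ?(BU _ xB) in xU).
all: try (by rewrite ?(BU _ yB) in yU).
all: rewrite ?addr_ge0//.
all: have := F0 x; have := F0 y; try (rewrite (K x x1 xU xB)); try (rewrite (K y y1 yU yB)); lra.
Qed.

Lemma good_measurable A : measurable A -> good A.
Proof.
move: A; apply: smallest_sub; first exact: good_sigma.
rewrite -bigcup_seq/=; apply: bigcup_sub => i _ _ [Y mY <-]; rewrite setTI.
suff H : (measurable : set (set (measurableTypeR R))) `<=` [set Y | good [set x : E | Y (x ord0 i)]] by exact: H.
apply: smallest_sub; last by move=> _ [[a b] _ <-]; exact: good_slab.
have [g0 gC gU] := good_sigma; split => /=.
- exact: g0.
- by move=> Z gZ; exact: (gC _ gZ).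
- by move=> Z gZ; have := gU _ gZ; congr good.
Qed.

(** The sum counts the integers from [1] to [J] that do not exceed [c]. It writes a bounded function
    as a sum of indicators of level sets, up to one level. *)
Lemma layer_count (J : nat) (c : R) : 0 <= c ->
  \sum_(j < J) ((j.+1%:R <= c)%R : nat)%:R <= c /\
  (c <= J%:R -> c - 1 <= \sum_(j < J) ((j.+1%:R <= c)%R : nat)%:R).
Proof.
elim: J c => [|J ih] c c0; first by rewrite big_ord0; split => // h; lra.
rewrite big_ord_recl /=; have [c1|c1] := leP 1 c.
  have [h1 h2] := ih (c - 1) ltac:(lra).
  have -> : \sum_(i < J) ((2 + i)%:R <= c)%R%:R = \sum_(i < J) (i.+1%:R <= c - 1)%R%:R :> R.
    by apply: eq_bigr => i _; rewrite lerBrDr natr1 add2n.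
  rewrite -[true%:R]/(1 : R); set S := \sum_(j < J) _ in h1 h2 *.
  by split; [lra|rewrite -natr1 => h; have := h2 ltac:(lra); lra].
rewrite -[false%:R]/(0 : R) big1 ?addr0; first by split => // _; lra.
move=> i _; rewrite leNgt (lt_le_trans c1)//= ler1n; exact: ltn0Sn.
Qed.

Lemma gap_sum (A : nat -> set E) (n s : R) J : (forall j, measurable (A j)) -> 0 < n -> 0 < s ->
  exists2 e0, 0 < e0 & forall e k, e <= e0 -> mollifier e k -> \sum_(j < J) gap n (A j) k <= J%:R * s.
Proof.
move=> mA n0 s0; elim: J => [|J [e0 e00 He]].
  by exists 1 => // e k _ _; rewrite big_ord0 mul0r.
have [e1 e10 H1] := (good_measurable (mA J)).2 n s n0 s0.
exists (Num.min e0 e1); first by rewrite lt_min e00.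
move=> e k; rewrite le_min => /andP[h1 h2] mk; rewrite big_ord_recr /= -natr1 mulrDl mul1r.
by apply: lerD; [exact: He h1 mk|exact: H1 h2 mk].
Qed.

(** The mean-square oscillation of [f] at the scale of [k]. *)
Definition dev2 f k : R := \int[mu2]_z ((f z.1 - f z.2) ^+ 2 * k (z.1 - z.2)).

Lemma itg_dev2 f e k : L2r f -> mollifier e k -> itg mu2 (fun z => (f z.1 - f z.2) ^+ 2 * k (z.1 - z.2)).
Proof.
move=> [mf if2] mk; have f0 x : 0 <= f x ^+ 2 by exact: sqr_ge0.
have [i1 _] := schur_sub1 if2 (mol_itg mk) f0 (mol_ge0 mk).
have [i2 _] := schur_sub2 if2 (mol_itg mk) f0 (mol_ge0 mk).
apply: itg_dom (itgZ 2 (itgD i1 i2)) _.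
  apply: measurable_funM; last exact: measurable_sub (itg_measurable (mol_itg mk)).
  by apply: measurable_funX; apply: measurable_funB; [exact: (measurable_fun1 mf)|exact: (measurable_fun2 mf)].
move=> [x y]; rewrite /fst /snd normrM (ger0_norm (mol_ge0 mk _)) ger0_norm ?sqr_ge0// -mulrDl mulrA.
apply: ler_wpM2r; first exact: mol_ge0 mk _.
have := sqr_ge0 (f x + f y); rewrite sqrrB sqrrD !mulr2n; lra.
Qed.

(** With levels spaced by [r], [|g x - g y|] is at most [r] plus [r] times the number of level sets
    separating [x] from [y], and level sets are good. The bound [|g x - g y| <= 2 K] reduces the
    square to a first power. *)
Lemma dev2_bounded g (K : R) : 0 < K -> measurable_fun setT g -> (forall x, `|g x| <= K) ->
  (forall x, K < `|x| -> g x = 0) -> forall tau, 0 < tau ->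
  exists2 e0, 0 < e0 & forall e k, e <= e0 -> mollifier e k -> dev2 g k <= tau.
Proof.
move=> K0 mg gK g0 tau tau0; set n := K + 1.
have n0 : 0 < n by rewrite addr_gt0.
set c := (2 * n) ^+ d; have c0 : 0 < c by rewrite exprn_gt0// mulr_gt0.
have L2g : L2r g.
  split => //; apply: itg_dom (itgZ (K ^+ 2) (itg_ind K)) _; first exact: measurable_funX.
  move=> x; rewrite normrX indE; have [xK|xK] := leP `|x| K; last by rewrite g0// normr0 mulr0 expr0n.
  by rewrite mulr1 ler_pXn2r ?nnegrE// ltW.
pose r := tau / (8 * K * c); have r0 : 0 < r by rewrite divr_gt0// !mulr_gt0.
pose J := Num.trunc (2 * K / r); pose A (j : nat) := [set x : E | - K + j.+1%:R * r <= g x].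
have mA j : measurable (A j).
  rewrite -[A j]setTI; exact: (measurable_fun_le measurableT (measurable_cst _) mg).
have JK : 2 * K / r <= J.+1%:R.
  have h : 0 <= 2 * K / r by apply: divr_ge0; [apply: mulr_ge0 => //|]; exact: ltW.
  by have /andP[_ /ltW] := truncn_itv h.
have JJ0 : 0 < (J.+1%:R : R) by rewrite ltr0n.
have s0 : 0 < tau / (4 * K * r * J.+1%:R) by apply: divr_gt0 => //; apply: mulr_gt0 => //; apply: mulr_gt0 => //; exact: mulr_gt0.
have [e0 e00 He] := gap_sum J.+1 mA n0 s0.
exists (Num.min 1 e0); first by rewrite lt_min ltr01.
move=> e k; rewrite le_min => /andP[e1 ee0] mk; have {He} := He e k ee0 mk.
have k0 := mol_ge0 mk; have ik := mol_itg mk.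
have [i1 e1'] := schur_sub1 (itg_ind n) ik (@ind_ge0 _ _ n) k0.
rewrite (mol_int mk) mulr1 cube_measure ?(ltW n0)// -/c in e1'.
rewrite /gap -int_sum; last by move=> j; exact: itg_gap mk.
set G := (fun z : E * E => \sum_(j < J.+1) _).
have iG : itg mu2 G by apply: itg_sum => j; exact: itg_gap mk.
move=> HG; have : \int[mu2]_z (2 * K * r * (\1_(cube n) z.1 * k (z.1 - z.2)) + 2 * K * r * G z) <= tau.
  rewrite intD; [|exact: itgZ|exact: itgZ]; rewrite !intZ// e1'.
  have -> : 2 * K * r * c = tau / 4 by rewrite /r; field; rewrite !gt_eqF.
  have h : 0 < 2 * K * r by apply: mulr_gt0 => //; exact: mulr_gt0.
  have := ler_wpM2l (ltW h) HG.
  have -> : 2 * K * r * (J.+1%:R * (tau / (4 * K * r * J.+1%:R))) = tau / 2.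
    by field; rewrite !gt_eqF.
  by lra.
clear HG; clearbody r.
apply: le_trans; apply: int_le; [exact: itg_dev2 mk|by apply: itgD; exact: itgZ|].
move=> [x y]; rewrite /G /fst /snd.
have [xye|xye] := leP e `|x - y|.
  rewrite (mol_supp mk xye) !mulr0 add0r big1 ?mulr0// => j _; by rewrite mulr0.
rewrite -mulr_suml !mulrA -mulrDl; apply: ler_wpM2r => //.
have xyK : n < `|x| -> K < `|x| /\ K < `|y|.
  move=> xn; split; first by apply: lt_trans xn; rewrite ltrDl.
  have := ler_normD (x - y) y; rewrite subrK => h.
  by move: h xn xye e1; rewrite /n; lra.
have [xn|xn] := leP `|x| n; last first.
  have [h1 h2] := xyK xn; rewrite !g0// subrr expr0n /= ind_out// mulr0 add0r.
  by rewrite big1 ?mulr0// => j _; rewrite mul0r.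
rewrite indE xn mulr1; under eq_bigr do rewrite mul1r.
have step : `|g x - g y| <= r + r * \sum_(j < J.+1) `|\1_(A j) x - \1_(A j) y|.
  have cnt z : let S : R := \sum_(j < J.+1) \1_(A j) z in r * S <= g z + K /\ g z + K - r <= r * S.
    have gz0 : 0 <= (g z + K) / r by rewrite divr_ge0 ?(ltW r0)//; have := gK z; rewrite ler_norml; lra.
    have [h1 h2] := layer_count J.+1 gz0.
    have gzJ : (g z + K) / r <= J.+1%:R.
      by apply: le_trans JK; rewrite ler_pM2r ?invr_gt0//; have := gK z; rewrite ler_norml; lra.
    have SE : \sum_(j < J.+1) \1_(A j) z = \sum_(j < J.+1) ((j.+1%:R <= (g z + K) / r)%R : nat)%:R :> R.
      apply: eq_bigr => j _; rewrite indicE ler_pdivlMr//; congr (nat_of_bool _)%:R.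
      apply/idP/idP => [|h]; first by rewrite inE /A/=; lra.
      by rewrite inE /A /=; lra.
    rewrite /= SE; split.
      by have := ler_wpM2l (ltW r0) h1; rewrite [leRHS]mulrC divfK// gt_eqF.
    have := ler_wpM2l (ltW r0) (h2 gzJ); rewrite mulrBr mulr1 [r * (_ / r)]mulrC divfK//.
    by rewrite gt_eqF.
  have [a1 a2] := cnt x; have [b1 b2] := cnt y.
  have -> : r * \sum_(j < J.+1) `|\1_(A j) x - \1_(A j) y| = \sum_(j < J.+1) `|r * \1_(A j) x - r * \1_(A j) y|.
    by rewrite mulr_sumr; apply: eq_bigr => j _; rewrite -mulrBr normrM (ger0_norm (ltW r0)).
  have := ler_norm_sum (index_enum 'I_J.+1) (fun j => r * \1_(A j) x - r * \1_(A j) y) xpredT.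
  rewrite sumrB -!mulr_sumr => h; apply: le_trans (lerD (lexx r) h).
  rewrite ler_norml; apply/andP; split.
    have := ler_norm (- (r * (\sum_(i < J.+1) \1_(A i) x) - r * \sum_(i < J.+1) \1_(A i) y)).
    by rewrite normrN; lra.
  have := ler_norm (r * (\sum_(i < J.+1) \1_(A i) x) - r * \sum_(i < J.+1) \1_(A i) y).
  by lra.
apply: (@le_trans _ _ (2 * K * `|g x - g y|)); last first.
  by rewrite -!mulrA -!mulrDr mulrA mulrA ler_pM2l ?mulr_gt0.
rewrite -real_normK ?num_real// expr2; apply: ler_wpM2r => //.
apply: le_trans (ler_normB _ _) _; have := gK x; have := gK y; lra.
Qed.

(** Truncating in value and in space approximates [f] in L^2, by dominated convergence; the Schur
    identities bound the oscillation of the difference by its L^2 norm. *)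
Lemma dev2_small f tau : L2r f -> 0 < tau ->
  exists2 e0, 0 < e0 & forall e k, e <= e0 -> mollifier e k -> dev2 f k <= tau.
Proof.
move=> L2f tau0; have [mf if2] := L2f.
pose g (n : nat) x : R := \1_(cube n%:R) x * Num.max (- n%:R) (Num.min n%:R (f x)).
have mg n : measurable_fun setT (g n).
  apply: measurable_funM; first exact: measurable_ind.
  by apply: measurable_maxr => //; apply: measurable_minr.
have trb (n : nat) (v : R) : `|Num.max (- n%:R) (Num.min n%:R v)| <= n%:R.
  rewrite ler_norml le_max lexx /= ge_max ge_min lexx /= andbT.
  by have : 0 <= n%:R :> R by []; lra.
have gb n x : `|g n x| <= n%:R.
  rewrite normrM (ger0_norm (ind_ge0 _ _)); apply: le_trans (trb n (f x)).
  by rewrite ler_piMl ?ind_le1.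
have gf n x : (f x - g n x) ^+ 2 <= f x ^+ 2.
  rewrite /g indE; have n0 : 0 <= n%:R :> R by [].
  have [_|_] := leP `|x| n%:R; last by rewrite mul0r subr0.
  rewrite mul1r; have [h1|h1] := leP n%:R (f x).
    rewrite (_ : Num.max _ _ = n%:R); last by apply/max_idPr; lra.
    rewrite -subr_ge0 (_ : _ - _ = n%:R * (f x + (f x - n%:R))); last by ring.
    by rewrite mulr_ge0//; lra.
  have [h2|h2] := leP (- n%:R) (f x); first by rewrite subrr expr0n sqr_ge0.
  rewrite -subr_ge0 (_ : _ - _ = n%:R * (- f x + (- f x - n%:R))); last by ring.
  by rewrite mulr_ge0//; lra.
have cvg_g : \int[mu]_x ((f x - g n x) ^+ 2) @[n --> \oo] --> (0 : R).
  have [] := @dominated_convergence _ _ _ mu setT measurableT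
    (fun n x => ((f x - g n x) ^+ 2)%:E) (cst 0%E) (fun x => (f x ^+ 2)%:E).
  - by move=> n; apply/measurable_EFinP; apply: measurable_funX; exact: measurable_funB.
  - exact: measurable_cst.
  - apply/aeW => x _; apply: cvg_near_cst; near=> n.
    rewrite /g indE; have xn : `|x| <= n%:R by near: n; exact: nbhs_infty_ger.
    have fn : `|f x| <= n%:R by near: n; exact: nbhs_infty_ger.
    move: fn; rewrite ler_norml => /andP[f1 f2].
    by rewrite xn mul1r (min_idPr f2) (max_idPr f1) subrr expr0n.
  - exact: if2.
  - by apply/aeW => x n _; rewrite /= lee_fin ger0_norm ?sqr_ge0.
  move=> _ _; rewrite integral0 => h.
  by move/fine_cvgP: h => [].
have t16 : 0 < tau / 16 by rewrite divr_gt0.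
have [n n1 Hn] : exists2 n : nat, (0 < n)%N & \int[mu]_x ((f x - g n x) ^+ 2) <= tau / 16.
  move/cvgrPdist_le: cvg_g => /(_ _ t16) [N _ H]; exists N.+1 => //.
  have := H N.+1 (leqnSn N); rewrite /= sub0r normrN; exact: le_trans (ler_norm _).
have nK : 0 < n%:R :> R by rewrite ltr0n.
have gout x : n%:R < `|x| -> g n x = 0 by move=> h; rewrite /g ind_out// mul0r.
have t4 : 0 < tau / 4 by rewrite divr_gt0.
have [e0 e00 He] := dev2_bounded nK (mg n) (gb n) gout t4.
exists e0 => // e k ee0 mk; have {He} := He e k ee0 mk => He.
have L2g : L2r (g n).
  split => //; apply: itg_dom (itgZ (n%:R ^+ 2) (itg_ind n%:R)) _; first exact: measurable_funX.
  move=> x; rewrite normrX indE; have [xK|xK] := leP `|x| n%:R; last by rewrite gout// normr0 mulr0 expr0n.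
  by rewrite mulr1 ler_pXn2r ?nnegrE.
have [mr ir] := L2rB L2f L2g; pose h x := (f x - g n x) ^+ 2.
have h0 x : 0 <= h x by exact: sqr_ge0.
have [i1 e1] := schur_sub1 ir (mol_itg mk) h0 (mol_ge0 mk).
have [i2 e2] := schur_sub2 ir (mol_itg mk) h0 (mol_ge0 mk).
rewrite (mol_int mk) mulr1 in e1 e2.
have i3 := itg_dev2 L2g mk.
apply: (@le_trans _ _ (\int[mu2]_z (2 * ((g n z.1 - g n z.2) ^+ 2 * k (z.1 - z.2)) +
   4 * (h z.1 * k (z.1 - z.2)) + 4 * (h z.2 * k (z.1 - z.2))))); last first.
  rewrite intD; [|by apply: itgD; exact: itgZ|exact: itgZ].
  rewrite intD; [|exact: itgZ|exact: itgZ].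
  by rewrite !intZ// e1 e2; move: He Hn; rewrite /dev2 /h; lra.
apply: int_le; [exact: itg_dev2 mk|by apply: itgD; [apply: itgD|]; exact: itgZ|].
move=> [x y]; rewrite /fst /snd !mulrA -!mulrDl; apply: ler_wpM2r; first exact: mol_ge0 mk _.
rewrite /h; set u := f x - g n x; set v := f y - g n y; set w := g n x - g n y.
have -> : f x - f y = w + (u - v) by rewrite /w /u /v; ring.
have := sqr_ge0 (w - (u - v)); have := sqr_ge0 (u + v); nra.
Unshelve. all: by end_near. Qed.

End mollifiers.

(** * Bounds on the derivative of wig *)

Section rate_estimates.
Context {R : realType} {d : nat}.
Notation E := 'rV[R]_d.
Notation mu := (@lebesgue_rV R d).
Notation mu2 := (lebesgue_rV d \x lebesgue_rV d)%E.
Implicit Types (X k h : E -> R).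

Section pointwise.
Variables (a b a' b' th : R).
Let I := (a * a' + b * b') * cos th + (b * a' - a * b') * sin th.
Let J := (b * a' - a * b') * cos th - (a * a' + b * b') * sin th.

(** [I] and [J] are the real and imaginary parts of [z conj(z') e^(- i th)], with [z = a + i b] and
    [z' = a' + i b']; both sides are [|z - e^(i th) z'|^2]. *)
Lemma phase_dist : (a ^+ 2 + b ^+ 2) + (a' ^+ 2 + b' ^+ 2) - 2 * I =
  (a - (a' * cos th - b' * sin th)) ^+ 2 + (b - (a' * sin th + b' * cos th)) ^+ 2.
Proof.
have := cos2Dsin2 th; set c := cos th; set s := sin th => cs.
rewrite /I -/c -/s (_ : a' ^+ 2 + b' ^+ 2 = (a' ^+ 2 + b' ^+ 2) * (c ^+ 2 + s ^+ 2)); last by rewrite cs mulr1.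
ring.
Qed.

Lemma phase_le1 : 2 * I <= (a ^+ 2 + b ^+ 2) + (a' ^+ 2 + b' ^+ 2).
Proof. by rewrite -subr_ge0 phase_dist addr_ge0 ?sqr_ge0. Qed.

Lemma phase_norm : 2 * `|J| <= (a ^+ 2 + b ^+ 2) + (a' ^+ 2 + b' ^+ 2).
Proof.
have := cos2Dsin2 th; rewrite /J; set c := cos th; set s := sin th => cs.
have H (e : R) : e ^+ 2 = 1 ->
    2 * (e * ((b * a' - a * b') * c - (a * a' + b * b') * s)) <= (a ^+ 2 + b ^+ 2) + (a' ^+ 2 + b' ^+ 2).
  move=> e1; rewrite -subr_ge0.
  have -> : (a ^+ 2 + b ^+ 2) + (a' ^+ 2 + b' ^+ 2) =
    (a ^+ 2 + b ^+ 2) * e ^+ 2 + (a' ^+ 2 + b' ^+ 2) * (c ^+ 2 + s ^+ 2) by rewrite e1 cs !mulr1.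
  rewrite (_ : _ - _ = (e * b - (a' * c - b' * s)) ^+ 2 + (e * a + (a' * s + b' * c)) ^+ 2).
    by rewrite addr_ge0 ?sqr_ge0.
  ring.
case: (ger0P ((b * a' - a * b') * c - (a * a' + b * b') * s)) => _.
  by have := H 1 (expr1n _ _); rewrite mul1r.
by have := H (-1) _; rewrite mulN1r; apply; rewrite sqrrN expr1n.
Qed.

(** Cazenave--Haraux applied to [z] and [e^(i th) z']: the rotation does not change the logarithm of
    the modulus. *)
Lemma phase_log : `|J * (lnsq a b - lnsq a' b')| <= 2 * ((a ^+ 2 + b ^+ 2) + (a' ^+ 2 + b' ^+ 2) - 2 * I).
Proof.
rewrite phase_dist; set A := a' * cos th - b' * sin th; set B := a' * sin th + b' * cos th.
have -> : lnsq a' b' = lnsq A B.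
  rewrite /lnsq; congr ln; rewrite /A /B; have := cos2Dsin2 th.
  set c := cos th; set s := sin th => cs.
  rewrite -[LHS]mulr1 -cs; ring.
have -> : J = b * A - a * B by rewrite /J /A /B; ring.
exact: lnsq_cross.
Qed.

End pointwise.

Definition ss (a b : E -> R) (x : E) : R := a x ^+ 2 + b x ^+ 2.

(** The value [2 wig] would have under exact symmetry: by [phase_dist], [massk - 2 wig] is the
    integral of [|psi(x) - e^(i p.(x - y)) psi(y)|^2] against [X] and [k]. *)
Definition massk X k (q : E) (a b : E -> R) : R :=
  \int[mu2]_z ((ss a b z.1 + ss a b z.2) * pk X (fun w => k (w - 2 *: q)) z).

Definition rateint (lam : R) (U : E -> R) X k (w q p : E) (a b : E -> R) : R :=
  \int[mu2]_z ((b z.1 * a z.2 - a z.1 * b z.2) *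
     rate cos lam U X k w q p (fun x => lnsq (a x) (b x)) z -
   (a z.1 * a z.2 + b z.1 * b z.2) *
     rate sin lam U X k w q p (fun x => lnsq (a x) (b x)) z).

Variables (a b : E -> R).
Hypotheses (ha : L2r a) (hb : L2r b).

Lemma ss_ge0 x : 0 <= ss a b x.
Proof. exact: sumsq_ge0. Qed.

Lemma itg_ss : itg mu (ss a b).
Proof. by apply: itgD; [case: ha|case: hb]. Qed.

Variables (X k : E -> R) (q p : E).
Hypotheses (tX : test_function X) (tk : test_function k).
Hypotheses (X0 : forall x, 0 <= X x) (k0 : forall x, 0 <= k x).

Let kpk : kern (pk X (fun w => k (w - 2 *: q))).
Proof. by apply: kern_pk => //; exact: test_shift. Qed.

Lemma itg_massk1 : itg mu2 (fun z => ss a b z.1 * pk X (fun w => k (w - 2 *: q)) z).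
Proof.
have := itg_kern (L1loc_itg itg_ss) (L1loc_cst 1) kpk.
by congr (itg mu2); apply/funext => z; rewrite mulr1.
Qed.

Lemma itg_massk2 : itg mu2 (fun z => ss a b z.2 * pk X (fun w => k (w - 2 *: q)) z).
Proof.
have := itg_kern (L1loc_cst 1) (L1loc_itg itg_ss) kpk.
by congr (itg mu2); apply/funext => z; rewrite mul1r.
Qed.

Lemma itg_massk : itg mu2 (fun z => (ss a b z.1 + ss a b z.2) * pk X (fun w => k (w - 2 *: q)) z).
Proof.
have := itgD itg_massk1 itg_massk2.
by congr (itg mu2); apply/funext => z; exact/esym/mulrDl.
Qed.

Lemma itg_wig : itg mu2 (fun z => (a z.1 * a z.2 + b z.1 * b z.2) * ker cos X k q p z +
               (b z.1 * a z.2 - a z.1 * b z.2) * ker sin X k q p z).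
Proof.
have La := L2r_L1loc ha; have Lb := L2r_L1loc hb.
have kc := kern_ker q p (@smooth1_cos R) tX tk.
have ks := kern_ker q p (@smooth1_sin R) tX tk.
have := itgD (itgD (itg_kern La La kc) (itg_kern Lb Lb kc)) (itgB (itg_kern Lb La ks) (itg_kern La Lb ks)).
by congr (itg mu2); apply/funext => z; ring.
Qed.

Lemma massk_wig : massk X k q a b - 2 * wig X k q p a b =
  \int[mu2]_z (((ss a b z.1 + ss a b z.2) - 2 * ((a z.1 * a z.2 + b z.1 * b z.2) * cos (dotv p (z.1 - z.2)) +
     (b z.1 * a z.2 - a z.1 * b z.2) * sin (dotv p (z.1 - z.2)))) * (X (z.1 - z.2) * k (z.1 + z.2 - 2 *: q))).
Proof.
rewrite /massk /wig -intZ; last exact: itg_wig.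
rewrite -intB; [|exact: itg_massk|exact: itgZ itg_wig].
by apply: int_eq => z; rewrite /ker /pk; ring.
Qed.

Lemma massk_wig_ge0 : 0 <= massk X k q a b - 2 * wig X k q p a b.
Proof.
rewrite massk_wig; apply: int_ge0 => z; rewrite mulr_ge0 ?mulr_ge0// subr_ge0.
exact: phase_le1.
Qed.

Lemma measurable_rate (h : R -> R) lam U w e : smooth1 h -> continuous U -> measurable_fun setT e ->
  measurable_fun setT (rate h lam U X k w q p e).
Proof.
move=> sh cU me; have mU := continuous_rV_measurable cU.
apply: measurable_funD.
  apply: measurable_funM => //; apply: measurable_sum => j.
  by case: (kern_ker q p sh (test_partial j tX) (test_partial j tk)).
apply: measurable_funM; last by case: (kern_ker q p sh tX tk).
apply: measurable_funD; first apply: measurable_funB; first apply: measurable_funB.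
- exact: (measurable_fun1 mU).
- exact: (measurable_fun2 mU).
- exact: (measurable_sub (f := dotv w) (continuous_rV_measurable (@continuous_dotv _ _ w))).
- apply: measurable_funM => //; apply: measurable_funB; [exact: (measurable_fun1 me)|exact: (measurable_fun2 me)].
Qed.

(** The kinetic and potential terms use [2 |J| <= ss x + ss y] and the Schur identities, the kernels
    being dominated by functions of [x - y] or [x + y] up to a shift; the logarithmic term uses
    [phase_log]. The weight [W] allows for growth of the remainder. Both forms of the bound are
    required, since the density may sit at [x] or at [y]. *)
Lemma rate_bound (lam : R) (U : E -> R) (w : E) (K1 s1 s2 : R) (c1 c2 : E) (h1 h2 W : E -> R) :
  continuous U -> s1 = 1 \/ s1 = -1 -> s2 = 1 \/ s2 = -1 ->
  itg mu h1 -> (forall x, 0 <= h1 x) -> itg mu h2 -> (forall x, 0 <= h2 x) ->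
  (forall x, 0 <= W x) -> itg mu (fun x => W x * ss a b x) ->
  (forall x y, 2 * \sum_j `|partial j X (x - y) * partial j k (x + y - 2 *: q)| <= K1 * h1 (c1 + x + s1 *: y)) ->
  (forall x y, `|U x - U y - dotv w (x - y)| * (X (x - y) * k (x + y - 2 *: q)) <= W x * h2 (c2 + x + s2 *: y)) ->
  (forall x y, `|U x - U y - dotv w (x - y)| * (X (x - y) * k (x + y - 2 *: q)) <= W y * h2 (c2 + x + s2 *: y)) ->
  `|rateint lam U X k w q p a b| <= K1 * \int[mu]_x ss a b x * \int[mu]_x h1 x +
    \int[mu]_x (W x * ss a b x) * \int[mu]_x h2 x +
    2 * `|lam| * (massk X k q a b - 2 * wig X k q p a b).
Proof.
move=> cU s1E s2E ih1 h10 ih2 h20 W0 iW kin pot1 pot2.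
have is0 := itg_ss; have ss0 := ss_ge0.
have Ws0 x : 0 <= W x * ss a b x by rewrite mulr_ge0.
have i1 := itg_schur1 c1 s1E is0 ih1 ss0 h10; have e1 := int_schur1 c1 s1E is0 ih1 ss0 h10.
have i2 := itg_schur2 c1 s1 is0 ih1 ss0 h10; have e2 := int_schur2 c1 s1 is0 ih1 ss0 h10.
have i3 := itg_schur1 c2 s2E iW ih2 Ws0 h20; have e3 := int_schur1 c2 s2E iW ih2 Ws0 h20.
have i4 := itg_schur2 c2 s2 iW ih2 Ws0 h20; have e4 := int_schur2 c2 s2 iW ih2 Ws0 h20.
have i5 := itg_massk; have i6 := itg_wig.
rewrite -/(massk X k q a b) in i5.
set D := massk X k q a b - _; set m := \int[mu]_x ss a b x; set H1 := \int[mu]_x h1 x.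
set H2 := \int[mu]_x h2 x; set w2 := \int[mu]_x (W x * ss a b x).
rewrite -/m -/H1 in e1 e2; rewrite -/w2 -/H2 in e3 e4.
pose B z := K1 / 2 * (ss a b z.1 * h1 (c1 + z.1 + s1 *: z.2)) + K1 / 2 * (ss a b z.2 * h1 (c1 + z.1 + s1 *: z.2)) +
  (2^-1 * (W z.1 * ss a b z.1 * h2 (c2 + z.1 + s2 *: z.2)) + 2^-1 * (W z.2 * ss a b z.2 * h2 (c2 + z.1 + s2 *: z.2))) +
  2 * `|lam| * ((ss a b z.1 + ss a b z.2) * pk X (fun w => k (w - 2 *: q)) z -
    2 * ((a z.1 * a z.2 + b z.1 * b z.2) * ker cos X k q p z +
               (b z.1 * a z.2 - a z.1 * b z.2) * ker sin X k q p z)).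
have j1 := itgD (itgZ (K1 / 2) i1) (itgZ (K1 / 2) i2).
have j2 := itgD (itgZ 2^-1 i3) (itgZ 2^-1 i4).
have j3 := itgZ (2 * `|lam|) (itgB i5 (itgZ 2 i6)).
have iB : itg mu2 B by exact: itgD (itgD j1 j2) j3.
have eB : \int[mu2]_z B z = K1 * m * H1 + w2 * H2 + 2 * `|lam| * D.
  rewrite /B (intD (itgD j1 j2) j3) (intD j1 j2) (intD (itgZ (K1 / 2) i1) (itgZ (K1 / 2) i2)).
  rewrite (intD (itgZ 2^-1 i3) (itgZ 2^-1 i4)) !intZ//; try exact: (itgB i5 (itgZ 2 i6)).
  rewrite e1 e2 e3 e4 (intB i5 (itgZ 2 i6)) (intZ _ i6) /D /massk /wig.
  by field.
rewrite -eB /rateint; have mab : measurable_fun setT (fun x => lnsq (a x) (b x)).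
  apply: (measurableT_comp (@measurable_ln R)).
  by apply: measurable_funD; apply: measurable_funX; exact: L2r_measurable.
have ma := L2r_measurable ha; have mb := L2r_measurable hb.
have mm (f g : E -> R) : measurable_fun setT f -> measurable_fun setT g ->
    measurable_fun setT (fun z : E * E => f z.1 * g z.2).
  by move=> mf mg; apply: measurable_funM; [exact: (measurable_fun1 mf)|exact: (measurable_fun2 mg)].
apply: int_norm => //.
  apply: measurable_funB; apply: measurable_funM.
  - by apply: measurable_funB; exact: mm.
  - by apply: measurable_rate => //; exact: smooth1_cos.
  - by apply: measurable_funD; exact: mm.
  - by apply: measurable_rate => //; exact: smooth1_sin.
move=> [x y]; rewrite /B /rate !kerE /pk /fst /snd.
set u := x - y; set v := x + y - 2 *: q; set th := dotv p u.
under eq_bigr do rewrite kerE -/u -/v -/th.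
under [X in _ - _ * (_ * X + _)]eq_bigr do rewrite kerE -/u -/v -/th.
set J := (b x * a y - a x * b y) * cos th - (a x * a y + b x * b y) * sin th.
set S := \sum_j partial j X u * partial j k v.
have -> : \sum_j partial j X u * cos th * partial j k v = S * cos th.
  by rewrite mulr_suml; apply: eq_bigr => j _; ring.
have -> : \sum_j partial j X u * sin th * partial j k v = S * sin th.
  by rewrite mulr_suml; apply: eq_bigr => j _; ring.
set L := lnsq (a x) (b x) - lnsq (a y) (b y); set P := U x - U y - dotv w u.
have -> : (b x * a y - a x * b y) * (-2 * (S * cos th) + (P + lam * L) * (X u * cos th * k v)) -
   (a x * a y + b x * b y) * (-2 * (S * sin th) + (P + lam * L) * (X u * sin th * k v)) =
   J * (-2 * S) + J * P * (X u * k v) + lam * (J * L) * (X u * k v) by rewrite /J; ring.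
have nJ : 2 * `|J| <= ss a b x + ss a b y by exact: phase_norm.
have lJ := phase_log (a x) (b x) (a y) (b y) th; rewrite -/J -/L in lJ.
have Xk0 : 0 <= X u * k v by rewrite mulr_ge0.
apply: le_trans (ler_normD _ _) _; apply: lerD; first apply: le_trans (ler_normD _ _) _; first apply: lerD.
- have := kin x y; rewrite -/u -/v; set H := h1 _ => hk.
  have S1 : 2 * `|S| <= K1 * H by apply: le_trans hk; rewrite ler_pM2l//; exact: ler_norm_sum.
  rewrite !normrM normrN (ger0_norm (ltW (ltr0Sn R 1))).
  apply: (@le_trans _ _ (`|J| * (K1 * H))); first by rewrite ler_wpM2l.
  have KH0 : 0 <= K1 * H by apply: le_trans S1; rewrite mulr_ge0.
  have := ler_wpM2r KH0 nJ; lra.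
- have := pot1 x y; have := pot2 x y; rewrite -/u -/v -/P; set H := h2 _ => p2 p1.
  rewrite !normrM (ger0_norm (X0 _)) (ger0_norm (k0 _)) -mulrA.
  have PX0 : 0 <= `|P| * (X u * k v) by rewrite mulr_ge0.
  have := ler_wpM2r PX0 nJ; have := ler_wpM2l (ss0 x) p1; have := ler_wpM2l (ss0 y) p2.
  set PX := `|P| * _; lra.
- rewrite !normrM (ger0_norm (X0 _)) (ger0_norm (k0 _)) -(normrM J).
  have := ler_wpM2l (normr_ge0 lam) (ler_wpM2r Xk0 lJ).
  rewrite -/(ss a b x) -/(ss a b y) !mulrA => h; apply: le_trans h _.
  by rewrite le_eqVlt; apply/orP; left; apply/eqP; ring.
Qed.

End rate_estimates.

(** * Cutoffs of small slope *)

Section cutoff.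
Context {R : realType} {d : nat}.
Notation E := 'rV[R]_d.

(** In each coordinate, [1 / (1 - t) + 1 / (1 + t) = 2 / (1 - t^2) >= 2]. *)
Lemma bump_le0 (x : E) : bump x <= bump (0 : E).
Proof.
apply: ler_prod => j _; rewrite mulr_ge0 ?flat_ge0//= !mxE subr0 addr0.
set t := x ord0 j; rewrite /flat ltr01.
case: ifPn => t1; last by rewrite mul0r mulr_ge0// mulr_ge0// expR_ge0.
case: ifPn => t2; last by rewrite mulr0 mulr_ge0// mulr_ge0// expR_ge0.
rewrite !expr0 !mul1r -!expRD ler_expR invr1 -!opprD lerN2.
have -> : (1 - t)^-1 + (1 + t)^-1 = 2 / ((1 - t) * (1 + t)).
  by field; rewrite !gt_eqF.
by rewrite ler_pdivlMr ?mulr_gt0//; have := sqr_ge0 t; lra.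
Qed.

(** The bump normalised to be [1] at [0] and dilated by [r]: both the slope and the deviation from
    [1] scale like [1 / r]. *)
Lemma cutoff_family : exists2 L : R, 0 < L & forall r : R, 0 < r -> exists k : E -> R,
  [/\ test_function k, forall v, 0 <= k v <= 1, forall j v, `|partial j k v| <= L / r &
   forall v, `|1 - k v| <= L / r * `|v|].
Proof.
have b0 : 0 < bump (0 : E) by apply: bump_gt0; rewrite normr0.
pose c (x : E) : R := bump x * (bump (0 : E))^-1.
have tc : test_function c.
  have := test_mul (@test_bump R d) (smooth_cst (bump (0 : E))^-1).
  by congr test_function; apply/funext.
have [L L0 HL] := test_lipschitz tc.
have /choice [C HC] : forall j, exists C : R, 0 < C /\ forall x, `|partial j c x| <= C.
  by move=> j; have [C C0 H] := test_bounded (test_partial j tc); exists C.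
pose S := \sum_j C j.
have S0 : 0 <= S by apply: sumr_ge0 => j _; case: (HC j) => /ltW.
exists (L + S); first by rewrite ltr_wpDr.
move=> r r0; have r1 : r^-1 != 0 by rewrite invr_eq0 gt_eqF.
exists (fun v => c (0 + r^-1 *: v)); split.
- exact: test_affine.
- move=> v; rewrite /c divr_ge0 ?bump_ge0 ?(ltW b0)//= ler_pdivrMr// mul1r; exact: bump_le0.
- move=> j v; rewrite (partial_affineE j _ _ _ (test_smooth tc)) normrM ger0_norm ?invr_ge0 ?(ltW r0)//.
  rewrite mulrC ler_pM2r ?invr_gt0//; case: (HC j) => _ h; apply: le_trans (h _) _.
  rewrite ler_wpDl ?(ltW L0)// /S (bigD1 j)//= lerDl sumr_ge0// => i _; by case: (HC i) => /ltW.
- move=> v; have c1 : c 0 = 1 by rewrite /c divff// gt_eqF.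
  rewrite -{1}c1; apply: le_trans (HL _ _) _.
  rewrite distrC subr0 add0r normrZ ger0_norm ?invr_ge0 ?(ltW r0)// mulrA ler_wpM2r//.
  by rewrite ler_wpM2r ?invr_ge0 ?(ltW r0)// lerDl.
Qed.

End cutoff.

(** * Conservation of mass *)

Section mass.
Context {R : realType} {d : nat}.
Notation E := 'rV[R]_d.
Notation mu := (@lebesgue_rV R d).
Notation mu2 := (lebesgue_rV d \x lebesgue_rV d)%E.
Implicit Types (X k f g : E -> R).

Lemma sqnorm_ge0 (x : E) : 0 <= sqnorm x.
Proof. by apply: sumr_ge0 => j _; exact: sqr_ge0. Qed.

Lemma sqr_coord_le (x : E) j : x ord0 j ^+ 2 <= sqnorm x.
Proof. by rewrite /sqnorm (bigD1 j)//= lerDl sumr_ge0// => i _; exact: sqr_ge0. Qed.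

Lemma norm_le_sqnorm (x : E) : `|x| <= 1 + sqnorm x.
Proof.
apply/normrV_le; first by rewrite addr_ge0// sqnorm_ge0.
move=> j; apply: le_trans (lerD (lexx 1) (sqr_coord_le x j)).
rewrite -real_normK ?num_real//; have := sqr_ge0 (`|x ord0 j| - 1); have : 0 <= `|x ord0 j| by [].
by nra.
Qed.

(** Carries a small oscillation at time [t] over to nearby times, where the state is close in
    L^2. *)
Lemma dev2_close f g e k : L2r f -> L2r g -> mollifier e k ->
  dev2 f k <= 2 * dev2 g k + 8 * \int[mu]_x ((f x - g x) ^+ 2).
Proof.
move=> L2f L2g mk; have [mr ir] := L2rB L2f L2g; pose h x := (f x - g x) ^+ 2.
have h0 x : 0 <= h x by exact: sqr_ge0.
have [i1 e1] := schur_sub1 ir (mol_itg mk) h0 (mol_ge0 mk).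
have [i2 e2] := schur_sub2 ir (mol_itg mk) h0 (mol_ge0 mk).
rewrite (mol_int mk) mulr1 in e1 e2.
have i3 := itg_dev2 L2g mk.
apply: (@le_trans _ _ (\int[mu2]_z (2 * ((g z.1 - g z.2) ^+ 2 * k (z.1 - z.2)) +
   4 * (h z.1 * k (z.1 - z.2)) + 4 * (h z.2 * k (z.1 - z.2))))); last first.
  rewrite intD; [|by apply: itgD; exact: itgZ|exact: itgZ].
  rewrite intD; [|exact: itgZ|exact: itgZ].
  by rewrite !intZ// e1 e2 /dev2 /h; lra.
apply: int_le; [exact: itg_dev2 mk|by apply: itgD; [apply: itgD|]; exact: itgZ|].
move=> [x y]; rewrite /fst /snd !mulrA -!mulrDl; apply: ler_wpM2r; first exact: mol_ge0 mk _.
rewrite /h; set u := f x - g x; set v := f y - g y; set w := g x - g y.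
have -> : f x - f y = w + (u - v) by rewrite /w /u /v; ring.
have := sqr_ge0 (w - (u - v)); have := sqr_ge0 (u + v); nra.
Qed.

Section local.
Variables (a b : E -> R) (M ep : R) (X k : E -> R) (Lr : R).
Hypotheses (ha : L2r a) (hb : L2r b) (mX : mollifier ep X) (ep1 : ep <= 1).
Hypothesis mM : \int[mu]_x ss a b x <= M.
Hypothesis wi : itg mu (fun x => sqnorm x * ss a b x).
Hypothesis wM : \int[mu]_x (sqnorm x * ss a b x) <= M.
Hypotheses (tk : test_function k) (k01 : forall v, 0 <= k v <= 1).
Hypotheses (Lr0 : 0 <= Lr) (kL : forall j v, `|partial j k v| <= Lr) (k1 : forall v, `|1 - k v| <= Lr * `|v|).

Let k0 v : 0 <= k v. Proof. by case/andP: (k01 v). Qed.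
Let tX := mol_test mX.
Let X0 := mol_ge0 mX.

Let shift0 (x y : E) : x + y - 2 *: (0 : E) = x + y.
Proof. by rewrite scaler0 subr0. Qed.

(** At the origin of phase space there is no phase: the defect is the oscillation weighted by
    [k <= 1]. *)
Lemma massk_wig_dev : massk X k 0 a b - 2 * wig X k 0 0 a b <= dev2 a X + dev2 b X.
Proof.
rewrite massk_wig// /dev2 -intD; try exact: itg_dev2 mX.
have i1 := itgB (itg_massk ha hb 0 tX tk) (itgZ 2 (itg_wig ha hb 0 0 tX tk)).
apply: int_le; [|apply: itgD; exact: itg_dev2 mX|].
  move: i1; congr (itg mu2); apply/funext => z; rewrite /ker /pk; ring.
move=> [x y]; rewrite /fst /snd phase_dist shift0.
have -> : dotv (0 : E) (x - y) = 0 by rewrite /dotv big1// => j _; rewrite mxE mul0r.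
rewrite cos0 sin0 !mulr1 !mulr0 subr0 add0r mulrA -mulrDl.
by rewrite ler_piMr ?mulr_ge0 ?addr_ge0 ?sqr_ge0//; case/andP: (k01 (x + y)).
Qed.

Lemma sum_le (x y : E) : `|x - y| <= ep -> `|x + y| <= 3 + 2 * sqnorm x /\ `|x + y| <= 3 + 2 * sqnorm y.
Proof.
move=> xy; have := norm_le_sqnorm x; have := norm_le_sqnorm y.
have h1 : `|x + y| <= 2 * `|x| + `|x - y|.
  have -> : x + y = x + x - (x - y) by apply/rowP => j; rewrite !mxE; ring.
  by apply: le_trans (ler_normB _ _) _; apply: lerD => //; apply: le_trans (ler_normD _ _) _; lra.
have h2 : `|x + y| <= 2 * `|y| + `|x - y|.
  have -> : x + y = y + y + (x - y) by apply/rowP => j; rewrite !mxE; ring.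
  by apply: le_trans (ler_normD _ _) _; apply: lerD => //; apply: le_trans (ler_normD _ _) _; lra.
by move: xy ep1 h1 h2; lra.
Qed.

(** Without the cutoff, [massk] would be twice the mass, as [X] has integral [1]. On the support of
    [X] the error [Lr |x + y|] is dominated by [1] and the square of either variable, so the second
    moment pays for it. *)
Lemma mass_massk : `|2 * \int[mu]_x ss a b x - massk X k 0 a b| <= 10 * M * Lr.
Proof.
have is0 := itg_ss ha hb; have s0 := ss_ge0 a b.
pose V x := (3 + 2 * sqnorm x) * ss a b x.
have V0 x : 0 <= V x by rewrite mulr_ge0// addr_ge0// mulr_ge0// sqnorm_ge0.
have iV : itg mu V.
  by have := itgD (itgZ 3 is0) (itgZ 2 wi); congr (itg mu); apply/funext => x; rewrite /V; ring.
have VM : \int[mu]_x V x <= 5 * M.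
  have -> : \int[mu]_x V x = 3 * \int[mu]_x ss a b x + 2 * \int[mu]_x (sqnorm x * ss a b x).
    by rewrite -!intZ// -intD; [apply: int_eq => x; rewrite /V; ring|exact: itgZ|exact: itgZ].
  by move: mM wM; lra.
have iX := mol_itg mX.
have [i1 e1] := schur_sub1 is0 iX s0 X0; have [i2 e2] := schur_sub2 is0 iX s0 X0.
have [i3 e3] := schur_sub1 iV iX V0 X0; have [i4 e4] := schur_sub2 iV iX V0 X0.
rewrite (mol_int mX) mulr1 in e1 e2 e3 e4.
have i5 := itg_massk ha hb 0 tX tk.
have -> : 2 * \int[mu]_x ss a b x - massk X k 0 a b = \int[mu2]_z (ss a b z.1 * X (z.1 - z.2) +
    ss a b z.2 * X (z.1 - z.2) - (ss a b z.1 + ss a b z.2) * pk X (fun w => k (w - 2 *: 0)) z).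
  rewrite (intB (itgD i1 i2) i5) (intD i1 i2) e1 e2 /massk; congr (_ - _); ring.
apply: (@le_trans _ _ (\int[mu2]_z (Lr * (V z.1 * X (z.1 - z.2)) + Lr * (V z.2 * X (z.1 - z.2))))); last first.
  rewrite intD; [|exact: itgZ|exact: itgZ]; rewrite !intZ// e3 e4.
  have := ler_wpM2l Lr0 VM; lra.
apply: int_norm.
- exact: itg_measurable (itgB (itgD i1 i2) i5).
- by apply: itgD; exact: itgZ.
move=> [x y]; rewrite /pk /fst /snd shift0.
have [xy|xy] := leP ep `|x - y|; first by rewrite (mol_supp mX xy) mul0r !mulr0 subr0 addr0 normr0.
have [h1 h2] := sum_le (ltW xy).
have -> : ss a b x * X (x - y) + ss a b y * X (x - y) - (ss a b x + ss a b y) * (X (x - y) * k (x + y)) =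
  (ss a b x + ss a b y) * X (x - y) * (1 - k (x + y)) by ring.
rewrite normrM (ger0_norm (mulr_ge0 (addr_ge0 (s0 x) (s0 y)) (X0 _))).
apply: le_trans (ler_wpM2l _ (k1 (x + y))) _; first by rewrite mulr_ge0// addr_ge0.
have K1 := ler_wpM2l Lr0 h1; have K2 := ler_wpM2l Lr0 h2.
have P1 := ler_wpM2l (mulr_ge0 (s0 x) (X0 (x - y))) K1.
have P2 := ler_wpM2l (mulr_ge0 (s0 y) (X0 (x - y))) K2.
apply: le_trans (_ : _ <= ss a b x * X (x - y) * (Lr * `|x + y|) + ss a b y * X (x - y) * (Lr * `|x + y|)) _.
  by rewrite le_eqVlt; apply/orP; left; apply/eqP; ring.
apply: le_trans (lerD P1 P2) _.
by rewrite /V le_eqVlt; apply/orP; left; apply/eqP; ring.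
Qed.

(* Here [X] is the approximate identity and [k] the cutoff, so that [wig] approximates the mass. *)
Lemma mass_wig : `|2 * \int[mu]_x ss a b x - 2 * wig X k 0 0 a b| <= dev2 a X + dev2 b X + 10 * M * Lr.
Proof.
have h1 := mass_massk; have h2 := massk_wig_dev.
have h3 := massk_wig_ge0 ha hb 0 0 tX tk X0 k0.
move: h1; rewrite !ler_norml => /andP[h4 h5].
by apply/andP; split; lra.
Qed.

(** The kinetic term is small because [k] is nearly flat, the potential one because [|x - y| < ep]
    on the support of [X], the growth of [U] being absorbed by the second moment, and the
    logarithmic one by [massk_wig_dev]. *)
Lemma static_rate (lam CU : R) (U : E -> R) : continuous U -> 0 <= CU ->
  (forall x y, `|U x - U y| <= CU * `|x - y| * (1 + `|x| + `|y|)) ->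
  0 <= M -> 0 < ep ->
  `|rateint lam U X k 0 0 0 a b| <= 2 * Lr * M * \int[mu]_x (\sum_j `|partial j X x|) +
    6 * CU * ep * M + 2 * `|lam| * (dev2 a X + dev2 b X).
Proof.
move=> cU CU0 HU M0 ep0.
pose h1 x := \sum_j `|partial j X x|.
pose W (x : E) := CU * ep * (4 + 2 * sqnorm x).
have ih1 : itg mu h1 by apply: itg_sum => j; apply: itg_norm; exact: test_itg (test_partial j tX).
have h10 x : 0 <= h1 x by apply: sumr_ge0.
have CE0 : 0 <= CU * ep by rewrite mulr_ge0// ltW.
have W0 x : 0 <= W x by rewrite mulr_ge0// addr_ge0// mulr_ge0// sqnorm_ge0.
have is0 := itg_ss ha hb.
have iW : itg mu (fun x => W x * ss a b x).
  have := itgD (itgZ (CU * ep * 4) is0) (itgZ (CU * ep * 2) wi).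
  by congr (itg mu); apply/funext => x; rewrite /W; ring.
have WM : \int[mu]_x (W x * ss a b x) <= 6 * CU * ep * M.
  have -> : \int[mu]_x (W x * ss a b x) = CU * ep * 4 * \int[mu]_x ss a b x + CU * ep * 2 * \int[mu]_x (sqnorm x * ss a b x).
    by rewrite -!intZ// -intD; [apply: int_eq => x; rewrite /W; ring|exact: itgZ|exact: itgZ].
  have := ler_wpM2l CE0 mM; have := ler_wpM2l CE0 wM; lra.
have sN : (-1 : R) = 1 \/ (-1 : R) = -1 by right.
have dot0 z : dotv (0 : E) z = 0 by rewrite /dotv big1// => j _; rewrite mxE mul0r.
have aff (x y : E) : 0 + x + (-1) *: y = x - y by rewrite add0r scaleN1r.
have pot x y : `|U x - U y - dotv 0 (x - y)| * (X (x - y) * k (x + y - 2 *: 0)) <=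
    CU * ep * (1 + `|x| + `|y|) * X (x - y).
  rewrite dot0 subr0 shift0; have [xy|xy] := leP ep `|x - y|.
    by rewrite (mol_supp mX xy) mul0r !mulr0.
  apply: ler_pM; rewrite ?mulr_ge0//.
    apply: le_trans (HU x y) _; rewrite ler_wpM2r ?addr_ge0// ler_wpM2l//; exact: ltW.
  by rewrite ler_piMr//; case/andP: (k01 (x + y)).
have H := rate_bound ha hb 0 tX tk X0 k0 lam (w := 0) (q := 0) (K1 := 2 * Lr)
   (c1 := 0) (c2 := 0) cU sN sN ih1 h10 (mol_itg mX) X0 W0 iW.
apply: le_trans (H _ _ _) _.
- move=> x y; rewrite aff shift0 -mulrA ler_pM2l// /h1 mulr_sumr; apply: ler_sum => j _.
  by rewrite normrM mulrC ler_wpM2r.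
- move=> x y; apply: le_trans (pot x y) _; rewrite aff.
  have [xy|xy] := leP ep `|x - y|; first by rewrite (mol_supp mX xy) !mulr0.
  rewrite ler_wpM2r// /W ler_wpM2l//.
  have yE : x - (x - y) = y by apply/rowP => j; rewrite !mxE; ring.
  by have := ler_normB x (x - y); rewrite yE; have := norm_le_sqnorm x; move: xy ep1; lra.
- move=> x y; apply: le_trans (pot x y) _; rewrite aff.
  have [xy|xy] := leP ep `|x - y|; first by rewrite (mol_supp mX xy) !mulr0.
  rewrite ler_wpM2r// /W ler_wpM2l//.
  by have := norm_le_sqnorm y; have := ler_normD (x - y) y; rewrite subrK; move: xy ep1; lra.
rewrite (mol_int mX) mulr1; apply: lerD; first apply: lerD => //.
- by rewrite ler_wpM2r ?int_ge0// ler_wpM2l// mulr_ge0.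
- by rewrite ler_wpM2l// ?mulr_ge0//; exact: massk_wig_dev.
Qed.

End local.

Variables (lam : R) (U : E -> R) (s0 s1 M CU : R) (a b : R -> E -> R).
Hypotheses (cU : continuous U) (hb : basic s0 s1 M a b) (hh : hamiltonian lam U s0 s1 a b).
Hypothesis (s01 : s0 < s1).
Hypotheses (CU0 : 0 <= CU) (HU : forall x y, `|U x - U y| <= CU * `|x - y| * (1 + `|x| + `|y|)).

Let m t := \int[mu]_x ss (a t) (b t) x.

Lemma path0 t : path (fun=> 0 : E) (fun=> 0 : E) 0 t.
Proof.
split.
- move=> s _ j; under eq_fun do rewrite mxE; rewrite mxE; exact: is_derive_cst.
- move=> s _ j; under eq_fun do rewrite mxE; rewrite mxE oppr0; exact: is_derive_cst.
- by exists 0 => s _; rewrite normr0.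
Qed.

(** [m] is close to [wig], whose derivative is at most [e] near [t]; so
    [|m s - m t| <= e |s - t| + rho] for every [rho]. The order of choices matters: the
    neighbourhood of [t] depends on [e] alone, through continuity in L^2; only then, for given [s]
    and [rho], come [ep], [X] and finally the slope [Lr], which depends on [X]. *)
Lemma mass_derive t : s0 < t < s1 -> is_derive t (1 : R) m 0.
Proof.
move=> ht; have inn r : s0 < r < s1 -> s0 <= r <= s1 by move=> /andP[h1 h2]; rewrite !ltW.
have M0 : 0 <= M by apply: (basic_M hb); exact: ltW.
suff D : is_derive t (1 : R) (fun s => m s - m t) 0.
  have := is_deriveD D (@is_derive_cst _ _ _ (m t) t 1); rewrite addr0.
  by congr is_derive; apply/funext => s; rewrite !fctE /= subrK.
apply: is_derive_small; first by rewrite subrr.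
move=> e e0.
have e3 : 0 < e / 3 by rewrite divr_gt0.
have l0 : 0 < 24 * `|lam| + 1 by rewrite ltr_wpDl// mulr_ge0.
(* [24] is twice [12]: near [t] the two oscillations add up to at most [12 sg], of which [4 sg] come
   from time [t] and [8 sg] from the distance to it. *)
pose sg := e / 3 / (24 * `|lam| + 1).
have sg0 : 0 < sg by rewrite divr_gt0.
have [de1 de10 Hd] := bas_c hb (inn t ht) sg0.
have [de2 de20 Hin] : exists2 d5 : R, 0 < d5 & forall s, `|s - t| < d5 -> s0 < s < s1.
  case/andP: (ht) => h1 h2; exists (Num.min (t - s0) (s1 - t)).
    by rewrite lt_min !subr_gt0 h1.
  move=> s; rewrite lt_min ltr_norml => /andP[/andP[k1 _]] /ltr_normlP[_ k2]; apply/andP; split; lra.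
pose de := Num.min de1 de2; have de0 : 0 < de by rewrite lt_min de10.
have dein s : `|s - t| < de -> s0 < s < s1 by rewrite lt_min => /andP[_]; exact: Hin.
have dedist s : `|s - t| < de -> dist2 a b s t <= sg.
  by move=> hs; apply: Hd; [exact/inn/dein|move: hs; rewrite lt_min => /andP[]].
exists de => // s hs; have ins := dein s hs.
apply/ler_addgt0Pr => rho rho0.
have r8 : 0 < rho / 8 by rewrite divr_gt0.
have La r (hr : s0 < r < s1) := bas_a hb (inn r hr); have Lb r (hr : s0 < r < s1) := bas_b hb (inn r hr).
pose tau := Num.min sg (rho / 8); have tau0 : 0 < tau by rewrite lt_min sg0.
have [ea ea0 Ha] := dev2_small (La t ht) tau0; have [eb eb0 Hb] := dev2_small (Lb t ht) tau0.
have [ec ec0 Hc] := dev2_small (La s ins) r8; have [ed ed0 Hdd] := dev2_small (Lb s ins) r8.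
have c0 : 0 < 6 * CU * M + 1 by rewrite ltr_wpDl// !mulr_ge0.
pose ep := Num.min (Num.min 1 (e / 3 / (6 * CU * M + 1))) (Num.min (Num.min ea eb) (Num.min ec ed)).
have ep0 : 0 < ep by rewrite !lt_min ltr01 ea0 eb0 ec0 ed0 divr_gt0.
have [ep1 ep2 epa epb epc] : [/\ ep <= 1, ep <= e / 3 / (6 * CU * M + 1), ep <= ea, ep <= eb & ep <= ec].
  by rewrite /ep; split; rewrite !ge_min lexx ?orbT.
have epd : ep <= ed by rewrite /ep !ge_min lexx ?orbT.
have [X mX] := mollifier_exists (d := d) ep0.
have {Ha}Ha := Ha ep X epa mX; have {Hb}Hb := Hb ep X epb mX.
have {Hc}Hc := Hc ep X epc mX; have {Hdd}Hdd := Hdd ep X epd mX.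
have [tsg tr8] : tau <= sg /\ tau <= rho / 8 by rewrite /tau; split; rewrite ge_min lexx ?orbT.
set H1 := \int[mu]_x (\sum_j `|partial j X x|).
have H10 : 0 <= H1 by apply: int_ge0 => x; exact: sumr_ge0.
have [L L0 cut] := @cutoff_family R d.
pose Lr := Num.min (e / 3 / (2 * M * H1 + 1)) (rho / 4 / (10 * M + 1)).
have q1 : 0 < 2 * M * H1 + 1 by rewrite ltr_wpDl// !mulr_ge0.
have q2 : 0 < 10 * M + 1 by rewrite ltr_wpDl// !mulr_ge0.
have Lr0 : 0 < Lr by rewrite lt_min !divr_gt0.
have [k [tk k01 kL k1]] := cut (L / Lr) (divr_gt0 L0 Lr0).
have LLr : L / (L / Lr) = Lr by rewrite invf_div mulrCA divff ?mulr1 ?gt_eqF.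
rewrite LLr in kL k1.
have LrA : 2 * Lr * M * H1 <= e / 3.
  have : Lr <= e / 3 / (2 * M * H1 + 1) by rewrite ge_min lexx.
  by rewrite ler_pdivlMr//; move: (ltW Lr0); lra.
have LrB : 10 * M * Lr <= rho / 4.
  have : Lr <= rho / 4 / (10 * M + 1) by rewrite ge_min lexx orbT.
  by rewrite ler_pdivlMr//; move: (ltW Lr0); lra.
have epB : 6 * CU * ep * M <= e / 3.
  by move: ep2; rewrite ler_pdivlMr//; move: (ltW ep0); lra.
have sgB : 2 * `|lam| * (12 * sg) <= e / 3.
  have : sg * (24 * `|lam| + 1) = e / 3 by rewrite /sg divfK// gt_eqF.
  by move: (ltW sg0); lra.
pose Nw r := wig X k 0 0 (a r) (b r).
have appr r (hr : s0 < r < s1) : dev2 (a r) X <= rho / 8 -> dev2 (b r) X <= rho / 8 ->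
    `|m r - Nw r| <= rho / 4.
  move=> h1 h2; have := mass_wig (La r hr) (Lb r hr) mX ep1 (bas_m hb (inn r hr)) (bas_wi hb (inn r hr))
    (bas_w hb (inn r hr)) tk k01 (ltW Lr0) k1.
  rewrite -/(m r) -/(Nw r) -mulrBr normrM ger0_norm//; lra.
have a1 := appr s ins Hc Hdd; have a2 := appr t ht (le_trans Ha tr8) (le_trans Hb tr8).
have dN r : t - de < r < t + de -> is_derive r (1 : R) Nw (rateint lam U X k 0 0 0 (a r) (b r)).
  rewrite -ltr_distl => /dein hr.
  exact: (wig_derive cU hb hh s01 (mol_test mX) tk (path0 r) hr).
have bN r : t - de < r < t + de -> `|rateint lam U X k 0 0 0 (a r) (b r)| <= e.
  rewrite -ltr_distl => hr'; have hr := dein r hr'.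
  have h := static_rate (La r hr) (Lb r hr) mX ep1 (bas_m hb (inn r hr)) (bas_wi hb (inn r hr))
    (bas_w hb (inn r hr)) tk k01 (ltW Lr0) kL lam cU CU0 HU M0 ep0.
  apply: le_trans h _; rewrite -/H1.
  have d1 := dev2_close (La r hr) (La t ht) mX; have d2 := dev2_close (Lb r hr) (Lb t ht) mX.
  have := dedist r hr'; rewrite /dist2 intD; first last.
  - by case: (L2rB (Lb r hr) (Lb t ht)).
  - by case: (L2rB (La r hr) (La t ht)).
  move=> d3; have D12 : dev2 (a r) X + dev2 (b r) X <= 12 * sg by move: Ha Hb tsg; lra.
  have := ler_wpM2l (mulr_ge0 (ltW (ltr0Sn R 1)) (normr_ge0 lam)) D12; lra.
have := mvt_le dN bN (s := s) (t := t); rewrite -ltr_distl => /(_ hs).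
rewrite ltrBlDr !ltrDl de0 => /(_ isT) => fin.
have -> : m s - m t = (m s - Nw s) + (Nw s - Nw t) - (m t - Nw t) by ring.
apply: le_trans (ler_normB _ _) _; apply: le_trans (lerD (ler_normD _ _) (lexx _)) _.
by move: fin a1 a2 rho0; lra.
Qed.

Lemma mass_cont t : s0 <= t <= s1 -> forall e, 0 < e -> exists2 de, 0 < de &
  forall s, s0 <= s <= s1 -> `|s - t| < de -> `|m s - m t| <= e.
Proof.
move=> ht e e0; have M0 : 0 <= M by apply: (basic_M hb); exact: ltW.
have K0 : 0 < 4 * M + 1 by rewrite ltr_wpDl// mulr_ge0.
pose eta := e / 2 / (4 * M + 1); have eta0 : 0 < eta by rewrite !divr_gt0.
have c0 : 0 < eta^-1 + 1 by rewrite addr_gt0// invr_gt0.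
have [de de0 H] := bas_c hb ht (divr_gt0 (divr_gt0 e0 (ltr0Sn R 1)) c0).
exists de => // s hs st; have {}H := H s hs st.
have ia := L2rB (bas_a hb hs) (bas_a hb ht); have ib := L2rB (bas_b hb hs) (bas_b hb ht).
have i1 := itg_ss (bas_a hb hs) (bas_b hb hs); have i2 := itg_ss (bas_a hb ht) (bas_b hb ht).
have i3 := itg_dist2 hb hs ht.
rewrite /m -intB//.
apply: (@le_trans _ _ (\int[mu]_x (2 * eta * (ss (a s) (b s) x + ss (a t) (b t) x) +
   eta^-1 * ((a s x - a t x) ^+ 2 + (b s x - b t x) ^+ 2)))); last first.
  rewrite intD; [|by apply: itgZ; exact: itgD|exact: itgZ].
  rewrite !intZ//; last exact: itgD.
  rewrite intD// -/(dist2 a b s t).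
  have h1 : eta * (4 * M + 1) = e / 2 by rewrite /eta divfK// gt_eqF.
  have h2 : eta^-1 * dist2 a b s t <= e / 2.
    move: H; rewrite ler_pdivlMr// => H; have : 0 <= dist2 a b s t by apply: int_ge0 => x; exact: sumsq_ge0.
    by move=> D0; move: H; rewrite mulrDr mulr1 mulrC; lra.
  have := bas_m hb hs; have := bas_m hb ht; rewrite -/(ss _ _) => m1 m2.
  have k1 := ler_wpM2l (ltW eta0) m1; have k2 := ler_wpM2l (ltW eta0) m2.
  by rewrite -/(ss (a s) (b s)) -/(ss (a t) (b t)) in k1 k2; rewrite /ss; move: (ltW eta0); lra.
apply: int_norm; [exact: (itg_measurable (itgB i1 i2))|by apply: itgD; [apply: itgZ; exact: itgD|exact: itgZ]|].
move=> x; rewrite /ss; set p := a s x; set q := a t x; set p' := b s x; set q' := b t x.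
have K (u v : R) : `|u ^+ 2 - v ^+ 2| <= 2 * eta * (u ^+ 2 + v ^+ 2) + eta^-1 * (u - v) ^+ 2.
  have h1 (c : R) : c * (u ^+ 2 - v ^+ 2) <= eta * (c * (u + v)) ^+ 2 + eta^-1 * (u - v) ^+ 2.
    have h2 : 0 <= eta^-1 * (eta * (c * (u + v)) - (u - v)) ^+ 2 by rewrite mulr_ge0 ?sqr_ge0// invr_ge0 ltW.
    have h3 : eta^-1 * (eta * (c * (u + v)) - (u - v)) ^+ 2 =
      eta * (c * (u + v)) ^+ 2 - 2 * (c * (u ^+ 2 - v ^+ 2)) + eta^-1 * (u - v) ^+ 2 by field; rewrite gt_eqF.
    have h4 : 0 <= eta * (c * (u + v)) ^+ 2 by rewrite mulr_ge0 ?sqr_ge0// ltW.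
    have h5 : 0 <= eta^-1 * (u - v) ^+ 2 by rewrite mulr_ge0 ?sqr_ge0// invr_ge0 ltW.
    by lra.
  have h6 : eta * (u + v) ^+ 2 <= 2 * eta * (u ^+ 2 + v ^+ 2).
    have -> : 2 * eta * (u ^+ 2 + v ^+ 2) = eta * (2 * (u ^+ 2 + v ^+ 2)) by ring.
    rewrite ler_pM2l//; have := sqr_ge0 (u - v); rewrite sqrrB sqrrD !mulr2n; lra.
  rewrite ler_norml; apply/andP; split.
    by have := h1 (-1); rewrite mulN1r exprMn sqrrN expr1n mul1r; lra.
  by have := h1 1; rewrite !mul1r; lra.
have -> : p ^+ 2 + p' ^+ 2 - (q ^+ 2 + q' ^+ 2) = (p ^+ 2 - q ^+ 2) + (p' ^+ 2 - q' ^+ 2) by ring.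
apply: le_trans (ler_normD _ _) _; apply: le_trans (lerD (K _ _) (K _ _)) _.
by rewrite le_eqVlt; apply/orP; left; apply/eqP; ring.
Qed.

(** The derivative vanishes inside the interval, and continuity in L^2 extends the constant to the
    endpoints. *)
Lemma mass_const t : s0 <= t <= s1 -> m t = m s0.
Proof.
move=> ht.
have h0 : s0 <= s0 <= s1 by rewrite lexx ltW.
have cst s r : s0 < s < s1 -> s0 < r < s1 -> m s = m r.
  move=> hs hr; apply/eqP; rewrite -subr_eq0 -normr_le0 -(mul0r `|s - r|).
  by apply: (mvt_le (df := cst 0) (s0 := s0) (s1 := s1)) => //= x hx; [exact: mass_derive|rewrite normr0].
pose c := (s0 + s1) / 2; have hc : s0 < c < s1 by rewrite /c; move: s01 => h; apply/andP; split; lra.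
suff K r : s0 <= r <= s1 -> m r = m c by rewrite (K t)// (K s0).
move=> hr; apply/eqP; rewrite -subr_eq0 -normr_le0; apply/ler_addgt0Pr => e e0; rewrite add0r.
have [de de0 H] := mass_cont hr e0.
have [s hs sr] : exists2 s, s0 < s < s1 & `|s - r| < de.
  pose th := Num.min 1 (de / (2 * (s1 - s0))).
  have D0 : 0 < 2 * (s1 - s0) by rewrite mulr_gt0// subr_gt0.
  have th0 : 0 < th by rewrite lt_min ltr01 divr_gt0.
  have [th1 th2] : th <= 1 /\ th * (2 * (s1 - s0)) <= de.
    by rewrite -ler_pdivlMr// /th; split; rewrite ge_min lexx ?orbT.
  case/andP: hr => r1 r2; exists (r + th * (c - r)).
    case/andP: hc => c1 c2; apply/andP; split; nra.
  rewrite addrC addKr normrM (ger0_norm (ltW th0)).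
  have : `|c - r| <= s1 - s0 by rewrite ler_norml /c; move: s01 => h; apply/andP; split; lra.
  move=> h; have := ler_wpM2l (ltW th0) h; have : 0 < th * (s1 - s0) by rewrite mulr_gt0// subr_gt0.
  lra.
rewrite -(cst s c hs hc) distrC; apply: H => //.
by case/andP: hs => h1 h2; rewrite !ltW.
Qed.

End mass.

(** * Classical trajectories *)

Section taylor.
Context {R : realType} {d : nat}.
Notation E := 'rV[R]_d.
Implicit Types (U : E -> R) (F : E -> E) (x y q p w : E).

(** [F] stands for the gradient. A linear potential shifts [F] and leaves [C] alone
    ([taylor_linear]), whence the independence of the control in small time. *)
Definition taylor U F (C : R) := forall x q, `|U x - U q - dotv (F q) (x - q)| <= C * `|x - q| ^+ 2.

Lemma dotvC x y : dotv x y = dotv y x.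
Proof. by apply: eq_bigr => j _; rewrite mulrC. Qed.

Lemma dotvNr x y : dotv x (- y) = - dotv x y.
Proof. by rewrite -scaleN1r dotvZr mulN1r. Qed.

Lemma dotvBl x y z : dotv (x - y) z = dotv x z - dotv y z.
Proof. by rewrite dotvC dotvDr dotvNr ![dotv z _]dotvC. Qed.

Lemma taylor_two U F C x y q : taylor U F C ->
  `|U x - U y - dotv (F q) (x - y)| <= C * (`|x - q| ^+ 2 + `|y - q| ^+ 2).
Proof.
move=> h; have -> : U x - U y - dotv (F q) (x - y) =
    (U x - U q - dotv (F q) (x - q)) - (U y - U q - dotv (F q) (y - q)).
  by rewrite !dotvDr !dotvNr; ring.
by rewrite mulrDr; apply: le_trans (ler_normB _ _) _; apply: lerD; exact: h.
Qed.

Lemma norm_delta (r : R) (j : 'I_d) : `|r *: (delta_mx ord0 j : E)| <= `|r|.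
Proof.
apply/normrV_le => // i; rewrite !mxE normrM; case: (i == j); rewrite /= ?andbT ?andbF ?normr1 ?mulr1//.
by rewrite normr0 mulr0.
Qed.

(** The values at [q'] and at [q' + r e_j], with [r = |q - q'|], are compared in the expansions at
    [q] and at [q']: the remainders are at most [4 C r^2], [C r^2] and [C r^2]. *)
Lemma taylor_lip U F C q q' : 0 <= C -> taylor U F C -> `|F q - F q'| <= 6 * C * `|q - q'|.
Proof.
move=> C0 h; have [->|qq'] := eqVneq q q'; first by rewrite !subrr normr0 mulr0.
set r := `|q - q'|; have r0 : 0 < r by rewrite normr_gt0 subr_eq0.
apply/normrV_le; first by rewrite !mulr_ge0// ltW.
move=> j; pose x := q' + r *: delta_mx ord0 j.
have x1 : `|x - q'| <= r by rewrite /x addrC addKr; apply: le_trans (norm_delta _ _) _; rewrite ger0_norm// ltW.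
have x2 : `|x - q| <= 2 * r.
  have -> : x - q = (x - q') - (q - q') by rewrite opprB addrA subrK.
  by apply: le_trans (ler_normB _ _) _; rewrite -/r; move: x1; lra.
have h1 := h x q; have h2 := h x q'; have h3 := h q' q.
have key : dotv (F q - F q') (x - q') = r * (F q - F q') ord0 j.
  have -> : x - q' = r *: delta_mx ord0 j by rewrite /x addrC addKr.
  by rewrite dotvZr dotvC /dotv (bigD1 j)//= !mxE !eqxx mul1r big1 ?addr0// => i ij;
    rewrite !mxE (negbTE ij) andbF mul0r.
have K : `|dotv (F q - F q') (x - q')| <= 6 * C * r ^+ 2.
  have -> : dotv (F q - F q') (x - q') =
     (U x - U q' - dotv (F q') (x - q')) - (U x - U q - dotv (F q) (x - q)) + (U q' - U q - dotv (F q) (q' - q)).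
    have e1 : x - q = (x - q') + (q' - q) by rewrite addrA subrK.
    by rewrite dotvBl e1 (dotvDr _ (x - q')); ring.
  apply: le_trans (ler_normD _ _) _; apply: le_trans (lerD (ler_normB _ _) (lexx _)) _.
  have q1 : `|x - q'| ^+ 2 <= r ^+ 2 by rewrite ler_pXn2r ?nnegrE// ltW.
  have q2 : `|x - q| ^+ 2 <= 4 * r ^+ 2.
    have : `|x - q| ^+ 2 <= (2 * r) ^+ 2 by rewrite ler_pXn2r ?nnegrE// mulr_ge0// ltW.
    by rewrite exprMn; lra.
  have q3 : `|q' - q| ^+ 2 = r ^+ 2 by rewrite distrC.
  have := ler_wpM2l C0 q1; have := ler_wpM2l C0 q2; rewrite q3 in h3; lra.
move: K; rewrite key normrM (ger0_norm (ltW r0)) mxE => K.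
by rewrite -(ler_pM2l r0); apply: le_trans K _; rewrite le_eqVlt; apply/orP; left; apply/eqP; ring.
Qed.

Lemma taylor_growth U F C : 0 <= C -> taylor U F C -> exists2 CU : R, 0 <= CU &
  forall x y, `|U x - U y| <= CU * `|x - y| * (1 + `|x| + `|y|).
Proof.
move=> C0 h; pose CU := d%:R * (`|F 0| + 6 * C) + C.
have CU0 : 0 <= CU by rewrite !addr_ge0// mulr_ge0// addr_ge0// mulr_ge0.
exists CU => // x y.
have Fy : `|F y| <= `|F 0| + 6 * C * `|y|.
  rewrite -{1}(subrK (F 0) (F y)) addrC; apply: le_trans (ler_normD _ _) _; rewrite lerD2l.
  by have := taylor_lip y 0 C0 h; rewrite subr0.
have h1 : `|U x - U y| <= d%:R * (`|F y| * `|x - y|) + C * `|x - y| ^+ 2.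
  have -> : U x - U y = dotv (F y) (x - y) + (U x - U y - dotv (F y) (x - y)) by ring.
  by apply: le_trans (ler_normD _ _) _; apply: lerD; [exact: dotv_norm|exact: h].
apply: le_trans h1 _; set D := `|x - y|.
have D0 : 0 <= D by exact: normr_ge0.
have h2 : D <= `|x| + `|y| by exact: ler_normB.
have h3 : d%:R * (`|F y| * D) <= d%:R * (`|F 0| + 6 * C) * D * (1 + `|x| + `|y|).
  have : `|F y| <= (`|F 0| + 6 * C) * (1 + `|x| + `|y|).
    apply: le_trans Fy _; have := mulr_ge0 (normr_ge0 (F 0)) (addr_ge0 (normr_ge0 x) (normr_ge0 y)).
    have := mulr_ge0 C0 (normr_ge0 x); set f0 := `|F 0|; set nx := `|x|; set ny := `|y|; lra.
  move=> /(ler_wpM2r D0) /(ler_wpM2l (ler0n R d)) h4; apply: le_trans h4 _.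
  by rewrite le_eqVlt; apply/orP; left; apply/eqP; ring.
have h4 : C * D ^+ 2 <= C * D * (1 + `|x| + `|y|).
  rewrite expr2 mulrA ler_wpM2l ?mulr_ge0//; move: h2; lra.
by have := lerD h3 h4; rewrite /CU; lra.
Qed.

Lemma taylor_linear_growth U F C q : 0 <= C -> taylor U F C -> `|F q| <= (`|F 0| + 6 * C) * (1 + `|q|).
Proof.
move=> C0 h; have : `|F q| <= `|F 0| + 6 * C * `|q|.
  rewrite -{1}(subrK (F 0) (F q)) addrC; apply: le_trans (ler_normD _ _) _; rewrite lerD2l.
  by have := taylor_lip q 0 C0 h; rewrite subr0.
have := mulr_ge0 (normr_ge0 (F 0)) (normr_ge0 q); set f0 := `|F 0|; set nq := `|q|; lra.
Qed.

End taylor.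

(** * Trajectories made of parabolic arcs *)

Section polygon.
Context {R : realType} {d : nat}.
Notation E := 'rV[R]_d.
Implicit Types (q p w : E) (F : E -> E).

(** [ppath] and [qpath] solve [p' = - w], [q' = p] from [(q0, p0)] at time [t0]. *)
Definition ppath (t0 : R) p0 w (s : R) : E := p0 - (s - t0) *: w.
Definition qpath (t0 : R) q0 p0 w (s : R) : E := q0 + (s - t0) *: p0 - ((s - t0) ^+ 2 / 2) *: w.

Lemma ppath0 t0 p0 w : ppath t0 p0 w t0 = p0.
Proof. by rewrite /ppath subrr scale0r subr0. Qed.

Lemma qpath0 t0 q0 p0 w : qpath t0 q0 p0 w t0 = q0.
Proof. by rewrite /qpath subrr expr0n mul0r !scale0r subr0 addr0. Qed.

Lemma path_poly t0 q0 p0 w t : path (qpath t0 q0 p0 w) (ppath t0 p0 w) w t.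
Proof.
split.
- move=> s _ j.
  have -> : (fun r => qpath t0 q0 p0 w r ord0 j) =
     (fun r => q0 ord0 j + (r - t0) * p0 ord0 j - (r - t0) ^+ 2 / 2 * w ord0 j).
    by apply/funext => r; rewrite !mxE.
  by apply: is_derive_eq; rewrite !mxE /GRing.scale/=; field.
- move=> s _ j.
  have -> : (fun r => ppath t0 p0 w r ord0 j) = (fun r => p0 ord0 j - (r - t0) * w ord0 j).
    by apply/funext => r; rewrite !mxE.
  by apply: is_derive_eq; rewrite /GRing.scale/=; ring.
- pose D := `|t - t0| + 1.
  exists (`|q0| + D * `|p0| + D ^+ 2 * `|w| + (`|p0| + D * `|w|)) => s st.
  have D0 : 0 <= D by rewrite addr_ge0.
  have sD : `|s - t0| <= D.
    have -> : s - t0 = (t - t0) + (s - t) by ring.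
    by apply: le_trans (ler_normD _ _) _; rewrite lerD2l ltW.
  have k1 := ler_wpM2r (normr_ge0 p0) sD; have k2 := ler_wpM2r (normr_ge0 w) sD.
  have k3 : `|(s - t0) ^+ 2 / 2| * `|w| <= D ^+ 2 * `|w|.
    apply: ler_wpM2r => //; rewrite normrM normrX (ger0_norm (_ : 0 <= (2 : R)^-1)) ?invr_ge0//.
    have : `|s - t0| ^+ 2 <= D ^+ 2 by rewrite ler_pXn2r ?nnegrE.
    by have := sqr_ge0 `|s - t0|; lra.
  have p1 : `|ppath t0 p0 w s| <= `|p0| + D * `|w|.
    by apply: le_trans (ler_normB _ _) _; rewrite lerD2l normrZ.
  have q1 : `|qpath t0 q0 p0 w s| <= `|q0| + D * `|p0| + D ^+ 2 * `|w|.
    apply: le_trans (ler_normB _ _) _; apply: lerD; last by rewrite normrZ.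
    by apply: le_trans (ler_normD _ _) _; rewrite lerD2l normrZ.
  split; first by apply: le_trans q1 _; rewrite lerDl addr_ge0// mulr_ge0.
  by apply: le_trans p1 _; rewrite lerDr !addr_ge0 ?mulr_ge0 ?sqr_ge0.
Qed.

Section piece.
Variables (Gam : R -> E -> E -> R) (F : E -> E) (s0 s1 B LF Q tol : R).
Hypotheses (s01 : s0 < s1) (B0 : 0 <= B) (LF0 : 0 <= LF) (tol0 : 0 < tol).
Hypothesis growth : forall q, `|F q| <= B * (1 + `|q|).
Hypothesis lip : forall q q', `|F q - F q'| <= LF * `|q - q'|.
Hypothesis step : forall t0 q0 p0 w t1 t2, s0 <= t1 -> t1 < t2 -> t2 <= s1 ->
  (forall s, t1 <= s <= t2 -> `|qpath t0 q0 p0 w s| <= Q /\ `|F (qpath t0 q0 p0 w s) - w| <= tol) ->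
  Gam t2 (qpath t0 q0 p0 w t2) (ppath t0 p0 w t2) <= Gam t1 (qpath t0 q0 p0 w t1) (ppath t0 p0 w t1).

(** The force is frozen at [w = F q0]. The position moves by at most [h (1 + B) e], which bounds the
    force error by the Lipschitz constant, and [1 + |q| + |p|] grows at most by the factor
    [1 + (1 + 2 B) h]. *)
Lemma one_step t1 t2 q0 p0 (e := 1 + `|q0| + `|p0|) (h := t2 - t1) :
  s0 <= t1 -> t1 < t2 -> t2 <= s1 -> h <= 1 ->
  e * expR ((1 + 2 * B) * h) <= Q -> LF * h * ((1 + B) * Q) <= tol ->
  exists q1 p1, Gam t2 q1 p1 <= Gam t1 q0 p0 /\ 1 + `|q1| + `|p1| <= e * expR ((1 + 2 * B) * h).
Proof.
move=> s0t1 t12 t2s1 h1 eQ htol.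
have h0 : 0 < h by rewrite subr_gt0.
have e1 : 1 <= e by rewrite /e -addrA lerDl addr_ge0.
have e0 : 0 <= e by exact: le_trans e1.
pose w := F q0; have wB : `|w| <= B * e.
  by apply: le_trans (growth q0) _; rewrite ler_wpM2l// /e lerDl.
have pe : `|p0| <= e by rewrite /e lerDr addr_ge0.
have exph : 1 + (1 + 2 * B) * h <= expR ((1 + 2 * B) * h) by exact: expR_ge1Dx.
have eexp : e * (1 + (1 + 2 * B) * h) <= e * expR ((1 + 2 * B) * h) by rewrite ler_wpM2l.
have Be0 : 0 <= B * e by rewrite mulr_ge0.
have eQ' : e <= Q.
  apply: le_trans eQ; apply: le_trans eexp; rewrite ler_peMr// lerDl mulr_ge0 ?(ltW h0)//.
  by rewrite addr_ge0// mulr_ge0.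
have dq s : t1 <= s <= t2 -> `|qpath t1 q0 p0 w s - q0| <= h * (e + B * e) /\
    `|qpath t1 q0 p0 w s| + `|ppath t1 p0 w s| <= `|q0| + `|p0| + h * (e + 2 * (B * e)).
  move=> /andP[k1 k2]; have r0 : 0 <= s - t1 by rewrite subr_ge0.
  have rh : s - t1 <= h by rewrite /h lerD2r.
  have r1 : s - t1 <= 1 by exact: le_trans h1.
  set r := s - t1 in r0 rh r1 *.
  have m1 : r * `|p0| <= h * e by apply: ler_pM.
  have m2 : r ^+ 2 / 2 * `|w| <= h * (B * e).
    apply: ler_pM => //; first by rewrite divr_ge0// sqr_ge0.
    apply: le_trans rh; rewrite expr2; nra.
  have m3 : r * `|w| <= h * (B * e) by apply: ler_pM.
  have n2 : `|(r ^+ 2 / 2) *: w| = r ^+ 2 / 2 * `|w| by rewrite normrZ ger0_norm// divr_ge0// sqr_ge0.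
  have n1 : `|r *: p0| = r * `|p0| by rewrite normrZ ger0_norm.
  have n3 : `|r *: w| = r * `|w| by rewrite normrZ ger0_norm.
  have a1 : `|qpath t1 q0 p0 w s - q0| <= r * `|p0| + r ^+ 2 / 2 * `|w|.
    rewrite /qpath -/r (_ : _ - q0 = r *: p0 - (r ^+ 2 / 2) *: w); last first.
      by rewrite addrAC [q0 + _]addrC addrK.
    by apply: le_trans (ler_normB _ _) _; rewrite n1 n2.
  have a2 : `|ppath t1 p0 w s| <= `|p0| + r * `|w|.
    by apply: le_trans (ler_normB _ _) _; rewrite -/r n3.
  have a3 : `|qpath t1 q0 p0 w s| <= `|q0| + `|qpath t1 q0 p0 w s - q0|.
    by rewrite -{1}(subrK q0 (qpath t1 q0 p0 w s)) addrC; exact: ler_normD.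
  split; first by apply: le_trans a1 _; rewrite mulrDr; exact: lerD.
  by move: a1 a2 a3 m1 m2 m3; set A := `|qpath _ _ _ _ _ - _|; lra.
have qpE : `|q0| + `|p0| = e - 1 by rewrite /e; ring.
have ok s : t1 <= s <= t2 -> `|qpath t1 q0 p0 w s| <= Q /\ `|F (qpath t1 q0 p0 w s) - w| <= tol.
  move=> hs; have [d1 d2] := dq s hs; split.
    apply: le_trans eQ; apply: le_trans eexp; have : 0 <= `|ppath t1 p0 w s| by [].
    by rewrite qpE in d2; move: d2; set A := `|qpath _ _ _ _ _|; lra.
  apply: le_trans (lip _ _) _; apply: le_trans htol; rewrite -mulrA ler_wpM2l//.
  apply: le_trans d1 _; rewrite ler_pM2l//.
  have := ler_wpM2l (addr_ge0 ler01 B0) eQ'; lra.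
exists (qpath t1 q0 p0 w t2), (ppath t1 p0 w t2); split.
  by have := step s0t1 t12 t2s1 ok; rewrite qpath0 ppath0.
have t22 : t1 <= t2 <= t2 by rewrite lexx ltW.
have [_ d2] := dq t2 t22; apply: le_trans eexp.
by rewrite qpE in d2; move: d2; set A := `|qpath _ _ _ _ _|; set A' := `|ppath _ _ _ _|; lra.
Qed.

(** The interval is cut into [N] equal steps, [N] large enough for the force error to stay below
    [tol]. The exponential bounds multiply over the steps, so their number does not affect the final
    bound and every position stays within [Q]. *)
Lemma polygon_piece q0 p0 : (1 + `|q0| + `|p0|) * expR ((1 + 2 * B) * (s1 - s0)) <= Q ->
  exists q1 p1, Gam s1 q1 p1 <= Gam s0 q0 p0 /\
    1 + `|q1| + `|p1| <= (1 + `|q0| + `|p0|) * expR ((1 + 2 * B) * (s1 - s0)).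
Proof.
move=> HQ; set e := 1 + `|q0| + `|p0|.
have e0 : 0 <= e by rewrite !addr_ge0.
have Q0 : 0 <= Q by apply: le_trans HQ; rewrite mulr_ge0// expR_ge0.
pose K := (s1 - s0) * (1 + LF * ((1 + B) * Q) / tol).
have [N N0 NK] : exists2 N : nat, (0 < N)%N & K <= N%:R.
  exists (Num.trunc K).+1 => //; have K0 : 0 <= K.
    by rewrite mulr_ge0 ?subr_ge0 ?(ltW s01)// addr_ge0// divr_ge0 ?(ltW tol0)// !mulr_ge0// addr_ge0.
  by have /andP[_ /ltW] := truncn_itv K0.
have NR : 0 < N%:R :> R by rewrite ltr0n.
pose h := (s1 - s0) / N%:R; have h0 : 0 < h by rewrite divr_gt0// subr_gt0.
have hN : h * N%:R = s1 - s0 by rewrite /h divfK// gt_eqF.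
have hK : h * (1 + LF * ((1 + B) * Q) / tol) <= 1.
  by rewrite -(ler_pM2r NR) mulrAC hN mul1r.
have P0 : 0 <= LF * ((1 + B) * Q) / tol by rewrite divr_ge0 ?(ltW tol0)// !mulr_ge0// addr_ge0.
have h1 : h <= 1.
  apply: le_trans hK; rewrite ler_peMr ?(ltW h0)//; lra.
have htol : LF * h * ((1 + B) * Q) <= tol.
  have : h * (LF * ((1 + B) * Q) / tol) <= 1 by apply: le_trans hK; rewrite ler_wpM2l ?(ltW h0)// lerDr.
  by rewrite mulrA ler_pdivrMr// mul1r; apply: le_trans; rewrite le_eqVlt; apply/orP; left; apply/eqP; ring.
have B'0 : 0 <= 1 + 2 * B by rewrite addr_ge0// mulr_ge0.
suff [q1 [p1 [H1 H2]]] : exists q1 p1, Gam (s0 + N%:R * h) q1 p1 <= Gam s0 q0 p0 /\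
    1 + `|q1| + `|p1| <= e * expR ((1 + 2 * B) * (N%:R * h)).
  have E1 : N%:R * h = s1 - s0 by rewrite mulrC.
  move: H1 H2; rewrite E1 addrC subrK => H1 H2.
  by exists q1, p1.
have: (N <= N)%N by [].
elim: {1 3 4}N => [|i ih] iN.
  by exists q0, p0; rewrite mul0r addr0 mulr0 expR0 mulr1.
have [q1 [p1 [H1 H2]]] := ih (ltnW iN).
have iNR : i.+1%:R * h <= s1 - s0 by rewrite -hN mulrC ler_pM2l// ler_nat.
have ih0 : 0 <= i%:R * h by rewrite mulr_ge0// ltW.
have st : (s0 + i.+1%:R * h) - (s0 + i%:R * h) = h by rewrite -natr1; ring.
have expS : expR ((1 + 2 * B) * (i%:R * h)) * expR ((1 + 2 * B) * h) = expR ((1 + 2 * B) * (i.+1%:R * h)).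
  by rewrite -expRD; congr expR; rewrite -natr1; ring.
have H3 : (1 + `|q1| + `|p1|) * expR ((1 + 2 * B) * h) <= e * expR ((1 + 2 * B) * (i.+1%:R * h)).
  by rewrite -expS [leRHS]mulrA ler_wpM2r// expR_ge0.
have [||||||q2 [p2 [G1 G2]]] := @one_step (s0 + i%:R * h) (s0 + i.+1%:R * h) q1 p1; rewrite ?st//.
- by rewrite lerDl.
- by rewrite -subr_gt0 st.
- by rewrite addrC -lerBrDr.
- apply: le_trans H3 _; apply: le_trans HQ; rewrite ler_wpM2l// ler_expR ler_wpM2l//.
- exists q2, p2; split; first exact: le_trans H1.
  by rewrite st in G2; exact: le_trans G2 H3.
Qed.

End piece.

End polygon.

(** * Propagation along trajectories *)

Section continuity.
Context {R : realType} {d : nat}.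
Notation E := 'rV[R]_d.
Notation mu := (@lebesgue_rV R d).
Notation mu2 := (lebesgue_rV d \x lebesgue_rV d)%E.

Lemma cont_on_within (s0 s1 : R) (F : R -> R) : cont_on s0 s1 F -> {within `[s0, s1], continuous F}.
Proof.
move=> cF; apply/subspace_continuousP => t /=; rewrite in_itv/= => ht.
apply/cvgrPdist_le => e e0; have [de de0 H] := cF t ht e e0.
rewrite near_withinE; have : \forall s \near t, `|t - s| < de.
  by apply: (@cvgr_dist_lt _ _ _ (nbhs t) _ id) => //; exact: cvg_id.
apply: filterS => s st; rewrite /= in_itv/= => hs; rewrite distrC; apply: H => //.
by rewrite distrC.
Qed.

Lemma eq_cont_on (s0 s1 : R) (F G : R -> R) : (forall t, s0 <= t <= s1 -> F t = G t) ->
  cont_on s0 s1 F -> cont_on s0 s1 G.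
Proof.
move=> FG cF t ht e e0; have [de de0 H] := cF t ht e e0.
by exists de => // s hs st; rewrite -!FG//; exact: H.
Qed.

Lemma cont_onM (s0 s1 : R) (F G : R -> R) : cont_on s0 s1 F -> cont_on s0 s1 G ->
  cont_on s0 s1 (fun t => F t * G t).
Proof.
move=> cF cG t ht e e0.
have f0 : 0 < `|F t| + 1 by rewrite ltr_wpDl.
have g0 : 0 < `|G t| + 1 by rewrite ltr_wpDl.
have e1 : 0 < Num.min 1 (e / 2 / (`|G t| + 1)) by rewrite lt_min ltr01 !divr_gt0.
have e2 : 0 < e / 2 / (`|F t| + 1) by rewrite !divr_gt0.
have [d1 d10 H1] := cF t ht _ e1; have [d2 d20 H2] := cG t ht _ e2.
exists (Num.min d1 d2); first by rewrite lt_min d10.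
move=> s hs; rewrite lt_min => /andP[k1 k2].
have {}H2 := H2 s hs k2; have := H1 s hs k1; rewrite le_min => /andP[H3 H4].
have -> : F s * G s - F t * G t = F s * (G s - G t) + (F s - F t) * G t by ring.
apply: le_trans (ler_normD _ _) _; rewrite !normrM.
have y1 : `|F s| <= `|F t| + 1.
  have -> : F s = F t + (F s - F t) by ring.
  by apply: le_trans (ler_normD _ _) _; rewrite lerD2l.
have p1 : `|F s| * `|G s - G t| <= e / 2.
  by apply: le_trans (ler_pM _ _ y1 H2) _ => //; rewrite mulrC divfK// gt_eqF.
have p2 : `|F s - F t| * `|G t| <= e / 2.
  apply: le_trans (ler_wpM2r _ H4) _ => //.
  by rewrite mulrAC ler_pdivrMr// ler_pM2l ?divr_gt0// lerDl.
by have := lerD p1 p2; lra.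
Qed.

Lemma derivable_cont_on (s0 s1 : R) (F : R -> R) : (forall t, derivable F t 1) -> cont_on s0 s1 F.
Proof.
move=> dF t _ e e0; have cF : {for t, continuous F}.
  by apply: differentiable_continuous; exact/derivable1_diffP.
move/cvgrPdist_le: cF => /(_ _ e0) /nbhs_ballP [de /= de0 H]; exists de => // s _ st.
by rewrite distrC; apply: H; rewrite /ball/= distrC.
Qed.

Lemma cont_on_decr (s0 s1 : R) (F df : R -> R) : s0 < s1 -> cont_on s0 s1 F ->
  (forall t, s0 < t < s1 -> is_derive t (1 : R) F (df t)) ->
  (forall t, s0 < t < s1 -> df t <= 0) -> F s1 <= F s0.
Proof.
move=> s01 cF dF df0; have [] := @MVT _ F df s0 s1 s01.
  exact: cont_on_within.
move=> x; rewrite in_itv/= => hx H.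
by rewrite -subr_le0 H mulr_le0_ge0 ?df0// subr_ge0 ltW.
Qed.

(** Continuity up to the endpoints, whereas [bilin_derive] covers interior times; monotonicity over
    a closed piece needs both. *)
Lemma bil_cont (s0 s1 : R) (f g : R -> E -> R) (M M' : R -> E * E -> R) :
  (forall t, s0 <= t <= s1 -> L2r (f t)) -> (forall t, s0 <= t <= s1 -> L2r (g t)) ->
  (forall t, s0 <= t <= s1 -> forall e, 0 < e -> exists2 de, 0 < de &
    forall s, s0 <= s <= s1 -> `|s - t| < de -> \int[mu]_x ((f s x - f t x) ^+ 2) <= e) ->
  (forall t, s0 <= t <= s1 -> forall e, 0 < e -> exists2 de, 0 < de &
    forall s, s0 <= s <= s1 -> `|s - t| < de -> \int[mu]_x ((g s x - g t x) ^+ 2) <= e) ->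
  (forall t, s0 <= t <= s1 -> kern (M t) /\ kcurve M M' t) ->
  cont_on s0 s1 (fun s => \int[mu2]_z (f s z.1 * g s z.2 * M s z)).
Proof.
move=> Lf Lg cf cg HM t ht e e0; have [kM kc] := HM t ht.
have [d1 [C1 [n1 [d10 C10 HL]]]] := kcurve_lip kc.
have [C2 [n2 [C20 n20 HB]]] := kern_bound kM.
pose lf := l1 n1 (f t) + 1; pose lg := l1 n1 (g t) + 1; pose lf2 := l1 n2 (f t) + 1; pose lg2 := l1 n2 (g t) + 1.
have pos (n : R) (h : E -> R) : 0 < l1 n h + 1 by rewrite ltr_wpDl// l1_ge0.
pose D := C1 * (lf * lg) + C2 * lg2 + C2 * lf2.
have D0 : 0 < D.
  by apply: addr_gt0; [apply: addr_gt0|]; apply: mulr_gt0 => //; try apply: mulr_gt0; exact: pos.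
pose ee := Num.min 1 (e / D).
have ee0 : 0 < ee by rewrite lt_min ltr01 divr_gt0.
have ee1 : ee <= 1 by rewrite ge_min lexx.
have eeD : D * ee <= e by rewrite mulrC -ler_pdivlMr// ge_min lexx orbT.
clearbody ee.
have [q1 q10 Q1] := l1_small n1 ee0 (d := d); have [q2 q20 Q2] := l1_small n2 ee0 (d := d).
have q0 : 0 < Num.min q1 q2 by rewrite lt_min q10.
have [d3 d30 Hf] := cf t ht _ q0; have [d4 d40 Hg] := cg t ht _ q0.
exists (Num.min (Num.min d1 ee) (Num.min d3 d4)); first by rewrite !lt_min d10 ee0 d30.
move=> s hs; rewrite !lt_min => /andP[/andP[k1 k2] /andP[k3 k4]].
have Ldf := L2rB (Lf s hs) (Lf t ht); have Ldg := L2rB (Lg s hs) (Lg t ht).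
have {}Hf := Hf s hs k3; have {}Hg := Hg s hs k4.
have [hf1 hf2] : \int[mu]_x ((f s x - f t x) ^+ 2) <= q1 /\ \int[mu]_x ((f s x - f t x) ^+ 2) <= q2.
  by move: Hf; rewrite le_min => /andP.
have [hg1 hg2] : \int[mu]_x ((g s x - g t x) ^+ 2) <= q1 /\ \int[mu]_x ((g s x - g t x) ^+ 2) <= q2.
  by move: Hg; rewrite le_min => /andP.
have df1 := Q1 _ Ldf hf1; have df2 := Q2 _ Ldf hf2; have dg1 := Q1 _ Ldg hg1; have dg2 := Q2 _ Ldg hg2.
have Lfs := L2r_L1loc (Lf s hs); have Lgs := L2r_L1loc (Lg s hs).
have Lft := L2r_L1loc (Lf t ht); have Lgt := L2r_L1loc (Lg t ht).
have Ldf' := L2r_L1loc Ldf; have Ldg' := L2r_L1loc Ldg.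
have kMs := (HM s hs).1.
have bound n (h : R -> E -> R) : L1loc (h t) -> L1loc (fun x => h s x - h t x) ->
    l1 n (fun x => h s x - h t x) <= ee -> l1 n (h s) <= l1 n (h t) + 1.
  move=> L1h L1d hle.
  have {1}-> : h s = (fun x => h t x + (h s x - h t x)) by apply/funext => x; rewrite addrC subrK.
  by apply: le_trans (l1D _ L1h L1d) _; rewrite lerD2l (le_trans hle).
have bf1 := bound n1 f Lft Ldf' df1; have bg1 := bound n1 g Lgt Ldg' dg1; have bg2 := bound n2 g Lgt Ldg' dg2.
have kMM : kern (fun z => M s z - M t z).
  have := kernD kMs (kernZ (-1) kM); congr kern; apply/funext => z; by rewrite mulN1r.
have p1 := int_kern_le Lfs Lgs kMM.1 (HL s k1).
have p2 := int_kern_le Ldf' Lgs kM.1 HB.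
have p3 := int_kern_le Lft Ldg' kM.1 HB.
have j1 := itg_kern Lfs Lgs kMM; have j2 := itg_kern Ldf' Lgs kM; have j3 := itg_kern Lft Ldg' kM.
have -> : \int[mu2]_z (f s z.1 * g s z.2 * M s z) - \int[mu2]_z (f t z.1 * g t z.2 * M t z) =
  \int[mu2]_z (f s z.1 * g s z.2 * (M s z - M t z)) + \int[mu2]_z ((f s z.1 - f t z.1) * g s z.2 * M t z) +
  \int[mu2]_z (f t z.1 * (g s z.2 - g t z.2) * M t z).
  rewrite -(intD j1 j2) -(intD (itgD j1 j2) j3) -(intB (itg_kern Lfs Lgs kMs) (itg_kern Lft Lgt kM)).
  by apply: int_eq => z; ring.
apply: le_trans (ler_normD _ _) _; apply: le_trans (lerD (ler_normD _ _) (lexx _)) _.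
apply: le_trans (lerD (lerD p1 p2) p3) _; apply: le_trans eeD.
have -> : D * ee = C1 * (lf * lg) * ee + C2 * lg2 * ee + C2 * lf2 * ee.
  by rewrite /D (mulrDl _ _ ee) (mulrDl _ _ ee).
apply: lerD; first apply: lerD.
- rewrite mulrAC ler_pM ?mulr_ge0 ?l1_ge0 ?(ltW C10)//; last exact: ltW.
  by rewrite ler_wpM2l ?(ltW C10)//; apply: ler_pM; rewrite ?l1_ge0.
- rewrite -mulrA ler_pM2l// mulrC; apply: ler_pM; rewrite ?l1_ge0//.
- rewrite -mulrA ler_pM2l//; apply: ler_pM; rewrite ?l1_ge0//.
  by rewrite lerDl.
Qed.

Variables (s0 s1 M : R) (a b : R -> E -> R).
Hypothesis (hb : basic s0 s1 M a b).
Variables (X k : E -> R) (q p : R -> E) (w : E).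
Hypotheses (tX : test_function X) (tk : test_function k) (pth : forall t, path q p w t).

Lemma wig_cont : cont_on s0 s1 (fun s => wig X k (q s) (p s) (a s) (b s)).
Proof.
have dcos (x : R) : is_derive x (1 : R) cos (- sin x) by exact: is_derive_cos.
have dsin (x : R) : is_derive x (1 : R) sin (cos x) by exact: is_derive_sin.
have nsn (x : R) : `|- sin x| <= 1 by rewrite normrN norm_sin_le1.
have cos_sin : smooth1 (fun x : R => - sin x).
  exists (fun f => exists u v : R, f = fun x => u * cos x + v * sin x).
    by exists 0, (-1); apply/funext => x; rewrite mulN1r mul0r add0r.
  move=> _ [u [v ->]]; exists (fun x => v * cos x + - u * sin x); first by exists v, (- u).
  by move=> x; apply: is_derive_eq; rewrite /GRing.scale/=; ring.
have Ca t : s0 <= t <= s1 -> forall e, 0 < e -> exists2 de, 0 < de &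
    forall s, s0 <= s <= s1 -> `|s - t| < de -> \int[mu]_x ((a s x - a t x) ^+ 2) <= e.
  move=> ht e e0; have [de de0 H] := bas_c hb ht e0; exists de => // s hs st.
  apply: le_trans (H s hs st); apply: int_le.
  + by case: (L2rB (bas_a hb hs) (bas_a hb ht)).
  + exact: (itg_dist2 hb).
  + by move=> x; rewrite lerDl sqr_ge0.
have Cb t : s0 <= t <= s1 -> forall e, 0 < e -> exists2 de, 0 < de &
    forall s, s0 <= s <= s1 -> `|s - t| < de -> \int[mu]_x ((b s x - b t x) ^+ 2) <= e.
  move=> ht e e0; have [de de0 H] := bas_c hb ht e0; exists de => // s hs st.
  apply: le_trans (H s hs st); apply: int_le.
  + by case: (L2rB (bas_b hb hs) (bas_b hb ht)).
  + exact: (itg_dist2 hb).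
  + by move=> x; rewrite lerDr sqr_ge0.
have Kc t : s0 <= t <= s1 -> kern (ker cos X k (q t) (p t)) /\ kcurve (fun s => ker cos X k (q s) (p s))
    (fun s => ker' cos (fun x => - sin x) X k w (q s) (p s)) t.
  move=> _; split; first exact: (kern_ker _ _ (@smooth1_cos R)).
  exact: (kcurve_ker dcos (@smooth1_cos R) cos_sin (@norm_cos_le1 R) nsn).
have Ks t : s0 <= t <= s1 -> kern (ker sin X k (q t) (p t)) /\ kcurve (fun s => ker sin X k (q s) (p s))
    (fun s => ker' sin cos X k w (q s) (p s)) t.
  move=> _; split; first exact: (kern_ker _ _ (@smooth1_sin R)).
  exact: (kcurve_ker dsin (@smooth1_sin R) (@smooth1_cos R) (@norm_sin_le1 R) (@norm_cos_le1 R)).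
have La := @bas_a _ _ _ _ _ _ _ hb; have Lb := @bas_b _ _ _ _ _ _ _ hb.
have c1 := bil_cont La La Ca Ca Kc; have c2 := bil_cont Lb Lb Cb Cb Kc.
have c3 := bil_cont Lb La Cb Ca Ks; have c4 := cont_onZ (-1) (bil_cont La Lb Ca Cb Ks).
apply: eq_cont_on (cont_onD (cont_onD c1 c2) (cont_onD c3 c4)) => t ht.
have Lat := L2r_L1loc (La t ht); have Lbt := L2r_L1loc (Lb t ht).
have kc := (Kc t ht).1; have ks := (Ks t ht).1.
have j1 := itg_kern Lat Lat kc; have j2 := itg_kern Lbt Lbt kc.
have j3 := itg_kern Lbt Lat ks; have j4 := itg_kern Lat Lbt ks.
rewrite /= mulN1r -(intD j1 j2) -(intB j3 j4) -(intD (itgD j1 j2) (itgB j3 j4)).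
by apply: int_eq => z; ring.
Qed.

End continuity.

(** * A Gronwall functional along the trajectory *)

Section monotone.
Context {R : realType} {d : nat}.
Notation E := 'rV[R]_d.
Notation mu := (@lebesgue_rV R d).
Variables (lam : R) (U : E -> R) (s0 s1 M : R) (a b : R -> E -> R).
Hypotheses (cU : continuous U) (hb : basic s0 s1 M a b) (hh : hamiltonian lam U s0 s1 a b).
Hypotheses (s00 : 0 <= s0) (s01 : s0 < s1).
Variables (X k : E -> R) (F : E -> E) (m c err Q tol : R).
Hypotheses (tX : test_function X) (tk : test_function k) (c0 : 0 <= c) (err0 : 0 <= err).
Hypothesis rate_le : forall t q p w, s0 < t < s1 -> `|q| <= Q -> `|F q - w| <= tol ->
  `|rateint lam U X k w q p (a t) (b t)| <= err + c * (2 * m - 2 * wig X k q p (a t) (b t)).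

(** The factor [e^(- 2 c t)] compensates the growth proportional to the defect, and [2 err t] the
    additive error. With [rate_le] its derivative along a path is nonpositive. *)
Definition gam (t : R) (q p : E) : R :=
  expR (- (2 * c * t)) * (2 * m - 2 * wig X k q p (a t) (b t)) - 2 * err * t.

Lemma gam_decr t0 q0 p0 w t1 t2 : s0 <= t1 -> t1 < t2 -> t2 <= s1 ->
  (forall s, t1 <= s <= t2 -> `|qpath t0 q0 p0 w s| <= Q /\ `|F (qpath t0 q0 p0 w s) - w| <= tol) ->
  gam t2 (qpath t0 q0 p0 w t2) (ppath t0 p0 w t2) <= gam t1 (qpath t0 q0 p0 w t1) (ppath t0 p0 w t1).
Proof.
move=> st1 t12 ts1 H; set q := qpath t0 q0 p0 w; set p := ppath t0 p0 w.
pose N s := wig X k (q s) (p s) (a s) (b s).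
pose D s := 2 * m - 2 * N s.
have pth t : path q p w t by exact: path_poly.
have hb' := basic_sub st1 ts1 hb.
have ein t : t1 < t < t2 -> s0 < t < s1.
  by move=> /andP[h1 h2]; rewrite (le_lt_trans st1 h1) (lt_le_trans h2 ts1).
have dN t : t1 < t < t2 -> is_derive t (1 : R) N (rateint lam U X k w (q t) (p t) (a t) (b t)).
  by move=> /ein ht; exact: (wig_derive cU hb hh s01 tX tk (pth t) ht).
have dexp (t : R) : is_derive t (1 : R) (fun s => expR (- (2 * c * s))) (- (2 * c) * expR (- (2 * c * t))).
  have h1 : is_derive t (1 : R) (fun s : R => - (2 * c * s)) (- (2 * c)).
    have -> : (fun s : R => - (2 * c * s)) = (fun s => (- (2 * c)) * s).
      by apply/funext => s; rewrite mulNr.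
    have := @is_deriveZ _ _ _ _ (- (2 * c)) _ _ _ (is_derive_id t (1 : R)).
    by rewrite /GRing.scale/= mulr1.
  apply: (is_derive_eq (@is_derive1_comp _ expR (fun s => - (2 * c * s)) t _ _ (is_derive_expR _) h1)).
    by rewrite [LHS]mulrC.
pose df t := expR (- (2 * c * t)) * (- 2 * rateint lam U X k w (q t) (p t) (a t) (b t)) +
   (- (2 * c) * expR (- (2 * c * t))) * D t - 2 * err.
apply: (@cont_on_decr R t1 t2 (fun s => gam s (q s) (p s)) df t12).
- have cN : cont_on t1 t2 N by exact: (wig_cont hb' tX tk pth).
  have cst (e : R) : cont_on t1 t2 (fun=> e).
    by move=> t _ e' e0'; exists 1 => // s _ _; rewrite subrr normr0 ltW.
  have cD : cont_on t1 t2 D.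
    by have := cont_onD (cst (2 * m)) (cont_onZ (-2) cN); congr cont_on; apply/funext => s; rewrite /D mulNr.
  have cid : cont_on t1 t2 (fun s : R => - (2 * err * s)).
    have idc : cont_on t1 t2 (fun s : R => s).
      by move=> t _ e e0; exists e => // s _ /ltW.
    by have := cont_onZ (- (2 * err)) idc; congr cont_on; apply/funext => s; rewrite mulNr.
  apply: cont_onD cid; apply: cont_onM cD; apply: derivable_cont_on => t.
  by case: (dexp t).
- move=> t ht; have dNt := dN t ht.
  have dD : is_derive t (1 : R) D (- 2 * rateint lam U X k w (q t) (p t) (a t) (b t)).
    have := is_deriveD (@is_derive_cst _ _ _ (2 * m) t 1) (@is_deriveZ _ _ _ _ (-2) _ _ _ dNt).
    rewrite add0r /GRing.scale/=; congr is_derive.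
    by apply/funext => s; transitivity (2 * m + (-2) * N s); [|rewrite mulNr].
  have dI : is_derive t (1 : R) (fun s : R => - (2 * err * s)) (- (2 * err)).
    have -> : (fun s : R => - (2 * err * s)) = (fun s => (- (2 * err)) * s).
      by apply/funext => s; rewrite mulNr.
    have := @is_deriveZ _ _ _ _ (- (2 * err)) _ _ _ (is_derive_id t (1 : R)).
    by rewrite /GRing.scale/= mulr1.
  apply: (is_derive_eq (is_deriveD (is_deriveM (dexp t) dD) dI)).
  by rewrite /df /GRing.scale/=; ring.
- move=> t ht; have t1t2 : t1 <= t <= t2 by case/andP: ht => h1 h2; rewrite !ltW.
  have [hq hF] := H t t1t2; have hr : `|rateint lam U X k w (q t) (p t) (a t) (b t)| <= err + c * D t.
    exact: (rate_le (p t) (ein t ht) hq hF).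
  have t0' : 0 <= t by case/andP: (ein t ht) => h1 _; rewrite (le_trans s00)// ltW.
  have x1 : expR (- (2 * c * t)) <= 1.
    by rewrite -expR0 ler_expR oppr_le0 !mulr_ge0.
  have x0 : 0 <= expR (- (2 * c * t)) by exact: expR_ge0.
  rewrite /df; set x := expR _ in x0 x1 *; set r := rateint _ _ _ _ _ _ _ _ _ in hr *.
  have h1 : - r <= err + c * D t by apply: le_trans hr; rewrite -normrN ler_norm.
  have := ler_wpM2l x0 h1; have := ler_wpM2r err0 x1; lra.
Qed.

Lemma gam_piece (B LF : R) q0 p0 : 0 <= B -> 0 <= LF -> 0 < tol ->
  (forall q, `|F q| <= B * (1 + `|q|)) -> (forall q q', `|F q - F q'| <= LF * `|q - q'|) ->
  (1 + `|q0| + `|p0|) * expR ((1 + 2 * B) * (s1 - s0)) <= Q ->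
  exists q1 p1, gam s1 q1 p1 <= gam s0 q0 p0 /\
    1 + `|q1| + `|p1| <= (1 + `|q0| + `|p0|) * expR ((1 + 2 * B) * (s1 - s0)).
Proof.
move=> B0 LF0 tol0 gr lip; exact: (polygon_piece s01 B0 LF0 tol0 gr lip gam_decr).
Qed.

End monotone.

(** * From the initial to the final time *)

Section propagation.
Context {R : realType} {d m : nat}.
Notation E := 'rV[R]_d.
Notation mu := (@lebesgue_rV R d).
Variables (lam : R) (V : E -> R) (W : 'rV[R]_m -> E -> R) (T : R) (u : R -> 'rV[R]_m)
  (psi : R -> E -> R[i]).
Hypothesis sol : Sigma_solution lam V W T u psi.
Hypothesis pu : piecewise_constant T u.
Variables (F : 'rV[R]_m -> E -> E) (CT : 'rV[R]_m -> R).
Hypotheses (CT0 : forall c, 0 <= CT c) (tay : forall c, taylor (fun x => V x + W c x) (F c) (CT c)).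
Hypothesis cVW : forall c, continuous (fun x => V x + W c x).
Hypothesis T0 : 0 <= T.

Let a t x := complex.Re (psi t x).
Let b t x := complex.Im (psi t x).

Lemma partition_mono (s : seq R) j k : itv_partition 0 T s -> (j <= k)%N -> (k <= size s)%N ->
  nth 0 (0 :: s) j <= nth 0 (0 :: s) k.
Proof.
move=> hs; elim: k => [|k ih]; first by rewrite leqn0 => /eqP ->.
rewrite leq_eqVlt => /predU1P[->//|jk] ks.
by apply: le_trans (ih _ (ltnW ks)) (ltW (nth_partition hs ks)); rewrite -ltnS.
Qed.

Lemma mass_global t : 0 <= t <= T -> \int[mu]_x ss (a t) (b t) x = \int[mu]_x ss (a 0) (b 0) x.
Proof.
have [M hbas] := Sigma_basic sol T0; have [s hs hpc] := pu.
suff K k : (k <= size s)%N -> forall t, 0 <= t <= nth 0 (0 :: s) k ->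
    \int[mu]_x ss (a t) (b t) x = \int[mu]_x ss (a 0) (b 0) x.
  by rewrite -{1}(nth_partition_last hs); exact: K.
elim: k => [|k ih] ks {}t.
  by rewrite /= -eq_le => /eqP <-.
move=> /andP[t0 tk]; have [h|h] := leP t (nth 0 (0 :: s) k).
  by apply: ih; rewrite ?(ltnW ks)// t0.
have [c hc] := hpc k ks.
have s0 := nth_partition_ge0 hs (ltnW ks); have s1 := nth_partition hs ks.
have sT : nth 0 (0 :: s) k.+1 <= T by rewrite -(nth_partition_last hs); exact: partition_mono.
have hh := Sigma_hamiltonian sol pu cVW s0 s1 sT hc.
have hb' := basic_sub s0 sT hbas.
have [CU CU0 HU] := taylor_growth (CT0 c) (tay c).
rewrite (mass_const (@cVW c) hb' hh s1 CU0 HU); last by rewrite (ltW h).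
by apply: ih; rewrite ?(ltnW ks)// s0 lexx.
Qed.

(** [gam] decreases along a polygonal trajectory issued from the origin of phase space, over each
    piece of constant control in turn. [Q] depends on the control values and the potentials only,
    and is given before [X], [k], [err] and [tol]: for quadratic potentials these are chosen in
    terms of [Q]. *)
Lemma propagation : exists (s : seq R) (cv : nat -> 'rV[R]_m) (Q : R),
  forall X k mm c err tol, test_function X -> test_function k -> 0 <= c -> 0 <= err -> 0 < tol ->
  (forall j t q p w, (j < size s)%N -> 0 <= t <= T -> `|q| <= Q -> `|F (cv j) q - w| <= tol ->
    `|rateint lam (fun x => V x + W (cv j) x) X k w q p (a t) (b t)| <=
      err + c * (2 * mm - 2 * wig X k q p (a t) (b t))) ->
  exists q p, expR (- (2 * c * T)) * (2 * mm - 2 * wig X k q p (a T) (b T)) <=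
    2 * mm - 2 * wig X k 0 0 (a 0) (b 0) + 2 * err * T.
Proof.
have [M hbas] := Sigma_basic sol T0; have [s hs hpc] := pu.
have /choice [cv hcv] : forall j, exists c, (j < size s)%N -> forall t, nth 0 (0 :: s) j < t < nth 0 (0 :: s) j.+1 -> u t = c.
  move=> j; have [js|js] := ltnP j (size s); last by exists 0.
  by have [c hc] := hpc j js; exists c.
pose B := \sum_(j < size s) (`|F (cv j) 0| + 6 * CT (cv j)).
have B1 j : 0 <= `|F (cv j) 0| + 6 * CT (cv j) by rewrite addr_ge0// mulr_ge0.
have B0 : 0 <= B by apply: sumr_ge0.
have BB j : (j < size s)%N -> `|F (cv j) 0| + 6 * CT (cv j) <= B.
  by move=> js; rewrite /B (bigD1 (Ordinal js))//= lerDl sumr_ge0.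
have B'0 : 0 <= 1 + 2 * B by rewrite addr_ge0// mulr_ge0.
exists s, cv, (expR ((1 + 2 * B) * T)) => X k mm c err tol tX tk c0 err0 tol0 hrate.
pose G := gam a b X k mm c err.
suff K j : (j <= size s)%N -> exists q p, G (nth 0 (0 :: s) j) q p <= G 0 0 0 /\
    1 + `|q| + `|p| <= expR ((1 + 2 * B) * nth 0 (0 :: s) j).
  have [q [p [h _]]] := K (size s) (leqnn _); exists q, p.
  by move: h; rewrite (nth_partition_last hs) /G /gam !mulr0 oppr0 expR0 mul1r addr0 lerBlDr.
elim: j => [|j ih] js.
  by exists 0, 0; rewrite /= mulr0 expR0 normr0 !addr0.
have [q0 [p0 [H1 H2]]] := ih (ltnW js).
have s0 := nth_partition_ge0 hs (ltnW js); have s1 := nth_partition hs js.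
have sT : nth 0 (0 :: s) j.+1 <= T by rewrite -(nth_partition_last hs); exact: partition_mono.
have hh := Sigma_hamiltonian sol pu cVW s0 s1 sT (hcv j js).
have hb' := basic_sub s0 sT hbas.
have lip q q' := taylor_lip q q' (CT0 (cv j)) (tay (cv j)).
have gr q : `|F (cv j) q| <= B * (1 + `|q|).
  apply: le_trans (taylor_linear_growth q (CT0 (cv j)) (tay (cv j))) _.
  by rewrite ler_wpM2r ?addr_ge0//; exact: BB.
have LF0 : 0 <= 6 * CT (cv j) by rewrite mulr_ge0.
have expS : expR ((1 + 2 * B) * nth 0 (0 :: s) j) * expR ((1 + 2 * B) * (nth 0 (0 :: s) j.+1 - nth 0 (0 :: s) j)) =
    expR ((1 + 2 * B) * nth 0 (0 :: s) j.+1) by rewrite -expRD; congr expR; ring.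
have H3 : (1 + `|q0| + `|p0|) * expR ((1 + 2 * B) * (nth 0 (0 :: s) j.+1 - nth 0 (0 :: s) j)) <=
    expR ((1 + 2 * B) * nth 0 (0 :: s) j.+1) by rewrite -expS ler_wpM2r ?expR_ge0.
have [t q p w ht||q1 [p1 [G1 G2]]] := @gam_piece _ _ lam _ _ _ _ a b (@cVW (cv j)) hb' hh s0 s1 X k (F (cv j))
   mm c err (expR ((1 + 2 * B) * T)) tol tX tk c0 err0 _ B (6 * CT (cv j)) q0 p0 B0 LF0 tol0 gr lip.
- apply: hrate => //; case/andP: ht => h1 h2.
  by rewrite (le_trans s0 (ltW h1)) (le_trans (ltW h2) sT).
- apply: le_trans H3 _; rewrite ler_expR ler_wpM2l//.
- exists q1, p1; split; first exact: le_trans G1 H1.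
  exact: le_trans G2 H3.
Qed.

End propagation.

(** * Rates of change under quadratic and general potentials *)

Section wig_bounds.
Context {R : realType} {d : nat}.
Notation E := 'rV[R]_d.
Notation mu := (@lebesgue_rV R d).
Notation mu2 := (lebesgue_rV d \x lebesgue_rV d)%E.
Implicit Types (X k : E -> R).

Lemma phase_amgm (a b a' b' th e : R) : 0 < e ->
  2 * `|(a * a' + b * b') * cos th + (b * a' - a * b') * sin th| <=
    e * (a ^+ 2 + b ^+ 2) + e^-1 * (a' ^+ 2 + b' ^+ 2).
Proof.
move=> e0; have H (s : R) : s ^+ 2 = 1 ->
    2 * (s * ((a * a' + b * b') * cos th + (b * a' - a * b') * sin th)) <=
    e * (a ^+ 2 + b ^+ 2) + e^-1 * (a' ^+ 2 + b' ^+ 2).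
  move=> s2; have h := phase_le1 (s * e * a) (s * e * b) a' b' th.
  rewrite -(ler_pM2l e0); apply: le_trans (_ : _ <= (s * e * a) ^+ 2 + (s * e * b) ^+ 2 + (a' ^+ 2 + b' ^+ 2)) _.
    by apply: le_trans h; rewrite le_eqVlt; apply/orP; left; apply/eqP; ring.
  rewrite !exprMn s2 le_eqVlt; apply/orP; left; apply/eqP; field; exact: lt0r_neq0.
case: (ger0P (_ + _)) => _; first by have := H 1 (expr1n _ _); rewrite mul1r.
have n1 : (-1 : R) ^+ 2 = 1 by rewrite sqrrN expr1n.
by have := H (-1) n1; rewrite mulN1r.
Qed.

Section schur_kernel.
Variables (X k : E -> R) (q : E) (s : R) (c : E) (h : E -> R).
Hypotheses (tX : test_function X) (tk : test_function k).
Hypotheses (X0 : forall x, 0 <= X x) (k0 : forall x, 0 <= k x).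
Hypotheses (sE : s = 1 \/ s = -1) (ih : itg mu h) (h0 : forall x, 0 <= h x).
Hypothesis Xk_le : forall x y, X (x - y) * k (x + y - 2 *: q) <= h (c + x + s *: y).

Lemma massk_le a b : L2r a -> L2r b ->
  massk X k q a b <= 2 * \int[mu]_x ss a b x * \int[mu]_x h x.
Proof.
move=> ha hb; have is0 := itg_ss ha hb; have s0 := ss_ge0 a b.
have i1 := itg_schur1 c sE is0 ih s0 h0; have e1 := int_schur1 c sE is0 ih s0 h0.
have i2 := itg_schur2 c s is0 ih s0 h0; have e2 := int_schur2 c s is0 ih s0 h0.
have -> : 2 * \int[mu]_x ss a b x * \int[mu]_x h x = \int[mu2]_z (ss a b z.1 * h (c + z.1 + s *: z.2) +
    ss a b z.2 * h (c + z.1 + s *: z.2)).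
  by rewrite (intD i1 i2) e1 e2; ring.
apply: int_le; [exact: itg_massk|exact: itgD|].
by move=> [x y]; rewrite /pk /fst /snd -mulrDl; apply: ler_wpM2l; [rewrite addr_ge0|exact: Xk_le].
Qed.

Lemma wig_massk a b p : L2r a -> L2r b -> `|2 * wig X k q p a b| <= massk X k q a b.
Proof.
move=> ha hb; have i1 := itg_wig ha hb q p tX tk; have i2 := itg_massk ha hb q tX tk.
rewrite /wig -intZ//; apply: int_norm => //; first exact: itg_measurable (itgZ 2 i1).
move=> [x y]; rewrite !kerE /pk /fst /snd.
set u := x - y; set v := x + y - 2 *: q; set th := dotv p u.
have -> : 2 * ((a x * a y + b x * b y) * (X u * cos th * k v) + (b x * a y - a x * b y) * (X u * sin th * k v)) =
  2 * ((a x * a y + b x * b y) * cos th + (b x * a y - a x * b y) * sin th) * (X u * k v) by ring.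
rewrite normrM (ger0_norm (mulr_ge0 (X0 _) (k0 _))) ler_wpM2r ?mulr_ge0//.
have := phase_amgm (a x) (b x) (a y) (b y) th ltr01; rewrite invr1 !mul1r normrM ger0_norm//.
Qed.

(** [wig] is a quadratic form. Its difference consists of two cross terms, split with the weight
    [e], and of the form at the difference of the states; each is bounded by the Schur
    identities. *)
Lemma wig_close a b a' b' p e : L2r a -> L2r b -> L2r a' -> L2r b' -> 0 < e ->
  `|wig X k q p a b - wig X k q p a' b'| <=
  (e * \int[mu]_x ss a' b' x + (e^-1 + 1) * \int[mu]_x ((a x - a' x) ^+ 2 + (b x - b' x) ^+ 2)) * \int[mu]_x h x.
Proof.
move=> ha hb ha' hb' e0.
pose f x := a x - a' x; pose g x := b x - b' x.
have hf : L2r f by exact: L2rB. have hg : L2r g by exact: L2rB.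
have is0 := itg_ss ha' hb'; have s0 := ss_ge0 a' b'.
have it0 := itg_ss hf hg; have t0 := ss_ge0 f g.
have i1 := itg_schur1 c sE is0 ih s0 h0; have e1 := int_schur1 c sE is0 ih s0 h0.
have i2 := itg_schur2 c s is0 ih s0 h0; have e2 := int_schur2 c s is0 ih s0 h0.
have i3 := itg_schur1 c sE it0 ih t0 h0; have e3 := int_schur1 c sE it0 ih t0 h0.
have i4 := itg_schur2 c s it0 ih t0 h0; have e4 := int_schur2 c s it0 ih t0 h0.
have j1 := itg_wig ha hb q p tX tk; have j2 := itg_wig ha' hb' q p tX tk.
pose c2 := (e^-1 + 1) / 2.
have l1 := itgD (itgZ (e / 2) i1) (itgZ (e / 2) i2); have l2 := itgD (itgZ c2 i3) (itgZ c2 i4).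
have -> : (e * \int[mu]_x ss a' b' x + (e^-1 + 1) * \int[mu]_x ((a x - a' x) ^+ 2 + (b x - b' x) ^+ 2)) * \int[mu]_x h x =
  \int[mu2]_z (e / 2 * (ss a' b' z.1 * h (c + z.1 + s *: z.2)) + e / 2 * (ss a' b' z.2 * h (c + z.1 + s *: z.2)) +
    (c2 * (ss f g z.1 * h (c + z.1 + s *: z.2)) + c2 * (ss f g z.2 * h (c + z.1 + s *: z.2)))).
  rewrite (intD l1 l2) (intD (itgZ (e / 2) i1) (itgZ (e / 2) i2)) (intD (itgZ c2 i3) (itgZ c2 i4)).
  rewrite !intZ// e1 e2 e3 e4 /c2 -/(ss f g) -[\int[mu]_x ((_ - _) ^+ 2 + _)]/(\int[mu]_x ss f g x).
  by field; rewrite gt_eqF.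
rewrite /wig -(intB j1 j2); apply: int_norm; [exact: itg_measurable (itgB j1 j2)|exact: itgD|].
move=> [x y]; rewrite !kerE /fst /snd.
set u := x - y; set v := x + y - 2 *: q; set th := dotv p u; set H := h _.
have H1 : X u * k v <= H by exact: Xk_le.
have Xk0 : 0 <= X u * k v by rewrite mulr_ge0.
pose I a b a' b' : R := (a * a' + b * b') * cos th + (b * a' - a * b') * sin th.
have -> : (a x * a y + b x * b y) * (X u * cos th * k v) + (b x * a y - a x * b y) * (X u * sin th * k v) -
   ((a' x * a' y + b' x * b' y) * (X u * cos th * k v) + (b' x * a' y - a' x * b' y) * (X u * sin th * k v)) =
   (I (a' x) (b' x) (f y) (g y) + I (f x) (g x) (a' y) (b' y) + I (f x) (g x) (f y) (g y)) * (X u * k v).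
  by rewrite /I /f /g; ring.
rewrite normrM (ger0_norm Xk0).
have p1 := phase_amgm (a' x) (b' x) (f y) (g y) th e0.
have ei0 : 0 < e^-1 by rewrite invr_gt0.
have p2 := phase_amgm (f x) (g x) (a' y) (b' y) th ei0; rewrite invrK in p2.
have p3 := phase_amgm (f x) (g x) (f y) (g y) th ltr01; rewrite invr1 !mul1r in p3.
rewrite -!/(I _ _ _ _) in p1 p2 p3.
pose S : R := e / 2 * ss a' b' x + e / 2 * ss a' b' y + (c2 * ss f g x + c2 * ss f g y).
have IS : `|I (a' x) (b' x) (f y) (g y) + I (f x) (g x) (a' y) (b' y) + I (f x) (g x) (f y) (g y)| <= S.
  apply: le_trans (ler_normD _ _) _; apply: le_trans (lerD (ler_normD _ _) (lexx _)) _.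
  rewrite /S /c2 /ss; lra.
have S0 : 0 <= S by apply: le_trans IS.
apply: le_trans (ler_pM _ _ IS H1) _ => //.
by rewrite /S le_eqVlt; apply/orP; left; apply/eqP; ring.
Qed.

End schur_kernel.

(** The global phase left free in the definition of controllability does not affect [wig]. *)
Lemma wig_rot X k (q p : E) (a b : E -> R) (th : R) :
  wig X k q p (fun x => cos th * a x - sin th * b x) (fun x => cos th * b x + sin th * a x) = wig X k q p a b.
Proof.
apply: int_eq => z; have := cos2Dsin2 th; set c := cos th; set s := sin th => cs.
have h1 : (c * a z.1 - s * b z.1) * (c * a z.2 - s * b z.2) + (c * b z.1 + s * a z.1) * (c * b z.2 + s * a z.2) =
  (a z.1 * a z.2 + b z.1 * b z.2) * (c ^+ 2 + s ^+ 2) by ring.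
have h2 : (c * b z.1 + s * a z.1) * (c * a z.2 - s * b z.2) - (c * a z.1 - s * b z.1) * (c * b z.2 + s * a z.2) =
  (b z.1 * a z.2 - a z.1 * b z.2) * (c ^+ 2 + s ^+ 2) by ring.
by rewrite h1 h2 cs !mulr1.
Qed.

Lemma ss_close (a b a' b' : E -> R) (e : R) : L2r a -> L2r b -> L2r a' -> L2r b' -> 0 < e ->
  \int[mu]_x ss a b x <= (1 + e) * \int[mu]_x ss a' b' x +
    (1 + e^-1) * \int[mu]_x ((a x - a' x) ^+ 2 + (b x - b' x) ^+ 2).
Proof.
move=> ha hb ha' hb' e0; have i1 := itg_ss ha hb; have i2 := itg_ss ha' hb'.
have i3 : itg mu (fun x => (a x - a' x) ^+ 2 + (b x - b' x) ^+ 2).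
  by apply: itgD; [case: (L2rB ha ha')|case: (L2rB hb hb')].
rewrite -!intZ// -intD; [|exact: itgZ|exact: itgZ].
apply: int_le; [exact: i1|by apply: itgD; exact: itgZ|].
move=> x; have K (u v : R) : u ^+ 2 <= (1 + e) * v ^+ 2 + (1 + e^-1) * (u - v) ^+ 2.
  rewrite -subr_ge0 (_ : _ - _ = e^-1 * (e * v - (u - v)) ^+ 2); last by field; rewrite gt_eqF.
  by rewrite mulr_ge0 ?sqr_ge0// invr_ge0 ltW.
by rewrite /ss; have := K (a x) (a' x); have := K (b x) (b' x); lra.
Qed.

(** * Quadratic potentials *)

Section quadratic_rate.
Variables (a b : E -> R) (M ep Lr A Q tol : R) (X k : E -> R) (lam : R) (U : E -> R) (F : E -> E) (q p w : E).
Hypotheses (ha : L2r a) (hb : L2r b) (mk : mollifier ep k) (ep1 : ep <= 1).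
Hypotheses (mM : \int[mu]_x ss a b x <= M) (wi : itg mu (fun x => sqnorm x * ss a b x))
  (wM : \int[mu]_x (sqnorm x * ss a b x) <= M).
Hypotheses (tX : test_function X) (X01 : forall v, 0 <= X v <= 1) (XL : forall j v, `|partial j X v| <= Lr).
Hypotheses (cU : continuous U) (A0 : 0 <= A)
  (HU : forall x y, `|U x - U y - dotv (F q) (x - y)| <= A * (`|x + y - 2 *: q| * `|x - y|)).
Hypotheses (qQ : `|q| <= Q) (Fw : `|F q - w| <= tol).

(** Here [k] is the approximate identity and [X] the cutoff, so [|x + y - 2 q| < ep]. The remainder
    is [O(ep |x - y|)], the force error [O(tol |x - y|)], and [|x - y|] is paid for by the second
    moment. Since [X <= 1], [massk] is at most twice the mass, which gives the defect in Gronwall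
    form. *)
Lemma quadratic_rate :
  `|rateint lam U X k w q p a b| <= 2 * Lr * \int[mu]_x ss a b x * \int[mu]_x (\sum_j `|partial j k x|) +
    (A * ep + d%:R * tol) * (5 + 2 * Q) * M +
    2 * `|lam| * (2 * \int[mu]_x ss a b x - 2 * wig X k q p a b).
Proof.
have tk := mol_test mk; have k0 := mol_ge0 mk; have ik := mol_itg mk.
have X0 v : 0 <= X v by case/andP: (X01 v).
have Q0 : 0 <= Q by exact: le_trans qQ.
have tol0 : 0 <= tol by exact: le_trans Fw.
have is0 := itg_ss ha hb; have s0 := ss_ge0 a b.
have M0 : 0 <= M by apply: le_trans mM; exact: int_ge0.
pose h1 x := \sum_j `|partial j k x|.
have ih1 : itg mu h1 by apply: itg_sum => j; apply: itg_norm; exact: test_itg (test_partial j tk).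
have h10 x : 0 <= h1 x by apply: sumr_ge0.
(* A mollifier of nonpositive radius would vanish, against its integral being [1]. *)
have [ep0|ep0] := leP ep 0.
  have k00 x : k x = 0 by apply: (mol_supp mk); exact: le_trans ep0 _.
  have := mol_int mk; under eq_Rintegral do rewrite k00; rewrite Rintegral_cst// mul0r => /eqP.
  by rewrite eq_sym oner_eq0.
pose K := A * ep + d%:R * tol.
have K0 : 0 <= K by rewrite addr_ge0// mulr_ge0// ltW.
pose W (x : E) := K * (3 + 2 * Q + 2 * sqnorm x).
have W0 x : 0 <= W x by rewrite mulr_ge0// !addr_ge0// mulr_ge0// sqnorm_ge0.
have iW : itg mu (fun x => W x * ss a b x).
  have := itgD (itgZ (K * (3 + 2 * Q)) is0) (itgZ (K * 2) wi).
  by congr (itg mu); apply/funext => x; rewrite /W; ring.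
have WM : \int[mu]_x (W x * ss a b x) <= K * (5 + 2 * Q) * M.
  have -> : \int[mu]_x (W x * ss a b x) = K * (3 + 2 * Q) * \int[mu]_x ss a b x + K * 2 * \int[mu]_x (sqnorm x * ss a b x).
    by rewrite -!intZ// -intD; [apply: int_eq => x; rewrite /W; ring|exact: itgZ|exact: itgZ].
  have c1 : 0 <= K * (3 + 2 * Q) by rewrite mulr_ge0// addr_ge0// mulr_ge0.
  have c2 : 0 <= K * 2 by rewrite mulr_ge0.
  by have := ler_wpM2l c1 mM; have := ler_wpM2l c2 wM; lra.
have sP : (1 : R) = 1 \/ (1 : R) = -1 by left.
have aff (x y : E) : - (2 *: q) + x + 1 *: y = x + y - 2 *: q by rewrite scale1r -addrA addrC.
have pot x y : `|U x - U y - dotv w (x - y)| * (X (x - y) * k (x + y - 2 *: q)) <=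
    K * (`|x - y| * k (x + y - 2 *: q)).
  have [vk|vk] := leP ep `|x + y - 2 *: q|.
    by rewrite (mol_supp mk vk) !mulr0.
  have -> : U x - U y - dotv w (x - y) = (U x - U y - dotv (F q) (x - y)) + dotv (F q - w) (x - y).
    by rewrite dotvBl; ring.
  have n1 := HU x y; have n2 := dotv_norm (F q - w) (x - y).
  have n3 : A * (`|x + y - 2 *: q| * `|x - y|) <= A * ep * `|x - y|.
    by rewrite -mulrA ler_wpM2l// ler_wpM2r// ltW.
  have n4 : d%:R * (`|F q - w| * `|x - y|) <= d%:R * tol * `|x - y|.
    by rewrite -mulrA ler_wpM2l// ler_wpM2r.
  rewrite [leRHS]mulrA; apply: ler_pM; rewrite ?mulr_ge0//.
    apply: le_trans (ler_normD _ _) _; rewrite /K mulrDl; apply: lerD; first exact: le_trans n3.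
    exact: le_trans n4.
  by rewrite ler_piMl//; case/andP: (X01 (x - y)).
have zx x y : `|x + y - 2 *: q| < ep -> `|x - y| <= 3 + 2 * Q + 2 * sqnorm x /\ `|x - y| <= 3 + 2 * Q + 2 * sqnorm y.
  move=> vk; have := norm_le_sqnorm x; have := norm_le_sqnorm y.
  have b1 : `|x - y| <= 2 * `|x| + `|x + y - 2 *: q| + 2 * `|q|.
    have -> : x - y = x + x - (x + y - 2 *: q) - 2 *: q by apply/rowP => j; rewrite !mxE; ring.
    apply: le_trans (ler_normB _ _) _; rewrite normrZ ger0_norm//; apply: lerD => //.
    by apply: le_trans (ler_normB _ _) _; apply: lerD => //; apply: le_trans (ler_normD _ _) _; lra.
  have b2 : `|x - y| <= 2 * `|y| + `|x + y - 2 *: q| + 2 * `|q|.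
    have -> : x - y = - (y + y) + (x + y - 2 *: q) + 2 *: q by apply/rowP => j; rewrite !mxE; ring.
    apply: le_trans (ler_normD _ _) _; rewrite normrZ ger0_norm//; apply: lerD => //.
    apply: le_trans (ler_normD _ _) _; apply: lerD => //; rewrite normrN.
    by apply: le_trans (ler_normD _ _) _; lra.
  by move: vk ep1 qQ b1 b2; lra.
have H := rate_bound ha hb p tX tk X0 k0 lam (w := w) (q := q) (K1 := 2 * Lr)
   (c1 := - (2 *: q)) (c2 := - (2 *: q)) cU sP sP ih1 h10 ik k0 W0 iW.
apply: le_trans (H _ _ _) _.
- move=> x y; rewrite aff -mulrA ler_pM2l// /h1 mulr_sumr; apply: ler_sum => j _.
  by rewrite normrM ler_wpM2r.
- move=> x y; apply: le_trans (pot x y) _; rewrite aff.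
  have [vk|vk] := leP ep `|x + y - 2 *: q|; first by rewrite (mol_supp mk vk) !mulr0.
  by rewrite mulrA ler_wpM2r// /W ler_wpM2l//; case: (zx x y vk).
- move=> x y; apply: le_trans (pot x y) _; rewrite aff.
  have [vk|vk] := leP ep `|x + y - 2 *: q|; first by rewrite (mol_supp mk vk) !mulr0.
  by rewrite mulrA ler_wpM2r// /W ler_wpM2l//; case: (zx x y vk).
rewrite (mol_int mk) mulr1; apply: lerD; first by apply: lerD.
rewrite ler_wpM2l ?mulr_ge0// lerD2r.
have := massk_le tX tk sP ik k0 (q := q) (c := - (2 *: q)) _ ha hb; rewrite (mol_int mk) mulr1; apply.
move=> x y; rewrite aff ler_piMl//; by case/andP: (X01 (x - y)).
Qed.

End quadratic_rate.

(** * Bounded second derivatives *)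

Section fixed_scale_rate.

(** On the support of the kernel [x] and [y] are within [1] of [q], so the remainder is at most
    [2 CF + d]: the force itself, hence a linear control, enters only through [F q - w]. The defect
    is bounded crudely by the mass. *)
Lemma bump_rate (lam CF : R) : 0 <= CF -> exists2 C : R, 0 <= C & forall (a b : E -> R) (U : E -> R) (F : E -> E) (q p w : E),
  L2r a -> L2r b -> continuous U -> taylor U F CF -> `|F q - w| <= 1 ->
  `|rateint lam U bump bump w q p a b| <= C * \int[mu]_x ss a b x.
Proof.
move=> CF0; have tb := @test_bump R d.
have b0 := @bump_ge0 R d; have b1 := @bump_le1 R d.
have /choice [Cj HCj] : forall j, exists C : R, 0 < C /\ forall x : E, `|partial j bump x| <= C.
  by move=> j; have [C C0 H] := test_bounded (test_partial j tb); exists C.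
pose Cb := \sum_j Cj j.
have CjC j : Cj j <= Cb.
  by rewrite /Cb (bigD1 j)//= lerDl sumr_ge0// => i _; case: (HCj i) => /ltW.
have Cb0 : 0 <= Cb by apply: sumr_ge0 => j _; case: (HCj j) => /ltW.
pose h1 (x : E) : R := \sum_j `|partial j bump x|.
have ih1 : itg mu h1 by apply: itg_sum => j; apply: itg_norm; exact: test_itg (test_partial j tb).
have h10 x : 0 <= h1 x by apply: sumr_ge0.
have ib := test_itg tb.
set S := \int[mu]_x (bump x : R); set H1 := \int[mu]_x h1 x.
have S0 : 0 <= S by exact: int_ge0.
have H10 : 0 <= H1 by exact: int_ge0.
pose K := 2 * CF + d%:R.
have K0 : 0 <= K by rewrite addr_ge0// mulr_ge0.
exists (2 * Cb * H1 + K * S + 2 * `|lam| * (4 * S)); first by rewrite !addr_ge0// !mulr_ge0.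
move=> a b U F q p w ha hb cU tay Fw.
have is0 := itg_ss ha hb; have s0 := ss_ge0 a b.
have sN : (-1 : R) = 1 \/ (-1 : R) = -1 by right.
have aff (x y : E) : 0 + x + (-1) *: y = x - y by rewrite add0r scaleN1r.
have pot x y : `|U x - U y - dotv w (x - y)| * (bump (x - y) * bump (x + y - 2 *: q)) <= K * bump (x - y).
  have [z1|z1] := leP 1 `|x - y|; first by rewrite (bump_eq0 z1) mul0r !mulr0.
  have [v1|v1] := leP 1 `|x + y - 2 *: q|; first by rewrite (bump_eq0 v1) !mulr0 mulr_ge0.
  have half (u v : E) : `|u| <= 1 -> `|v| <= 1 -> `|2^-1 *: (u + v)| <= 1.
    move=> h1' h2'; rewrite normrZ ger0_norm//; have := ler_normD u v; lra.
  have xq : `|x - q| <= 1.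
    have -> : x - q = 2^-1 *: ((x - y) + (x + y - 2 *: q)) by apply/rowP => j; rewrite !mxE; field.
    by apply: half; exact: ltW.
  have yq : `|y - q| <= 1.
    have -> : y - q = 2^-1 *: (- (x - y) + (x + y - 2 *: q)) by apply/rowP => j; rewrite !mxE; field.
    by apply: half; rewrite ?normrN; exact: ltW.
  apply: ler_pM; rewrite ?mulr_ge0//; last by rewrite ler_piMr.
  have -> : U x - U y - dotv w (x - y) = (U x - U y - dotv (F q) (x - y)) + dotv (F q - w) (x - y).
    by rewrite dotvBl; ring.
  apply: le_trans (ler_normD _ _) _; rewrite /K; apply: lerD.
    apply: le_trans (taylor_two x y q tay) _; rewrite mulrC ler_wpM2r//.
    have : `|x - q| ^+ 2 <= 1 by rewrite expr_le1.
    have : `|y - q| ^+ 2 <= 1 by rewrite expr_le1.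
    lra.
  apply: le_trans (dotv_norm _ _) _; rewrite ler_piMr// mulr_ile1//; exact: ltW.
have H := rate_bound ha hb p tb tb b0 b0 lam (w := w) (q := q) (K1 := 2 * Cb)
   (c1 := 0) (c2 := 0) cU sN sN ih1 h10 ib b0 (fun=> K0) (itgZ K is0).
apply: le_trans (H _ _ _) _.
- move=> x y; rewrite aff -mulrA ler_pM2l// /h1 mulr_sumr; apply: ler_sum => j _.
  rewrite normrM mulrC ler_wpM2r//; case: (HCj j) => _ h; exact: le_trans (h _) (CjC j).
- by move=> x y; rewrite aff; exact: pot.
- by move=> x y; rewrite aff; exact: pot.
have m1 : massk bump bump q a b <= 2 * \int[mu]_x ss a b x * S.
  apply: (massk_le tb tb sN ib b0 (c := 0)) => // x y.
  by rewrite aff ler_piMr.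
have := wig_massk q tb tb b0 b0 p ha hb; rewrite ler_norml => /andP[w1 w2].
have m0 : 0 <= \int[mu]_x ss a b x by exact: int_ge0.
rewrite -/S -/H1 intZ//.
move: m1 w1 w2; set m := \int[mu]_x ss a b x; set mk := massk _ _ _ _ _; set wg := wig _ _ _ _ _ _ => m1 w1 w2.
have hl : 2 * `|lam| * (mk - 2 * wg) <= 2 * `|lam| * (4 * m * S) by rewrite ler_wpM2l ?mulr_ge0//; lra.
clear H pot HCj CjC; clearbody S H1 K; lra.
Qed.

End fixed_scale_rate.

End wig_bounds.

(** * The two classes of potentials *)

Section potentials.
Context {R : realType} {d : nat}.
Notation E := 'rV[R]_d.
Notation mu := (@lebesgue_rV R d).

Lemma ballE (c : E) (r : R) : 0 < r ->
  [set x : E | `|x - c| <= r] = [set x | forall i, `[c ord0 i - r, c ord0 i + r]%classic (x ord0 i)].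
Proof.
move=> r0; apply/seteqP; split => x /=.
  by move=> /(normrV_le _ (ltW r0)) H i; have := H i; rewrite !mxE in_itv/= ler_distl.
by move=> H; apply/(normrV_le _ (ltW r0)) => i; have := H i; rewrite !mxE in_itv/= ler_distl.
Qed.

Lemma ball_measure (c : E) (r : R) : 0 < r ->
  measurable [set x : E | `|x - c| <= r] /\ (0 < mu [set x : E | (`|x - c| <= r)%R])%E.
Proof.
move=> r0; rewrite ballE//; split.
  by apply: (measurable_box (A := fun i => `[c ord0 i - r, c ord0 i + r]%classic)) => i.
rewrite (lebesgue_rV_box (A := fun i => `[c ord0 i - r, c ord0 i + r]%classic))//.
rewrite (eq_bigr (fun=> (2 * r)%:E)); first by rewrite prodEFin lte_fin prodr_gt0// => i _; rewrite mulr_gt0.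
move=> i _; rewrite lebesgue_measure_itv/= lte_fin ifT; last by lra.
by rewrite -EFinB; congr EFin; ring.
Qed.

(** If a continuous function exceeded the essential bound at a point, it would do so on a ball,
    which has positive measure. *)
Lemma Lnormy_bounded (g : E -> R) : continuous g -> ('N[mu]_+oo[EFin \o g] < +oo)%E ->
  exists2 C : R, 0 <= C & forall x, `|g x| <= C.
Proof.
(* The norm unfolds to an essential supremum once the whole space is known to have positive
   measure. *)
move=> cg; rewrite unlock ifT; last first.
  have [mB B0] := ball_measure 0 ltr01.
  by apply: lt_le_trans B0 _; apply: le_measure; rewrite ?inE//; exact: subsetT.
set S := ess_sup_inf.ess_sup _ _ => SM; have [M M0 SM'] : exists2 M : R, 0 <= M & (S <= M%:E)%E.
  case: S SM => [r _|//|_]; last by exists 0 => //; rewrite leNye.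
  by exists `|r| => //; rewrite lee_fin ler_norm.
exists M => // x; rewrite leNgt; apply/negP => Mx.
have /ess_sup_inf.ess_supP[N [mN N0 HN]] := SM'.
have [r r0 Hr] : exists2 r : R, 0 < r & forall y, `|y - x| <= r -> M < `|g y|.
  have /cvgrPdist_lt/(_ (`|g x| - M)) := cg x; rewrite subr_gt0 => /(_ Mx)/nbhs_ballP[r r0 H].
  exists (r / 2); first by rewrite divr_gt0.
  move=> y yx; have : ball x r y.
    by rewrite -ball_normE /= distrC; apply: le_lt_trans yx _; rewrite ltr_pdivrMr// ltr_pMr ?ltr1n.
  move=> /H /=; have := ler_norm (`|g x| - `|g y|); have := ler_dist_dist (g x) (g y).
  by move=> h1 h2 h3; lra.
have [mB] := ball_measure x r0; rewrite ltNge; apply/negP/negPn; rewrite -N0.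
apply: le_measure; rewrite ?inE// => y /= /Hr My; apply: HN => /=.
by rewrite lee_fin leNgt My.
Qed.

Lemma foldr_skip (b : 'I_d -> nat) (f : E -> R) (s : seq 'I_d) : (forall j, j \in s -> b j = 0%N) ->
  foldr (fun j => iter (b j) (partial j)) f s = f.
Proof.
elim: s => //= j s ih H; rewrite (H j) ?mem_head//= ih// => i si.
by apply: H; rewrite in_cons si orbT.
Qed.

(** [mpartial] puts the derivative of smallest index outermost. [hessian_taylor] calls for mixed
    derivatives in this order only, so their symmetry is not invoked. *)
Lemma mpartial2 (f : E -> R) (i k : 'I_d) : (i <= k)%N ->
  mpartial (fun j => (j == i) + (j == k))%N f = partial i (partial k f).
Proof.
move=> ik; have srt : pairwise (fun x y : 'I_d => (x < y)%N) (enum 'I_d).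
  have := iota_ltn_sorted 0 d; rewrite -val_enum_ord sorted_pairwise; last exact: ltn_trans.
  by rewrite pairwise_map.
have un := enum_uniq 'I_d; rewrite /mpartial.
have := mem_enum 'I_d i; have := mem_enum 'I_d k; rewrite !inE.
move: srt un; move=> /[swap] un /[swap] ke /[swap] ie; move: un ke; move: ie => /splitPr[s1 s2].
rewrite pairwise_cat cat_uniq pairwise_cons => un ke /and3P[a12 _ _].
move: un => /and3P[u1 u12 /= /andP[is2 u2]].
have ks1 : k \notin s1.
  apply/negP => h; move/allrelP : a12 => /(_ k i h); rewrite mem_head => /(_ isT).
  by rewrite ltnNge ik.
have is1 : i \notin s1 by apply: contra u12 => h; apply/hasP; exists i => //; rewrite mem_head.
rewrite foldr_cat foldr_skip; last first.
  move=> j js; have /negbTE -> : j != i by apply: contraNneq is1 => <-.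
  by have /negbTE -> : j != k by apply: contraNneq ks1 => <-.
rewrite /= eqxx; have [ki|ki] := eqVneq i k.
  rewrite foldr_skip ?ki//= => j js; have /negbTE -> : j != k; last by [].
  by apply: contraNneq is2 => h; rewrite ki -h.
rewrite /=; congr partial.
have : k \in s2 by move: ke; rewrite mem_cat (negbTE ks1) /= in_cons eq_sym (negbTE ki).
move=> ks2; move: is2 u2; case/splitPr: ks2 => s3 s4; rewrite mem_cat in_cons !negb_or cat_uniq /=.
move=> /and3P[i3 _ i4] /and4P[_ /norP[/negP h3 _] ks4 _].
have k3 : k \notin s3 by apply/negP.
rewrite foldr_cat foldr_skip /=; last first.
  move=> j js; have /negbTE -> : j != i by apply: contraNneq i3 => <-.
  by have /negbTE -> : j != k by apply: contraNneq k3 => <-.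
rewrite eq_sym (negbTE ki) eqxx /= foldr_skip// => j js.
have /negbTE -> : j != i by apply: contraNneq i4 => <-.
by have /negbTE -> : j != k by apply: contraNneq ks4 => <-.
Qed.

Definition grad (f : E -> R) (x : E) : E := \row_j partial j f x.

(** The increment of [V] is taken along the axes, then again that of its [k]-th derivative between
    [q] and [xi k]. As these two points agree in the coordinates after [k], only derivatives with
    [i <= k] occur. *)
Lemma hessian_taylor (V : E -> R) (B : R) : smooth V -> 0 <= B ->
  (forall (i k : 'I_d) (x : E), (i <= k)%N -> `|partial i (partial k V) x| <= B) -> taylor V (grad V) (d%:R ^+ 2 * B).
Proof.
move=> sV B0 HB x q; have : x = q + (x - q) by rewrite addrC subrK.
move: (x - q) => z ->.
have [xi [Hxi e]] := coordinate_mvt q z (fun j y => @smooth_derivable _ _ _ j y sV).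
rewrite e /dotv -sumrB; apply: le_trans (ler_norm_sum _ _ _) _.
rewrite (_ : d%:R ^+ 2 * B * _ = \sum_(k < d) (d%:R * B * `|z| ^+ 2)); last first.
  by rewrite sumr_const card_ord -mulr_natl; ring.
apply: ler_sum => k _; rewrite mxE (mulrC (partial k V q)) -mulrBr normrM.
have -> : d%:R * B * `|z| ^+ 2 = `|z| * (d%:R * B * `|z|) by ring.
apply: ler_pM => //; first exact: coord_le_norm.
have [t tz ek] := Hxi k; set z' := xi k - q.
have z'z : `|z'| <= `|z| by rewrite /z' ek; exact: partway_close.
have z'0 (i : 'I_d) : (k < i)%N -> z' ord0 i = 0.
  move=> ki; rewrite /z' ek !mxE /= (leq_gtF (ltnW ki)).
  by rewrite (_ : (i == k) = false) ?mulr0 ?addr0 ?subrr//; apply/negbTE; rewrite -val_eqE /= gtn_eqF.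
have [eta [_ e']] := coordinate_mvt_close q z' (fun j y => @smooth_derivable _ _ _ j y (smooth_partial k sV)).
rewrite (_ : xi k = q + z') ?e'; last by rewrite /z' addrC subrK.
apply: le_trans (ler_norm_sum _ _ _) _.
rewrite (_ : d%:R * B * _ = \sum_(i < d) (`|z| * B)); last by rewrite sumr_const card_ord -mulr_natl; ring.
apply: ler_sum => i _; rewrite normrM; have [ik|ki] := leqP i k.
  by apply: ler_pM => //; [apply: le_trans z'z; exact: coord_le_norm|exact: HB].
by rewrite z'0// normr0 mul0r mulr_ge0.
Qed.

Lemma smooth_taylor (V : E -> R) : smooth V ->
  (forall b : 'I_d -> nat, (2 <= \sum_(j < d) b j)%N -> ('N[mu]_+oo[EFin \o mpartial b V] < +oo)%E) ->
  exists2 C : R, 0 <= C & taylor V (grad V) C.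
Proof.
move=> sV HV; have /choice [f Hf] : forall ik : 'I_d * 'I_d, exists C : R, 0 <= C /\
    ((ik.1 <= ik.2)%N -> forall x, `|partial ik.1 (partial ik.2 V) x| <= C).
  move=> [i k]; have [ik|ik] := leqP i k; last by exists 0; split => //=; rewrite leqNgt ik.
  have [||C C0 HC] := @Lnormy_bounded (partial i (partial k V)).
  - by apply: smooth_cont; do 2 apply: smooth_partial.
  - rewrite -mpartial2//; apply: HV; rewrite big_split /=.
    by rewrite (bigD1 i)//= (bigD1 k (F := fun j => nat_of_bool (j == k)))//= !eqxx addnACA -[2%N]/(1 + 1)%N leq_addr.
  by exists C.
have f0 ik : 0 <= f ik by case: (Hf ik).
have S0 : 0 <= \sum_ik f ik by apply: sumr_ge0.
exists (d%:R ^+ 2 * \sum_ik f ik); first by rewrite mulr_ge0// exprn_ge0.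
apply: hessian_taylor => // i k x ik; have [_ /(_ ik x) H] := Hf (i, k); apply: le_trans H _.
by rewrite (bigD1 (i, k))//= lerDl sumr_ge0.
Qed.

Lemma dotvDl (x y a : E) : dotv (x + y) a = dotv x a + dotv y a.
Proof. by rewrite dotvC dotvDr !(dotvC a). Qed.

Lemma dotvZl (t : R) (x a : E) : dotv (t *: x) a = t * dotv x a.
Proof. by rewrite dotvC dotvZr (dotvC a). Qed.

Lemma taylor_linear (U : E -> R) (F : E -> E) (C : R) (c : E) : taylor U F C ->
  taylor (fun x => U x + dotv c x) (fun x => F x + c) C.
Proof.
move=> H x q; apply: le_trans (H x q); rewrite le_eqVlt; apply/orP; left; apply/eqP; congr `|_|.
rewrite dotvDl (_ : dotv c x = dotv c q + dotv c (x - q)); last by rewrite -dotvDr addrC subrK.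
ring.
Qed.

Definition quad (A g : R) (B x : E) : R := A * sqnorm x + dotv B x + g.

(** The expansion is exact when [q] is the midpoint of [x] and [y]; the error is linear in
    [x + y - 2 q]. *)
Lemma quad_two (A g : R) (B x y q : E) :
  quad A g B x - quad A g B y - dotv ((2 * A) *: q + B) (x - y) = A * dotv (x + y - 2 *: q) (x - y).
Proof.
have sq (v : E) : sqnorm v = dotv v v by apply: eq_bigr => j _; rewrite expr2.
have e1 : sqnorm x - sqnorm y = dotv (x + y) (x - y).
  by rewrite !sq dotvDl (dotvC x (x - y)) (dotvC y (x - y)) !dotvBl (dotvC y x); ring.
have e2 : dotv B x - dotv B y = dotv B (x - y) by rewrite !(dotvC B) dotvBl.
rewrite /quad dotvBl (dotvDl (_ *: q) B) !dotvZl -e1 -e2; ring.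
Qed.

Lemma quad_diff (A g : R) (B x y q : E) :
  `|quad A g B x - quad A g B y - dotv ((2 * A) *: q + B) (x - y)| <=
  `|A| * d%:R * (`|x + y - 2 *: q| * `|x - y|).
Proof. by rewrite quad_two normrM -mulrA ler_wpM2l// dotv_norm. Qed.

Lemma quad_taylor (A g : R) (B : E) : taylor (quad A g B) (fun q => (2 * A) *: q + B) (`|A| * d%:R).
Proof.
move=> x q; apply: le_trans (quad_diff _ _ _ _ _ _) _.
by rewrite (_ : x + q - 2 *: q = x - q) ?expr2//; apply/rowP => j; rewrite !mxE; ring.
Qed.

Lemma quad_cont (A g : R) (B : E) : continuous (quad A g B).
Proof.
have sc : continuous (@sqnorm R d).
  have -> : @sqnorm R d = \sum_j (fun y : E => y ord0 j * y ord0 j).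
    by apply/funext => y; rewrite fct_sumE; apply: eq_bigr => j _; rewrite expr2.
  elim/big_ind: _ => [|f h cf ch|i _]; first exact: cst_continuous.
    by move=> x; exact: (continuousD (cf x) (ch x)).
  by move=> x; exact: (continuousM (@coord_continuous _ _ _ _ _ x) (@coord_continuous _ _ _ _ _ x)).
move=> x; suff : {for x, continuous (cst A * @sqnorm R d + dotv B + cst g)} by exact.
apply: continuousD; last exact: cst_continuous.
apply: continuousD; last exact: continuous_dotv.
by apply: continuousM; [exact: cst_continuous|exact: sc].
Qed.

End potentials.

(** * Initial and target states *)

Section states.
Context {R : realType} {d : nat}.
Notation E := 'rV[R]_d.
Notation mu := (@lebesgue_rV R d).
Notation mu2 := (lebesgue_rV d \x lebesgue_rV d)%E.
Notation zero := (fun _ : E => (0 : R)).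
Implicit Types (X k f : E -> R) (x y q p v : E).

Lemma ind_shift (n : R) v : 0 <= n -> itg mu (fun x => \1_(cube n) (x - v) : R) /\
  \int[mu]_x (\1_(cube n) (x - v) : R) = (2 * n) ^+ d.
Proof.
move=> n0; have s1 : (1 : R) = 1 \/ (1 : R) = -1 by left.
have e : (fun x : E => \1_(cube n) (x - v) : R) = fun x => \1_(cube n) (- v + 1 *: x).
  by apply/funext => x; rewrite scale1r addrC.
have m1 : measurable_fun setT (EFin \o (\1_(@cube R d n) : E -> R)) by apply/measurable_EFinP; exact: measurable_ind.
have I := integral_affine (- v) s1 m1 (fun x => @ind_ge0 R d n x).
have I0 := itgE (@itg_ind R d n).
have i1 : itg mu (fun x => \1_(cube n) (x - v) : R).
  rewrite e; apply: itg_ge0P => [||].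
  - apply: (measurableT_comp (@measurable_ind R d n)); exact: measurable_affine.
  - by move=> x; exact: ind_ge0.
  - by rewrite I I0 ltry.
split => //; rewrite -cube_measure// e.
by apply: EFin_inj; rewrite -I0 -I -itgE// -e.
Qed.

Lemma ind_sq (n : R) x : \1_(cube n) x * \1_(cube n) x = \1_(cube n) x :> R.
Proof. by rewrite indE; case: (_ <= _); rewrite ?mulr1 ?mulr0. Qed.

Lemma L2r0 : L2r zero.
Proof. by split; [exact: measurable_cst|under eq_fun do rewrite expr0n /=; exact: itg0]. Qed.

Lemma L2r_ind_shift (n : R) v : 0 <= n -> L2r (fun x => \1_(cube n) (x - v) : R).
Proof.
move=> n0; have [i _] := ind_shift v n0; split; first exact: itg_measurable i.
by under eq_fun do rewrite expr2 ind_sq.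
Qed.

Lemma wig_le X k f g q p : test_function X -> test_function k -> (forall x, 0 <= X x) -> (forall x, 0 <= k x) ->
  (forall x, 0 <= f x) -> L2r f -> itg mu2 g ->
  (forall x y, f x * f y * (X (x - y) * k (x + y - 2 *: q)) <= g (x, y)) ->
  wig X k q p f zero <= \int[mu2]_z g z.
Proof.
move=> tX tk X0 k0 f0 hf hg H; apply: (int_le (itg_wig hf L2r0 q p tX tk) hg).
move=> [x y]; rewrite !kerE /= !mul0r mulr0 subr0 mul0r !addr0; apply: le_trans (H x y).
apply: ler_wpM2l; first exact: mulr_ge0.
apply: ler_wpM2r => //; rewrite -[leRHS]mulr1; apply: ler_wpM2l => //; exact: cos_le1.
Qed.

Lemma wig_ge X k f g : test_function X -> test_function k -> L2r f -> itg mu2 g ->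
  (forall x y, g (x, y) <= f x * f y * (X (x - y) * k (x + y))) ->
  \int[mu2]_z g z <= wig X k 0 0 f zero.
Proof.
move=> tX tk hf hg H; apply: (int_le hg (itg_wig hf L2r0 0 0 tX tk)).
move=> [x y]; rewrite !kerE /= !mul0r mulr0 subr0 mul0r !addr0; apply: le_trans (H x y) _.
rewrite scaler0 subr0 (_ : dotv 0 _ = 0) ?cos0 ?mulr1//.
by rewrite /dotv big1// => j _; rewrite mxE mul0r.
Qed.

Lemma bernoulli (t : R) (n : nat) : 0 <= t <= 1 -> 1 - n%:R * t <= (1 - t) ^+ n.
Proof.
move=> /andP[t0 t1]; elim: n => [|n ih]; first by rewrite mul0r subr0 expr0.
have h : (1 - t) * (1 - n%:R * t) <= (1 - t) ^+ n.+1 by rewrite exprS ler_wpM2l// subr_ge0.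
apply: le_trans h; rewrite -natr1; have := mulr_ge0 (mulr_ge0 (ler0n R n) t0) t0; nra.
Qed.

(** Equal to its reflection through the origin, and of mass [1]. *)
Definition cube_state x : R := \1_(cube 2^-1) x.

Lemma cube_state_L2r : L2r cube_state.
Proof.
have h : (0 : R) <= 2^-1 by [].
by have := L2r_ind_shift 0 h; congr L2r; apply/funext => x; rewrite subr0.
Qed.

Lemma cube_state_mass : \int[mu]_x (cube_state x ^+ 2) = 1.
Proof.
transitivity (\int[mu]_x (\1_(@cube R d 2^-1) x : R)).
  by apply: int_eq => x; rewrite expr2 ind_sq.
by rewrite cube_measure// divff// expr1n.
Qed.

(** For [x] in the cube shrunk by [e], [|x + y| < e] forces [y] into the full cube; then
    [|x - y| <= 1] and [X >= 1 - b]. Shrinking loses a volume of at most [2 d e], by Bernoulli. *)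
Lemma cube_state_mollified X k (b e : R) : mollifier e k -> 0 <= e -> 2 * e <= 1 -> 0 <= b <= 1 ->
  test_function X -> (forall v, `|1 - X v| <= b * `|v|) ->
  1 - b - d%:R * (2 * e) <= wig X k 0 0 cube_state zero.
Proof.
move=> mk e0 e1 /andP[b0 b1] tX HX; have tk := mol_test mk; have k0 := mol_ge0 mk.
have r0 : 0 <= 2^-1 - e by lra.
have [i1 I1] := schur_add1 (@itg_ind R d (2^-1 - e)) (mol_itg mk) (@ind_ge0 _ _ _) k0 0.
apply: (@le_trans _ _ ((1 - b) * \int[mu2]_z (\1_(cube (2^-1 - e)) z.1 * k (z.1 + z.2 - 0)))).
  rewrite I1 (mol_int mk) mulr1 cube_measure//.
  have -> : 2 * (2^-1 - e) = 1 - 2 * e by field.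
  have h : 1 - d%:R * (2 * e) <= (1 - 2 * e) ^+ d by apply: bernoulli; rewrite e1 mulr_ge0.
  have b2 : 0 <= 1 - b by rewrite subr_ge0.
  apply: le_trans (ler_wpM2l b2 h).
  by have := mulr_ge0 b0 (mulr_ge0 (ler0n R d) (mulr_ge0 (ler0n R 2) e0)); nra.
rewrite -intZ//; apply: wig_ge => //; [exact: cube_state_L2r|exact: itgZ|].
move=> x y /=; rewrite subr0; have [xye|xye] := leP e `|x + y|.
  by rewrite (mol_supp mk xye) !mulr0.
have Xge v : `|v| <= 1 -> 1 - b <= X v.
  move=> v1; have := HX v; rewrite ler_norml => /andP[_ h].
  have : b * `|v| <= b * 1 by rewrite ler_wpM2l.
  by move: h; lra.
rewrite /cube_state !indE; have [xe|xe] := leP `|x| (2^-1 - e); last first.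
  rewrite mul0r mulr0; have [h1|] := leP `|x| 2^-1; last by rewrite !mul0r.
  have [h2|] := leP `|y| 2^-1; last by rewrite mulr0 mul0r.
  rewrite !mul1r mulr_ge0//; apply: le_trans (Xge _ _); first by rewrite subr_ge0.
  by apply: le_trans (ler_normB _ _) _; lra.
have hx : `|x| <= 2^-1 by lra.
have hy : `|y| <= 2^-1.
  have := ler_normB (x + y) x; rewrite addrAC subrr add0r => hxy.
  by lra.
rewrite hx hy !mul1r; apply: ler_wpM2r => //; apply: Xge.
by apply: le_trans (ler_normB _ _) _; lra.
Qed.

Lemma cube_state_bump : 0 < wig bump bump 0 0 cube_state zero.
Proof.
have tb := @test_bump R d.
set c : R := flat 0 (2^-1 : R) ^+ 2 ^+ d.
have c0 : 0 < c by rewrite !exprn_gt0// flat_gt0.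
(* Small enough for [|x| <= r] and [|x + y| <= r] to put [y] in the cube and give
   [|x - y| <= 1 / 2], where [bump] is bounded below. *)
pose r : R := 8^-1.
have r0 : 0 < r by rewrite invr_gt0.
have [i1 I1] := schur_add1 (@itg_ind R d r) (@itg_ind R d r) (@ind_ge0 _ _ _) (@ind_ge0 _ _ _) 0.
apply: (@lt_le_trans _ _ (c ^+ 2 * \int[mu2]_z (\1_(cube r) z.1 * \1_(cube r) (z.1 + z.2 - 0)))).
  have v0 : 0 < (2 * r) ^+ d by rewrite exprn_gt0// mulr_gt0.
  rewrite I1 (cube_measure (ltW r0)); exact: mulr_gt0 (exprn_gt0 _ c0) (mulr_gt0 v0 v0).
rewrite -intZ//; apply: wig_ge => //; [exact: cube_state_L2r|exact: itgZ|].
move=> x y /=; rewrite subr0 /cube_state !indE.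
have b0 := @bump_ge0 R d.
have [hx|hx] := leP `|x| r; last first.
  by rewrite mul0r mulr0; apply: mulr_ge0; apply: mulr_ge0.
have [hy|hy] := leP `|x + y| r; last first.
  by rewrite !mulr0; apply: mulr_ge0; apply: mulr_ge0.
rewrite /r in hx hy.
have hy' : `|y| <= 4^-1.
  have := ler_normB (x + y) x; rewrite addrAC subrr add0r => hxy.
  by lra.
have hx2 : `|x| <= 2^-1 by lra.
have hy2 : `|y| <= 2^-1 by lra.
rewrite hx2 hy2 !mul1r mulr1 expr2; apply: ler_pM; [exact: ltW|exact: ltW| |]; apply: bump_ge.
  by apply: le_trans (ler_normB _ _) _; lra.
by lra.
Qed.

(** The normalised indicator of a cube of side [L]: a product of two values is at most [L^(-d)], and
    the kernel confines [x] to a unit neighbourhood of [q], so [wig] is [O(L^(-d))] uniformly in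
    [(q, p)]; for [d > 0] this is at most [O(1 / L)]. *)
Lemma spread_state (n0 : R) : (0 < d)%N -> 0 < n0 -> exists f1 : E -> R,
  [/\ L2r f1, \int[mu]_x (f1 x ^+ 2) = 1 & forall q p, wig bump bump q p f1 zero <= n0].
Proof.
move=> d0 n00; have tb := @test_bump R d; have b0 := @bump_ge0 R d; have b1 := @bump_le1 R d.
set I := \int[mu]_x bump x; have I0 : 0 <= I by exact: int_ge0.
pose L : R := 1 + 2 ^+ d * I / n0.
have J0 : 0 <= 2 ^+ d * I / n0 by exact: divr_ge0 (mulr_ge0 (exprn_ge0 _ (ler0n _ 2)) I0) (ltW n00).
have L1 : 1 <= L by rewrite lerDl.
have L0 : 0 < L by exact: lt_le_trans L1.
pose c := (Num.sqrt (L ^+ d))^-1.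
have c2 : c ^+ 2 = (L ^+ d)^-1 by rewrite exprVn sqr_sqrtr// exprn_ge0// ltW.
have c0 : 0 <= c by rewrite invr_ge0 sqrtr_ge0.
have Lh : 0 <= L / 2 by apply: divr_ge0 => //; exact: ltW.
have hi : L2r (fun x => \1_(cube (L / 2)) x : R).
  by have := L2r_ind_shift 0 Lh; congr L2r; apply/funext => x; rewrite subr0.
exists (fun x => c * \1_(cube (L / 2)) x); split.
- exact: L2rZ.
- transitivity (c ^+ 2 * \int[mu]_x (\1_(@cube R d (L / 2)) x : R)).
    rewrite -intZ; last exact: itg_ind.
    by apply: int_eq => x; rewrite exprMn; congr (_ * _); rewrite expr2 ind_sq.
  rewrite cube_measure// (_ : 2 * (L / 2) = L); last by field.
  by rewrite c2 mulVf// expf_neq0// gt_eqF.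
- move=> q p; have [i1 I1] := ind_shift q (@ler01 R).
  have [i2 I2] := schur_add1 i1 (test_itg tb) (fun x => @ind_ge0 R d 1 (x - q)) b0 (2 *: q).
  have ci : 0 <= c ^+ 2 by exact: sqr_ge0.
  apply: (@le_trans _ _ (c ^+ 2 * \int[mu2]_z (\1_(cube 1) (z.1 - q) * bump (z.1 + z.2 - 2 *: q)))).
    rewrite -intZ//; apply: wig_le => //; [by move=> x; rewrite mulr_ge0//; exact: ind_ge0|exact: L2rZ|exact: itgZ|].
    move=> x y /=; have [h|h] := leP 1 `|x - y|.
      by rewrite (bump_eq0 h) mul0r mulr0 !mulr_ge0//; exact: ind_ge0.
    have [h'|h'] := leP 1 `|x + y - 2 *: q|.
      by rewrite (bump_eq0 h') !mulr0.
    have xq : `|x - q| <= 1.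
      have -> : x - q = 2^-1 *: ((x - y) + (x + y - 2 *: q)) by apply/rowP => j; rewrite !mxE; field.
      rewrite normrZ ger0_norm//; have := ler_normD (x - y) (x + y - 2 *: q); lra.
    rewrite [\1_(cube 1) _]indE xq mul1r.
    have := ind_ge0 (L / 2) x; have := ind_le1 (L / 2) x; set i := \1_(cube (L / 2)) x : R.
    have := ind_ge0 (L / 2) y; have := ind_le1 (L / 2) y; set j := \1_(cube (L / 2)) y : R.
    move=> j1 j0 i1' i0; have -> : c * i * (c * j) * (bump (x - y) * bump (x + y - 2 *: q)) =
      c ^+ 2 * bump (x + y - 2 *: q) * (i * j * bump (x - y)) by ring.
    rewrite -[leRHS]mulr1; apply: ler_wpM2l; first exact: mulr_ge0.
    by apply: mulr_ile1 => //; [exact: mulr_ge0|exact: mulr_ile1].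
  rewrite I2 I1 mulr1 c2.
  have LL : L <= L ^+ d by rewrite -[leLHS]expr1; exact: ler_weXn2l.
  have Ld : 0 < L ^+ d by rewrite exprn_gt0.
  rewrite mulrC ler_pdivrMr// -/I; apply: (@le_trans _ _ (n0 * L)); last by rewrite ler_pM2l.
  rewrite /L mulrDr mulr1 (mulrC n0 (_ / _)) divfK ?gt_eqF//.
  by rewrite lerDr ltW.
Qed.

(** Sums of two positions lie in [[-1, 1]], [[2, 4]] or [[5, 7]], according to the humps. These stay
    disjoint when widened by [1 / 4], so near a given [t] only one kind of pair occurs, of total
    weight [4 / 5], [2 / 5 + 2 / 5] or [1 / 5]. The weight is charged to the hump of the first
    point. *)
Lemma two_hump_count (t : R) : exists m1 m2 : R, m1 + m2 <= 4 / 5 /\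
    (forall s r (a b a' b' : bool), `|s + r - t| <= 4^-1 -> (a -> - 2^-1 <= s <= 2^-1) -> (b -> 3 - 2^-1 <= s <= 3 + 2^-1) ->
    (a' -> - 2^-1 <= r <= 2^-1) -> (b' -> 3 - 2^-1 <= r <= 3 + 2^-1) ->
    5^-1 * ((2 * a%:R + b%:R) * (2 * a'%:R + b'%:R)) <= m1 * a%:R + m2 * b%:R).
Proof.
have pairs (m1 m2 : R) : 0 <= m1 -> 0 <= m2 -> (t <= 5 / 4 -> 4 / 5 <= m1) ->
    (7 / 4 <= t <= 17 / 4 -> 2 / 5 <= m1 /\ 2 / 5 <= m2) -> (19 / 4 <= t -> 1 / 5 <= m2) ->
    forall s r (a b a' b' : bool), `|s + r - t| <= 4^-1 -> (a -> - 2^-1 <= s <= 2^-1) -> (b -> 3 - 2^-1 <= s <= 3 + 2^-1) ->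
    (a' -> - 2^-1 <= r <= 2^-1) -> (b' -> 3 - 2^-1 <= r <= 3 + 2^-1) ->
    5^-1 * ((2 * a%:R + b%:R) * (2 * a'%:R + b'%:R)) <= m1 * a%:R + m2 * b%:R.
  move=> m10 m20 h1 h2 h3 s r a b a' b'; rewrite ler_distl => /andP[k1 k2].
  have e1 : -2^-1 <= s <= 2^-1 -> -2^-1 <= r <= 2^-1 -> 4 / 5 <= m1.
    by move=> /andP[? ?] /andP[? ?]; apply: h1; lra.
  have e2 : -2^-1 <= s <= 2^-1 -> 3 - 2^-1 <= r <= 3 + 2^-1 -> 2 / 5 <= m1.
    by move=> /andP[? ?] /andP[? ?]; apply: (h2 _).1; apply/andP; split; lra.
  have e3 : 3 - 2^-1 <= s <= 3 + 2^-1 -> -2^-1 <= r <= 2^-1 -> 2 / 5 <= m2.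
    by move=> /andP[? ?] /andP[? ?]; apply: (h2 _).2; apply/andP; split; lra.
  have e4 : 3 - 2^-1 <= s <= 3 + 2^-1 -> 3 - 2^-1 <= r <= 3 + 2^-1 -> 1 / 5 <= m2.
    by move=> /andP[? ?] /andP[? ?]; apply: h3; lra.
  have n1 (u : R) : - 2^-1 <= u <= 2^-1 -> 3 - 2^-1 <= u <= 3 + 2^-1 -> False.
    by move=> /andP[? ?] /andP[? ?]; lra.
  move: {h1 h2 h3 k1 k2} (n1 s) (n1 r) => n1' n2.
  case: a => [/(_ isT) ha|_]; case: b => [/(_ isT) hb|_]; try by case: (n1' ha hb).
  - case: a' => [/(_ isT) ha'|_]; case: b' => [/(_ isT) hb'|_]; try by case: (n2 ha' hb').
    + by have := e1 ha ha' => /=; lra.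
    + by have := e2 ha hb' => /=; lra.
    + by rewrite /=; lra.
  - case: a' => [/(_ isT) ha'|_]; case: b' => [/(_ isT) hb'|_]; try by case: (n2 ha' hb').
    + by have := e3 hb ha' => /=; lra.
    + by have := e4 hb hb' => /=; lra.
    + by rewrite /=; lra.
  - by move=> _ _ /=; lra.
have [t1|t1] := leP t (3 / 2).
  by exists (4 / 5), 0; split; [lra|apply: pairs => //; lra].
have [t2|t2] := leP t (9 / 2).
  by exists (2 / 5), (2 / 5); split; [lra|apply: pairs => //; lra].
by exists 0, (1 / 5); split; [lra|apply: pairs => //; lra].
Qed.

(* The two humps have unequal weights, since two equal ones would make [wig] equal to 1 halfway. *)
Lemma two_hump_state (j0 : 'I_d) : exists f1 : E -> R,
  [/\ L2r f1, \int[mu]_x (f1 x ^+ 2) = 1 & forall X k ep q p, mollifier ep k -> ep <= 4^-1 ->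
    test_function X -> (forall v, 0 <= X v <= 1) -> wig X k q p f1 zero <= 4 / 5].
Proof.
have [v vj] : exists v : E, v ord0 j0 = 3 by exists (const_mx 3); rewrite mxE.
pose f2 (x : E) : R := \1_(cube 2^-1) (x - v).
have h2 : (0 : R) <= 2^-1 by [].
have [i2 I2] := ind_shift v h2; have L2 := L2r_ind_shift v h2.
(* The amplitudes [2] and [1] give mass [4 + 1] before normalisation. *)
pose c : R := (Num.sqrt 5)^-1.
have c2 : c ^+ 2 = 5^-1 by rewrite exprVn sqr_sqrtr.
have c0 : 0 <= c by rewrite invr_ge0 sqrtr_ge0.
have A0 x : 0 <= cube_state x by exact: ind_ge0. have B0 x : 0 <= f2 x by exact: ind_ge0.
have iA : itg mu cube_state by exact: itg_ind.
have IA : \int[mu]_x cube_state x = 1 by rewrite /cube_state cube_measure// divff// expr1n.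
have IB : \int[mu]_x f2 x = 1 by rewrite I2 divff// expr1n.
have bA x : exists2 u : bool, cube_state x = u%:R & u -> - 2^-1 <= x ord0 j0 <= 2^-1.
  exists (`|x| <= 2^-1); first by rewrite /cube_state indE.
  by move=> h; rewrite -ler_norml; apply: le_trans (coord_le_norm _ _) h.
have bB x : exists2 u : bool, f2 x = u%:R & u -> 3 - 2^-1 <= x ord0 j0 <= 3 + 2^-1.
  exists (`|x - v| <= 2^-1); first by rewrite /f2 indE.
  move=> h; have := le_trans (coord_le_norm (x - v) j0) h.
  by rewrite !mxE vj ler_distl.
exists (fun x => c * (2 * cube_state x + f2 x)); split.
- by apply: L2rZ; apply: L2rD => //; apply: L2rZ; exact: cube_state_L2r.
- transitivity (c ^+ 2 * \int[mu]_x (4 * cube_state x + f2 x)).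
    rewrite -intZ; last by apply: itgD => //; exact: itgZ.
    apply: int_eq => x; rewrite exprMn; congr (_ * _).
    have [u -> hu] := bA x; have [w -> hw] := bB x.
    by case: u hu => hu; case: w hw => hw /=; [have := hu isT; have := hw isT; lra|ring|ring|ring].
  by rewrite intD ?intZ ?IA ?IB ?c2//; [field|exact: itgZ].
move=> X k ep q p mk ep4 tX X01; have tk := mol_test mk; have k0 := mol_ge0 mk.
have [j1 J1] := schur_add1 iA (mol_itg mk) A0 k0 (2 *: q).
have [j2 J2] := schur_add1 i2 (mol_itg mk) B0 k0 (2 *: q).
rewrite IA (mol_int mk) mulr1 in J1; rewrite I2 divff// expr1n (mol_int mk) mulr1 in J2.
have f1L : L2r (fun x => c * (2 * cube_state x + f2 x)) by apply: L2rZ; apply: L2rD => //; apply: L2rZ; exact: cube_state_L2r.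
have f10 x : 0 <= c * (2 * cube_state x + f2 x) by apply: mulr_ge0 => //; apply: addr_ge0 => //; exact: mulr_ge0.
set t := 2 * q ord0 j0.
suff [m1 [m2 [mh hm]]] : exists m1 m2 : R, m1 + m2 <= 4 / 5 /\
    (forall s r (a b a' b' : bool), `|s + r - t| <= 4^-1 -> (a -> - 2^-1 <= s <= 2^-1) -> (b -> 3 - 2^-1 <= s <= 3 + 2^-1) ->
    (a' -> - 2^-1 <= r <= 2^-1) -> (b' -> 3 - 2^-1 <= r <= 3 + 2^-1) ->
    5^-1 * ((2 * a%:R + b%:R) * (2 * a'%:R + b'%:R)) <= m1 * a%:R + m2 * b%:R).
  apply: le_trans mh; have j12 := itgD (itgZ m1 j1) (itgZ m2 j2).
  have -> : m1 + m2 = \int[mu2]_z (m1 * (cube_state z.1 * k (z.1 + z.2 - 2 *: q)) + m2 * (f2 z.1 * k (z.1 + z.2 - 2 *: q))).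
    by rewrite intD ?intZ ?J1 ?J2 ?mulr1//; exact: itgZ.
  apply: wig_le => //; first by move=> w; case/andP: (X01 w).
  move=> x y /=; have [h|h] := leP ep `|x + y - 2 *: q|; first by rewrite (mol_supp mk h) !mulr0 addr0.
  have [a ea ha] := bA x; have [a' ea' ha'] := bA y; have [b eb hb] := bB x; have [b' eb' hb'] := bB y.
  rewrite -/(f2 x) ea ea' eb eb'.
  have hs : `|x ord0 j0 + y ord0 j0 - t| <= 4^-1.
    have := coord_le_norm (x + y - 2 *: q) j0; rewrite !mxE => h'.
    by apply: le_trans h' (ltW (lt_le_trans h ep4)).
  have M := hm _ _ _ _ _ _ hs ha hb ha' hb'; have /andP[X0 X1] := X01 (x - y).
  set P := (2 * a%:R + b%:R) * (2 * a'%:R + b'%:R) in M.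
  have P0 : 0 <= 5^-1 * P by rewrite mulr_ge0// mulr_ge0// addr_ge0// mulr_ge0.
  have -> : c * (2 * a%:R + b%:R) * (c * (2 * a'%:R + b'%:R)) = 5^-1 * P by rewrite -c2 /P; ring.
  clearbody P; rewrite !mulrA -mulrDl; apply: ler_wpM2r => //; apply: le_trans M.
  by rewrite -[leRHS]mulr1; apply: ler_wpM2l.
exact: two_hump_count.
Qed.

End states.

(** * The obstructions *)

Section endpoints.
Context {R : realType} {d m : nat}.
Notation E := 'rV[R]_d.
Notation mu := (@lebesgue_rV R d).
Notation zero := (fun _ : E => (0 : R)).
Variables (lam : R) (V : E -> R) (W : 'rV[R]_m -> E -> R).

Lemma real_sphere (f : E -> R) : L2r f -> \int[mu]_x (f x ^+ 2) = 1 -> L2sphere (fun x => (f x)%:C%C).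
Proof.
move=> [mf hf] f1; have e : (fun x : E => complex.Re (f x)%:C%C ^+ 2 + complex.Im (f x)%:C%C ^+ 2) = fun x => f x ^+ 2.
  by apply/funext => x /=; rewrite expr0n addr0.
have L : L2 (fun x => (f x)%:C%C) by apply: L2_of; rewrite ?e.
by split => //; rewrite L2_nrm// /nrm2 e f1 sqrtr1.
Qed.

Lemma L2_sub (f g : E -> R[i]) : L2 f -> L2 g -> L2 (fun x => f x - g x).
Proof.
move=> hf hg; have [f1 f2] := L2_L2r hf; have [g1 g2] := L2_L2r hg.
have e1 x : complex.Re (f x - g x) = complex.Re (f x) - complex.Re (g x) by case: (f x) => ? ?; case: (g x).
have e2 x : complex.Im (f x - g x) = complex.Im (f x) - complex.Im (g x) by case: (f x) => ? ?; case: (g x).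
have [m1 i1] := L2rB f1 g1; have [m2 i2] := L2rB f2 g2.
apply: L2_of.
- by under eq_fun do rewrite e1.
- by under eq_fun do rewrite e2.
- by under eq_fun do rewrite e1 e2; exact: itgD.
Qed.

Let dist (a b a' b' : E -> R) : R := \int[mu]_x ((a x - a' x) ^+ 2 + (b x - b' x) ^+ 2).

Lemma dist_le (f g : E -> R[i]) (e : R) : L2 f -> L2 g -> 0 < e -> (L2norm (fun x => f x - g x)%R <= e%:E)%E ->
  dist (fun x => complex.Re (f x)) (fun x => complex.Im (f x)) (fun x => complex.Re (g x)) (fun x => complex.Im (g x)) <= e ^+ 2.
Proof.
move=> hf hg e0 /(L2_le (L2_sub hf hg) (ltW e0)); congr (_ <= _); apply: int_eq => x.
by case: (f x) => ? ?; case: (g x).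
Qed.

Lemma dist_trans (a b a' b' a'' b'' : E -> R) : L2r a -> L2r b -> L2r a' -> L2r b' -> L2r a'' -> L2r b'' ->
  dist a b a'' b'' <= 2 * dist a b a' b' + 2 * dist a' b' a'' b''.
Proof.
move=> h1 h2 h3 h4 h5 h6.
have i (f g f' g' : E -> R) : L2r f -> L2r g -> L2r f' -> L2r g' -> itg mu (fun x => (f x - f' x) ^+ 2 + (g x - g' x) ^+ 2).
  by move=> k1 k2 k3 k4; apply: itgD; [case: (L2rB k1 k3)|case: (L2rB k2 k4)].
have j1 := i _ _ _ _ h1 h2 h3 h4; have j2 := i _ _ _ _ h3 h4 h5 h6.
rewrite -!intZ// -intD; [|exact: itgZ|exact: itgZ].
apply: int_le; [exact: i|by apply: itgD; exact: itgZ|].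
by move=> x; have := sqr_ge0 (a x - a' x - (a' x - a'' x)); have := sqr_ge0 (b x - b' x - (b' x - b'' x)); nra.
Qed.

(** The L^2 solution is replaced by a solution in Sigma within [eta] of it, where [eta] is unrelated
    to the accuracy [eps] at the target. The factors [2] are those of the triangle inequality for
    squared distances. *)
Lemma steers_close (T : R) (u : R -> 'rV[R]_m) (g0 g1 : E -> R) (eps eta : R) : 0 <= T -> 0 < eps -> 0 < eta -> L2r g0 -> L2r g1 ->
  steers lam V W T u (fun x => (g0 x)%:C%C) (fun x => (g1 x)%:C%C) eps -> exists th psi,
  [/\ Sigma_solution lam V W T u psi,
    dist (fun x => complex.Re (psi 0 x)) (fun x => complex.Im (psi 0 x)) g0 zero <= eta ^+ 2 &
    dist (fun x => complex.Re (psi T x)) (fun x => complex.Im (psi T x))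
      (fun x => cos th * g1 x - sin th * 0) (fun x => cos th * 0 + sin th * g1 x) <= 2 * eta ^+ 2 + 2 * eps ^+ 2].
Proof.
move=> T0 eps0 eta0 h0 h1 [th [_ [psi [Lpsi _ ini Happ] fin]]].
have [psi' sol Hc] := Happ eta eta0; exists th, psi'; have t0 : 0 <= (0 : R) <= T by rewrite lexx.
have tT : 0 <= T <= T by rewrite lexx T0.
have L' t : 0 <= t <= T -> L2 (psi' t).
  by move=> ht; have [_ [M HM] _] := sol; case: (HM t ht).
have i0 (f g f' g' : E -> R) : L2r f -> L2r g -> L2r f' -> L2r g' -> itg mu (fun x => (f x - f' x) ^+ 2 + (g x - g' x) ^+ 2).
  by move=> k1 k2 k3 k4; apply: itgD; [case: (L2rB k1 k3)|case: (L2rB k2 k4)].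
split => //.
- apply: le_trans (dist_le (L' 0 t0) (Lpsi 0 t0) eta0 (Hc 0 t0)).
  rewrite le_eqVlt; apply/orP; left; apply/eqP; congr fine; apply: ae_eq_integral => //.
  + by apply/measurable_EFinP; exact: (itg_measurable (i0 _ _ _ _ (L2_L2r (L' 0 t0)).1 (L2_L2r (L' 0 t0)).2 h0 L2r0)).
  + by apply/measurable_EFinP; exact: (itg_measurable (i0 _ _ _ _ (L2_L2r (L' 0 t0)).1 (L2_L2r (L' 0 t0)).2 (L2_L2r (Lpsi 0 t0)).1 (L2_L2r (Lpsi 0 t0)).2)).
  + by apply: filterS ini => x /= -> _.
- pose z x := expi th * (g1 x)%:C%C.
  have ez1 x : complex.Re (z x) = cos th * g1 x - sin th * 0 by rewrite /z /=.
  have ez2 x : complex.Im (z x) = cos th * 0 + sin th * g1 x by rewrite /z /=.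
  have r1 : L2r (fun x => cos th * g1 x - sin th * 0) by apply: L2rB; apply: L2rZ => //; exact: L2r0.
  have r2 : L2r (fun x => cos th * 0 + sin th * g1 x) by apply: L2rD; apply: L2rZ => //; exact: L2r0.
  have Lz : L2 z.
    apply: L2_of; [by under eq_fun do rewrite ez1; case: r1|by under eq_fun do rewrite ez2; case: r2|].
    by under eq_fun do rewrite ez1 ez2; apply: itgD; [case: r1|case: r2].
  have [p1 p2] := L2_L2r (Lpsi T tT); have [q1 q2] := L2_L2r (L' T tT).
  apply: le_trans (dist_trans q1 q2 p1 p2 r1 r2) _.
  have d1 := dist_le (L' T tT) (Lpsi T tT) eta0 (Hc T tT).
  have d2 := dist_le (Lpsi T tT) Lz eps0 (ltW fin).
  by rewrite lerD// ler_wpM2l//; exact: d2.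
Qed.

End endpoints.

(** * The obstruction in small time *)

Section small_time.
Context {R : realType} {d : nat}.
Notation E := 'rV[R]_d.
Notation mu := (@lebesgue_rV R d).
Notation zero := (fun _ : E => (0 : R)).

Lemma share_le (n K : R) : 0 < n -> 0 <= K -> 0 < n / (K + 1) /\ K * (n / (K + 1)) <= n.
Proof.
move=> n0 K0; have K1 : 0 < K + 1 by rewrite ltr_wpDl.
split; first by rewrite divr_gt0.
have -> : K * (n / (K + 1)) = n * (K / (K + 1)) by ring.
rewrite -[leRHS]mulr1; apply: ler_wpM2l; first exact: ltW.
by rewrite ler_pdivrMr// mul1r lerDl.
Qed.

Lemma dist_bounds (x y z : R) : `|x - y| <= z -> x <= y + z /\ y <= x + z.
Proof. by rewrite ler_distl => /andP[h1 h2]; split; lra. Qed.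

Lemma ss_zero (f : E -> R) : \int[mu]_x ss f zero x = \int[mu]_x (f x ^+ 2).
Proof. by apply: int_eq => x; rewrite /ss expr0n addr0. Qed.

Lemma ss_rot (f : E -> R) th : \int[mu]_x ss (fun x => cos th * f x - sin th * 0) (fun x => cos th * 0 + sin th * f x) x =
  \int[mu]_x (f x ^+ 2).
Proof.
apply: int_eq => x; rewrite /ss !mulr0 subr0 add0r !exprMn -mulrDl cos2Dsin2 mul1r//.
Qed.

Lemma L2r_rot (f : E -> R) th : L2r f ->
  L2r (fun x => cos th * f x - sin th * 0) /\ L2r (fun x => cos th * 0 + sin th * f x).
Proof.
by move=> hf; split; [apply: L2rB; apply: L2rZ => //; exact: L2r0|apply: L2rD; apply: L2rZ => //; exact: L2r0].
Qed.

Lemma wig_near (X k : E -> R) (q p : E) (a b a' b' : E -> R) (e : R) : test_function X -> test_function k ->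
  (forall v, 0 <= X v <= 1) -> (forall v, 0 <= k v) -> L2r a -> L2r b -> L2r a' -> L2r b' -> 0 < e ->
  `|wig X k q p a b - wig X k q p a' b'| <=
  (e * \int[mu]_x ss a' b' x + (e^-1 + 1) * \int[mu]_x ((a x - a' x) ^+ 2 + (b x - b' x) ^+ 2)) * \int[mu]_x k x.
Proof.
move=> tX tk X01 k0 ha hb ha' hb' e0; have sE : (1 : R) = 1 \/ (1 : R) = -1 by left.
have X0 v : 0 <= X v by case/andP: (X01 v).
have Xk x y : X (x - y) * k (x + y - 2 *: q) <= k (- (2 *: q) + x + 1 *: y).
  rewrite scale1r (addrC (- _)) (addrAC x (- _) y).
  by rewrite -[leRHS]mul1r; apply: ler_wpM2r => //; case/andP: (X01 (x - y)).
exact: (wig_close tX tk X0 k0 sE (test_itg tk) k0 Xk p ha hb ha' hb' e0).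
Qed.

(** Taking [c = 0] and [mm = 0] in [propagation] bounds the loss of [wig] by [4 C T], the mass being
    at most [4]. Initially [wig] is near [n > 0] at the origin; for the target it is at most [n / 4]
    everywhere. The other errors total at most [3 n / 8], too little to fill the gap. *)
Lemma small_time_obstruction (lam : R) (V : E -> R) (F : E -> E) (CF : R) : (0 < d)%N -> continuous V -> 0 <= CF ->
  taylor V F CF -> ~ small_time_L2_approx_controllable lam V (fun c x : E => \sum_(j < d) c ord0 j * x ord0 j).
Proof.
move=> d0 cV CF0 tay ctr; have tb := @test_bump R d; have b0 := @bump_ge0 R d; have b1 := @bump_le1 R d.
have [C C0 rate_le] := bump_rate (d := d) lam CF0.
have n0 := @cube_state_bump R d; set n := wig _ _ _ _ _ _ in n0.
have n4 : 0 < n / 4 by rewrite divr_gt0.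
have [f1 [f1L f1m f1w]] := spread_state d0 n4.
set I := \int[mu]_x (bump x : R); have I0 : 0 <= I by exact: int_ge0.
have n8 : 0 < n / 8 by rewrite divr_gt0.
have [e0] := share_le n8 I0; set e := n / 8 / (I + 1) in e0 * => eI; rewrite mulrC in eI.
(* The coefficient of [eps]: the distance to the cube counts once at time [0], that to the target
   four times at time [T], and [4 C] comes from the drift over [T <= eps]. *)
pose K := 5 * (e^-1 + 1) * I + 4 * C.
have ei : 0 < e^-1 by rewrite invr_gt0.
have K0 : 0 <= K by rewrite /K addr_ge0 ?mulr_ge0 ?addr_ge0// ltW.
have [eps0'] := share_le n8 K0; set eps' := n / 8 / (K + 1) in eps0' * => Keps'.
pose eps := Num.min 1 eps'.
have eps0 : 0 < eps by rewrite lt_min ltr01.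
have eps1 : eps <= 1 by rewrite ge_min lexx.
have Keps : K * eps <= n / 8.
  by apply: le_trans Keps'; apply: ler_wpM2l => //; rewrite ge_min lexx orbT.
have KE : K * eps = (e^-1 + 1) * I * eps + (e^-1 + 1) * I * (4 * eps) + 4 * C * eps by rewrite /K; ring.
clearbody eps K e; clear eps' eps0' Keps'.
have [T [/andP[T0 Te] [u pu st]]] := ctr _ _ (real_sphere (@cube_state_L2r R d) (@cube_state_mass R d)) (real_sphere f1L f1m) eps eps0.
have [th [psi [sol D0 DT]]] := steers_close T0 eps0 eps0 (@cube_state_L2r R d) f1L st.
have cW (c : E) : continuous (fun x => V x + \sum_(j < d) c ord0 j * x ord0 j).
  by move=> x; exact: (continuousD (cV x) (@continuous_dotv _ _ c x)).
have [M hbas] := Sigma_basic sol T0.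
have [s [cv [Q prop]]] := propagation sol pu (CT := fun=> CF) (fun=> CF0) (fun c => taylor_linear c tay) cW T0.
set a := fun t x => complex.Re (psi t x) in hbas; set b := fun t x => complex.Im (psi t x) in hbas.
have t00 : 0 <= (0 : R) <= T by rewrite lexx.
have tT : 0 <= T <= T by rewrite lexx T0.
have ha t (ht : 0 <= t <= T) : L2r (a t) := bas_a hbas ht.
have hb t (ht : 0 <= t <= T) : L2r (b t) := bas_b hbas ht.
have mass t : 0 <= t <= T -> \int[mu]_x ss (a t) (b t) x <= 4.
  move=> ht; rewrite (mass_global sol pu (fun=> CF0) (fun c => taylor_linear c tay) cW T0 ht).
  have := ss_close (ha 0 t00) (hb 0 t00) (@cube_state_L2r R d) (@L2r0 R d) ltr01.
  rewrite ss_zero cube_state_mass invr1 => h; apply: le_trans h _.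
  have : eps ^+ 2 <= 1 by rewrite expr_le1// ltW.
  by move: D0; lra.
have err0 : 0 <= 4 * C by rewrite mulr_ge0.
have simp (x y : R) : expR (- (2 * 0 * T)) * (2 * 0 - 2 * x) <= 2 * 0 - 2 * y + 2 * (4 * C) * T -> y <= x + 4 * C * T.
  by rewrite !mulr0 mul0r oppr0 expR0 mul1r !sub0r; lra.
have [|q [p /simp prp]] := prop bump bump 0 0 (4 * C) 1 tb tb (lexx 0) err0 ltr01.
  move=> j t q p w js ht _ Fw; rewrite mul0r addr0.
  apply: le_trans (rate_le _ _ _ _ q p w (ha t ht) (hb t ht) (cW (cv j)) (taylor_linear (cv j) tay) Fw) _.
  by rewrite mulrC ler_wpM2r// mass.
have b01 (v : E) : 0 <= bump v <= 1 by rewrite b0 b1.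
have c0 := wig_near 0 0 tb tb b01 b0 (ha 0 t00) (hb 0 t00) (@cube_state_L2r R d) (@L2r0 R d) e0.
have [r1 r2] := L2r_rot th f1L.
have cT := wig_near q p tb tb b01 b0 (ha T tT) (hb T tT) r1 r2 e0.
rewrite ss_zero cube_state_mass mulr1 in c0; rewrite -/I in c0; change (wig bump bump 0 0 cube_state zero) with n in c0.
rewrite ss_rot f1m mulr1 -/I (wig_rot bump bump q p f1 zero th) in cT.
have w1 := f1w q p.
have e2 : eps ^+ 2 <= eps by rewrite expr2 ler_piMl// ltW.
have E0 : 0 <= e^-1 + 1 by rewrite addr_ge0// ltW.
set dist0 := \int[mu]_x _ in c0 D0; set distT := \int[mu]_x _ in cT DT.
clearbody dist0 distT.
have share D t : D <= t -> (e + (e^-1 + 1) * D) * I <= e * I + (e^-1 + 1) * I * t.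
  move=> Dt; have h := ler_wpM2l (mulr_ge0 E0 I0) Dt.
  by rewrite [leLHS]mulrDl lerD2l (mulrAC (_ + _) D).
have B0 := share _ _ (le_trans D0 e2).
have BT : (e + (e^-1 + 1) * distT) * I <= e * I + (e^-1 + 1) * I * (4 * eps).
  by apply: share; apply: le_trans DT _; move: e2; clear; lra.
have TC : 4 * C * T <= 4 * C * eps by rewrite ler_wpM2l.
have [_ c0'] := dist_bounds c0; have [cT' _] := dist_bounds cT.
have prp' : wig bump bump 0 0 (a 0) (b 0) <= wig bump bump q p (a T) (b T) + 4 * C * T by exact: prp.
clear prp c0 cT; move: (wig _ _ _ _ (a T) (b T)) (wig _ _ _ _ (a 0) (b 0)) (wig _ _ _ _ f1 _) w1 c0' cT' prp' => WT W0 W1.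
clearbody n I; clear - n0 eI Keps B0 BT TC KE => w1 c0 cT prp.
have h1 := le_trans c0 (lerD prp B0); have h2 := le_trans cT (lerD w1 BT).
have : n <= n / 4 + 2 * (e * I) + K * eps by rewrite KE; move: h1 h2 TC; clear; lra.
by move: n0 eI Keps; clear; lra.
Qed.

End small_time.

(** * The obstruction for quadratic potentials *)

Section large_time.
Context {R : realType} {d m : nat}.
Notation E := 'rV[R]_d.
Notation mu := (@lebesgue_rV R d).
Notation zero := (fun _ : E => (0 : R)).

Lemma small_scale (n K : R) : 0 < n -> 0 <= K -> exists2 z, 0 < z & K * z <= n.
Proof. by move=> n0 K0; have [h1 h2] := share_le n0 K0; exists (n / (K + 1)). Qed.

(** [propagation] with the conserved mass [m0] and [c = 2 |lam|] bounds [tau = e^(- 4 |lam| T)]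
    times the final defect by the initial one plus errors. The final defect is at least [1 / 5]
    because [wig <= 4 / 5] at the target, the initial one is at most [15 eta + 2 kap], and the
    accumulated error is at most [3 kap]; with [eta <= tau / 400] and [kap <= tau / 800] this is
    impossible. *)
Lemma large_time_obstruction (lam g : R) (V : E -> R) (W : 'rV[R]_m -> E -> R) (A : 'rV[R]_m -> R) (B : 'rV[R]_m -> E)
    (j0 : 'I_d) : (forall c x, V x + W c x = quad (A c) g (B c) x) -> ~ L2_approx_controllable lam V W.
Proof.
move=> VW ctr; have eVW c : (fun x => V x + W c x) = quad (A c) g (B c) by apply/funext.
pose F c q : E := (2 * A c) *: q + B c; pose CT c : R := `|A c| * d%:R.
have CT0 c : 0 <= CT c by rewrite mulr_ge0.
have tay c : taylor (fun x => V x + W c x) (F c) (CT c) by rewrite eVW; exact: quad_taylor.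
have cVW c : continuous (fun x => V x + W c x) by rewrite eVW; exact: quad_cont.
have [f1 [f1L f1m f1w]] := @two_hump_state R d j0.
(* The accuracy at the target is a fixed number, so that [T] and [u] are known before the errors
   that must be small compared with [tau]. *)
have eps0 : 0 < (200^-1 : R) by rewrite invr_gt0.
have [T [T0' [u pu st]]] := ctr _ _ (real_sphere (@cube_state_L2r R d) (@cube_state_mass R d)) (real_sphere f1L f1m) _ eps0.
have T0 := ltW T0'.
pose cc : R := 2 * `|lam|; have cc0 : 0 <= cc by rewrite mulr_ge0.
have [tau tauE] : exists tau : R, tau = expR (- (2 * cc * T)) by exists (expR (- (2 * cc * T))).
have tau0 : 0 < tau by rewrite tauE expR_gt0.
have tau1 : tau <= 1 by rewrite tauE -expR0 ler_expR oppr_le0 !mulr_ge0.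
have [eta eta0 etaE] := small_scale tau0 (ler0n R 400).
have [kap kap0 kapE] := small_scale tau0 (ler0n R 800).
have [th [psi [sol D0 DT]]] := steers_close T0 eps0 eta0 (@cube_state_L2r R d) f1L st.
have [M hbas] := Sigma_basic sol T0.
have mg := mass_global sol pu CT0 tay cVW T0.
have [s [cv [Q prop]]] := propagation sol pu CT0 tay cVW T0.
set a := fun t x => complex.Re (psi t x) in hbas mg; set b := fun t x => complex.Im (psi t x) in hbas mg.
have t00 : 0 <= (0 : R) <= T by rewrite lexx.
have tT : 0 <= T <= T by rewrite lexx T0.
have ha t (ht : 0 <= t <= T) : L2r (a t) := bas_a hbas ht.
have hb t (ht : 0 <= t <= T) : L2r (b t) := bas_b hbas ht.
set m0 := \int[mu]_x ss (a 0) (b 0) x in mg.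
have m00 : 0 <= m0 by apply: int_ge0 => x; exact: ss_ge0.
have M0 := basic_M hbas T0.
have etaI : (1 + eta^-1) * eta ^+ 2 = eta ^+ 2 + eta by field; rewrite gt_eqF.
have ei : 0 <= 1 + eta^-1 by rewrite addr_ge0// invr_ge0 ltW.
have [m1 m2] : m0 <= 1 + 3 * eta /\ 1 - 3 * eta <= m0.
  have h1 := ss_close (ha 0 t00) (hb 0 t00) (@cube_state_L2r R d) (@L2r0 R d) eta0.
  have h2 := ss_close (@cube_state_L2r R d) (@L2r0 R d) (ha 0 t00) (hb 0 t00) eta0.
  have e2 : \int[mu]_x ((cube_state x - a 0 x) ^+ 2 + (0 - b 0 x) ^+ 2) = \int[mu]_x ((a 0 x - cube_state x) ^+ 2 + (b 0 x - 0) ^+ 2).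
    by apply: int_eq => x; ring.
  move: h1 h2; rewrite e2 ss_zero cube_state_mass -/m0 mulr1.
  have h3 := ler_wpM2l ei D0; rewrite etaI in h3.
  have e1 : eta <= 1 by move: etaE tau1 eta0; clear; lra.
  have h4 := sqr_ge0 eta; have h5 : eta ^+ 2 <= eta by rewrite expr2 ler_piMl// ltW.
  move=> h1 h2; have k1 := le_trans h1 (lerD (lexx _) h3); have k2 := le_trans h2 (lerD (lexx _) h3).
  clearbody m0; split; first by move: k1 h5; clear; lra.
  rewrite leNgt; apply/negP => k3.
  have : (1 + eta) * m0 <= (1 + eta) * (1 - 3 * eta) by rewrite ler_wpM2l ?addr_ge0// ltW.
  by move: k2 h5 h4 eta0; rewrite !expr2; clear; nra.
pose Q' := Num.max Q 0; have Q'0 : 0 <= Q' by rewrite le_max lexx orbT.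
have QQ' : Q <= Q' by rewrite le_max lexx.
have [K1 K1E] : exists K1 : R, K1 = (5 + 2 * Q') * M by eexists.
have K10 : 0 <= K1 by rewrite K1E mulr_ge0// addr_ge0// mulr_ge0.
pose SA : R := \sum_(j < size s) CT (cv j).
have SA0 : 0 <= SA by exact: sumr_ge0.
have SAj j : (j < size s)%N -> CT (cv j) <= SA.
  by move=> js; rewrite /SA (bigD1 (Ordinal js))//= lerDl sumr_ge0.
clearbody SA m0; have T2 : 0 <= 2 * T by rewrite mulr_ge0.
have [tol tol0 tolE] : exists2 tol : R, 0 < tol & (d%:R * K1 * (2 * T)) * tol <= kap.
  by apply: small_scale => //; rewrite !mulr_ge0.
have [ep ep0 epE] : exists2 ep : R, 0 < ep & (SA * K1 * (2 * T) + 4 * d%:R + 4) * ep <= kap.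
  by apply: small_scale => //; rewrite !addr_ge0 ?mulr_ge0.
have [ep1 ep2 ep3] : [/\ SA * K1 * (2 * T) * ep <= kap, 4 * d%:R * ep <= kap & 4 * ep <= kap].
  have h1 : 0 <= SA * K1 * (2 * T) * ep by rewrite !mulr_ge0// ltW.
  have h2 : 0 <= 4 * d%:R * ep by rewrite !mulr_ge0// ltW.
  by move: epE h1 h2 ep0; rewrite !mulrDl; clear; split; lra.
have kap1 : kap <= 1 by move: kapE tau1 kap0; clear; lra.
have [k mk] := @mollifier_exists R d ep ep0.
have k0 := mol_ge0 mk; have tk := mol_test mk.
have [L L0 fam] := @cutoff_family R d.
set Ik := \int[mu]_x (\sum_j `|partial j k x|).
have Ik0 : 0 <= Ik by apply: int_ge0 => x; exact: sumr_ge0.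
(* The slope [z] of the cutoff [X] is chosen after [k]: it multiplies the integral [Ik] of the
   gradient of [k], which depends on [ep]. *)
have [z z0 zE] : exists2 z : R, 0 < z & (2 * m0 * Ik * (2 * T) + 2) * z <= kap.
  by apply: small_scale => //; rewrite addr_ge0// !mulr_ge0.
have [z1 z2] : 2 * m0 * Ik * (2 * T) * z <= kap /\ 2 * z <= kap.
  have h1 : 0 <= 2 * m0 * Ik * (2 * T) * z by rewrite !mulr_ge0// ltW.
  by move: zE h1 z0; rewrite mulrDl; clear; split; lra.
have [X [tX X01 Xp XL]] := fam (L / z) (divr_gt0 L0 z0).
have Lz : L / (L / z) = z by field; rewrite !gt_eqF.
rewrite Lz in Xp XL.
pose err := 2 * z * m0 * Ik + (SA * ep + d%:R * tol) * K1.
have err0 : 0 <= err by rewrite addr_ge0// !mulr_ge0// ?addr_ge0 ?mulr_ge0// ltW.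
have epa : ep <= 1 by move: ep3 kap1 ep0; clear; lra.
have [|q [p prp]] := prop X k m0 cc err tol tX tk cc0 err0 tol0.
  move=> j t q p w js ht qQ Fw.
  have HU x y : `|V x + W (cv j) x - (V y + W (cv j) y) - dotv (F (cv j) q) (x - y)| <= SA * (`|x + y - 2 *: q| * `|x - y|).
    rewrite !VW; apply: le_trans (quad_diff _ _ _ _ _ _) _; apply: ler_wpM2r; first exact: mulr_ge0.
    exact: SAj.
  have := quadratic_rate lam p (ha t ht) (hb t ht) mk epa (bas_m hbas ht) (bas_wi hbas ht) (bas_w hbas ht) tX X01 Xp (cVW (cv j))
    SA0 HU (le_trans qQ QQ') Fw.
  have := mg t ht; rewrite -/(ss (a t) (b t)) => ->; move=> h; apply: le_trans h _.
  by rewrite /err /cc K1E (mulrA (SA * ep + _)).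
have b1 : 0 <= z <= 1 by rewrite (ltW z0); move: z2 kap1 z0; clear; lra.
have ep5 : 2 * ep <= 1 by move: ep3 kap1 ep0; clear; lra.
have ep6 : ep <= 4^-1 by move: ep3 kap1 ep0; clear; lra.
have low := cube_state_mollified mk (ltW ep0) ep5 b1 tX XL.
have n0 := wig_near 0 0 tX tk X01 k0 (ha 0 t00) (hb 0 t00) (@cube_state_L2r R d) (@L2r0 R d) eta0.
rewrite (mol_int mk) mulr1 ss_zero cube_state_mass mulr1 in n0.
have [r1 r2] := L2r_rot th f1L.
(* With this weight, [wig] at time [T] is within [1 / 100 + 101 (2 eta^2 + 2 / 200^2)] of its value
   at the target, which keeps it well below the mass. *)
have e1 : 0 < (100^-1 : R) by rewrite invr_gt0.
have nT := wig_near q p tX tk X01 k0 (ha T tT) (hb T tT) r1 r2 e1.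
rewrite (mol_int mk) mulr1 ss_rot f1m mulr1 invrK (wig_rot X k q p f1 zero th) in nT.
have up := f1w X k ep q p mk ep6 tX X01.
have prp' : tau * (2 * m0 - 2 * wig X k q p (a T) (b T)) <= 2 * m0 - 2 * wig X k 0 0 (a 0) (b 0) + 2 * err * T.
  by rewrite tauE; exact: prp.
have [_ n0'] := dist_bounds n0; have [nT' _] := dist_bounds nT.
set dist0 := \int[mu]_x _ in n0' D0; set distT := \int[mu]_x _ in nT' DT.
have errE : 2 * err * T = 2 * m0 * Ik * (2 * T) * z + SA * K1 * (2 * T) * ep + d%:R * K1 * (2 * T) * tol.
  by rewrite /err; ring.
have dd0 : (eta^-1 + 1) * dist0 <= eta ^+ 2 + eta.
  by rewrite -etaI (addrC 1); apply: ler_wpM2l D0; rewrite addrC.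
have eta2 : eta ^+ 2 <= eta * 400^-1.
  by rewrite expr2; apply: ler_wpM2l; [exact: ltW|move: etaE tau1; clear; lra].
have eta3 : eta <= 400^-1 by move: etaE tau1; clear; lra.
clearbody dist0 distT Ik err.
move: (wig _ _ _ _ (a T) (b T)) (wig _ _ _ _ (a 0) (b 0)) (wig _ _ _ _ f1 _) (wig _ _ _ _ cube_state _) up nT' prp' n0' low => WT W0 W1 Wf.
move=> up nT' prp' n0' low.
have D1 : 2 * m0 - 2 * W0 <= 15 * eta + 2 * kap.
  by move: n0' low dd0 eta2 m1 z2 ep2 eta0; clear; lra.
have D2 : 5^-1 <= 2 * m0 - 2 * WT.
  by move: nT' up DT m2 eta2 eta3 eta0; clear; lra.
have := ler_wpM2l (ltW tau0) D2 => h.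
by move: (le_trans h prp') D1 z1 ep1 tolE; rewrite errE; move: etaE kapE tau0; clear; lra.
Qed.

End large_time.

Theorem theorem1p6 (R : realType) (d : nat) (hd : (0 < d)%N) (lam : R) :
  (forall (alpha gamma : R) (beta : 'rV[R]_d),
     ~ L2_approx_controllable lam
         (fun x : 'rV[R]_d => alpha * sqnorm x + dotv beta x + gamma)
         (fun (c : 'rV[R]_d.+1) (x : 'rV[R]_d) =>
            c ord0 ord0 * (sqnorm x / 2)
            + \sum_(j < d) c ord0 (lift ord0 j) * x ord0 j))
  /\
  (forall V : 'rV[R]_d -> R,
     smooth V ->
     (forall b : 'I_d -> nat, (2 <= \sum_(j < d) b j)%N ->
        ('N[lebesgue_rV d]_+oo[EFin \o mpartial b V] < +oo)%E) ->
     ~ small_time_L2_approx_controllable lam V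
         (fun (c x : 'rV[R]_d) => \sum_(j < d) c ord0 j * x ord0 j)).
Proof.
split=> [alpha gamma beta|V sV HV].
- apply: (large_time_obstruction (g := gamma) (A := fun c => alpha + c ord0 ord0 / 2)
    (B := fun c => beta + \row_j c ord0 (lift ord0 j)) (Ordinal hd)) => c x.
  rewrite /quad dotvDl [dotv (\row_j _) x](_ : _ = \sum_(j < d) c ord0 (lift ord0 j) * x ord0 j); first by ring.
  by apply: eq_bigr => j _; rewrite mxE.
- have [C C0 tay] := smooth_taylor sV HV.
  exact: small_time_obstruction hd (smooth_cont sV) C0 tay.
Qed.
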